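(* Let $z,z'$ be admissible, $t=zz'$. For $x_1,\dots,x_n>0$, $$\tilde\rho_n^{(zz')}(x_1,\dots,x_n)=\det\big[M(x_i,x_j)\big]_{i,j=1}^n,$$ where $$M(x,y)=t\iint_{t_1,t_2}\phi_{-z}(t_1)\phi_{-z'}(t_2)\phi_{z'}(t_1+1)\phi_{z}(t_2+1)\,\frac{e^{-x(t_1+1/2)-y(t_2+1/2)}}{t_1+t_2+1}\,dt_1\,dt_2 .$$
   Context: Thoma simplex $\Omega$: pairs of sequences $(\alpha|\beta)$, $\alpha_1\ge\alpha_2\ge\dots\ge0$, $\beta_1\ge\beta_2\ge\dots\ge0$, $\sum_i(\alpha_i+\beta_i)\le1$; $\Omega_0$: the subset where the sum equals $1$. Admissible parameters: $z'=\bar z$, $z\notin\mathbb Z$, or $z,z'\in\mathbb R$ with $m<z,z'<m+1$ for some $m\in\mathbb Z$; $t=zz'>0$, $(a)_k=\Gamma(a+k)/\Gamma(a)$. $P^{(n)}_{zz'}$ is the probability measure on $\Omega_0$ supported on points with $\alpha_i=(p_i+1/2)/n$, $\beta_i=(q_i+1/2)/n$ ($i\le d$), $\alpha_i=\beta_i=0$ ($i>d$), where $p_1>\dots>p_d\ge0$, $q_1>\dots>q_d\ge0$ are integers with $\sum_i(p_i+q_i+1)=n$, with mass $\frac{n!\,t^d}{(t)_n}\prod_{i=1}^d\frac{(z+1)_{p_i}(z'+1)_{p_i}(-z+1)_{q_i}(-z'+1)_{q_i}}{(p_i!)^2(q_i!)^2}\big(\det[\frac1{p_i+q_j+1}]\big)^2$.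 It is known that $P^{(n)}_{zz'}\to P_{zz'}$ weakly, and that $P_{zz'}$ is concentrated on $\Omega_0$. Lifted process: on $\Omega_0\times(0,\infty)$ take $P_{zz'}\otimes\frac{s^{t-1}e^{-s}}{\Gamma(t)}ds$ and associate to $((\alpha|\beta),s)$ the configuration in $\mathbb R\setminus\{0\}$ of points $s\alpha_i$ ($\alpha_i\neq0$) and $-s\beta_i$ ($\beta_i\ne0$), indexed by $i$. Its $n$-th correlation measure gives to $A$ the expected number of ordered $n$-tuples of pairwise distinct indexed points in $A$; $\tilde\rho^{(zz')}_n$ is its density w.r.t. Lebesgue measure. For $a\in\mathbb C$, $\phi_a(u)=u_+^a/\Gamma(a+1)$: for $\Re a>-1$ it is the locally integrable function equal to $u^a/\Gamma(a+1)$ for $u>0$ and $0$ for $u<0$; for other $a$ it is the distribution obtained by analytic continuation in $a$ (e.g. $\phi_{-1}=\delta$). The integral defining $M$ is the pairing of the distribution $\phi_{-z}(t_1)\phi_{-z'}(t_2)\phi_{z'}(t_1+1)\phi_{z}(t_2+1)$ with the remaining factor. *)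

(* Defs.v *)
From HB Require Import structures.
From mathcomp Require Import all_boot all_order all_algebra.
From mathcomp Require Import all_classical all_reals all_analysis.
From mathcomp Require Export complex.
Set Implicit Arguments. Unset Strict Implicit. Unset Printing Implicit Defensive.
Import Order.TTheory GRing.Theory Num.Theory.
Import numFieldNormedType.Exports.
Local Open Scope ring_scope.
Local Open Scope classical_set_scope.

Section Defs.
Context {R : realType}.
Local Notation C := R[i].

Definition mkC (a b : R) : C := Complex a b.
Definition rc (r : R) : C := Complex r 0.
Definition ReC (w : C) : R := complex.Re w.
Definition ImC (w : C) : R := complex.Im w.

Definition posR : set R := [set u | 0 < u].

Definition cpow (u : R) (w : C) : C :=
  rc (expR (ReC w * ln u)) * mkC (cos (ImC w * ln u)) (sin (ImC w * ln u)).

Definition cint (D : set R) (f : R -> C) : C :=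
  mkC (Rintegral (@lebesgue_measure R) D (fun u => ReC (f u)))
      (Rintegral (@lebesgue_measure R) D (fun u => ImC (f u))).

Definition Gamma_int (w : C) : C :=
  cint posR (fun u => cpow u (w - 1) * rc (expR (- u))).

(** Gamma function on C: Gamma(w) = Gamma(w+m) / (w)_m with Re(w+m) > 0.
    (At poles the division by 0 gives 0, i.e. 1/Gamma is not represented
    there; poles never occur below.) *)
Definition cGamma (w : C) : C :=
  let m := (Num.truncn `|ReC w|).+1 in
  Gamma_int (w + m%:R) / \prod_(j < m) (w + j%:R).

Definition cpoch (a : C) (k : nat) : C := \prod_(j < k) (a + j%:R).
Definition rpoch (a : R) (k : nat) : R := \prod_(j < k) (a + j%:R).

(** phi_a(u) = u_+^a / Gamma(a+1) as a function; used only where it is a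
    locally integrable function (Re a > -1), or away from u = 0. *)
Definition phi (a : C) (u : R) : C :=
  if 0 < u then cpow u a / cGamma (a + 1) else 0.

Definition dC (f : R -> C) : R -> C :=
  fun u => mkC (derive1 (fun r => ReC (f r)) u) (derive1 (fun r => ImC (f r)) u).
Definition dCn (k : nat) (f : R -> C) : R -> C := iter k dC f.

(** number of integrations by parts used for the analytic continuation:
    Re a + kcont a > -1 *)
Definition kcont (a : C) : nat := (Num.truncn `|ReC a|).+1.

(** Pairing of the distribution phi_a(t1) phi_b(t2) with a test function g
    (smooth near [0,oo)^2, exponentially decaying), defined by the analytic
    continuation in (a,b):
    <phi_a (x) phi_b, g> = (-1)^(k+l) << phi_(a+k) (x) phi_(b+l), d1^k d2^l g >>
    where the right-hand side is an honest absolutely convergent integral. *)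
Definition pair2 (a b : C) (g : R -> R -> C) : C :=
  let k := kcont a in let l := kcont b in
  (-1) ^+ (k + l) *
  cint posR (fun u => cint posR (fun v =>
     phi (a + k%:R) u * phi (b + l%:R) v *
     dCn k (fun r1 => dCn l (fun r2 => g r1 r2) v) u)).

Definition tpar (z z' : C) : R := ReC (z * z').

Definition admissible (z z' : C) : Prop :=
  (z' = conjc z /\ ~ (exists m : int, z = m%:~R)) \/
  (ImC z = 0 /\ ImC z' = 0 /\
   exists m : int, (m%:~R < ReC z < m%:~R + 1) /\ (m%:~R < ReC z' < m%:~R + 1)).

(** The kernel M(x,y). The factors phi_{z'}(t1+1), phi_z(t2+1) are smooth
    near the support [0,oo)^2 of phi_{-z}(t1) phi_{-z'}(t2), so the
    distribution of the paper is phi_{-z} (x) phi_{-z'} paired with them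
    included in the test function. *)
Definition Mker (z z' : C) (x y : R) : C :=
  rc (tpar z z') *
  pair2 (- z) (- z') (fun t1 t2 =>
     phi z' (t1 + 1) * phi z (t2 + 1) *
     rc (expR (- (x * (t1 + 2^-1)) - y * (t2 + 2^-1))) / rc (t1 + t2 + 1)).

Definition detMker (z z' : C) (n : nat) (x : nat -> R) : C :=
  \det (\matrix_(i < n, j < n) Mker z z' (x i) (x j)).

Definition InOmega (al be : nat -> R) : Prop :=
  (forall i, 0 <= al i.+1 <= al i) /\ (forall i, 0 <= be i.+1 <= be i) /\
  (forall N, \sum_(i < N) (al i + be i) <= 1).

Definition OmegaBdd (F : (nat -> R) * (nat -> R) -> R) : Prop :=
  exists c : R, forall al be, InOmega al be -> `|F (al, be)| <= c.

(** continuity on Omega for the (metrizable) product topology *)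
Definition OmegaCont (F : (nat -> R) * (nat -> R) -> R) : Prop :=
  forall (alm bem : nat -> nat -> R) (al be : nat -> R),
    (forall m, InOmega (alm m) (bem m)) -> InOmega al be ->
    (forall i, alm m i @[m --> \oo] --> al i) ->
    (forall i, bem m i @[m --> \oo] --> be i) ->
    F (alm m, bem m) @[m --> \oo] --> F (al, be).

Definition strdec (n d : nat) (p : {ffun 'I_d -> 'I_n}) : bool :=
  [forall i : 'I_d, forall j : 'I_d, (i < j)%N ==> (p j < p i)%N].

Definition ptseq (n d : nat) (p : {ffun 'I_d -> 'I_n}) : nat -> R :=
  fun i => if (insub i : option 'I_d) is Some j
           then ((p j)%:R + 2^-1) / n%:R else 0.

Definition Pn_mass (z z' : C) (n d : nat) (p q : {ffun 'I_d -> 'I_n}) : R :=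
  ReC (rc (n`!%:R * tpar z z' ^+ d / rpoch (tpar z z') n) *
       \prod_(i < d) (cpoch (z + 1) (p i) * cpoch (z' + 1) (p i) *
                      cpoch (- z + 1) (q i) * cpoch (- z' + 1) (q i) /
                      rc (((p i)`!%:R) ^+ 2 * ((q i)`!%:R) ^+ 2)))
  * (\det (\matrix_(i < d, j < d) ((p i + q j).+1%:R : R)^-1)) ^+ 2.

Definition Pn_expect (z z' : C) (n : nat) (F : (nat -> R) * (nat -> R) -> R) : R :=
  \sum_(d < n.+1) \sum_(p : {ffun 'I_d -> 'I_n}) \sum_(q : {ffun 'I_d -> 'I_n})
    (if [&& strdec p, strdec q & (\sum_(i < d) (p i + q i).+1 == n)%N]
     then Pn_mass z z' p q * F (ptseq p, ptseq q) else 0).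

Definition gamma_law (t : R) (B : set R) : \bar R :=
  (\int[@lebesgue_measure R]_(u in B `&` posR)
     (expR ((t - 1) * ln u) * expR (- u) / ReC (cGamma (rc t)))%:E)%E.

Definition lab_ok (al be : nat -> R) (l : nat * bool) : Prop :=
  if l.2 then al l.1 <> 0 else be l.1 <> 0.
Definition lab_val (al be : nat -> R) (s : R) (l : nat * bool) : R :=
  if l.2 then s * al l.1 else - (s * be l.1).

Definition corr_meas (d : measure_display) (T : measurableType d)
  (Pr : probability T R) (al be : nat -> T -> R) (s : T -> R)
  (n : nat) (A : nat -> set R) : \bar R :=
  (\int[Pr]_w
     \esum_(f in [set f : {ffun 'I_n -> nat * bool} | injective f])
       (\1_[set f : {ffun 'I_n -> nat * bool} | forall k : 'I_n,
              lab_ok (fun i => al i w) (fun i => be i w) (f k) /\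
              A k (lab_val (fun i => al i w) (fun i => be i w) (s w) (f k))] f)%:E)%E.

Fixpoint iterint (A : nat -> set R) (k : nat) (F : (nat -> R) -> \bar R)
  (x : nat -> R) : \bar R :=
  match k with
  | 0 => F x
  | k'.+1 => (\int[@lebesgue_measure R]_(y in A k')
                iterint A k' F (fun i => if i == k' then y else x i))%E
  end.

End Defs.

(* Main.v *)
Require Import Defs.
From HB Require Import structures.
From mathcomp Require Import all_boot all_order all_algebra fingroup perm.
From mathcomp Require Import all_classical all_reals all_analysis.
From mathcomp Require Import complex measurable_realfun.
From mathcomp Require Import ring lra zify.
Import Order.TTheory GRing.Theory Num.Theory.
Import numFieldNormedType.Exports.
Set Implicit Arguments. Unset Strict Implicit. Unset Printing Implicit Defensive.
Local Open Scope ring_scope.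

(** Multiplying the points by an independent Gamma(t) variable is the limit, as m goes to
infinity, of poissonizing n: under the weights (t)_n/n! e^{-n/m} the variable n/m is
asymptotically Gamma(t), and the points (p_i+1/2)/m of the resulting mixture of the P^(n)
form an L-ensemble with weights det(A_PQ)^2, whose correlations are minors of
K = 1 - (1 + A A^T)^{-1}. Up to a gauge, A A^T is a truncated product of Hankel and
Toeplitz matrices built from the coefficients of (1 - r x)^a. The Toeplitz factors have
explicit inverses, and a Wiener-Hopf commutation identity then gives K in closed form,
up to an exponentially small defect, as a sum of products of two hypergeometric sums.
The scaling limits of these sums (Gauss' limit of (a)_n/n!, an exchange of two Laplace
integrals, and contiguity recursions for the continuation in z) turn the Riemann sums of
the minors into integrals of det M. The correlation functional and the functional with
density det M thus agree on products of Lipschitz bumps, hence on products of sets. *)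

(** * Correlations of a finite L-ensemble *)

(** The weak limit of the P^(n) is known only through bounded continuous functions on Omega, and
    this dictates the test functions: a bump that vanishes near 0 sees finitely many of the points u
    al_i, so its sum over distinct indices is continuous. Since only the positive half-line is
    observed, the coordinates q of the beta side are summed out, which replaces the two-sided
    process by the one-sided matrix A A^T. All operators are cut down to finite matrices, so that no
    Fredholm theory enters. The price is the defect; it is harmless because the poissonization
    weight makes it of order e^-m up to powers of m, while the resolvent of a real symmetric matrix
    is bounded whatever A is. The closed form of the kernel may be complex, hence the conjugation
    between the two pictures, which leaves minors unchanged. The normalization det(1 + A A^T) is
    never computed: the case of zero points shows that it grows like m^t, and the other cases are
    divided by it. The discrete minors are nonnegative, a property that passes to the limit and
    permits monotone class arguments with density det M. *)

Section FiniteDeterminants.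
Variable F : fieldType.

(** Sylvester's identity: both sides are the determinant of one block matrix, in which either
    diagonal block can be eliminated. *)
Lemma det_1D_mulC m n (U : 'M[F]_(m, n)) (V : 'M[F]_(n, m)) :
  \det (1%:M + U *m V) = \det (1%:M + V *m U).
Proof.
have -> : \det (1%:M + U *m V) = \det (block_mx 1%:M (- U) V 1%:M).
  have -> : block_mx 1%:M (- U) V 1%:M =
      block_mx (1%:M + U *m V) (- U) 0 1%:M *m block_mx 1%:M 0 V 1%:M.
    by rewrite mulmx_block ?mulmx1 ?mulmx0 ?mul0mx ?mul1mx ?add0r mulNmx addrK.
  by rewrite det_mulmx det_ublock det_lblock !det1 !mulr1.
have -> : block_mx 1%:M (- U) V 1%:M =
    block_mx 1%:M 0 V 1%:M *m block_mx 1%:M (- U) 0 (1%:M + V *m U).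
  rewrite mulmx_block ?mulmx1 ?mulmx0 ?mul0mx ?mul1mx ?addr0 mulmxN.
  by rewrite addrCA addNr addr0.
by rewrite det_mulmx det_ublock det_lblock !det1 !mul1r.
Qed.

(** The principal minor of [S] on [P], kept at full size by identity rows so that sets of all
    cardinals share one matrix type. *)
Definition row_minor D (S : 'M[F]_D) (P : {set 'I_D}) : F :=
  \det (\matrix_(i, j) if i \in P then S i j else (i == j)%:R).

(** Multilinearity in the rows: each row outside [X] splits into its identity part and its [S] part,
    and [P] is the set of rows where [S] is chosen. *)
Lemma det_diag_add D (S : 'M[F]_D) (X : {set 'I_D}) :
  \det (\matrix_(i, j) (if i \in X then S i j else (i == j)%:R + S i j)) =
  \sum_(P : {set 'I_D} | X \subset P) row_minor S P.
Proof.
rewrite /row_minor /determinant exchange_big /=; apply: eq_bigr => s _.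
rewrite -mulr_sumr; congr (_ * _).
transitivity (\prod_i (S i (s i) + (if i \in X then 0 else (i == s i)%:R))).
  by apply: eq_bigr => i _; rewrite mxE; case: ifP; rewrite ?addr0 // addrC.
rewrite bigA_distr [RHS]big_mkcond /=; apply: eq_bigr => P _.
case: ifPn => [XP|/subsetPn[i iX iP]].
  apply: eq_bigr => i _; rewrite mxE; case: ifPn => // iP; case: ifPn => // iX.
  by rewrite (fintype.subsetP XP _ iX) in iP.
by rewrite (bigD1 i) //= (negbTE iP) iX mul0r.
Qed.

Definition inj_mx D n (x : 'I_n -> 'I_D) : 'M[F]_(D, n) :=
  \matrix_(i, k) (i == x k)%:R.

Lemma inj_mx_mul D n (x : 'I_n -> 'I_D) : injective x ->
  inj_mx x *m (inj_mx x)^T =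
  \matrix_(i, j) ((i == j) && (i \in [set x k | k in 'I_n]))%:R.
Proof.
move=> xI; apply/matrixP => i j; rewrite !mxE.
case: (boolP (i \in _)) => [/imsetP[k _ ->]|iX].
  rewrite (bigD1 k) //= !mxE eqxx mul1r big1 ?addr0 ?andbT 1?eq_sym // => l lk.
  by rewrite !mxE (inj_eq xI) eq_sym (negbTE lk) mul0r.
rewrite andbF big1 // => k _; rewrite !mxE; case: eqP => [e|]; last by rewrite mul0r.
by rewrite e imset_f in iX.
Qed.

Lemma inj_mx_sub D n (x : 'I_n -> 'I_D) (M : 'M[F]_D) :
  (inj_mx x)^T *m (M *m inj_mx x) = \matrix_(k, l) M (x k) (x l).
Proof.
apply/matrixP => k l; rewrite !mxE (bigD1 (x k)) //= !mxE eqxx mul1r.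
rewrite (bigD1 (x l)) //= !mxE eqxx mulr1 !big1 ?addr0 // => i ik.
  by rewrite [X in X * _]mxE mxE (negbTE ik) mul0r.
by rewrite !mxE (negbTE ik) mulr0.
Qed.

(** The full-size matrix differs from the identity only in the rows in the range of [p]. It is a
    perturbation of rank at most [d], which Sylvester's identity brings down to size [d]. *)
Lemma row_minor_inj D d (p : 'I_d -> 'I_D) (S : 'M[F]_D) : injective p ->
  row_minor S [set p k | k in 'I_d] = \det (\matrix_(i, j) S (p i) (p j)).
Proof.
move=> pI; rewrite /row_minor.
have -> : (\matrix_(i, j) if i \in [set p k | k in 'I_d] then S i j else (i == j)%:R)
   = 1%:M + inj_mx p *m ((inj_mx p)^T *m (S - 1%:M)).
  rewrite mulmxA inj_mx_mul //; apply/matrixP => i j; rewrite !mxE.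
  rewrite (bigD1 i) //= big1 ?addr0 => [|k ki]; last first.
    by rewrite !mxE eq_sym (negbTE ki) mul0r.
  by rewrite !mxE eqxx /=; case: ifP => _; rewrite ?mul1r ?mul0r ?addr0 // addrCA subrr addr0.
rewrite det_1D_mulC -mulmxA inj_mx_sub; congr (\det _); apply/matrixP => k l.
by rewrite !mxE (inj_eq pI) addrCA subrr addr0.
Qed.

(** The sum is the determinant of [1 + S] minus the projection onto the range of [x]. Factoring out
    [1 + S] leaves a perturbation of the identity of rank at most [n], whence the kernel S (1 +
    S)^-1 of an L-ensemble. *)
Lemma sum_row_minor_supset D n (x : 'I_n -> 'I_D) (S : 'M[F]_D) :
  injective x -> 1%:M + S \in unitmx ->
  \sum_(P : {set 'I_D} | [set x k | k in 'I_n] \subset P) row_minor S P =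
  \det (1%:M + S) * \det (\matrix_(i, j) (1%:M - invmx (1%:M + S)) (x i) (x j)).
Proof.
move=> xI uS; rewrite -det_diag_add; set X := imset _ _.
have -> : (\matrix_(i, j) (if i \in X then S i j else (i == j)%:R + S i j)) =
    (1%:M + S) *m (1%:M + (- (invmx (1%:M + S) *m inj_mx x)) *m (inj_mx x)^T).
  rewrite mulmxDr mulmx1 mulNmx mulmxN !mulmxA mulmxV // mul1mx inj_mx_mul //.
  apply/matrixP => i j; rewrite !mxE -/X; case: ifP => _; rewrite ?andbT ?andbF ?subr0 //.
  by rewrite addrAC subrr add0r.
rewrite det_mulmx det_1D_mulC mulmxN inj_mx_sub; congr (_ * \det _).
by apply/matrixP => k l; rewrite !mxE (inj_eq xI).
Qed.

(** Cauchy-Binet for [A *m A^T] over ordered tuples, which list every set of columns d! times. *)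
Lemma sum_ffun_det_sqr D d (A : 'M[F]_D) (p : 'I_d -> 'I_D) :
  \sum_(q : {ffun 'I_d -> 'I_D}) (\det (\matrix_(i, j) A (p i) (q j))) ^+ 2 =
  d`!%:R * \det (\matrix_(i, j) (A *m A^T) (p i) (p j)).
Proof.
have E : \det (\matrix_(i, j) (A *m A^T) (p i) (p j)) =
   \sum_(q : {ffun 'I_d -> 'I_D}) \prod_i A (p i) (q i) *
       \det (\matrix_(i, j) A (p i) (q j)).
  rewrite /determinant (eq_bigr (fun s : 'S_d => \sum_(q : {ffun 'I_d -> 'I_D})
      \prod_i A (p i) (q i) * ((-1) ^+ s * \prod_i A (p (s i)) (q i)))); last first.
    move=> s _; rewrite (eq_bigr (fun i => \sum_q (A (p i) q * A (p (s i)) q))); last first.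
      by move=> i _; rewrite !mxE; apply: eq_bigr => q _; rewrite mxE.
    rewrite bigA_distr_bigA /= mulr_sumr; apply: eq_bigr => q _.
    by rewrite big_split /= mulrCA.
  rewrite exchange_big /=; apply: eq_bigr => q _; rewrite mulr_sumr.
  rewrite [RHS](reindex_inj (@invg_inj _)) /=; apply: eq_bigr => s _.
  rewrite odd_permV; congr (_ * (_ * _)).
  rewrite (reindex_inj (@perm_inj _ s^-1)) /=; apply: eq_bigr => i _.
  by rewrite permKV mxE.
(* Relabelling [q] by [s] changes the determinant by a sign; summing over all [s] rebuilds the
   second determinant from the product. *)
have H (s : 'S_d) : \det (\matrix_(i, j) (A *m A^T) (p i) (p j)) =
   \sum_(q : {ffun 'I_d -> 'I_D}) ((-1) ^+ s * \prod_i A (p i) (q (s i))) *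
       \det (\matrix_(i, j) A (p i) (q j)).
  have rj : injective (fun q : {ffun 'I_d -> 'I_D} => [ffun i => q (s i)]).
    move=> q q' /ffunP e; apply/ffunP => i.
    by have := e ((s^-1)%g i); rewrite !ffunE permKV.
  rewrite E (reindex_inj rj) /=; apply: eq_bigr => q _.
  have -> : (\matrix_(i, j) A (p i) ([ffun i => q (s i)] j)) =
      col_perm s (\matrix_(i, j) A (p i) (q j)).
    by apply/matrixP => i j; rewrite !mxE ffunE.
  rewrite col_permE det_mulmx det_perm mulrA mulrAC odd_permV; congr (_ * _).
  by rewrite mulrC; congr (_ * _); apply: eq_bigr => i _; rewrite ffunE.
have cS : d`! = #|'S_d| by rewrite -[d in LHS]card_ord card_Sn card_ord.
rewrite mulr_natl cS -sumr_const (eq_bigr _ (fun s _ => H s)) exchange_big /=.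
apply: eq_bigr => q _; rewrite -mulr_suml expr2; congr (_ * _).
by rewrite /determinant; apply: eq_bigr => s _; congr (_ * _); apply: eq_bigr => i _; rewrite mxE.
Qed.

Definition ffun_perm d N (q : {ffun 'I_d -> 'I_N}) (s : 'S_d) : {ffun 'I_d -> 'I_N} :=
  [ffun i => q (s i)].

Lemma ffun_perm_inj d N (s : 'S_d) : injective (fun q : {ffun 'I_d -> 'I_N} => ffun_perm q s).
Proof.
move=> q q' /ffunP e; apply/ffunP => i.
by have := e ((s^-1)%g i); rewrite !ffunE permKV.
Qed.

Section Rank.
Variables (d N : nat) (q : {ffun 'I_d -> 'I_N}).

Lemma rank_lt (i : 'I_d) : (#|[pred j | q i < q j]%N| < d)%N.
Proof.
rewrite -[X in (_ < X)%N](card_ord d) -(cardC (pred1 i)) card1 add1n ltnS.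
by apply: subset_leq_card; apply/fintype.subsetP => j; rewrite !inE; apply: contraTneq => ->; rewrite ltnn.
Qed.

Definition rank i := Ordinal (rank_lt i).

Lemma rank_le i j : (q i <= q j)%N -> (rank j <= rank i)%N.
Proof.
move=> ij; apply: subset_leq_card; apply/fintype.subsetP => k; rewrite !inE.
exact: leq_ltn_trans.
Qed.

Lemma rank_ltn i j : (q i < q j)%N -> (rank j < rank i)%N.
Proof.
move=> ij; apply: proper_card; apply/properP; split.
  by apply/fintype.subsetP => k; rewrite !inE; apply: ltn_trans.
by exists j; rewrite inE // ltnn.
Qed.

Hypothesis qI : injective q.

Lemma rank_inj : injective rank.
Proof.
move=> i j e; apply: qI; apply: val_inj => /=.
by case: (ltngtP (q i) (q j)) => // /rank_ltn; rewrite e ltnn.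
Qed.

(** In a strictly decreasing sequence the entry at position i is exceeded by exactly i others, so
    the only permutation that sorts [q] is the inverse of its ranking. *)
Lemma strdec_perm s : strdec (ffun_perm q s) = (s == (perm rank_inj)^-1)%g.
Proof.
apply/idP/eqP => [/'forall_'forall_implyP H|->].
  apply/permP => i; apply: (@perm_inj _ (perm rank_inj)); rewrite permKV permE.
  apply: val_inj => /=; rewrite -sum1_card (reindex_inj (@perm_inj _ s)) /=.
  rewrite (eq_bigl (fun j : 'I_d => j < i)%N) => [|j].
    by rewrite -(big_ord_widen d (fun=> 1%N)) ?sum1_card ?card_ord // ltnW.
  rewrite !inE; case: (ltngtP j i) => [ji|ij|/val_inj->]; last by rewrite ltnn.
    by have := H _ _ ji; rewrite !ffunE.
  by have := H _ _ ij; rewrite !ffunE ltnNge leq_eqVlt negb_or => /andP[_ /negbTE].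
apply/'forall_'forall_implyP => i j ij; rewrite !ffunE ltnNge; apply/negP => /rank_le.
by rewrite -!(permE rank_inj) !permKV leqNgt ij.
Qed.

End Rank.

Lemma sum_strdec d N (f : {ffun 'I_d -> 'I_N} -> F) :
  (forall q (s : 'S_d), f (ffun_perm q s) = f q) ->
  (forall q : {ffun 'I_d -> 'I_N}, ~ injective q -> f q = 0) ->
  \sum_q f q = d`!%:R * \sum_(q : {ffun 'I_d -> 'I_N} | strdec q) f q.
Proof.
move=> fs f0.
have cS : d`! = #|'S_d| by rewrite -[d in LHS]card_ord card_Sn card_ord.
rewrite mulr_natl cS -sumr_const.
rewrite (eq_bigr (fun s : 'S_d => \sum_(q : {ffun 'I_d -> 'I_N} | strdec (ffun_perm q s)) f q)); last first.
  move=> s _; rewrite (reindex_inj (@ffun_perm_inj d N s)) /=.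
  by apply: eq_bigr => q _; rewrite fs.
rewrite (exchange_big_dep xpredT) //=; apply: eq_bigr => q _.
case: (pselect (injective q)) => [qI|/f0->]; last by rewrite big1.
by rewrite (eq_bigl _ _ (strdec_perm qI)) big_pred1_eq.
Qed.

Lemma sum_injective_image d D (f : {set 'I_D} -> F) :
  \sum_(p : {ffun 'I_d -> 'I_D} | injectiveb p) f [set p k | k in 'I_d] =
  d`!%:R * \sum_(P : {set 'I_D} | #|P| == d) f P.
Proof.
rewrite (partition_big (fun p : {ffun 'I_d -> 'I_D} => [set p k | k in 'I_d])
  (fun P : {set 'I_D} => #|P| == d)) /=; last first.
  by move=> p /injectiveP pI; rewrite card_imset // card_ord.
rewrite mulr_sumr; apply: eq_bigr => P /eqP Pd.
rewrite (eq_bigr (fun=> f P)) => [|p /andP[_ /eqP->//]].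
rewrite sumr_const mulr_natl; congr (_ *+ _).
have := card_inj_ffuns_on 'I_d (mem P); rewrite Pd card_ord ffactnn => <-.
apply: eq_card => p; rewrite [RHS]inE unfold_in andbC; case: (boolP (injectiveb p)); rewrite ?andbF // => pI; rewrite !andbT.
apply/eqP/ffun_onP => [<- i|H]; first by rewrite imset_f.
apply/eqP; rewrite eqEcard Pd card_imset ?card_ord ?leqnn ?andbT; last exact/injectiveP.
by apply/fintype.subsetP => _ /imsetP[i _ ->].
Qed.

Lemma det_noninj d D (B : 'M[F]_D) (q : 'I_d -> 'I_D) (p : 'I_d -> 'I_D) :
  ~ injective q -> \det (\matrix_(i, j) B (p i) (q j)) = 0.
Proof.
move=> qI; have [i [j [ij e]]] : exists i j, i != j /\ q i = q j.
  apply: contra_notP qI => H i j e; apply/eqP/negPn/negP => ij.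
  by apply: H; exists i, j.
rewrite -det_tr; apply: (determinant_alternate ij) => k; rewrite !mxE.
by rewrite e.
Qed.

Lemma det_ffun_perm_r d D (B : 'M[F]_D) (p : 'I_d -> 'I_D) (q : {ffun 'I_d -> 'I_D}) (s : 'S_d) :
  \det (\matrix_(i, j) B (p i) (ffun_perm q s j)) =
  (-1) ^+ s * \det (\matrix_(i, j) B (p i) (q j)).
Proof.
have -> : (\matrix_(i, j) B (p i) (ffun_perm q s j)) =
    col_perm s (\matrix_(i, j) B (p i) (q j)).
  by apply/matrixP => i j; rewrite !mxE ffunE.
by rewrite col_permE det_mulmx det_perm odd_permV mulrC.
Qed.

(** Choosing [n] distinct labels amounts to choosing [n] distinct positions in the range of [p]. In
    this form the sum depends on [p] through its range only, and can be exchanged with a sum over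
    sets. *)
Lemma sum_inj_comp n d D (p : {ffun 'I_d -> 'I_D}) (h : 'I_n -> 'I_D -> F) : injective p ->
  \sum_(f : {ffun 'I_n -> 'I_d} | injectiveb f) \prod_k h k (p (f k)) =
  \sum_(x : {ffun 'I_n -> 'I_D} | injectiveb x && ([set x k | k in 'I_n] \subset [set p k | k in 'I_d]))
     \prod_k h k (x k).
Proof.
move=> pI.
pose pc (f : {ffun 'I_n -> 'I_d}) : {ffun 'I_n -> 'I_D} := [ffun k => p (f k)].
have pcI : injective pc.
  by move=> f g /ffunP e; apply/ffunP => k; apply: pI; have := e k; rewrite !ffunE.
rewrite [RHS](eq_bigl (fun x => x \in [set pc f | f in [set f : {ffun 'I_n -> 'I_d} | injectiveb f]])).
  rewrite big_imset /=; last by move=> f g _ _ /pcI.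
  by apply: eq_big => [f|f _]; rewrite ?inE //; apply: eq_bigr => k _; rewrite ffunE.
move=> x; apply/andP/imsetP => [[/injectiveP xI /fintype.subsetP sx]|[f]].
  have H k : {i | p i = x k}.
    have /sx /imsetP/cid2[i _ ->] : x k \in [set x k | k in 'I_n] by rewrite imset_f.
    by exists i.
  exists [ffun k => sval (H k)]; last first.
    by apply/ffunP => k; rewrite !ffunE (svalP (H k)).
  rewrite inE; apply/injectiveP => k l; rewrite !ffunE => e; apply: xI.
  by rewrite -(svalP (H k)) e (svalP (H l)).
rewrite inE => /injectiveP fI ->; split.
  by apply/injectiveP => k l; rewrite !ffunE => /pI /fI.
by apply/fintype.subsetP => _ /imsetP[k _ ->]; rewrite ffunE imset_f.
Qed.

End FiniteDeterminants.

(** * Symmetric resolvents and the correlation functions of an L-ensemble *)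

Section Resolvent.
Variable R : realFieldType.

(** Pair the equation with [v]: A A^T contributes the nonnegative square norm of A^T v, so the
    square of the largest entry of [v] is at most that entry times the l1 norm of [e]. The bound
    does not involve [A]. *)
Lemma sym_resolvent_bound D (A : 'M[R]_D) (v e : 'cV[R]_D) x :
  (1%:M + A *m A^T) *m v = e -> `|v x 0| <= \sum_i `|e i 0|.
Proof.
move=> ve.
have [i0 _ M] := @Order.TotalTheory.arg_maxP _ _ _ x xpredT (fun i => `|v i 0|) isT.
apply: (le_trans (M x isT)).
have [->|v0] := eqVneq (v i0 0) 0; first by rewrite normr0 sumr_ge0.
have H : `|v i0 0| * `|v i0 0| <= `|v i0 0| * \sum_i `|e i 0|.
  apply: (@le_trans _ _ (\sum_i v i 0 * e i 0)).
    have -> : \sum_i v i 0 * e i 0 = \sum_i v i 0 ^+ 2 + \sum_i ((A^T *m v) i 0) ^+ 2.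
      transitivity ((v^T *m e) 0 0); first by rewrite mxE; apply: eq_bigr => i _; rewrite mxE.
      rewrite -ve mulmxDl mul1mx mulmxDr mxE; congr (_ + _).
        by rewrite mxE; apply: eq_bigr => i _; rewrite mxE expr2.
      rewrite -mulmxA mulmxA -[X in X *m _]trmxK trmx_mul trmxK mxE.
      by apply: eq_bigr => i _; rewrite mxE expr2.
    rewrite -expr2 real_normK ?num_real // (bigD1 i0) //= -addrA lerDl addr_ge0 ?sumr_ge0 // => i _; exact: sqr_ge0.
  rewrite mulr_sumr; apply: ler_sum => i _; rewrite (le_trans (ler_norm _)) // normrM.
  by apply: ler_wpM2r => //; exact: (M i isT).
by rewrite ler_pM2l ?normr_gt0 in H.
Qed.

Lemma sym_resolvent_unit D (A : 'M[R]_D) : 1%:M + A *m A^T \in unitmx.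
Proof.
rewrite unitmxE unitfE; apply/negP => /det0P[v v0 vA]; case/negP: v0; apply/eqP.
have H : (1%:M + A *m A^T) *m v^T = 0.
  by have := congr1 trmx vA; rewrite trmx_mul linearD /= trmx1 trmx_mul trmxK trmx0.
apply/rowP => i; rewrite mxE; have := sym_resolvent_bound i H.
rewrite big1 => [|j _]; last by rewrite mxE normr0.
by rewrite normr_le0 mxE => /eqP.
Qed.

(** Summing over [q] by Cauchy-Binet leaves the minors of [S] on the range of [p]; summing these
    over all sets that contain the range of [x] gives the minors of the correlation kernel. The
    factor det(1 + S) is the partition function. *)
Lemma correlation_L_ensemble D n (A : 'M[R]_D) (h : 'I_n -> 'I_D -> R) :
  let S := A *m A^T in
  \sum_(d < D.+1) \sum_(p : {ffun 'I_d -> 'I_D} | strdec p)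
    \sum_(q : {ffun 'I_d -> 'I_D} | strdec q)
      (\det (\matrix_(i, j) A (p i) (q j))) ^+ 2 *
      \sum_(f : {ffun 'I_n -> 'I_d} | injectiveb f) \prod_k h k (p (f k)) =
  \det (1%:M + S) * \sum_(x : {ffun 'I_n -> 'I_D}) \prod_k h k (x k) *
      \det (\matrix_(i, j) (1%:M - invmx (1%:M + S)) (x i) (x j)).
Proof.
move=> S; have uS : 1%:M + S \in unitmx by apply: sym_resolvent_unit.
pose C (P : {set 'I_D}) := \sum_(x : {ffun 'I_n -> 'I_D} | injectiveb x && ([set x k | k in 'I_n] \subset P))
     \prod_k h k (x k).
have f0 d : d`!%:R != 0 :> R by rewrite pnatr_eq0 -lt0n fact_gt0.
transitivity (\sum_(d < D.+1) \sum_(P : {set 'I_D} | #|P| == d) row_minor S P * C P).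
  apply: eq_bigr => d _.
  have E1 (p : {ffun 'I_d -> 'I_D}) : \sum_(q : {ffun 'I_d -> 'I_D} | strdec q)
      (\det (\matrix_(i, j) A (p i) (q j))) ^+ 2 = \det (\matrix_(i, j) S (p i) (p j)).
    apply: (mulfI (f0 d)); rewrite -sum_ffun_det_sqr sum_strdec // => q.
      by move=> s; rewrite det_ffun_perm_r exprMn sqrr_sign mul1r.
    by move=> qI; rewrite det_noninj // expr0n.
  under eq_bigr => p _ do rewrite -mulr_suml E1.
  apply: (mulfI (f0 d)); rewrite -sum_strdec => [|p s|p pI]; last 2 first.
  - congr (_ * _).
      have -> : (\matrix_(i, j) S (ffun_perm p s i) (ffun_perm p s j)) =
          row_perm s (col_perm s (\matrix_(i, j) S (p i) (p j))).
        by apply/matrixP => i j; rewrite !mxE !ffunE.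
      by rewrite row_permE col_permE !det_mulmx !det_perm odd_permV mulrCA -signr_addb addbb mulr1.
    pose sf (f : {ffun 'I_n -> 'I_d}) : {ffun 'I_n -> 'I_d} := [ffun k => s (f k)].
    have sfI : injective sf.
      by move=> f g /ffunP e; apply/ffunP => k; apply: (@perm_inj _ s); have := e k; rewrite !ffunE.
    rewrite [RHS](reindex_inj sfI) /=; apply: eq_big => [f|f _].
      apply/injectiveP/injectiveP => fI k l; first by rewrite !ffunE => /perm_inj /fI.
      by move=> e; apply: fI; rewrite !ffunE e.
    by apply: eq_bigr => k _; rewrite !ffunE.
  - by rewrite det_noninj // mul0r.
  rewrite -sum_injective_image [RHS]big_mkcond /=; apply: eq_bigr => p _.
  case: (boolP (injectiveb p)) => [/injectiveP pI|/negP pI]; last first.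
    by rewrite det_noninj ?mul0r // => /injectiveP.
  by rewrite row_minor_inj // sum_inj_comp.
rewrite (exchange_big_dep xpredT) //= (eq_bigr (fun P => row_minor S P * C P)); last first.
  move=> P _; have PD : (#|P| < D.+1)%N by rewrite ltnS -[X in (_ <= X)%N]card_ord max_card.
  by rewrite (big_pred1 (Ordinal PD)).
under eq_bigr => P _ do rewrite mulr_sumr.
rewrite (exchange_big_dep (fun x : {ffun 'I_n -> 'I_D} => injectiveb x)) /=; last by move=> ? ? _ /andP[].
rewrite mulr_sumr [RHS](bigID (fun x : {ffun 'I_n -> 'I_D} => injectiveb x)) /= [X in _ + X]big1 ?addr0 => [|x /negP xI]; last first.
  by rewrite det_noninj ?mulr0 // => /injectiveP.
apply: eq_bigr => x /injectiveP xI.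
rewrite -mulr_suml (eq_bigl (fun P : {set 'I_D} => [set x k | k in 'I_n] \subset P)); last first.
  by move=> P; have /injectiveP -> := xI.
by rewrite sum_row_minor_supset // mulrAC mulrA mulrC mulrA.
Qed.

End Resolvent.

(** * Truncated Wiener-Hopf factorization *)

Section WienerHopf.
Variable F : numFieldType.
Implicit Types h k : nat -> F.

(** The index i + j + 1 is the convention for which T(ab) - T(a) T(b) is a product of two Hankel
    operators. *)
Definition hankel_mx N h : 'M[F]_N := \matrix_(i, j) h (i + j).+1.
Definition toeplitz_mx N h : 'M[F]_N :=
  \matrix_(i, j) (if (i <= j)%N then h (j - i)%N else 0).

Lemma sum_ord_ge N i (f : nat -> F) :
  \sum_(l < N) (if (i <= l)%N then f l else 0) = \sum_(s < N - i) f (s + i)%N.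
Proof.
rewrite -big_mkcond /= (eq_bigl (fun l : 'I_N => true && (i <= l)%N)) //.
rewrite -(big_geq_mkord i N xpredT f) -{1}(add0n i) big_addn.
by rewrite big_mkord.
Qed.

Lemma sum_ord_le N i (f : nat -> F) : (i < N)%N ->
  \sum_(l < N) (if (l <= i)%N then f l else 0) = \sum_(s < i.+1) f s.
Proof.
move=> iN; rewrite -big_mkcond /= (eq_bigl (fun l : 'I_N => true && (l < i.+1)%N)) //.
by rewrite -(big_ord_widen_cond _ xpredT f iN).
Qed.

(** Triangular Toeplitz matrices multiply like power series even after truncation, because only
    indices between [i] and [j] enter the product. *)
Lemma toeplitz_mxK N h k :
  (forall n, \sum_(s < n.+1) h s * k (n - s)%N = (n == 0)%:R) ->
  toeplitz_mx N h *m toeplitz_mx N k = 1%:M.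
Proof.
move=> hk; apply/matrixP => i j; rewrite !mxE.
case: (leqP i j) => ij; last first.
  rewrite big1 ?gtn_eqF // => [|l _].
    by case: eqP ij => // ->; rewrite ltnn.
  rewrite !mxE; case: ifP => il; rewrite ?mul0r // ifF ?mulr0 //.
  by apply/negP => lj; move: ij; rewrite ltnNge (leq_trans il lj).
have -> : (i == j) = (j - i == 0)%N by rewrite -val_eqE /= eqn_leq ij subn_eq0.
rewrite -hk.
rewrite (eq_bigr (fun l : 'I_N => if (i <= l)%N then
    (fun l => if (l <= j)%N then h (l - i)%N * k (j - l)%N else 0) l else 0)); last first.
  by move=> l _; rewrite !mxE; do 2 case: ifP => ?; rewrite ?mul0r ?mulr0.
rewrite (sum_ord_ge N i (fun l => if (l <= j)%N then h (l - i)%N * k (j - l)%N else 0)).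
rewrite (eq_bigr (fun s : 'I_(N - i) => if (s <= j - i)%N then (fun s => h s * k (j - i - s)%N) s else 0)); last first.
  move=> s _; rewrite addnK (_ : (s + i <= j) = (s <= j - i))%N ?leq_subRL //; last by rewrite addnC.
  by rewrite subnDA [in RHS]subnAC.
rewrite (sum_ord_le (i := j - i) (fun s => h s * k (j - i - s)%N)) //.
by rewrite ltn_sub2r.
Qed.

Definition toeplitz_defect N h k : 'M[F]_N :=
  toeplitz_mx N h *m (toeplitz_mx N k)^T - (toeplitz_mx N k)^T *m toeplitz_mx N h
  - hankel_mx N k *m hankel_mx N h.

(** For i <= j the three entries are sums of one series over s < N - j, over s <= i and over i < s
    <= N + i. For semi-infinite matrices they cancel; here the terms with N - j <= s remain. *)
Lemma toeplitz_defectE N h k (i j : 'I_N) : (i <= j)%N ->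
  toeplitz_defect N h k i j =
  - \sum_(s < N + i.+1 - (N - j)) h (s + (N - j) + (j - i))%N * k (s + (N - j))%N.
Proof.
move=> ij; pose f s := h (s + (j - i))%N * k s.
have E1 : (toeplitz_mx N h *m (toeplitz_mx N k)^T) i j = \sum_(s < N - j) f s.
  rewrite mxE (eq_bigr (fun l : 'I_N => if (j <= l)%N then h (l - i)%N * k (l - j)%N else 0)); last first.
    move=> l _; rewrite !mxE; case: ifP => il; case: ifP => jl; rewrite ?mulr0 ?mul0r //.
    by rewrite (leq_trans ij jl) in il.
  rewrite (sum_ord_ge N j (fun l => h (l - i)%N * k (l - j)%N)); apply: eq_bigr => s _.
  by rewrite /f addnK addnBA.
have E2 : ((toeplitz_mx N k)^T *m toeplitz_mx N h) i j = \sum_(s < i.+1) f s.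
  rewrite mxE (eq_bigr (fun l : 'I_N => if (l <= i)%N then k (i - l)%N * h (j - l)%N else 0)); last first.
    move=> l _; rewrite !mxE; case: ifP => il; case: ifP => jl; rewrite ?mulr0 ?mul0r //.
    by rewrite (leq_trans il ij) in jl.
  rewrite (sum_ord_le (fun l => k (i - l)%N * h (j - l)%N)) //.
  rewrite (reindex_inj rev_ord_inj) /=; apply: eq_bigr => s _.
  have := ltn_ord s; rewrite ltnS => si.
  rewrite /f subSS subKn // mulrC; congr (h _ * _).
  by rewrite subnBA // addnC addnBA.
have E3 : (hankel_mx N k *m hankel_mx N h) i j = \sum_(i.+1 <= s < N + i.+1) f s.
  rewrite mxE -{1}(add0n i.+1) big_addn addnK big_mkord; apply: eq_bigr => s _.
  rewrite !mxE /f mulrC addnS; congr (h _ * k _); last by rewrite addnC.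
  by lia.
have -> : toeplitz_defect N h k i j = \sum_(s < N - j) f s - \sum_(s < i.+1) f s - \sum_(i.+1 <= s < N + i.+1) f s.
  by rewrite -E1 -E2 -E3 !mxE.
rewrite -addrA -opprD -(big_mkord xpredT f) -(big_mkord xpredT (fun s => f s)).
rewrite -big_cat_nat //= ?leq_addl //.
rewrite (@big_cat_nat _ _ _ (N - j) 0 (N + i.+1)) //=; last by rewrite (leq_trans (leq_subr _ _)) ?leq_addr.
rewrite opprD addrA subrr sub0r; congr (- _).
rewrite -{1}(add0n (N - j)%N) big_addn big_mkord.
by apply: eq_bigr => s _; rewrite /f.
Qed.

Lemma toeplitz_defect_tr N h k : (toeplitz_defect N h k)^T = toeplitz_defect N k h.
Proof.
have hT g : (hankel_mx N g)^T = hankel_mx N g by apply/matrixP => i j; rewrite !mxE addnC.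
by rewrite /toeplitz_defect !linearB /= !trmx_mul !hT !trmxK.
Qed.

(* For the semi-infinite operators the middle factor is zero, that is K = (1 + L)^{-1} L;
   truncation leaves a small defect. *)
Lemma wiener_hopf_defect N (H1 H2 U V Ui Vi : 'M[F]_N) :
  U *m Ui = 1%:M -> Ui *m U = 1%:M -> V *m Vi = 1%:M -> Vi *m V = 1%:M ->
  let L := H1 *m U *m (V *m H2) in let K := H1 *m V *m (U *m H2) in
  L - K - L *m K =
  (H1 *m U *m V) *m (Ui *m Vi - Vi *m Ui - H2 *m H1) *m (V *m U *m H2).
Proof.
move=> UUi UiU VVi ViV L K; rewrite !mulmxBr !mulmxBl; congr (_ - _ - _).
- rewrite /L; have -> : H1 *m U *m V *m (Ui *m Vi) *m (V *m U *m H2) =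
    H1 *m U *m V *m Ui *m (Vi *m V) *m U *m H2 by rewrite !mulmxA.
  by rewrite ViV mulmx1 -(mulmxA _ Ui U) UiU mulmx1 !mulmxA.
- rewrite /K; have -> : H1 *m U *m V *m (Vi *m Ui) *m (V *m U *m H2) =
    H1 *m U *m (V *m Vi) *m Ui *m V *m U *m H2 by rewrite !mulmxA.
  by rewrite VVi mulmx1 -(mulmxA H1 U Ui) UUi mulmx1 !mulmxA.
- by rewrite /L /K !mulmxA.
Qed.

Section Bounds.
Variables (N : nat) (P r : F).
Hypotheses (P0 : 0 <= P) (r0 : 0 <= r) (r1 : r <= 1).
(** No index beyond 2N occurs in products of N by N matrices of this kind; on this window polynomial
    growth of the coefficients can be put into the constant [P]. *)
Definition geo_bounded h := forall n, (n <= 2 * N)%N -> `|h n| <= P * r ^+ n.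

Lemma ler_sum_card n (f : 'I_n -> F) c : (forall i, `|f i| <= c) ->
  `|\sum_i f i| <= n%:R * c.
Proof.
move=> fc; apply: (le_trans (ler_norm_sum _ _ _)).
by apply: (le_trans (ler_sum _ (fun i _ => fc i))); rewrite sumr_const card_ord mulr_natl.
Qed.

(** The two indices of a surviving term add up to at least 2N - i - j. *)
Lemma toeplitz_defect_bound h k (i j : 'I_N) : geo_bounded h -> geo_bounded k ->
  `|toeplitz_defect N h k i j| <= (2 * N)%:R * (P ^+ 2 * r ^+ (2 * N - i - j)).
Proof.
wlog ij : h k i j / (i <= j)%N.
  move=> W bh bk; case: (leqP i j) => [ij|/ltnW ji]; first exact: W.
  by rewrite -toeplitz_defect_tr mxE subnAC; apply: W.
move=> bh bk; rewrite toeplitz_defectE // normrN.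
have iN := ltn_ord i; have jN := ltn_ord j.
apply: (@le_trans _ _ ((N + i.+1 - (N - j))%:R * (P ^+ 2 * r ^+ (2 * N - i - j)))).
  apply: ler_sum_card => s; have sl := ltn_ord s.
  rewrite normrM; apply: (@le_trans _ _ ((P * r ^+ (s + (N - j) + (j - i))) * (P * r ^+ (s + (N - j))))).
    by apply: ler_pM => //; [apply: bh|apply: bk]; lia.
  rewrite mulrACA -expr2 -exprD ler_wpM2l ?exprn_ge0 //.
  by apply: ler_wiXn2l => //; lia.
rewrite ler_wpM2r ?ler_nat ?mulr_ge0 ?exprn_ge0 //; lia.
Qed.

(** The factor [r ^+ k], like its mirror image in [toeplitz_hankel_bound], supplies what the
    exponent 2N - i - j of the defect lacks for large indices. *)
Lemma hankel_toeplitz_bound h hb kb (x k : 'I_N) :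
  geo_bounded h -> geo_bounded hb -> geo_bounded kb ->
  `|(hankel_mx N h *m toeplitz_mx N hb *m (toeplitz_mx N kb)^T) x k| <=
  (N * N)%:R * (P ^+ 3 * r ^+ k).
Proof.
move=> bh bhb bkb; rewrite mxE natrM -mulrA; apply: ler_sum_card => i.
rewrite mxE mulr_suml; apply: ler_sum_card => j; rewrite !mxE.
have iN := ltn_ord i; have jN := ltn_ord j; have xN := ltn_ord x; have kN := ltn_ord k.
case: ifP => ji; last by rewrite mulr0 mul0r normr0 mulr_ge0 ?exprn_ge0.
case: ifP => ki; last by rewrite mulr0 normr0 mulr_ge0 ?exprn_ge0.
rewrite !normrM; apply: (@le_trans _ _ (P * r ^+ (x + j).+1 * (P * r ^+ (i - j)) * (P * r ^+ (i - k)))).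
  by apply: ler_pM => //; [apply: ler_pM => //; [apply: bh|apply: bhb]|apply: bkb]; lia.
have -> : P * r ^+ (x + j).+1 * (P * r ^+ (i - j)) * (P * r ^+ (i - k)) =
  P ^+ 3 * (r ^+ (x + j).+1 * r ^+ (i - j) * r ^+ (i - k)) by ring.
rewrite -!exprD ler_wpM2l ?exprn_ge0 //.
by apply: ler_wiXn2l => //; lia.
Qed.

Lemma toeplitz_hankel_bound k hb kb (l y : 'I_N) :
  geo_bounded k -> geo_bounded hb -> geo_bounded kb ->
  `|((toeplitz_mx N kb)^T *m (toeplitz_mx N hb *m hankel_mx N k)) l y| <=
  (N * N)%:R * (P ^+ 3 * r ^+ l).
Proof.
move=> bk bhb bkb; rewrite mxE natrM -mulrA; apply: ler_sum_card => j.
rewrite [X in _ * X]mxE mulr_sumr; apply: ler_sum_card => i; rewrite !mxE.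
have iN := ltn_ord i; have jN := ltn_ord j; have lN := ltn_ord l; have yN := ltn_ord y.
case: ifP => jl; last by rewrite mul0r normr0 mulr_ge0 ?exprn_ge0.
case: ifP => ji; last by rewrite mul0r mulr0 normr0 mulr_ge0 ?exprn_ge0.
rewrite !normrM; apply: (@le_trans _ _ (P * r ^+ (l - j) * (P * r ^+ (i - j) * (P * r ^+ (i + y).+1)))).
  by apply: ler_pM => //; [apply: bkb|apply: ler_pM => //; [apply: bhb|apply: bk]]; lia.
have -> : P * r ^+ (l - j) * (P * r ^+ (i - j) * (P * r ^+ (i + y).+1)) =
  P ^+ 3 * (r ^+ (l - j) * r ^+ (i - j) * r ^+ (i + y).+1) by ring.
rewrite -!exprD ler_wpM2l ?exprn_ge0 //.
by apply: ler_wiXn2l => //; lia.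
Qed.

(** The exponents i, 2N - i - l and l of the three factors add up to 2N. The power N^7 counts the
    terms of the nested sums, and P^8 the eight coefficients in each term. *)
Lemma wiener_hopf_bound h hb k kb (x y : 'I_N) :
  geo_bounded h -> geo_bounded hb -> geo_bounded k -> geo_bounded kb ->
  `|((hankel_mx N h *m toeplitz_mx N hb *m (toeplitz_mx N kb)^T) *m
     toeplitz_defect N h k *m
     ((toeplitz_mx N kb)^T *m (toeplitz_mx N hb *m hankel_mx N k))) x y| <=
  (2 * N ^ 7)%:R * (P ^+ 8 * r ^+ (2 * N)).
Proof.
move=> bh bhb bk bkb.
have -> : (2 * N ^ 7)%:R * (P ^+ 8 * r ^+ (2 * N)) = N%:R * (N%:R * ((N * N)%:R * P ^+ 3 * ((2 * N)%:R * P ^+ 2) * ((N * N)%:R * P ^+ 3) * r ^+ (2 * N))).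
  by rewrite natrM natrX ![(_ * N)%:R]natrM; ring.
rewrite mxE; apply: ler_sum_card => l; rewrite mxE mulr_suml; apply: ler_sum_card => i.
have iN := ltn_ord i; have lN := ltn_ord l.
rewrite !normrM.
have B1 := hankel_toeplitz_bound x i bh bhb bkb.
have B2 := toeplitz_defect_bound i l bh bk.
have B3 := toeplitz_hankel_bound l y bk bhb bkb.
apply: (le_trans (ler_pM _ _ (ler_pM _ _ B1 B2) B3)) => //.
have -> : r ^+ (2 * N) = r ^+ i * r ^+ (2 * N - i - l) * r ^+ l by rewrite -!exprD; congr (_ ^+ _); lia.
by rewrite le_eqVlt; apply/orP; left; apply/eqP; ring.
Qed.
End Bounds.
End WienerHopf.

Local Open Scope classical_set_scope.

(** * Complex-valued limits and integrals *)

Section ComplexAnalysis.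
Context {R : realType}.
Local Notation C := R[i].
Local Notation mu := (@lebesgue_measure R).
Implicit Types (u v : nat -> C) (a b l w : C).

(** A modulus with values in [R]; the norm of [R[i]] takes its values in [R[i]] itself. *)
Definition cnorm (w : C) : R := Num.sqrt (ReC w ^+ 2 + ImC w ^+ 2).

Lemma cnormE w : cnorm w = ComplexField.Normc.normc w.
Proof. by case: w. Qed.

Lemma cnorm_ge0 w : 0 <= cnorm w. Proof. exact: sqrtr_ge0. Qed.
Lemma cnorm0 : cnorm 0 = 0.
Proof. by rewrite cnormE ComplexField.Normc.normc0. Qed.
Lemma cnorm1 : cnorm 1 = 1.
Proof. by rewrite cnormE ComplexField.Normc.normc1. Qed.
Lemma cnormM a b : cnorm (a * b) = cnorm a * cnorm b.
Proof. by rewrite !cnormE ComplexField.Normc.normcM. Qed.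
Lemma cnormD a b : cnorm (a + b) <= cnorm a + cnorm b.
Proof. by rewrite !cnormE; exact: le_normcD. Qed.
Lemma cnormN a : cnorm (- a) = cnorm a.
Proof. by rewrite !cnormE normcN. Qed.
Lemma cnormV a : cnorm a^-1 = (cnorm a)^-1.
Proof. by rewrite !cnormE ComplexField.Normc.normcV. Qed.
Lemma cnormX a n : cnorm (a ^+ n) = cnorm a ^+ n.
Proof. by elim: n => [|n IH]; rewrite ?expr0 ?cnorm1 // !exprS cnormM IH. Qed.
Lemma cnorm_eq0 a : cnorm a = 0 -> a = 0.
Proof. by rewrite cnormE; exact: ComplexField.Normc.eq0_normc. Qed.
Lemma cnorm_gt0 a : a != 0 -> 0 < cnorm a.
Proof.
move=> a0; rewrite lt_neqAle cnorm_ge0 andbT eq_sym.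
by apply: contraNneq a0 => /cnorm_eq0 ->.
Qed.
Lemma cnorm_normr a : `|a| = rc (cnorm a).
Proof. by rewrite cnormE. Qed.
Lemma cnorm_rc r : cnorm (rc r) = `|r|.
Proof. by rewrite /cnorm /= expr0n /= addr0 sqrtr_sqr. Qed.
Lemma cnorm_sum I (s : seq I) P (f : I -> C) :
  cnorm (\sum_(i <- s | P i) f i) <= \sum_(i <- s | P i) cnorm (f i).
Proof.
elim/big_ind2: _ => [|x x' y y' h1 h2|//]; first by rewrite cnorm0.
by rewrite (le_trans (cnormD _ _)) // lerD.
Qed.
Lemma cnorm_prod I (s : seq I) P (f : I -> C) :
  cnorm (\prod_(i <- s | P i) f i) = \prod_(i <- s | P i) cnorm (f i).
Proof. by elim/big_ind2: _ => [|x x' y y' <- <-|//]; rewrite ?cnorm1 // cnormM. Qed.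

Lemma Re_le_cnorm w : `|ReC w| <= cnorm w.
Proof. by rewrite -sqrtr_sqr ler_wsqrtr // lerDl sqr_ge0. Qed.
Lemma Im_le_cnorm w : `|ImC w| <= cnorm w.
Proof. by rewrite -sqrtr_sqr ler_wsqrtr // lerDr sqr_ge0. Qed.
Lemma cnorm_le w : cnorm w <= `|ReC w| + `|ImC w|.
Proof.
rewrite -(ger0_norm (addr_ge0 (normr_ge0 (ReC w)) (normr_ge0 (ImC w)))) -sqrtr_sqr.
by rewrite ler_wsqrtr // sqrrD !real_normK ?num_real // addrAC lerDl mulrn_wge0 // mulr_ge0.
Qed.

Lemma ReD a b : ReC (a + b) = ReC a + ReC b. Proof. by case: a; case: b. Qed.
Lemma ImD a b : ImC (a + b) = ImC a + ImC b. Proof. by case: a; case: b. Qed.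
Lemma ReN a : ReC (- a) = - ReC a. Proof. by case: a. Qed.
Lemma ImN a : ImC (- a) = - ImC a. Proof. by case: a. Qed.
Lemma ReM a b : ReC (a * b) = ReC a * ReC b - ImC a * ImC b.
Proof. by case: a; case: b. Qed.
Lemma ImM a b : ImC (a * b) = ReC a * ImC b + ImC a * ReC b.
Proof. by case: a; case: b. Qed.
Lemma rcD (x y : R) : rc (x + y) = rc x + rc y.
Proof. by rewrite /rc; apply/eqP; rewrite eq_complex /= addr0 !eqxx. Qed.
Lemma rcM (x y : R) : rc (x * y) = rc x * rc y.
Proof. by apply/eqP; rewrite eq_complex /= !mul0r !mulr0 subr0 addr0 !eqxx. Qed.
Lemma rcN (x : R) : rc (- x) = - rc x.
Proof. by apply/eqP; rewrite eq_complex /= oppr0 !eqxx. Qed.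
Lemma rcV (x : R) : rc x^-1 = (rc x)^-1.
Proof. exact: (fmorphV (real_complex R) x). Qed.
Lemma rcX (x : R) n : rc (x ^+ n) = rc x ^+ n.
Proof. by elim: n => [|n IH]; rewrite ?expr0 // !exprS rcM IH. Qed.
Lemma rc_nat n : rc (n%:R : R) = n%:R.
Proof. by elim: n => [//|n IH]; rewrite !mulrS rcD IH. Qed.
Lemma rc_sum I (s : seq I) P (f : I -> R) :
  rc (\sum_(i <- s | P i) f i) = \sum_(i <- s | P i) rc (f i).
Proof. by elim/big_ind2: _ => [//|x x' y y' <- <-|//]; rewrite rcD. Qed.
Lemma rc_prod I (s : seq I) P (f : I -> R) :
  rc (\prod_(i <- s | P i) f i) = \prod_(i <- s | P i) rc (f i).
Proof. by elim/big_ind2: _ => [//|x x' y y' <- <-|//]; rewrite rcM. Qed.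
Lemma Re_nat n : ReC (n%:R : C) = n%:R. Proof. by rewrite -rc_nat. Qed.
Lemma rc_neq0 (x : R) : x != 0 -> rc x != 0.
Proof. by apply: contra => /eqP[->]. Qed.
Lemma eqC a b : ReC a = ReC b -> ImC a = ImC b -> a = b.
Proof. by case: a; case: b => /= ? ? ? ? -> ->. Qed.
Lemma rcZ_Re (x : R) a : ReC (rc x * a) = x * ReC a.
Proof. by rewrite ReM /= mul0r subr0. Qed.
Lemma rcZ_Im (x : R) a : ImC (rc x * a) = x * ImC a.
Proof. by rewrite ImM /= mul0r addr0. Qed.
Lemma Re_sum I (s : seq I) P (f : I -> C) :
  ReC (\sum_(i <- s | P i) f i) = \sum_(i <- s | P i) ReC (f i).
Proof. by elim/big_ind2: _ => [//|x x' y y' <- <-|//]; rewrite ReD. Qed.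
Lemma Im_sum I (s : seq I) P (f : I -> C) :
  ImC (\sum_(i <- s | P i) f i) = \sum_(i <- s | P i) ImC (f i).
Proof. by elim/big_ind2: _ => [//|x x' y y' <- <-|//]; rewrite ImD. Qed.

Definition cvgC (u : nat -> C) (l : C) : Prop :=
  ((fun n => ReC (u n)) @ \oo --> ReC l) /\ ((fun n => ImC (u n)) @ \oo --> ImC l).

Lemma cvgC_cst l : cvgC (fun=> l) l.
Proof. by split; exact: cvg_cst. Qed.
Lemma cvgCD u v a b : cvgC u a -> cvgC v b -> cvgC (fun n => u n + v n) (a + b).
Proof.
move=> [u1 u2] [v1 v2]; split.
  by rewrite ReD; under eq_fun do rewrite ReD; exact: cvgD.
by rewrite ImD; under eq_fun do rewrite ImD; exact: cvgD.
Qed.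
Lemma cvgCN u a : cvgC u a -> cvgC (fun n => - u n) (- a).
Proof.
move=> [u1 u2]; split.
  by rewrite ReN; under eq_fun do rewrite ReN; exact: cvgN.
by rewrite ImN; under eq_fun do rewrite ImN; exact: cvgN.
Qed.
Lemma cvgCB u v a b : cvgC u a -> cvgC v b -> cvgC (fun n => u n - v n) (a - b).
Proof. by move=> ua vb; apply: cvgCD => //; exact: cvgCN. Qed.
Lemma cvgCM u v a b : cvgC u a -> cvgC v b -> cvgC (fun n => u n * v n) (a * b).
Proof.
move=> [u1 u2] [v1 v2]; split.
  rewrite ReM; under eq_fun do rewrite ReM.
  by apply: cvgB; exact: cvgM.
rewrite ImM; under eq_fun do rewrite ImM.
by apply: cvgD; exact: cvgM.
Qed.
Lemma cvgC_rc (f : nat -> R) (x : R) : f @ \oo --> x -> cvgC (fun n => rc (f n)) (rc x).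
Proof. by move=> fx; split => //=; exact: cvg_cst. Qed.
Lemma cvgC_unique u a b : cvgC u a -> cvgC u b -> a = b.
Proof.
move=> [u1 u2] [v1 v2]; apply: eqC.
  exact: (cvg_unique (@norm_hausdorff _ _) u1 v1).
exact: (cvg_unique (@norm_hausdorff _ _) u2 v2).
Qed.
Lemma cvgC_near u v l : (\forall n \near \oo, u n = v n) -> cvgC u l -> cvgC v l.
Proof.
move=> uv [u1 u2]; split.
  by apply: cvg_trans u1; apply: near_eq_cvg; apply: filterS uv => n ->.
by apply: cvg_trans u2; apply: near_eq_cvg; apply: filterS uv => n ->.
Qed.
Lemma cvgC_norm u l : cvgC u l -> (fun n => cnorm (u n)) @ \oo --> cnorm l.
Proof.
move=> [u1 u2]; rewrite /cnorm.
apply: (@continuous_cvg _ _ _ _ _ (fun n => ReC (u n) ^+ 2 + ImC (u n) ^+ 2) (@Num.sqrt R)).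
  exact: sqrt_continuous.
by apply: cvgD; under eq_fun do rewrite expr2; rewrite expr2; exact: cvgM.
Qed.
Lemma cvgC_norm0 u : (fun n => cnorm (u n)) @ \oo --> (0 : R) -> cvgC u 0.
Proof.
move=> u0; split => /=.
  apply/norm_cvg0P; apply: (squeeze_cvgr _ (@cvg_cst _ 0 _ \oo _) u0).
  by near=> n; rewrite normr_ge0 Re_le_cnorm.
apply/norm_cvg0P; apply: (squeeze_cvgr _ (@cvg_cst _ 0 _ \oo _) u0).
by near=> n; rewrite normr_ge0 Im_le_cnorm.
Unshelve. all: by end_near. Qed.
Lemma cvgCV u l : l != 0 -> cvgC u l -> cvgC (fun n => (u n)^-1) l^-1.
Proof.
move=> l0 ul; have n0 : cnorm l ^+ 2 != 0 by rewrite expf_neq0 // gt_eqF // cnorm_gt0.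
have E w : w^-1 = rc ((cnorm w ^+ 2)^-1) * mkC (ReC w) (- ImC w).
  rewrite /cnorm sqr_sqrtr ?addr_ge0 ?sqr_ge0 //; case: w => x y /=.
  by apply: eqC; rewrite ?(ReM, ImM) /= !mul0r ?subr0 ?addr0 mulrC ?mulNr ?mulrN.
rewrite E; under [X in cvgC X _]eq_fun do rewrite E.
apply: cvgCM; last first.
  by case: ul => u1 u2; split => //=; exact: cvgN.
apply: cvgC_rc; apply: cvgV => //; have h := cvgC_norm ul.
by under eq_fun do rewrite expr2; rewrite expr2; exact: cvgM.
Qed.
Lemma cvgC_sum I (s : seq I) (f : I -> nat -> C) (g : I -> C) :
  (forall i, cvgC (f i) (g i)) ->
  cvgC (fun n => \sum_(i <- s) f i n) (\sum_(i <- s) g i).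
Proof.
move=> fg; elim: s => [|i s IH].
  by rewrite big_nil; under [X in cvgC X _]eq_fun do rewrite big_nil; exact: cvgC_cst.
by rewrite big_cons; under [X in cvgC X _]eq_fun do rewrite big_cons; exact: cvgCD.
Qed.
Lemma cvgC_prod I (s : seq I) (f : I -> nat -> C) (g : I -> C) :
  (forall i, cvgC (f i) (g i)) ->
  cvgC (fun n => \prod_(i <- s) f i n) (\prod_(i <- s) g i).
Proof.
move=> fg; elim: s => [|i s IH].
  by rewrite big_nil; under [X in cvgC X _]eq_fun do rewrite big_nil; exact: cvgC_cst.
by rewrite big_cons; under [X in cvgC X _]eq_fun do rewrite big_cons; exact: cvgCM.
Qed.
Lemma cvgC_det n (f : 'I_n -> 'I_n -> nat -> C) (g : 'I_n -> 'I_n -> C) :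
  (forall i j, cvgC (f i j) (g i j)) ->
  cvgC (fun m => \det (\matrix_(i, j) f i j m)) (\det (\matrix_(i, j) g i j)).
Proof.
move=> fg; rewrite /determinant; apply: cvgC_sum => s.
apply: cvgCM; first exact: cvgC_cst.
rewrite (eq_bigr (fun i => g i (s i))) => [|i _]; last by rewrite mxE.
under [X in cvgC X _]eq_fun do under eq_bigr do rewrite mxE.
exact: cvgC_prod.
Qed.
Lemma cvgC_bounded u l : cvgC u l -> exists M : R, forall n, cnorm (u n) <= M.
Proof.
move=> /cvgC_norm ul; have : cvgn (fun n => cnorm (u n)) by apply/cvg_ex; exists (cnorm l).
move=> /cvg_seq_bounded [M [_ HM]]; exists (M + 1) => n.
by have := HM (M + 1) ltac:(by rewrite ltrDl) n Logic.I; rewrite /= ger0_norm ?cnorm_ge0.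
Qed.
Lemma cvgC_comp (f : nat -> nat) u l : f @ \oo --> \oo -> cvgC u l -> cvgC (fun n => u (f n)) l.
Proof.
by move=> fo [u1 u2]; split; [exact: (cvg_comp _ _ fo u1)|exact: (cvg_comp _ _ fo u2)].
Qed.

Lemma cpowD (x : R) a b : cpow x (a + b) = cpow x a * cpow x b.
Proof.
apply: eqC; rewrite /cpow !(ReM, ImM, ReD, ImD) /= !mulrDl expRD.
  rewrite cosD !mul0r !subr0 !addr0; ring.
rewrite sinD !mul0r !subr0 !addr0; ring.
Qed.
Lemma cpow0 (x : R) : cpow x 0 = 1.
Proof.
by apply: eqC; rewrite /cpow !(ReM, ImM) /= !mul0r ?expR0 ?cos0 ?sin0 ?mulr0 ?mulr1 ?subr0 ?addr0.
Qed.
Lemma cnorm_cpow (x : R) a : cnorm (cpow x a) = expR (ReC a * ln x).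
Proof.
rewrite /cpow cnormM cnorm_rc ger0_norm ?expR_ge0 // /cnorm /=.
by rewrite cos2Dsin2 sqrtr1 mulr1.
Qed.
Lemma cpow_neq0 (x : R) a : cpow x a != 0.
Proof.
apply/eqP => e; have := cnorm_cpow x a; rewrite e cnorm0 => /esym/eqP.
by rewrite gt_eqF // expR_gt0.
Qed.
Lemma cpowN (x : R) a : cpow x (- a) = (cpow x a)^-1.
Proof.
apply: (mulfI (cpow_neq0 x a)); rewrite -cpowD subrr cpow0 mulfV //; exact: cpow_neq0.
Qed.
Lemma cpow_rc (x y : R) : cpow x (rc y) = rc (expR (y * ln x)).
Proof. by apply: eqC; rewrite /cpow !(ReM, ImM) /= !mul0r ?cos0 ?sin0 ?mulr0 ?mulr1 ?subr0 ?addr0. Qed.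
Lemma cpow1 (x : R) : 0 < x -> cpow x 1 = rc x.
Proof. by move=> x0; rewrite (cpow_rc x 1) mul1r lnK. Qed.
Lemma cpowM (x y : R) a : 0 < x -> 0 < y -> cpow (x * y) a = cpow x a * cpow y a.
Proof.
move=> x0 y0; rewrite /cpow lnM ?posrE // !mulrDr expRD cosD sinD.
by apply: eqC; rewrite !(ReM, ImM) /= !mul0r !subr0 !addr0; ring.
Qed.
Lemma cvgC_cpow (f : nat -> R) (x : R) a : 0 < x -> f @ \oo --> x ->
  cvgC (fun n => cpow (f n) a) (cpow x a).
Proof.
move=> x0 fx; have lf : (fun n => ln (f n)) @ \oo --> ln x.
  by apply: (continuous_cvg _ _ fx); exact: continuous_ln.
have sf c : (fun n => c * ln (f n)) @ \oo --> c * ln x by apply: cvgM => //; exact: cvg_cst.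
apply: cvgCM.
  by apply: cvgC_rc; apply: (continuous_cvg _ _ (sf _)); exact: continuous_expR.
split => /=.
  by apply: (continuous_cvg _ _ (sf _)); exact: continuous_cos.
by apply: (continuous_cvg _ _ (sf _)); exact: continuous_sin.
Qed.

Definition cmeas (D : set R) (f : R -> C) : Prop :=
  measurable_fun D (fun x => ReC (f x)) /\ measurable_fun D (fun x => ImC (f x)).
Definition cintegrable (D : set R) (f : R -> C) : Prop :=
  mu.-integrable D (EFin \o (fun x => ReC (f x))) /\ mu.-integrable D (EFin \o (fun x => ImC (f x))).

Lemma cmeasD D f g : cmeas D f -> cmeas D g -> cmeas D (fun x => f x + g x).
Proof.
move=> [f1 f2] [g1 g2]; split.
  by under eq_fun do rewrite ReD; exact: measurable_funD.
by under eq_fun do rewrite ImD; exact: measurable_funD.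
Qed.
Lemma cmeasM D f g : cmeas D f -> cmeas D g -> cmeas D (fun x => f x * g x).
Proof.
move=> [f1 f2] [g1 g2]; split.
  by under eq_fun do rewrite ReM; apply: measurable_funB; exact: measurable_funM.
by under eq_fun do rewrite ImM; apply: measurable_funD; exact: measurable_funM.
Qed.
Lemma cmeas_cst D c : cmeas D (fun=> c).
Proof. by split; exact: measurable_cst. Qed.
Lemma cmeas_rc D (f : R -> R) : measurable_fun D f -> cmeas D (fun x => rc (f x)).
Proof. by move=> mf; split => //=; exact: measurable_cst. Qed.
Lemma measurable_comp_cont D (f g : R -> R) : measurable D -> continuous f -> measurable_fun D g ->
  measurable_fun D (fun x => f (g x)).
Proof.
move=> mD cf mg; apply: (measurableT_comp _ mg).
exact: continuous_measurable_fun.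
Qed.
Lemma cmeas_cpow D (f : R -> R) a : measurable D -> measurable_fun D f -> cmeas D (fun x => cpow (f x) a).
Proof.
move=> mD mf.
have ml : measurable_fun D (fun x => ln (f x)) by apply: measurableT_comp => //; exact: measurable_ln.
have mc c : measurable_fun D (fun x => c * ln (f x)) by apply: measurable_funM.
rewrite /cpow; apply: cmeasM.
  by apply: cmeas_rc; apply: measurableT_comp => //; exact: measurable_expR.
split => /=.
  by apply: measurable_comp_cont => //; exact: continuous_cos.
by apply: measurable_comp_cont => //; exact: continuous_sin.
Qed.

Lemma dom_cintegrable D f (g : R -> R) : measurable D -> cmeas D f ->
  mu.-integrable D (EFin \o g) -> (forall x, D x -> cnorm (f x) <= g x) -> cintegrable D f.
Proof.
move=> mD [f1 f2] ig fg; split.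
  apply: (@le_integrable _ _ _ mu D mD _ (EFin \o g) _ _ ig) => [|x Dx]; first exact/measurable_EFinP.
  by rewrite /= lee_fin (le_trans (Re_le_cnorm _)) // (le_trans (fg _ Dx)) // ler_norm.
apply: (@le_integrable _ _ _ mu D mD _ (EFin \o g) _ _ ig) => [|x Dx]; first exact/measurable_EFinP.
by rewrite /= lee_fin (le_trans (Im_le_cnorm _)) // (le_trans (fg _ Dx)) // ler_norm.
Qed.

Lemma eq_cint D (f g : R -> C) : (forall x, D x -> f x = g x) -> cint D f = cint D g.
Proof.
by move=> fg; congr mkC; apply: eq_Rintegral => x /set_mem Dx; rewrite fg.
Qed.

Lemma cintD D f g : measurable D -> cintegrable D f -> cintegrable D g ->
  cint D (fun x => f x + g x) = cint D f + cint D g.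
Proof.
move=> mD [f1 f2] [g1 g2]; apply: eqC; rewrite ?ReD ?ImD /=.
  by under eq_Rintegral do rewrite ReD; exact: RintegralD.
by under eq_Rintegral do rewrite ImD; exact: RintegralD.
Qed.
Lemma cintegrableZl D c f : measurable D -> cintegrable D f -> cintegrable D (fun x => c * f x).
Proof.
move=> mD [f1 f2]; split.
  rewrite (_ : _ \o _ = (fun x => (ReC c)%:E * (ReC (f x))%:E - (ImC c)%:E * (ImC (f x))%:E)%E); last first.
    by apply/funext => x /=; rewrite ReM EFinB !EFinM.
  by apply: integrableB => //; exact: integrableZl.
rewrite (_ : _ \o _ = (fun x => (ReC c)%:E * (ImC (f x))%:E + (ImC c)%:E * (ReC (f x))%:E)%E); last first.
  by apply/funext => x /=; rewrite ImM EFinD !EFinM.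
by apply: integrableD => //; exact: integrableZl.
Qed.
Lemma cintZl D c f : measurable D -> cintegrable D f -> cint D (fun x => c * f x) = c * cint D f.
Proof.
move=> mD [f1 f2].
have H (r : R) (h : R -> R) : mu.-integrable D (fun x => (h x)%:E) -> mu.-integrable D (EFin \o (fun x => r * h x)).
  move=> ih; rewrite (_ : _ \o _ = (fun x => r%:E * (h x)%:E)%E); first exact: integrableZl.
  by apply/funext => x /=; rewrite EFinM.
apply: eqC; rewrite ?(ReM, ImM) /=.
  by under eq_Rintegral do rewrite ReM; rewrite RintegralB ?RintegralZl //; exact: H.
by under eq_Rintegral do rewrite ImM; rewrite RintegralD ?RintegralZl //; exact: H.
Qed.
Lemma cintegrableD D f g : measurable D -> cintegrable D f -> cintegrable D g ->
  cintegrable D (fun x => f x + g x).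
Proof.
move=> mD [f1 f2] [g1 g2]; split.
  rewrite (_ : _ \o _ = (fun x => (ReC (f x))%:E + (ReC (g x))%:E)%E); first exact: integrableD.
  by apply/funext => x /=; rewrite ReD EFinD.
rewrite (_ : _ \o _ = (fun x => (ImC (f x))%:E + (ImC (g x))%:E)%E); first exact: integrableD.
by apply/funext => x /=; rewrite ImD EFinD.
Qed.
Lemma cintegrable_meas D f : cintegrable D f -> cmeas D f.
Proof.
by move=> [/integrableP[/measurable_EFinP f1 _] /integrableP[/measurable_EFinP f2 _]].
Qed.

(** Real and imaginary parts are bounded separately, whence the factor 2. *)
Lemma cnorm_cint D f (g : R -> R) : measurable D -> cmeas D f ->
  mu.-integrable D (EFin \o g) -> (forall x, D x -> cnorm (f x) <= g x) ->
  cnorm (cint D f) <= 2 * \int[mu]_(x in D) g x.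
Proof.
move=> mD mf ig fg; have [i1 i2] := dom_cintegrable mD mf ig fg.
rewrite (le_trans (cnorm_le _)) // mulr_natl mulr2n lerD //=.
  rewrite (le_trans (le_normr_Rintegral _ _)) //; apply: le_Rintegral => //.
    exact: (integrable_norm i1).
  by move=> x Dx; rewrite (le_trans (Re_le_cnorm _)) // fg.
rewrite (le_trans (le_normr_Rintegral _ _)) //; apply: le_Rintegral => //.
  exact: (integrable_norm i2).
by move=> x Dx; rewrite (le_trans (Im_le_cnorm _)) // fg.
Qed.

Lemma Rintegral_dct d (T : measurableType d) (nu : {measure set T -> \bar R}) (D : set T)
    (f : nat -> T -> R) (F g : T -> R) : measurable D ->
  (forall n, measurable_fun D (f n)) -> (forall x, D x -> (fun n => f n x) @ \oo --> F x) ->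
  nu.-integrable D (EFin \o g) -> (forall n x, D x -> `|f n x| <= g x) ->
  nu.-integrable D (EFin \o F) /\
  (fun n => \int[nu]_(x in D) f n x) @ \oo --> \int[nu]_(x in D) F x.
Proof.
move=> mD mf fF ig fg.
have mF : measurable_fun D F by apply: measurable_fun_cvg fF.
have [iF _ cF] := @dominated_convergence _ _ _ nu D mD (fun n x => (f n x)%:E) (fun x => (F x)%:E) (fun x => (g x)%:E)
  (fun n => (measurable_EFinP _ _).2 (mf n)) ((measurable_EFinP _ _).2 mF)
  ltac:(by apply: aeW => x Dx; apply/cvg_EFin; [exact: nearW|exact: fF]) ig
  ltac:(by apply: aeW => x n Dx; rewrite lee_fin; exact: fg).
split => //; rewrite /Rintegral; apply: fine_cvg; rewrite fineK //.
exact: integrable_fin_num.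
Qed.

Lemma cint_dct D (f : nat -> R -> C) (F : R -> C) (g : R -> R) : measurable D ->
  (forall n, cmeas D (f n)) -> (forall x, D x -> cvgC (fun n => f n x) (F x)) ->
  mu.-integrable D (EFin \o g) -> (forall n x, D x -> cnorm (f n x) <= g x) ->
  cintegrable D F /\ cvgC (fun n => cint D (f n)) (cint D F).
Proof.
move=> mD mf fF ig fg.
have [i1 c1] := @Rintegral_dct _ _ mu D (fun n x => ReC (f n x)) (fun x => ReC (F x)) g mD
  (fun n => (mf n).1) (fun x Dx => (fF x Dx).1) ig (fun n x Dx => le_trans (Re_le_cnorm _) (fg n x Dx)).
have [i2 c2] := @Rintegral_dct _ _ mu D (fun n x => ImC (f n x)) (fun x => ImC (F x)) g mD
  (fun n => (mf n).2) (fun x Dx => (fF x Dx).2) ig (fun n x Dx => le_trans (Im_le_cnorm _) (fg n x Dx)).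
by [].
Qed.

End ComplexAnalysis.

(** * Derivatives, improper integrals and powers *)

Section Calculus.
Context {R : realType}.
Local Notation C := R[i].
Local Notation mu := (@lebesgue_measure R).

Lemma is_derive_continuous (f : R -> R) (u l : R) : is_derive u 1 f l -> {for u, continuous f}.
Proof.
by move=> [df _]; apply: differentiable_continuous; exact/derivable1_diffP.
Qed.

Definition cderiv (f : R -> C) (u : R) (l : C) : Prop :=
  is_derive u 1 (fun r => ReC (f r)) (ReC l) /\ is_derive u 1 (fun r => ImC (f r)) (ImC l).

Lemma cderiv_eq f u l l' : cderiv f u l -> l = l' -> cderiv f u l'.
Proof. by move=> h <-. Qed.
Lemma cderiv_cst c u : cderiv (fun=> c) u 0.
Proof. by split; exact: is_derive_cst. Qed.
Lemma cderiv_rc (f : R -> R) (u l : R) : is_derive u 1 f l -> cderiv (fun r => rc (f r)) u (rc l).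
Proof. by move=> h; split => //=; exact: is_derive_cst. Qed.
Lemma cderivD f g u a b : cderiv f u a -> cderiv g u b -> cderiv (fun r => f r + g r) u (a + b).
Proof.
move=> [f1 f2] [g1 g2]; split.
  rewrite ReD (_ : (fun r => _) = (fun r => ReC (f r)) + (fun r => ReC (g r))); first exact: is_deriveD.
  by apply/funext => r; rewrite ReD.
rewrite ImD (_ : (fun r => _) = (fun r => ImC (f r)) + (fun r => ImC (g r))); first exact: is_deriveD.
by apply/funext => r; rewrite ImD.
Qed.
Lemma cderivM f g u a b : cderiv f u a -> cderiv g u b ->
  cderiv (fun r => f r * g r) u (f u * b + g u * a).
Proof.
move=> [f1 f2] [g1 g2]; split.
  rewrite (_ : (fun r => _) = (fun r => ReC (f r)) * (fun r => ReC (g r)) - (fun r => ImC (f r)) * (fun r => ImC (g r))); last first.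
    by apply/funext => r; rewrite ReM.
  have h1 := is_deriveM f1 g1; have h2 := is_deriveM f2 g2; have h := is_deriveB h1 h2.
  by apply: (is_derive_eq h); rewrite ReD !ReM /GRing.scale /=; ring.
rewrite (_ : (fun r => _) = (fun r => ReC (f r)) * (fun r => ImC (g r)) + (fun r => ImC (f r)) * (fun r => ReC (g r))); last first.
  by apply/funext => r; rewrite ImM.
have h1 := is_deriveM f1 g2; have h2 := is_deriveM f2 g1; have h := is_deriveD h1 h2.
by apply: (is_derive_eq h); rewrite ImD !ImM /GRing.scale /=; ring.
Qed.
Lemma cderiv_cpow u a : 0 < u -> cderiv (fun r => cpow r a) u (a * cpow u (a - 1)).
Proof.
move=> u0.
have E : a * cpow u (a - 1) = rc u^-1 * (a * cpow u a).
  rewrite cpowD cpowN cpow1 // rcV; ring.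
have ln' c : is_derive u 1 (fun r => c * ln r) (c * u^-1).
  have h := is_deriveZ c (is_derive1_ln u0).
  by apply: (is_derive_eq h).
have ex : is_derive u 1 (fun r => expR (ReC a * ln r)) (expR (ReC a * ln u) * (ReC a * u^-1)).
  exact: (is_derive1_comp (is_derive_expR _) (ln' _)).
have co : is_derive u 1 (fun r => cos (ImC a * ln r)) (- sin (ImC a * ln u) * (ImC a * u^-1)).
  exact: (is_derive1_comp (is_derive_cos _) (ln' _)).
have si : is_derive u 1 (fun r => sin (ImC a * ln r)) (cos (ImC a * ln u) * (ImC a * u^-1)).
  exact: (is_derive1_comp (is_derive_sin _) (ln' _)).
have h : cderiv (fun r => mkC (cos (ImC a * ln r)) (sin (ImC a * ln r))) u
  (mkC (- sin (ImC a * ln u) * (ImC a * u^-1)) (cos (ImC a * ln u) * (ImC a * u^-1))) by split.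
apply: (cderiv_eq (cderivM (cderiv_rc ex) h)).
by rewrite E /cpow; apply: eqC; rewrite !(ReM, ImM, ReD, ImD) /=; ring.
Qed.
Lemma cderiv_shift f u l c : cderiv f (u + c) l -> cderiv (fun r => f (r + c)) u l.
Proof.
have h : is_derive u 1 (fun r : R => r + c) 1.
  have h := is_deriveD (is_derive_id u 1) (is_derive_cst c u 1).
  by apply: (is_derive_eq h); rewrite addr0.
move=> [f1 f2]; split.
  by apply: (is_derive_eq (@is_derive1_comp _ (fun r => ReC (f r)) (fun r => r + c) u _ _ f1 h)); rewrite mulr1.
by apply: (is_derive_eq (@is_derive1_comp _ (fun r => ImC (f r)) (fun r => r + c) u _ _ f2 h)); rewrite mulr1.
Qed.
Lemma is_derive_near (f g : R -> R) (u l : R) : (\forall r \near u, f r = g r) ->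
  is_derive u 1 f l -> is_derive u 1 g l.
Proof. by move=> fg h; apply: near_eq_is_derive h => //; rewrite oner_neq0. Qed.
Lemma cderiv_near f g u l : (\forall r \near u, f r = g r) -> cderiv f u l -> cderiv g u l.
Proof.
move=> fg [f1 f2]; split.
  by apply: is_derive_near f1; apply: filterS fg => r ->.
by apply: is_derive_near f2; apply: filterS fg => r ->.
Qed.
Lemma dC_cderiv f u l : cderiv f u l -> dC f u = l.
Proof. by move=> [f1 f2]; apply: eqC; rewrite /dC /= derive1E derive_val. Qed.

Lemma segment_FTC (f F : R -> R) (a b : R) : a < b ->
  (forall u : R, a <= u <= b -> is_derive u 1 F (f u)) ->
  (forall u : R, a <= u <= b -> {for u, continuous f}) ->
  mu.-integrable `[a, b] (EFin \o f) /\ \int[mu]_(u in `[a, b]) f u = F b - F a.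
Proof.
move=> ab dF cf.
have wc : {within `[a, b], continuous f}.
  apply: continuous_in_subspaceT => u /[!inE] /= /[!in_itv] /=; exact: cf.
have dd : derivable_oo_LRcontinuous F a b.
  split.
  - move=> u /[!in_itv] /= /andP[au ub]; by have [] := dF u ltac:(by rewrite !ltW).
  - by apply: cvg_at_right_filter; apply: (is_derive_continuous (dF a _)); rewrite lexx ltW.
  - by apply: cvg_at_left_filter; apply: (is_derive_continuous (dF b _)); rewrite lexx ltW.
split; first by apply: continuous_compact_integrable => //; exact: segment_compact.
rewrite /Rintegral (continuous_FTC2 ab wc dd) //.
move=> u /[!in_itv] /= /andP[au ub]; rewrite derive1E.
by have [] := dF u ltac:(by rewrite !ltW).
Qed.

Lemma measurable_posR : measurable (@posR R : set (measurableTypeR R)).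
Proof. by rewrite (_ : posR = `]0, +oo[%classic) //; apply/seteqP; split => x /=; rewrite in_itv /= andbT. Qed.

Lemma is_derive_measurable (f : R -> R) : (forall u : R, 0 < u -> {for u, continuous f}) ->
  measurable_fun (@posR R) f.
Proof.
move=> cf; apply: open_continuous_measurable_fun; first exact: open_gt.
by move=> u /set_mem; exact: cf.
Qed.

Lemma posR_bigcup : @posR R = \bigcup_n `[(n.+2%:R)^-1, n.+2%:R].
Proof.
apply/seteqP; split => [x /= x0|x [n _]] /=; last first.
  by rewrite in_itv /= /posR /= => /andP[h _]; apply: lt_le_trans h; rewrite invr_gt0 ltr0n.
pose n := (Num.truncn x + Num.truncn x^-1)%N.
have h (y : R) : 0 < y -> y < (Num.truncn y).+1%:R by move=> y0; apply: truncnS_gt.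
have i0 : 0 < x^-1 by rewrite invr_gt0.
exists n => //=; rewrite in_itv /=; apply/andP; split.
  rewrite -[x in leRHS]invrK lef_pV2 ?posrE ?ltr0n // (le_trans (ltW (h _ i0))) // ler_nat /n; lia.
by rewrite (le_trans (ltW (h _ x0))) // ler_nat /n; lia.
Qed.

(** Over the segments [1/(n+2), n+2], which exhaust the half-line, the integral is an increment of
    [G]; monotone convergence then bounds the whole integral by [c]. *)
Lemma posR_FTC_integrable (g G : R -> R) (c : R) : (forall u, 0 < u -> 0 <= g u) ->
  (forall u : R, 0 < u -> is_derive u 1 G (g u)) ->
  (forall u : R, 0 < u -> {for u, continuous g}) ->
  (forall u v, 0 < u -> 0 < v -> G v - G u <= c) -> mu.-integrable (@posR R) (EFin \o g).
Proof.
move=> g0 dG cg Gc; have mg := is_derive_measurable cg.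
apply/integrableP; split; first exact/measurable_EFinP.
have E : (\int[mu]_(x in posR) `|(EFin \o g) x| = \int[mu]_(x in posR) (g x)%:E)%E.
  by apply: eq_integral => x /[!inE] x0; rewrite /= ger0_norm ?g0.
rewrite E; have i2 n : 0 < (n.+2%:R : R)^-1 by rewrite invr_gt0 ltr0n.
have H : (\int[mu]_(x in posR) (g x)%:E <= c%:E)%E; last exact: (le_lt_trans H (ltry _)).
have := @ge0_nondecreasing_set_cvg_integral _ (measurableTypeR R) R (fun n => `[(n.+2%:R : R)^-1, (n.+2%:R : R)]%classic) (EFin \o g) mu.
rewrite -posR_bigcup => /(_ _ _ _ _)/cvg_lim <- //.
- apply: lime_le; last apply: nearW => n.
    apply: ereal_nondecreasing_is_cvgn => m n mn; apply: ge0_subset_integral => //.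
    + by apply/measurable_EFinP; apply: measurable_funS mg => //; [exact: measurable_posR|move=> x /=; rewrite in_itv /= => /andP[h _]; exact: lt_le_trans h].
    + by move=> x /=; rewrite in_itv /= => /andP[h _]; rewrite lee_fin g0 // (lt_le_trans _ h).
    + move=> x /=; rewrite !in_itv /= => /andP[h1 h2]; rewrite (le_trans h2) ?ler_nat // andbT (le_trans _ h1) //.
      by rewrite lef_pV2 ?posrE ?ltr0n ?ler_nat.
  have ab : (n.+2%:R : R)^-1 < n.+2%:R.
    by rewrite (@lt_trans _ _ 1) // ?ltr1n // invf_lt1 ?ltr1n ?ltr0n.
  have [||i1 i3] := @segment_FTC g G _ _ ab.
  + by move=> u /andP[h _]; apply: dG; exact: lt_le_trans h.
  + by move=> u /andP[h _]; apply: cg; exact: lt_le_trans h.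
  rewrite -(fineK (integrable_fin_num _ i1)) // lee_fin.
  by rewrite [leLHS]i3 Gc // (lt_trans (i2 n)).
- move=> m n mn; apply/subsetPset => x /=; rewrite !in_itv /= => /andP[h1 h2]; rewrite (le_trans h2) ?ler_nat // andbT (le_trans _ h1) //.
  by rewrite lef_pV2 ?posrE ?ltr0n ?ler_nat.
- by move=> n; apply/measurable_EFinP; apply: measurable_funS mg => //; [exact: measurable_posR|move=> x /=; rewrite in_itv /= => /andP[h _]; exact: lt_le_trans h].
- by move=> n x /=; rewrite in_itv /= => /andP[h _]; rewrite lee_fin g0 // (lt_le_trans _ h).
Qed.

Lemma improper_FTC (f F : R -> R) (T : R) : 0 < T ->
  (forall u : R, 0 < u -> is_derive u 1 F (f u)) ->
  (forall u : R, 0 < u -> {for u, continuous f}) ->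
  mu.-integrable `]0, T] (EFin \o f) ->
  (fun n => F (T / n.+2%:R)) @ \oo --> (0 : R) ->
  \int[mu]_(u in `]0, T]) f u = F T.
Proof.
move=> T0 dF cf fi F0.
have d0 n : 0 < T / n.+2%:R by rewrite divr_gt0.
have dT n : T / n.+2%:R < T by rewrite gtr_pMr // invf_lt1 ?ltr1n ?ltr0n.
pose I n := `[T / n.+2%:R, T]%classic.
have mI n : measurable (I n) by exact: measurable_itv.
have mf : measurable_fun `]0, T] f by have /integrableP[/measurable_EFinP] := fi.
have E n : \int[mu]_(x in `]0, T]) (f \_ (I n)) x = F T - F (T / n.+2%:R).
  rewrite -Rintegral_mkcondr.
  have -> : `]0, T] `&` I n = I n.
    apply: setIidr => x; rewrite /I /= !in_itv /= => /andP[h ->]; rewrite andbT; exact: lt_le_trans h.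
  apply: (segment_FTC (dT n) _ _).2 => u /andP[h _]; [apply: dF|apply: cf]; exact: lt_le_trans h.
have [|||_ c] := @Rintegral_dct _ _ _ mu `]0, T]%classic (fun n => f \_ (I n)) f (fun u => `|f u|) (measurable_itv _) _ _ (integrable_norm fi) _.
- move=> n; apply/(measurable_restrict _ (mI n)) => //.
  by apply: measurable_funS mf => //; exact: subIsetl.
- move=> x /=; rewrite in_itv /= => /andP[x0 xT].
  apply: cvg_near_cst; near=> n; rewrite patchE ifT // inE /I /= in_itv /= xT andbT.
  rewrite ler_pdivrMr // mulrC -ler_pdivrMr //.
  apply: (@le_trans _ _ n%:R); last by rewrite ler_nat -addn2 leq_addr.
  by near: n; exact: nbhs_infty_ger.
- by move=> n x _; rewrite patchE; case: ifP => //; rewrite normr0.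
have : (fun n => F T - F (T / n.+2%:R)) @ \oo --> F T - 0 by apply: cvgB => //; exact: cvg_cst.
rewrite subr0; under eq_fun do rewrite -E.
by move=> c2; exact: (cvg_unique (@norm_hausdorff _ _) c c2).
Unshelve. all: by end_near. Qed.

Lemma integrable_mull d (T : measurableType d) (nu : {measure set T -> \bar R}) (D : set T) (f : T -> R) c :
  measurable D -> nu.-integrable D (EFin \o f) -> nu.-integrable D (EFin \o (fun x => c * f x)).
Proof.
move=> mD fi; rewrite (_ : _ \o _ = (fun x => c%:E * (f x)%:E)%E); first exact: integrableZl.
by apply/funext => x /=; rewrite EFinM.
Qed.

Lemma le_integrable_EFin d (T : measurableType d) (nu : {measure set T -> \bar R}) (D : set T) (f g : T -> R) :
  measurable D -> measurable_fun D f -> nu.-integrable D (EFin \o g) ->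
  (forall x, D x -> `|f x| <= g x) -> nu.-integrable D (EFin \o f).
Proof.
move=> mD mf gi fg; apply: (le_integrable mD _ _ gi); first exact/measurable_EFinP.
by move=> x Dx; rewrite /= lee_fin (le_trans (fg _ Dx)) // ler_norm.
Qed.

Section Power.
Implicit Types (x u a b : R).
Definition rpow u a := expR (a * ln u).

Lemma rpow_gt0 u a : 0 < rpow u a. Proof. exact: expR_gt0. Qed.
Lemma rpow_ge0 u a : 0 <= rpow u a. Proof. exact: expR_ge0. Qed.
Lemma rpowD u a b : rpow u (a + b) = rpow u a * rpow u b.
Proof. by rewrite /rpow mulrDl expRD. Qed.
Lemma rpow0 u : rpow u 0 = 1. Proof. by rewrite /rpow mul0r expR0. Qed.
Lemma rpow1 u : 0 < u -> rpow u 1 = u. Proof. by move=> u0; rewrite /rpow mul1r lnK. Qed.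
Lemma rpowN u a : rpow u (- a) = (rpow u a)^-1.
Proof. by rewrite /rpow mulNr expRN. Qed.
Lemma rpowM u x a : 0 < u -> 0 < x -> rpow (u * x) a = rpow u a * rpow x a.
Proof. by move=> u0 x0; rewrite /rpow lnM // mulrDr expRD. Qed.
Lemma rpowX u n : 0 < u -> rpow u n%:R = u ^+ n.
Proof.
by move=> u0; elim: n => [|n IH]; rewrite ?rpow0 // -natr1 rpowD IH rpow1 // exprSr.
Qed.
Lemma rpow_le u x a : 0 < u -> u <= x -> 0 <= a -> rpow u a <= rpow x a.
Proof. by move=> u0 ux a0; rewrite ler_expR ler_wpM2l // ler_ln ?posrE // (lt_le_trans u0). Qed.
Lemma rpow_le_neg u x a : 0 < u -> u <= x -> a <= 0 -> rpow x a <= rpow u a.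
Proof. by move=> u0 ux a0; rewrite ler_expR ler_wnM2l // ler_ln ?posrE // (lt_le_trans u0). Qed.
Lemma rpow_le1 u a b : 1 <= u -> a <= b -> rpow u a <= rpow u b.
Proof. by move=> u1 ab; rewrite ler_expR ler_wpM2r // ln_ge0. Qed.
Lemma cnorm_cpow_rpow u (w : C) : cnorm (cpow u w) = rpow u (ReC w).
Proof. exact: cnorm_cpow. Qed.

(** For a positive exponent k, the inequality y <= e^y at y = lam (1 + u) / k, raised to the power
    k. *)
Lemma expX_le (lam : R) (k : nat) : 0 < lam -> exists c : R, 0 < c /\ forall u, 0 <= u -> (1 + u) ^+ k * expR (- (lam * u)) <= c.
Proof.
move=> l0; case: k => [|k].
  exists 1; split => // u u0; rewrite expr0 mul1r -expR0 ler_expR oppr_le0 mulr_ge0 // ltW //.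
exists ((k.+1%:R / lam) ^+ k.+1 * expR lam); split.
  by rewrite mulr_gt0 ?expR_gt0 // exprn_gt0 // divr_gt0.
move=> u u0; rewrite expRN ler_pdivrMr ?expR_gt0 // -mulrA -expRD.
have -> : lam + lam * u = lam * (1 + u) by rewrite mulrDr mulr1.
have [K [K0 Ke]] : exists K : R, K != 0 /\ K = k.+1%:R by exists k.+1%:R; rewrite pnatr_eq0.
have [y ye] : exists y, y = lam * (1 + u) / K by eexists.
have e1 : 1 + u = K / lam * y by rewrite ye; field; rewrite K0 gt_eqF.
have -> : expR (lam * (1 + u)) = expR y ^+ k.+1.
  by rewrite -expRM_natr ye -Ke divfK.
have Kp : 0 <= K by rewrite Ke.
rewrite -Ke {1}e1 exprMn ler_wpM2l ?exprn_ge0 ?divr_ge0 ?(ltW l0) //.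
have y0 : 0 <= y by rewrite ye divr_ge0 // mulr_ge0 ?ltW // ltr_pwDl.
by rewrite lerXn2r ?nnegrE ?expR_ge0 // (le_trans _ (expR_ge1Dx _)) // lerDr.
Qed.

(** The integrand is the derivative of (u/(1+u))^sig / sig, which stays between 0 and 1/sig. It
    behaves like u^(sig-1) at 0 and like u^-2 at infinity, so that up to a constant it dominates
    every integrand of gamma type. *)
Lemma integrable_gamma_base (sig : R) : 0 < sig ->
  mu.-integrable (@posR R) (EFin \o (fun u => rpow (u / (1 + u)) sig / (u * (1 + u)))).
Proof.
move=> s0; pose G u := sig^-1 * rpow (u / (1 + u)) sig.
pose g u := rpow (u / (1 + u)) sig / (u * (1 + u)).
have u1 u : 0 < u -> 0 < 1 + u by move=> u0; rewrite addr_gt0.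
have u2 u : 0 < u -> 0 < u / (1 + u) by move=> u0; rewrite divr_gt0 ?u1.
have q u : 0 < u -> is_derive u 1 (fun r => r / (1 + r)) (((1 + u) ^+ 2)^-1).
  move=> u0; have h1 : is_derive u 1 (fun r : R => 1 + r) 1.
    have h := is_deriveD (is_derive_cst (1 : R) u 1) (is_derive_id u 1).
    by apply: (is_derive_eq h); rewrite add0r.
  have n0 : 1 + u != 0 by rewrite gt_eqF // u1.
  have h2 := is_deriveM (is_derive_id u 1) (is_deriveV n0 h1).
  by apply: (is_derive_eq h2); rewrite /GRing.scale /=; field.
have dG u : 0 < u -> is_derive u 1 G (g u).
  move=> u0.
  have h1 := @is_derive1_comp _ (@ln R) (fun r => r / (1 + r)) u _ _ (is_derive1_ln (u2 _ u0)) (q _ u0).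
  have h2 := is_deriveZ sig h1.
  have h3 := @is_derive1_comp _ (@expR R) (fun r => sig * ln (r / (1 + r))) u _ _ (is_derive_expR _) h2.
  have h4 := is_deriveZ sig^-1 h3.
  apply: (is_derive_eq h4); rewrite /g /rpow /GRing.scale /=.
  field; rewrite !gt_eqF ?u1 //.
have cg u : 0 < u -> {for u, continuous g}.
  move=> u0.
  have h1 := @is_derive1_comp _ (@ln R) (fun r => r / (1 + r)) u _ _ (is_derive1_ln (u2 _ u0)) (q _ u0).
  have h2 := is_deriveZ sig h1.
  have h3 := @is_derive1_comp _ (@expR R) (fun r => sig * ln (r / (1 + r))) u _ _ (is_derive_expR _) h2.
  have n0 : u * (1 + u) != 0 by rewrite mulf_neq0 ?gt_eqF ?u1.
  apply: cvgM; first exact: (is_derive_continuous h3).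
  apply: (@cvgV _ _ _ _ (fun r => r * (1 + r)) _ n0).
  by apply: cvgM; [exact: cvg_id|apply: cvgD; [exact: cvg_cst|exact: cvg_id]].
apply: (posR_FTC_integrable (G := G) (c := sig^-1)) => //.
- by move=> u u0; rewrite divr_ge0 ?rpow_ge0 // mulr_ge0 // ltW ?u1.
- move=> u v u0 v0; rewrite /G -mulrBr -[leRHS]mulr1 ler_wpM2l ?invr_ge0 ?(ltW s0) //.
  rewrite lerBlDr (@le_trans _ _ 1) ?lerDl ?rpow_ge0 //.
  have E1 : rpow 1 sig = 1 by rewrite /rpow ln1 mulr0 expR0.
  by rewrite -[leRHS]E1; apply: rpow_le; rewrite ?u2 ?(ltW s0) // ler_pdivrMr ?u1 // mul1r lerDr.
Qed.

Lemma measurable_rpow D (f : R -> R) a : measurable_fun D f -> measurable_fun D (fun u => rpow (f u) a).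
Proof.
move=> mf; apply: measurableT_comp; first exact: measurable_expR.
apply: measurable_funM => //.
by apply: measurableT_comp => //; exact: measurable_ln.
Qed.

(** The majorant in the later limits: a power singularity at 0, polynomial growth and exponential
    decay. *)
Definition gdom sig (k : nat) lam u := rpow u (sig - 1) * (1 + u) ^+ k * expR (- (lam * u)).

Lemma measurable_gdom D sig k lam : measurable D -> measurable_fun D (gdom sig k lam).
Proof.
move=> mD; apply: measurable_funM.
  apply: measurable_funM; first exact: measurable_rpow.
  by apply: measurable_funX; exact: measurable_funD.
apply: measurableT_comp; first exact: measurable_expR.
by apply: measurableT_comp => //; exact: measurable_funM.
Qed.

Lemma gdom_ge0 sig k lam u : 0 < u -> 0 <= gdom sig k lam u.
Proof.
move=> u0; rewrite /gdom; apply: mulr_ge0; last exact: expR_ge0.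
by apply: mulr_ge0; rewrite ?rpow_ge0 ?exprn_ge0 ?addr_ge0 ?(ltW u0).
Qed.

Lemma integrable_gdom sig k lam : 0 < sig -> 0 < lam ->
  mu.-integrable (@posR R) (EFin \o gdom sig k lam).
Proof.
move=> s0 l0; pose M := (k + 1 + (Num.truncn sig).+1)%N.
have [c [c0 cP]] := expX_le M l0.
have i1 := integrable_mull c measurable_posR (integrable_gamma_base s0).
apply: (le_integrable_EFin measurable_posR _ i1).
  by apply: measurable_gdom; exact: measurable_posR.
move=> u u0.
have u1 : 0 < 1 + u by rewrite addr_gt0.
rewrite ger0_norm ?gdom_ge0 //.
rewrite rpowM ?invr_gt0 //.
have -> : c * (rpow u sig * rpow (1 + u)^-1 sig / (u * (1 + u))) =
  rpow u (sig - 1) * (c / (rpow (1 + u) sig * (1 + u))).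
  have -> : rpow (1 + u)^-1 sig = (rpow (1 + u) sig)^-1.
    by rewrite /rpow lnV // mulrN expRN.
  rewrite rpowD rpowN rpow1 //; field.
  by rewrite !gt_eqF ?rpow_gt0.
rewrite /gdom -mulrA ler_wpM2l ?rpow_ge0 // ler_pdivlMr ?mulr_gt0 ?rpow_gt0 //.
apply: le_trans (cP u (ltW u0)); rewrite mulrAC ler_wpM2r ?expR_ge0 //.
have u1' := ltW u1.
rewrite /M !exprD expr1 -mulrA ler_wpM2l ?exprn_ge0 ?u1' // mulrC ler_wpM2l ?u1' //.
by rewrite -rpowX // rpow_le1 ?lerDl ?(ltW u0) // ltW // truncnS_gt.
Qed.

Lemma integrable_rpow_itv sig T : 0 < sig -> 0 < T ->
  mu.-integrable `]0, T] (EFin \o (fun u => rpow u (sig - 1))).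
Proof.
move=> s0 T0.
have sub : `]0, T] `<=` posR by move=> x /=; rewrite in_itv /= => /andP[].
have i1 := integrable_mull (expR T) measurable_posR (integrable_gdom 0 s0 ltr01).
have i2 := integrableS measurable_posR (measurable_itv _) sub i1.
have mT : measurable (`]0, T] : set (measurableTypeR R)) by exact: measurable_itv.
apply: (le_integrable_EFin mT _ i2).
  exact: measurable_rpow.
move=> u /=; rewrite in_itv /= => /andP[u0 uT].
rewrite ger0_norm ?rpow_ge0 // /gdom expr0 mulr1 mul1r.
by rewrite mulrCA -expRD ler_peMr ?rpow_ge0 // -expR0 ler_expR subr_ge0.
Qed.
End Power.

Lemma cint_cpow_itv (T : R) (a : C) : 0 < T -> 0 < ReC a ->
  cint `]0, T] (fun u => cpow u (a - 1)) = cpow T a / a.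
Proof.
move=> T0 a0.
have an0 : a != 0 by apply: contraTneq a0 => ->; rewrite ltxx.
pose F u := a^-1 * cpow u a.
have dF u : 0 < u -> cderiv F u (cpow u (a - 1)).
  move=> u0; apply: (cderiv_eq (cderivM (cderiv_cst a^-1 u) (cderiv_cpow a u0))).
  by rewrite mulr0 addr0 mulrA mulVf // mul1r.
have cf u : 0 < u -> cderiv (fun u => cpow u (a - 1)) u ((a - 1) * cpow u (a - 1 - 1)).
  by move=> u0; exact: cderiv_cpow.
have sub : `]0, T] `<=` posR by move=> x /=; rewrite in_itv /= => /andP[].
have [i1 i2] : cintegrable `]0, T] (fun u => cpow u (a - 1)).
  apply: (dom_cintegrable (measurable_itv _) _ (integrable_rpow_itv a0 T0)).
    by apply: cmeas_cpow => //; exact: measurable_itv.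
  by move=> u _; rewrite cnorm_cpow_rpow ReD ReN.
have F0 : cvgC (fun n => F (T / n.+2%:R)) 0.
  rewrite -(mulr0 a^-1); apply: cvgCM; first exact: cvgC_cst.
  apply: cvgC_norm0; under eq_fun do rewrite cnorm_cpow.
  apply/cvgrPdist_lt => e e0.
  near=> n; rewrite sub0r normrN ger0_norm ?expR_ge0 //.
  rewrite -(lnK e0) ltr_expR mulrC -ltr_pdivlMr // ln_div ?posrE // ltrBlDr -ltrBlDl.
  rewrite -ltr_expR lnK ?posrE //; near: n.
  exists (Num.truncn (expR (ln T - ln e / ReC a))) => // n /= nn.
  by apply: (lt_le_trans (truncnS_gt _)); rewrite ler_nat ltnS (leq_trans nn).
have E1 := improper_FTC T0 (fun u u0 => (dF u u0).1) (fun u u0 => is_derive_continuous (cf u u0).1) i1 F0.1.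
have E2 := improper_FTC T0 (fun u u0 => (dF u u0).2) (fun u u0 => is_derive_continuous (cf u u0).2) i2 F0.2.
by rewrite mulrC; apply: eqC; rewrite /= ?E1 ?E2.
Unshelve. all: by end_near. Qed.

Lemma cmeas_beta (T : R) (a : C) n D : measurable D -> cmeas D (fun u => cpow u (a - 1) * rc ((1 - u / T) ^+ n)).
Proof.
move=> mD; apply: cmeasM; first exact: cmeas_cpow.
apply: cmeas_rc; apply: measurable_funX; apply: measurable_funB; first exact: measurable_cst.
by apply: measurable_funM => //; exact: measurable_cst.
Qed.

Lemma ReC_addn_neq0 (a : C) j : 0 < ReC a -> a + j%:R != 0.
Proof.
apply: contraTneq => /(congr1 (@ReC R)); rewrite ReD Re_nat => /eqP.
by rewrite addr_eq0 => /eqP ->; rewrite oppr_gt0 -leNgt.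
Qed.

(** Euler's beta integral, by induction on [n]: one factor 1 - u/T is split off, and its second term
    raises [a] by 1. *)
Lemma cint_beta_itv (T : R) (a : C) n : 0 < T -> 0 < ReC a ->
  cintegrable `]0, T] (fun u => cpow u (a - 1) * rc ((1 - u / T) ^+ n)) /\
  cint `]0, T] (fun u => cpow u (a - 1) * rc ((1 - u / T) ^+ n)) =
  cpow T a * n`!%:R / \prod_(j < n.+1) (a + j%:R).
Proof.
move=> T0 a0; split.
  apply: (dom_cintegrable (measurable_itv _) (cmeas_beta _ _ _ (measurable_itv _)) (integrable_rpow_itv a0 T0)).
  move=> u /=; rewrite in_itv /= => /andP[u0 uT].
  rewrite cnormM cnorm_cpow_rpow ReD ReN cnorm_rc ler_piMr ?rpow_ge0 // normrX exprn_ile1 //.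
  have h1 : 0 <= u / T by rewrite divr_ge0 ?ltW.
  have h2 : u / T <= 1 by rewrite ler_pdivrMr // mul1r.
  by rewrite ger0_norm ?subr_ge0 // gerBl.
elim: n a a0 => [|n IH] a a0.
  rewrite big_ord1 fact0 mulr1 addr0 -cint_cpow_itv //.
  by apply: eq_cint => u _; rewrite expr0 mulr1.
have I b m : 0 < ReC b -> cintegrable `]0, T] (fun u => cpow u (b - 1) * rc ((1 - u / T) ^+ m)).
  move=> b0; apply: (dom_cintegrable (measurable_itv _) (cmeas_beta _ _ _ (measurable_itv _)) (integrable_rpow_itv b0 T0)).
  move=> u /=; rewrite in_itv /= => /andP[u0 uT].
  rewrite cnormM cnorm_cpow_rpow ReD ReN cnorm_rc ler_piMr ?rpow_ge0 // normrX exprn_ile1 //.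
  have h1 : 0 <= u / T by rewrite divr_ge0 ?ltW.
  have h2 : u / T <= 1 by rewrite ler_pdivrMr // mul1r.
  by rewrite ger0_norm ?subr_ge0 // gerBl.
have a1 : 0 < ReC (a + 1) by rewrite ReD addr_gt0.
rewrite (@eq_cint _ _ _ (fun u => cpow u (a - 1) * rc ((1 - u / T) ^+ n) +
    - rc T^-1 * (cpow u (a + 1 - 1) * rc ((1 - u / T) ^+ n)))); last first.
  move=> u /=; rewrite in_itv /= => /andP[u0 uT].
  rewrite exprSr rcM rcD rcN rcM (_ : a + 1 - 1 = a - 1 + 1); last by ring.
  by rewrite [cpow u (a - 1 + 1)]cpowD cpow1 // rcV (_ : rc (1 : R) = 1) //; ring.
have mT : measurable `]0, T]%classic by exact: measurable_itv.
rewrite (cintD mT (I _ _ a0) (cintegrableZl _ mT (I _ _ a1))) (cintZl _ mT (I _ _ a1)) !IH //.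
rewrite [cpow T (a + 1)]cpowD cpow1 // rcV.
rewrite [X in _ = _ / X]big_ord_recl [X in _ + _ * (_ / X)]big_ord_recr /= [X in _ / X + _]big_ord_recl /=.
have P0 : \prod_(i < n) (a + 1 + i%:R) != 0.
  by apply/prodf_neq0 => i _; rewrite ReC_addn_neq0.
have -> : \prod_(i < n) (a + (lift ord0 i)%:R) = \prod_(i < n) (a + 1 + i%:R).
  by apply: eq_bigr => i _; rewrite /= /bump /= natrD addrA.
have -> : \prod_(i < n.+1) (a + (lift ord0 i)%:R) = \prod_(i < n) (a + 1 + i%:R) * (a + 1 + n%:R).
  rewrite big_ord_recr /=; congr (_ * _); last by rewrite /bump /= natrD addrA.
  by apply: eq_bigr => i _; rewrite /= /bump /= natrD addrA.
have T0' : rc T != 0 by rewrite rc_neq0 // gt_eqF.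
rewrite factS natrM -natr1; field.
by rewrite P0 T0' ReC_addn_neq0 //= andbT; have := ReC_addn_neq0 0 a0; rewrite addr0.
Qed.

End Calculus.

(** * Gauss' limit and the Gamma function *)

Section Gauss.
Context {R : realType}.
Local Notation C := R[i].
Local Notation mu := (@lebesgue_measure R).

Lemma cint_sub (D E : set (measurableTypeR R)) (f : R -> C) : D `<=` E ->
  cint E (fun u => if u \in D then f u else 0) = cint D f.
Proof.
move=> DE; have ED : E `&` D = D by exact/setIidr.
by congr mkC; rewrite -{2}ED Rintegral_mkcondr; apply: eq_Rintegral => u _; rewrite patchE; case: ifP.
Qed.

Lemma bernoulli_le (y : R) n : 0 <= y -> y <= 1 -> 1 - n%:R * y <= (1 - y) ^+ n.
Proof.
move=> y0 y1; elim: n => [|n IH]; first by rewrite mul0r subr0 expr0.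
rewrite exprSr; apply: le_trans (ler_wpM2r _ IH); last by rewrite subr_ge0.
rewrite -natr1; have : 0 <= n%:R * y ^+ 2 by rewrite mulr_ge0 // sqr_ge0.
by rewrite expr2; lra.
Qed.

Lemma cvg_exp_pow (x : R) : 0 <= x ->
  (fun n => (1 - x / n.+1%:R) ^+ n.+1) @ \oo --> expR (- x).
Proof.
move=> x0.
have c1 : (fun n => x / n.+1%:R) @ \oo --> (0 : R).
  rewrite -(mulr0 x); apply: cvgM; first exact: cvg_cst.
  exact: cvg_harmonic.
have c2 : (fun n => (1 - x * (x / n.+1%:R)) * expR (- x)) @ \oo --> (1 - x * 0) * expR (- x).
  apply: cvgM; last exact: cvg_cst.
  by apply: cvgB; [exact: cvg_cst|apply: cvgM => //; exact: cvg_cst].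
rewrite mulr0 subr0 mul1r in c2.
apply: (squeeze_cvgr _ c2 (cvg_cst _)); near=> n.
have n0 : 0 < n.+1%:R :> R by rewrite ltr0n.
set y := x / n.+1%:R.
have y0 : 0 <= y by rewrite divr_ge0 // ltW.
have y1 : y <= 1.
  rewrite ler_pdivrMr // mul1r (@le_trans _ _ n%:R) ?ler_nat //.
  by near: n; exact: nbhs_infty_ger.
have E : expR (- x) = expR (- y) ^+ n.+1.
  by rewrite -expRM_natr /y mulNr divfK // gt_eqF.
apply/andP; split; last first.
  by rewrite E lerXn2r ?nnegrE ?expR_ge0 ?subr_ge0 // (expR_ge1Dx (- y)).
rewrite -ler_pdivlMr ?expR_gt0 // E -exprVn -exprMn -expRN opprK.
(* Since e^y >= 1 + y, the quotient (1 - y) e^y is at least 1 - y^2, and Bernoulli's inequality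
   gives (1 - y^2)^(n+1) >= 1 - x^2/(n+1). *)
apply: (@le_trans _ _ ((1 - y ^+ 2) ^+ n.+1)).
  rewrite (le_trans _ (bernoulli_le _ _ _)) ?sqr_ge0 ?exprn_ile1 //.
  have xe : n.+1%:R * y = x by rewrite /y mulrCA mulfV ?mulr1 // gt_eqF.
  by rewrite expr2 mulrA xe.
rewrite lerXn2r ?nnegrE ?subr_ge0 ?exprn_ile1 ?mulr_ge0 ?subr_ge0 ?expR_ge0 //.
have -> : 1 - y ^+ 2 = (1 - y) * (1 + y) by ring.
by rewrite ler_wpM2l ?subr_ge0 // expR_ge1Dx.
Unshelve. all: by end_near. Qed.

Lemma pow_le_exp (y : R) n : 0 <= y -> y <= 1 -> `|(1 - y) ^+ n| <= expR (- (n%:R * y)).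
Proof.
move=> y0 y1; rewrite ger0_norm ?exprn_ge0 ?subr_ge0 // -mulrN mulrC expRM_natr.
by rewrite lerXn2r ?nnegrE ?expR_ge0 ?subr_ge0 // (expR_ge1Dx (- y)).
Qed.

Lemma cmeas_gamma (a : C) (lam : R) (D : set R) : measurable D ->
  cmeas D (fun u => cpow u (a - 1) * rc (expR (- (lam * u)))).
Proof.
move=> mD; apply: cmeasM; first exact: cmeas_cpow.
apply: cmeas_rc; apply: measurableT_comp; first exact: measurable_expR.
by apply: measurableT_comp => //; apply: measurable_funM => //; exact: measurable_cst.
Qed.

Lemma cnorm_gamma_gdom (a : C) (lam u : R) :
  cnorm (cpow u (a - 1) * rc (expR (- (lam * u)))) = gdom (ReC a) 0 lam u.
Proof.
rewrite cnormM cnorm_cpow_rpow ReD ReN cnorm_rc ger0_norm ?expR_ge0 //.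
by rewrite /gdom expr0 mulr1.
Qed.

(** The sequence is the beta integral of u^(a-1) (1 - lam u/(n+1))^(n+1) over (0, (n+1)/lam], which
    dominated convergence turns into the gamma integral. The case lam = 1 is Gauss' product
    formula. *)
Lemma cvgC_gamma_integral (a : C) (lam : R) : 0 < ReC a -> 0 < lam ->
  cvgC (fun n => cpow (n.+1%:R / lam) a * n.+1`!%:R / \prod_(j < n.+2) (a + j%:R))
       (cint posR (fun u => cpow u (a - 1) * rc (expR (- (lam * u))))).
Proof.
move=> a0 l0; pose T n : R := n.+1%:R / lam.
have T0 n : 0 < T n by rewrite divr_gt0 ?ltr0n.
pose f n u := if u \in `]0, T n]%classic then cpow u (a - 1) * rc ((1 - u / T n) ^+ n.+1) else 0.
have E n : cint posR (f n) = cpow (n.+1%:R / lam) a * n.+1`!%:R / \prod_(j < n.+2) (a + j%:R).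
  rewrite cint_sub; last by move=> u /=; rewrite in_itv /= => /andP[].
  exact: (cint_beta_itv n.+1 (T0 n) a0).2.
have -> : (fun n => cpow (n.+1%:R / lam) a * n.+1`!%:R / \prod_(j < n.+2) (a + j%:R)) = (fun n => cint posR (f n)).
  by apply/funext => n; rewrite E.
have fE n u : u / T n = (lam * u) / n.+1%:R by rewrite /T invf_div mulrA [u * lam]mulrC.
apply: (cint_dct measurable_posR _ _ (integrable_gdom 0 a0 l0) _).2.
- move=> n; rewrite /f; split.
    rewrite (_ : (fun x => _) = (fun u => ReC (cpow u (a - 1) * rc ((1 - u / T n) ^+ n.+1))) \_ (`]0, T n]%classic)); last first.
      by apply/funext => u; rewrite patchE; case: ifP.
    apply/(measurable_restrict _ (measurable_itv _) measurable_posR).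
    by apply: (cmeas_beta _ _ _ _).1; apply: measurableI; [exact: measurable_posR|exact: measurable_itv].
  rewrite (_ : (fun x => _) = (fun u => ImC (cpow u (a - 1) * rc ((1 - u / T n) ^+ n.+1))) \_ (`]0, T n]%classic)); last first.
    by apply/funext => u; rewrite patchE; case: ifP.
  apply/(measurable_restrict _ (measurable_itv _) measurable_posR).
  by apply: (cmeas_beta _ _ _ _).2; apply: measurableI; [exact: measurable_posR|exact: measurable_itv].
- move=> u u0.
  apply: (@cvgC_near _ (fun n => cpow u (a - 1) * rc ((1 - (lam * u) / n.+1%:R) ^+ n.+1))).
    near=> n; rewrite /f ifT ?fE // inE /= in_itv /= u0 /= /T ler_pdivlMr //.
    rewrite (@le_trans _ _ n%:R) ?ler_nat //; near: n; exact: nbhs_infty_ger.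
  apply: cvgCM; first exact: cvgC_cst.
  by apply: cvgC_rc; apply: cvg_exp_pow; rewrite mulr_ge0 ?ltW.
- move=> n u u0; rewrite /f; case: ifPn => [|_]; last by rewrite cnorm0 gdom_ge0.
  rewrite inE /= in_itv /= => /andP[_ uT].
  rewrite -cnorm_gamma_gdom cnormM [leRHS]cnormM ler_wpM2l ?cnorm_ge0 // !cnorm_rc.
  have h1 : 0 <= u / T n by rewrite divr_ge0 ?ltW.
  have h2 : u / T n <= 1 by rewrite ler_pdivrMr // mul1r.
  rewrite (le_trans (pow_le_exp _ h1 h2)) // ger0_norm ?expR_ge0 // ler_expR lerN2.
  by rewrite fE mulrCA mulfV ?mulr1.
Unshelve. all: by end_near. Qed.

(** The coefficient of x^n in (1 - x)^(-a). *)
Definition cbin (a : C) (n : nat) : C := cpoch a n / n`!%:R.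

Lemma factC_neq0 n : n`!%:R != 0 :> C.
Proof. by rewrite pnatr_eq0 -lt0n fact_gt0. Qed.
Lemma natC_neq0 n : n.+1%:R != 0 :> C.
Proof. by rewrite pnatr_eq0. Qed.
Lemma cpochS (a : C) n : cpoch a n.+1 = cpoch a n * (a + n%:R).
Proof. by rewrite /cpoch big_ord_recr. Qed.
Lemma cpochSl (a : C) n : cpoch a n.+1 = a * cpoch (a + 1) n.
Proof.
rewrite /cpoch big_ord_recl addr0; congr (_ * _); apply: eq_bigr => i _.
by rewrite /= /bump /= natrD addrA.
Qed.
Lemma cpochD (a : C) n m : cpoch a (n + m) = cpoch a n * cpoch (a + n%:R) m.
Proof.
elim: m => [|m IH]; first by rewrite addn0 [cpoch _ 0]/cpoch big_ord0 mulr1.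
by rewrite addnS !cpochS IH mulrA natrD addrA.
Qed.
Lemma cbin0 a : cbin a 0 = 1.
Proof. by rewrite /cbin /cpoch big_ord0 fact0 divr1. Qed.
Lemma cbinS a n : cbin a n.+1 = cbin a n * ((a + n%:R) / n.+1%:R).
Proof. by rewrite /cbin cpochS factS natrM invfM; ring. Qed.
Lemma cbin_shift (a : C) n : a * cbin (a + 1) n = cbin a n * (a + n%:R).
Proof. by rewrite /cbin mulrA -cpochSl cpochS mulrAC. Qed.

Definition nonpole (a : C) := forall j : nat, a + j%:R != 0.

Lemma nonpole_addn a m : nonpole a -> nonpole (a + m%:R).
Proof. by move=> h j; rewrite -addrA -natrD. Qed.
Lemma cpoch_neq0 a n : nonpole a -> cpoch a n != 0.
Proof. by move=> h; apply/prodf_neq0 => i _; exact: h. Qed.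
Lemma cbin_neq0 a n : nonpole a -> cbin a n != 0.
Proof. by move=> h; rewrite mulf_neq0 ?cpoch_neq0 // invr_eq0 factC_neq0. Qed.

(** Gauss' sequence for 1/Gamma(a); the base n + 1 keeps it meaningful at n = 0. *)
Definition gauss_seq (a : C) (n : nat) : C := cbin a n * cpow n.+1%:R (1 - a).

Lemma ReX2 (w : C) : cnorm (1 + w) <= expR (ReC w + cnorm w ^+ 2 / 2).
Proof.
rewrite -(ler_pXn2r (n := 2)) ?nnegrE ?cnorm_ge0 ?expR_ge0 // -expRM_natr.
rewrite /cnorm !sqr_sqrtr ?addr_ge0 ?sqr_ge0 // ReD ImD /=.
apply: le_trans (expR_ge1Dx _); rewrite add0r; set x := ReC w; set y := ImC w.
by rewrite le_eqVlt; apply/orP; left; apply/eqP; field.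
Qed.

Lemma ln1D_bounds (y : R) : 0 <= y -> y - y ^+ 2 <= ln (1 + y) /\ ln (1 + y) <= y.
Proof.
move=> y0; have y1 : 0 < 1 + y by rewrite ltr_pwDl.
split; last by apply: le_ln1Dx; rewrite (lt_le_trans _ y0) // ltrN10.
have h : ln (1 + y) = - ln (1 + - (y / (1 + y))).
  have -> : 1 + - (y / (1 + y)) = (1 + y)^-1 by field; rewrite gt_eqF.
  by rewrite lnV ?posrE // opprK.
rewrite h lerNr; apply: (le_trans (le_ln1Dx _)).
  by rewrite ltrN2 ltr_pdivrMr // mul1r ltrDr.
rewrite lerN2 ler_pdivlMr //.
have : 0 <= y ^+ 3 by rewrite exprn_ge0.
have -> : y ^+ 3 = y * y * y by ring.
rewrite expr2; lra.
Qed.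

(** The first-order terms of the ratio, (a - 1)/(n+1) and (1 - a) ln(1 + 1/(n+1)), cancel, so that
    its modulus is at most 1 + O(n^-2). *)
Lemma gauss_seq_step (a : C) n : cnorm (gauss_seq a n.+1) <=
  cnorm (gauss_seq a n) * expR ((cnorm (a - 1) ^+ 2 + `|1 - ReC a|) / n.+1%:R ^+ 2).
Proof.
have n0 : 0 < n.+1%:R :> R by rewrite ltr0n.
pose y : R := n.+1%:R^-1; have y0 : 0 < y by rewrite invr_gt0.
have y2 : 0 < 1 + y by rewrite addr_gt0.
have -> : gauss_seq a n.+1 = gauss_seq a n * ((1 + (a - 1) * rc y) * cpow (1 + y) (1 - a)).
  rewrite /gauss_seq cbinS.
  have -> : (n.+2%:R : R) = n.+1%:R * (1 + y) by rewrite /y mulrDr mulr1 mulfV ?gt_eqF // natr1.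
  rewrite cpowM // rcV rc_nat.
  rewrite [in RHS](_ : 1 + (a - 1) / n.+1%:R = (a + n%:R) / n.+1%:R); last first.
    have := natC_neq0 n; rewrite -natr1; set x := _ + 1 => x0.
    have -> : a + n%:R = x + (a - 1) by rewrite /x; ring.
    by rewrite [in RHS]mulrDl mulfV.
  by ring.
rewrite cnormM ler_wpM2l ?cnorm_ge0 // cnormM cnorm_cpow.
have -> : n.+1%:R ^+ 2 = (y ^+ 2)^-1 by rewrite /y exprVn invrK.
rewrite invrK; apply: (le_trans (ler_wpM2r (expR_ge0 _) (ReX2 _))).
rewrite -expRD ler_expR cnormM cnorm_rc (ger0_norm (ltW y0)) mulrC rcZ_Re !(ReD, ReN) /=.
have [l1 l2] := ln1D_bounds (ltW y0).
have h : (1 - ReC a) * (ln (1 + y) - y) <= `|1 - ReC a| * y ^+ 2.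
  rewrite (le_trans (ler_norm _)) // normrM ler_wpM2l // ler_norml; lra.
have h2 : 0 <= (cnorm (a - 1) * y) ^+ 2 by exact: sqr_ge0.
rewrite exprMn in h2 *; lra.
Qed.

(** Boundedness precedes the limit: in [gauss_Gamma_int] the sequence multiplies a quantity that
    tends to 0. *)
Lemma gauss_seq_bounded (a : C) : exists M, forall n, cnorm (gauss_seq a n) <= M.
Proof.
pose K := cnorm (a - 1) ^+ 2 + `|1 - ReC a|.
have K0 : 0 <= K by rewrite addr_ge0 ?sqr_ge0.
(* The increments 2K/((n+1)(n+2)) of this exponent are at least the K/(n+1)^2 that one step
   costs. *)
have H n : cnorm (gauss_seq a n) <= cnorm (gauss_seq a 0) * expR (2 * K * (1 - n.+1%:R^-1)).
  elim: n => [|n IH]; first by rewrite invr1 subrr mulr0 expR0 mulr1.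
  apply: (le_trans (gauss_seq_step a n)).
  apply: (le_trans (ler_wpM2r (expR_ge0 _) IH)).
  rewrite -[X in X <= _]mulrA -expRD ler_wpM2l ?cnorm_ge0 // ler_expR -/K.
  have n1 : 0 < n.+1%:R :> R by rewrite ltr0n.
  have -> : (n.+2%:R : R) = n.+1%:R + 1 by rewrite natr1.
  have n2 : 1 <= n.+1%:R :> R by rewrite ler1n.
  set x : R := n.+1%:R in n1 n2 *.
  have h : 0 <= 2 * K * (1 - (x + 1)^-1) - (2 * K * (1 - x^-1) + K / x ^+ 2).
    have -> : 2 * K * (1 - (x + 1)^-1) - (2 * K * (1 - x^-1) + K / x ^+ 2) = K * (x - 1) / (x ^+ 2 * (x + 1)).
      by field; rewrite !gt_eqF // addr_gt0.
    apply: divr_ge0; first by apply: mulr_ge0 => //; rewrite subr_ge0.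
    by apply: mulr_ge0; [exact: sqr_ge0|rewrite addr_ge0 ?(ltW n1)].
  by rewrite -subr_ge0.
exists (cnorm (gauss_seq a 0) * expR (2 * K)) => n; apply: (le_trans (H n)).
rewrite ler_wpM2l ?cnorm_ge0 // ler_expR ler_piMr ?mulr_ge0 // gerBl invr_ge0.
Qed.

Lemma cvgC_ratio (a : C) : cvgC (fun n => (a + n%:R) / n.+1%:R) 1.
Proof.
have E n : (a + n%:R) / n.+1%:R = 1 + (a - 1) * rc (n.+1%:R^-1 : R).
  rewrite rcV rc_nat; have := natC_neq0 n; rewrite -natr1; set x := _ + 1 => x0.
  have -> : a + n%:R = x + (a - 1) by rewrite /x; ring.
  by rewrite mulrDl mulfV.
under [X in cvgC X]eq_fun do rewrite E.
rewrite -[X in cvgC _ X]addr0 -(mulr0 (a - 1)).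
apply: cvgCD; first exact: cvgC_cst.
apply: cvgCM; first exact: cvgC_cst.
by apply: cvgC_rc; exact: cvg_harmonic.
Qed.

Lemma cvgC_ratioV (a : C) : cvgC (fun n => n.+1%:R / (a + n%:R)) 1.
Proof.
have := cvgCV (oner_neq0 _) (cvgC_ratio a); rewrite invr1.
by under [X in cvgC X _ -> _]eq_fun do rewrite invf_div.
Qed.

Lemma gauss_identity (x y c e f g : C) : x != 0 -> y != 0 -> c != 0 ->
  c / y * (g / x) * (x * (g * y) / (c * e * f)) = g / e * (g / f).
Proof.
move=> x0 y0 c0; rewrite !invfM.
rewrite [LHS](_ : _ = (c / c) * (y / y) * (x / x) * (g / e * (g / f))); last by ring.
by rewrite !mulfV // !mul1r.
Qed.

Lemma gauss_Gamma_int (a : C) : 0 < ReC a -> cvgC (fun n => gauss_seq a n * Gamma_int a) 1.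
Proof.
move=> a0; have ag := cvgC_gamma_integral a0 ltr01.
pose I n := cpow (n.+1%:R / 1 : R) a * n.+1`!%:R / \prod_(j < n.+2) (a + j%:R).
have np : nonpole a by move=> j; exact: ReC_addn_neq0.
have GE : cint posR (fun u => cpow u (a - 1) * rc (expR (- (1 * u)))) = Gamma_int a.
  by apply: eq_cint => u _; rewrite mul1r.
rewrite GE in ag.
have E n : gauss_seq a n * I n = n.+1%:R / (a + n%:R) * (n.+1%:R / (a + 1 + n%:R)).
  rewrite /gauss_seq /I divr1 /cbin.
  have -> : \prod_(j < n.+2) (a + j%:R) = cpoch a n * (a + n%:R) * (a + 1 + n%:R).
    by rewrite -/(cpoch a n.+2) !cpochS -natr1 addrAC addrA.
  rewrite (cpowD (n.+1%:R : R) 1 (- a)) (cpow1 (ltr0Sn _ _)) cpowN rc_nat factS natrM.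
  have p1 := cpow_neq0 (n.+1%:R : R) a; have p2 := factC_neq0 n; have p3 := cpoch_neq0 n np.
  exact: gauss_identity.
have c1 : cvgC (fun n => gauss_seq a n * I n) 1.
  under [X in cvgC X]eq_fun do rewrite E.
  by have := cvgCM (cvgC_ratioV a) (cvgC_ratioV (a + 1)); rewrite mulr1.
have [M HM] := gauss_seq_bounded a.
have c2 : cvgC (fun n => gauss_seq a n * (Gamma_int a - I n)) 0.
  apply: cvgC_norm0; under eq_fun do rewrite cnormM.
  have c3 : (fun n => M * cnorm (Gamma_int a - I n)) @ \oo --> (0 : R).
    rewrite -(mulr0 M); apply: cvgM; first exact: cvg_cst.
    rewrite -cnorm0 -(subrr (Gamma_int a)); apply: cvgC_norm.
    by apply: cvgCB; [exact: cvgC_cst|].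
  apply: (squeeze_cvgr _ (cvg_cst _) c3); near=> n.
  apply/andP; split; first by apply: mulr_ge0; exact: cnorm_ge0.
  by apply: ler_wpM2r; [exact: cnorm_ge0|exact: HM].
have := cvgCD c1 c2; rewrite addr0; under [X in cvgC X _ -> _]eq_fun do rewrite -mulrDr addrCA subrr addr0.
by [].
Unshelve. all: by end_near. Qed.

(** The identity (a)_n (a+n)_m = (a)_m (a+m)_n carries the limit from the half-plane Re > 0, where
    Gamma is an integral, to all arguments off the poles. *)
Lemma gauss_cGamma (a : C) : nonpole a -> cvgC (fun n => gauss_seq a n * cGamma a) 1.
Proof.
move=> np; rewrite /cGamma; set m := (Num.truncn _).+1.
have am : 0 < ReC (a + m%:R).
  rewrite ReD Re_nat addrC -ltrBlDr sub0r (le_lt_trans (ler_norm _)) // normrN.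
  exact: truncnS_gt.
have c1 := gauss_Gamma_int am.
have E n : gauss_seq a n * (Gamma_int (a + m%:R) / \prod_(j < m) (a + j%:R)) =
   gauss_seq (a + m%:R) n * Gamma_int (a + m%:R) * \prod_(j < m) (n.+1%:R / (a + j%:R + n%:R)).
  have h : cpoch a n * cpoch (a + n%:R) m = cpoch a m * cpoch (a + m%:R) n by rewrite -!cpochD addnC.
  have p1 := cpoch_neq0 m np; have p2 := cpoch_neq0 m (nonpole_addn n np).
  have -> : \prod_(j < m) (n.+1%:R / (a + j%:R + n%:R)) = n.+1%:R ^+ m / cpoch (a + n%:R) m.
    rewrite big_split /= prodr_const card_ord prodfV; congr (_ / _).
    by apply: eq_bigr => j _; rewrite addrAC.
  have h2 : cpoch a n = cpoch a m * cpoch (a + m%:R) n / cpoch (a + n%:R) m by rewrite -h mulfK.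
  have h3 : cpow (n.+1%:R : R) (1 - a) = cpow (n.+1%:R : R) (1 - (a + m%:R)) * n.+1%:R ^+ m.
    have -> : 1 - a = 1 - (a + m%:R) + m%:R by ring.
    rewrite [LHS]cpowD; congr (_ * _); rewrite -(rc_nat m) cpow_rc -rc_nat -rcX.
    by rewrite -/(rpow _ _) rpowX ?ltr0n.
  rewrite /gauss_seq /cbin h2 h3 -/(cpoch a m).
  have aux (p q x f g c k : C) : p != 0 ->
      p * q / x * f * (c * k) * (g / p) = q * f * c * g * (k / x).
    move=> p0; rewrite [LHS](_ : _ = (p / p) * (q * f * c * g * (k / x))); last by ring.
    by rewrite mulfV // mul1r.
  exact: aux.
under [X in cvgC X]eq_fun do rewrite E.
have c2 : cvgC (fun n => \prod_(j < m) (n.+1%:R / (a + j%:R + n%:R))) 1.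
  have := @cvgC_prod R _ (index_enum 'I_m) (fun j n => n.+1%:R / (a + j%:R + n%:R)) (fun=> 1) (fun j => cvgC_ratioV (a + j%:R)).
  by rewrite big1.
by have := cvgCM c1 c2; rewrite mulr1.
Qed.

Lemma cGamma_neq0 (a : C) : nonpole a -> cGamma a != 0.
Proof.
move=> np; apply/eqP => g0; have := gauss_cGamma np; rewrite g0.
under [X in cvgC X _ -> _]eq_fun do rewrite mulr0.
by move=> h; have /eqP := cvgC_unique h (cvgC_cst 0); rewrite oner_eq0.
Qed.

Lemma gauss_seq_cvg (a : C) : nonpole a -> cvgC (gauss_seq a) (cGamma a)^-1.
Proof.
move=> np; have := cvgCM (gauss_cGamma np) (cvgC_cst (cGamma a)^-1).
rewrite mul1r; under [X in cvgC X _ -> _]eq_fun do rewrite mulfK ?cGamma_neq0 //.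
by [].
Qed.

Lemma cGamma_int (a : C) : 0 < ReC a -> cGamma a = Gamma_int a.
Proof.
move=> a0; have np : nonpole a by move=> j; exact: ReC_addn_neq0.
have := cvgCM (gauss_Gamma_int a0) (cvgC_cst (cGamma a)); rewrite mul1r.
under [X in cvgC X _ -> _]eq_fun do rewrite mulrAC.
have := cvgCM (gauss_cGamma np) (cvgC_cst (Gamma_int a)); rewrite mul1r.
by move=> h1 h2; exact: (cvgC_unique h2 h1).
Qed.

(** Read off from Gauss' limit: in [cGamma] the number of shifts jumps with the real part, which
    hides the functional equation in the definition. *)
Lemma cGammaS (a : C) : nonpole a -> cGamma (a + 1) = a * cGamma a.
Proof.
move=> np; have np1 := nonpole_addn 1 np.
have a0 : a != 0 by have := np 0; rewrite addr0.
have c1 := gauss_seq_cvg np1.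
have E n : gauss_seq (a + 1) n = a^-1 * (gauss_seq a n * ((a + n%:R) / n.+1%:R)).
  rewrite /gauss_seq; have -> : cbin (a + 1) n = a^-1 * (cbin a n * (a + n%:R)) by rewrite -cbin_shift mulKf.
  have -> : 1 - (a + 1) = 1 - a - 1 by ring.
  by rewrite [cpow _ (1 - a - 1)]cpowD cpowN cpow1 ?ltr0n // rc_nat; ring.
have c2 : cvgC (gauss_seq (a + 1)) (a^-1 * ((cGamma a)^-1 * 1)).
  rewrite (_ : gauss_seq (a + 1) = (fun n => a^-1 * (gauss_seq a n * ((a + n%:R) / n.+1%:R)))); last exact/funext.
  apply: cvgCM; first exact: cvgC_cst.
  by apply: cvgCM; [exact: gauss_seq_cvg|exact: cvgC_ratio].
have := cvgC_unique c1 c2; rewrite mulr1 -invfM => /(congr1 GRing.inv); rewrite !invrK.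
by [].
Qed.

Lemma gamma_scale (a : C) (lam : R) : 0 < ReC a -> 0 < lam ->
  cint posR (fun u => cpow u (a - 1) * rc (expR (- (lam * u)))) = cGamma a * cpow lam (- a).
Proof.
move=> a0 l0; have c1 := cvgC_gamma_integral a0 l0; have c2 := cvgC_gamma_integral a0 ltr01.
have GE : cint posR (fun u => cpow u (a - 1) * rc (expR (- (1 * u)))) = Gamma_int a.
  by apply: eq_cint => u _; rewrite mul1r.
rewrite GE -(cGamma_int a0) in c2.
have := cvgCM c2 (cvgC_cst (cpow lam (- a))) => c3; apply: (cvgC_unique c1).
apply: cvgC_near c3; apply: nearW => n.
have l1 : 0 < lam^-1 by rewrite invr_gt0.
rewrite divr1 (cpowM a (ltr0Sn _ n) l1).
have -> : cpow lam^-1 a = cpow lam (- a).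
  by rewrite /cpow (lnV l0) ReN ImN !mulrN !mulNr.
have aux (x y v w : C) : x * v / w * y = x * y * v / w by ring.
exact: aux.
Qed.

End Gauss.

(** * Laplace transforms *)

Section Laplace.
Context {R : realType}.
Local Notation C := R[i].
Local Notation mu := (@lebesgue_measure R).
Local Notation P := (@posR R : set (measurableTypeR R)).

Lemma measurable_expR_mul : measurable_fun setT (fun z : measurableTypeR R * measurableTypeR R => expR (- (z.1 * z.2))).
Proof.
apply: measurableT_comp; first exact: measurable_expR.
apply: measurableT_comp => //; apply: measurable_funM; [exact: measurable_fst|exact: measurable_snd].
Qed.

Lemma laplace_dom (b : R -> R) x : 0 < x -> mu.-integrable P (EFin \o b) ->
  mu.-integrable P (EFin \o (fun y => b y * expR (- (x * y)))).
Proof.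
move=> x0 bi; have mb : measurable_fun P b by have /integrableP[/measurable_EFinP] := bi.
apply: (le_integrable_EFin measurable_posR _ (integrable_norm bi)).
  apply: measurable_funM => //; apply: measurableT_comp; first exact: measurable_expR.
  by apply: measurableT_comp => //; apply: measurable_funM => //; exact: measurable_cst.
move=> y y0; rewrite normrM ler_piMr // ger0_norm ?expR_ge0 // -expR0 ler_expR.
by rewrite oppr_le0 mulr_ge0 ?ltW.
Qed.

Definition Rlap (b : R -> R) (x : R) := \int[mu]_(y in P) (b y * expR (- (x * y))).

(** Fubini for the symmetric kernel e^(-xy), which is at most 1. Both functions are extended by 0 so
    that the product measure lives on the whole plane. *)
Lemma Rlaplace_swap (a b : R -> R) :
  mu.-integrable P (EFin \o a) -> mu.-integrable P (EFin \o b) ->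
  mu.-integrable P (EFin \o (fun x => a x * Rlap b x)) /\
  \int[mu]_(x in P) (a x * Rlap b x) = \int[mu]_(y in P) (b y * Rlap a y).
Proof.
move=> ai bi.
have ma : measurable_fun P a by have /integrableP[/measurable_EFinP] := ai.
have mb : measurable_fun P b by have /integrableP[/measurable_EFinP] := bi.
pose a' := a \_ P; pose b' := b \_ P.
have ma' : measurable_fun setT a' by apply/(measurable_restrictT _ measurable_posR).
have mb' : measurable_fun setT b' by apply/(measurable_restrictT _ measurable_posR).
have ai' : mu.-integrable setT (EFin \o a').
  by have := (integrable_mkcond _ measurable_posR).1 ai; rewrite restrict_EFin.
have bi' : mu.-integrable setT (EFin \o b').
  by have := (integrable_mkcond _ measurable_posR).1 bi; rewrite restrict_EFin.
pose f (z : measurableTypeR R * measurableTypeR R) := (a' z.1 * (b' z.2 * expR (- (z.1 * z.2))))%:E.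
have mf : measurable_fun setT f.
  apply/measurable_EFinP; apply: measurable_funM.
    by apply: measurableT_comp => //; exact: measurable_fst.
  apply: measurable_funM; last exact: measurable_expR_mul.
  by apply: measurableT_comp => //; exact: measurable_snd.
have fle x y : (`|f (x, y)| <= `|a' x|%:E * `|b' y|%:E)%E.
  rewrite /f /= -EFinM lee_fin !normrM /a' /b' !patchE.
  case: ifPn => [|_]; last by rewrite normr0 !mul0r.
  case: ifPn => [|_]; last by rewrite normr0 mul0r mulr0.
  rewrite !inE => y0 x0; rewrite ler_wpM2l // ler_piMr // ger0_norm ?expR_ge0 //.
  by rewrite -expR0 ler_expR oppr_le0 mulr_ge0 ?ltW.
have H : (\int[mu]_x \int[mu]_y `|f (x, y)| < +oo)%E.
  have [/integrableP[_ aoo] /integrableP[_ boo]] := (ai', bi').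
  have cE : (\int[mu]_y `|(EFin \o b') y|)%E = (fine (\int[mu]_y `|(EFin \o b') y|))%:E.
    by rewrite fineK // ge0_fin_numE // integral_ge0.
  apply: (@le_lt_trans _ _ (\int[mu]_x (`|(EFin \o a') x| * \int[mu]_y `|(EFin \o b') y|))%E).
    apply: ge0_le_integral => //.
    - by move=> x _; exact: integral_ge0.
    - have maf : measurable_fun setT (abse \o f) by apply: measurableT_comp.
      have h := @measurable_fun_fubini_tonelli_F _ _ _ _ R mu (abse \o f) maf (fun z => abse_ge0 _).
      exact h.
    - rewrite cE; apply: emeasurable_funM => //.
      by apply: measurableT_comp => //; exact/measurable_EFinP.
    - move=> x _; rewrite -ge0_integralZl //; last first.
        by apply: measurableT_comp => //; exact/measurable_EFinP.
      apply: ge0_le_integral => //.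
      + by apply: measurableT_comp => //; apply: measurableT_comp mf _ => //; exact: measurable_pair1.
      + apply: emeasurable_funM => //; apply: measurableT_comp => //; exact/measurable_EFinP.
  rewrite cE ge0_integralZr ?lee_fin ?fine_ge0 ?integral_ge0 //.
    have aE : (\int[mu]_y `|(EFin \o a') y|)%E = (fine (\int[mu]_y `|(EFin \o a') y|))%:E.
      by rewrite fineK // ge0_fin_numE // integral_ge0.
    by rewrite aE -EFinM ltry.
  by apply: measurableT_comp => //; exact/measurable_EFinP.
have fi := (@integrable12ltyP _ _ _ _ R mu mu f mf).2 H.
have F1 x : fubini_F mu f x = ((fun x => a x * Rlap b x) \_ P x)%:E.
  rewrite /fubini_F /f /= patchE /a'; case: ifPn => [|xP]; last first.
    by under eq_integral do rewrite patchE (negbTE xP) mul0r; rewrite integral0.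
  rewrite inE => x0; under eq_integral do rewrite patchE (mem_set x0).
  have bx := laplace_dom x0 bi.
  rewrite (_ : (fun y => _) = (fun y => (a x)%:E * (((fun y => b y * expR (- (x * y))) \_ P) y)%:E)%E); last first.
    apply/funext => y; rewrite -EFinM /b' !patchE; congr (_ * _)%:E.
    by case: ifP => // _; rewrite mul0r.
  have bx' : mu.-integrable setT (EFin \o ((fun y => b y * expR (- (x * y))) \_ P)).
    by have := (integrable_mkcond _ measurable_posR).1 bx; rewrite restrict_EFin.
  rewrite integralZl // EFinM; congr (_ * _)%E.
  by rewrite /Rlap Rintegral_mkcond /Rintegral fineK //; exact: integrable_fin_num.
have G1 y : fubini_G mu f y = ((fun y => b y * Rlap a y) \_ P y)%:E.
  rewrite /fubini_G /f /= patchE; case: ifPn => [|yP]; last first.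
    by under eq_integral do rewrite /b' patchE (negbTE yP) mul0r mulr0; rewrite integral0.
  rewrite inE => y0.
  have ax := laplace_dom y0 ai.
  rewrite (_ : (fun x => _) = (fun x => (b y)%:E * (((fun x => a x * expR (- (y * x))) \_ P) x)%:E)%E); last first.
    apply/funext => x; rewrite -EFinM /b' /a' !patchE (mem_set y0); congr (_%:E).
    by case: ifP => // _; rewrite ?mul0r ?mulr0 // mulrCA [y * x]mulrC.
  have ax' : mu.-integrable setT (EFin \o ((fun y0 => a y0 * expR (- (y * y0))) \_ P)).
    by have := (integrable_mkcond _ measurable_posR).1 ax; rewrite restrict_EFin.
  rewrite integralZl // EFinM; congr (_ * _)%E.
  by rewrite /Rlap Rintegral_mkcond /Rintegral fineK //; exact: integrable_fin_num.
split.
  have := integrable_fubini_F fi; rewrite (_ : fubini_F mu f = EFin \o ((fun x => a x * Rlap b x) \_ P)); last exact/funext.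
  by rewrite -restrict_EFin => h; apply/(integrable_mkcond _ measurable_posR).
rewrite [LHS]Rintegral_mkcond [RHS]Rintegral_mkcond /Rintegral; congr fine.
under eq_integral do rewrite -F1; under [RHS]eq_integral do rewrite -G1.
exact: Fubini.
Qed.

(** Fubini with a(x) = e^-x makes e^-x [Rlap b x] measurable, and multiplication by e^x removes the
    extra factor. *)
Lemma measurable_Rlap (b : R -> R) : mu.-integrable P (EFin \o b) -> measurable_fun P (Rlap b).
Proof.
move=> bi; have ei := integrable_gdom 0 (@ltr01 R) (@ltr01 R).
have [/integrableP[/measurable_EFinP h _] _] := Rlaplace_swap ei bi.
have e0 x : gdom 1 0 1 x = expR (- x) :> R.
  by rewrite /gdom expr0 mulr1 subrr rpow0 !mul1r.
have : measurable_fun P (fun x => expR x * (gdom 1 0 1 x * Rlap b x)).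
  by apply: measurable_funM => //; apply: measurable_funTS; exact: measurable_expR.
by under eq_fun do rewrite e0 mulrA -expRD subrr expR0 mul1r.
Qed.

Definition clap (b : R -> C) (x : R) := cint P (fun y => b y * rc (expR (- (x * y)))).

Lemma clapE b x : clap b x = mkC (Rlap (fun y => ReC (b y)) x) (Rlap (fun y => ImC (b y)) x).
Proof.
by congr mkC; apply: eq_Rintegral => y _; rewrite ?ReM ?ImM /= mulr0 ?subr0 ?add0r.
Qed.

Lemma clap_cintegrable b x : 0 < x -> cintegrable P b -> cintegrable P (fun y => b y * rc (expR (- (x * y)))).
Proof.
move=> x0 [b1 b2]; split.
  have := laplace_dom x0 b1; congr (_.-integrable _ _); apply/funext => y /=.
  by rewrite ReM /= mulr0 subr0.
have := laplace_dom x0 b2; congr (_.-integrable _ _); apply/funext => y /=.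
by rewrite ImM /= mulr0 add0r.
Qed.

Lemma claplace_swap (a b : R -> C) : cintegrable P a -> cintegrable P b ->
  cintegrable P (fun x => a x * clap b x) /\
  cint P (fun x => a x * clap b x) = cint P (fun y => b y * clap a y).
Proof.
move=> [a1 a2] [b1 b2].
have [i11 e11] := Rlaplace_swap a1 b1; have [i12 e12] := Rlaplace_swap a1 b2.
have [i21 e21] := Rlaplace_swap a2 b1; have [i22 e22] := Rlaplace_swap a2 b2.
have [j11 _] := Rlaplace_swap b1 a1; have [j12 _] := Rlaplace_swap b1 a2.
have [j21 _] := Rlaplace_swap b2 a1; have [j22 _] := Rlaplace_swap b2 a2.
split; first split.
- have := integrableB measurable_posR i11 i22; congr (_.-integrable _ _); apply/funext => x /=.
  by rewrite clapE ReM EFinB.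
- have := integrableD measurable_posR i12 i21; congr (_.-integrable _ _); apply/funext => x /=.
  by rewrite clapE ImM EFinD.
apply: eqC => /=.
  under eq_Rintegral do rewrite clapE ReM /=.
  under [RHS]eq_Rintegral do rewrite clapE ReM /=.
  by rewrite (RintegralB measurable_posR i11 i22) (RintegralB measurable_posR j11 j22) e11 e22.
under eq_Rintegral do rewrite clapE ImM /=.
under [RHS]eq_Rintegral do rewrite clapE ImM /=.
by rewrite (RintegralD measurable_posR i12 i21) (RintegralD measurable_posR j12 j21) e12 e21 addrC.
Qed.

Lemma cmeas_clap b : cintegrable P b -> cmeas P (clap b).
Proof.
move=> [b1 b2]; split.
  have := measurable_Rlap b1; apply: eq_measurable_fun => x _; by rewrite clapE.
have := measurable_Rlap b2; apply: eq_measurable_fun => x _; by rewrite clapE.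
Qed.

End Laplace.

(** * Scaling limits of hypergeometric sums *)

Section Scaling.
Context {R : realType}.
Local Notation C := R[i].
Local Notation mu := (@lebesgue_measure R).
Local Notation P := (@posR R : set (measurableTypeR R)).

Definition fl (m : nat) (u : R) : nat := Num.truncn (u * m%:R).

Lemma fl_bounds M u : 0 <= u -> (fl M.+1 u)%:R / M.+1%:R <= u /\ u < (fl M.+1 u).+1%:R / M.+1%:R.
Proof.
move=> u0; have m0 : 0 < M.+1%:R :> R by rewrite ltr0n.
have /truncn_itv/andP[h1 h2] : 0 <= u * M.+1%:R by rewrite mulr_ge0.
by split; rewrite ?ler_pdivrMr ?ltr_pdivlMr.
Qed.

Definition slim (n : nat -> nat) (x : R) := (fun M => (n M)%:R / M.+1%:R) @ \oo --> x.

Lemma cvg_inv_nat : (fun M => (M.+1%:R)^-1) @ \oo --> (0 : R).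
Proof. exact: cvg_harmonic. Qed.

Lemma slimD n k x y : slim n x -> slim k y -> slim (fun M => (n M + k M)%N) (x + y).
Proof. by move=> nx ky; rewrite /slim; under eq_fun do rewrite natrD mulrDl; exact: cvgD. Qed.

Lemma slim_cst k : slim (fun=> k) 0.
Proof. by rewrite /slim -(mulr0 k%:R); apply: cvgM; [exact: cvg_cst|exact: cvg_inv_nat]. Qed.

Lemma slimS n x : slim n x -> slim (fun M => (n M).+1) x.
Proof.
move=> nx; have := slimD nx (slim_cst 1); rewrite addr0.
by rewrite /slim; under eq_fun do rewrite addn1.
Qed.

Lemma slim_fl u : 0 <= u -> slim (fun M => fl M.+1 u) u.
Proof.
move=> u0; rewrite /slim.
have c : (fun M => u - (M.+1%:R)^-1) @ \oo --> u.
  by rewrite -[X in _ --> X]subr0; apply: cvgB; [exact: cvg_cst|exact: cvg_inv_nat].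
apply: (squeeze_cvgr _ c (cvg_cst _)); apply: nearW => M.
have [h1 h2] := fl_bounds M u0; rewrite h1 andbT lerBlDr ltW //.
by rewrite -[X in _ + X]mul1r -mulrDl natr1.
Qed.

Lemma slim_infty n x : 0 < x -> slim n x -> n @ \oo --> \oo.
Proof.
move=> x0 nx; apply/cvgnyPge => A.
have x2 : x / 2 < x by rewrite ltr_pdivrMr // ltr_pMr // ltr1n.
near=> M.
have h1 : x / 2 <= (n M)%:R / M.+1%:R.
  by apply: ltW; near: M; exact: (cvgr_gt _ nx).
have h2 : A%:R <= x / 2 * M.+1%:R.
  rewrite mulrC -ler_pdivrMr ?divr_gt0 // (@le_trans _ _ M%:R) ?ler_nat //.
  by near: M; exact: nbhs_infty_ger.
by rewrite -(ler_nat R) (le_trans h2) // -ler_pdivlMr ?ltr0n.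
Unshelve. all: by end_near. Qed.

Lemma slim_pos_bound n x : 0 < x -> slim n x ->
  exists d : R, 0 < d /\ forall M, d <= (n M).+1%:R / M.+1%:R.
Proof.
move=> x0 nx; have nx1 := slimS nx.
have : cvgC (fun M => rc (((n M).+1%:R / M.+1%:R)^-1)) (rc x^-1).
  by apply: cvgC_rc; apply: cvgV; rewrite ?gt_eqF.
move=> /cvgC_bounded [K HK].
have K0 : 0 < K.
  apply: lt_le_trans (HK 0%N); apply: cnorm_gt0; apply: rc_neq0.
  by rewrite gt_eqF // invr_gt0 divr_gt0 ?ltr0n.
exists K^-1; split => [|M]; first by rewrite invr_gt0.
have h : 0 < (n M).+1%:R / M.+1%:R :> R by rewrite divr_gt0 ?ltr0n.
rewrite -[leRHS]invrK lef_pV2 ?posrE ?invr_gt0 //.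
by rewrite (le_trans _ (HK M)) // cnorm_rc ler_norm.
Qed.

(** Normalized so that for j close to x m it approaches x^(a-1) / Gamma(a). *)
Definition sbin (m : nat) (a : C) (j : nat) : C := cpow m%:R (1 - a) * cbin a j.

Lemma sbinE M a j : sbin M.+1 a j = gauss_seq a j * cpow (j.+1%:R / M.+1%:R) (a - 1).
Proof.
have m0 : 0 < (M.+1%:R : R)^-1 by rewrite invr_gt0 ltr0n.
rewrite /sbin /gauss_seq (cpowM (a - 1) (ltr0Sn _ j) m0).
have -> : cpow (M.+1%:R)^-1 (a - 1) = cpow (M.+1%:R : R) (1 - a).
  by rewrite /cpow (lnV (ltr0Sn _ M)) -(opprB a 1) ReN ImN !mulrN !mulNr.
have h : cpow (j.+1%:R : R) (1 - a) * cpow (j.+1%:R : R) (a - 1) = 1.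
  by rewrite -cpowD -(opprB a 1) addNr cpow0.
have aux (x y v w : C) : x * y = 1 -> v * w = w * x * (y * v).
  by move=> xy; rewrite -mulrA (mulrA x) xy mul1r mulrC.
exact: aux.
Qed.

Lemma cvgC_sbin a j x : nonpole a -> 0 < x -> slim j x ->
  cvgC (fun M => sbin M.+1 a (j M)) (cpow x (a - 1) / cGamma a).
Proof.
move=> np x0 jx; under [X in cvgC X]eq_fun do rewrite sbinE.
rewrite mulrC; apply: cvgCM.
  by apply: (cvgC_comp (slim_infty x0 jx)); exact: gauss_seq_cvg.
by apply: cvgC_cpow => //; exact: slimS.
Qed.

Lemma sbin_bound a : exists K, 0 < K /\ forall M j,
  cnorm (sbin M.+1 a j) <= K * rpow (j.+1%:R / M.+1%:R) (ReC a - 1).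
Proof.
have [K HK] := gauss_seq_bounded a; exists (`|K| + 1); split => [|M j].
  by rewrite ltr_wpDl.
rewrite sbinE cnormM cnorm_cpow_rpow ReD ReN; apply: ler_wpM2r; first exact: rpow_ge0.
by rewrite (le_trans (HK j)) // (le_trans (ler_norm _)) // lerDl.
Qed.

(** A Riemann sum in the form of an integral of a step function, to which dominated convergence
    applies. *)
Lemma step_integral (f : nat -> R) M J :
  mu.-integrable P (EFin \o (fun u => if (fl M.+1 u < J)%N then f (fl M.+1 u) else 0)) /\
  \int[mu]_(u in P) (if (fl M.+1 u < J)%N then f (fl M.+1 u) else 0) =
  M.+1%:R^-1 * \sum_(j < J) f j.
Proof.
have m0 : 0 < M.+1%:R :> R by rewrite ltr0n.
elim: J => [|J [IH1 IH2]].
  rewrite big_ord0 mulr0; split.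
    by rewrite (_ : _ \o _ = cst 0%E) //; exact: integrable0.
  by rewrite /Rintegral integral0.
pose I : set (measurableTypeR R) := `[J%:R / M.+1%:R, J.+1%:R / M.+1%:R[%classic.
have mI : measurable I by exact: measurable_itv.
have flI u : P u -> (u \in I) = (fl M.+1 u == J).
  move=> u0.
  have -> : (u \in I) = (J%:R <= u * M.+1%:R < J.+1%:R).
    rewrite -ler_pdivrMr // -ltr_pdivlMr //.
    by apply/idP/idP => [/set_mem|h]; [|apply/mem_set]; rewrite /I /= in_itv.
  by rewrite [in RHS]/fl truncn_eq ?mulr_ge0 // ltW.
pose g := (fun=> f J : R) \_ I.
have E u : P u -> (if (fl M.+1 u < J.+1)%N then f (fl M.+1 u) else 0) =
    (if (fl M.+1 u < J)%N then f (fl M.+1 u) else 0) + g u.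
  move=> u0; rewrite /g patchE flI // ltnS.
  by case: ltngtP => h; rewrite ?h ?addr0 // add0r.
have PI : (mu (P `&` I) = (M.+1%:R^-1)%:E)%E.
  have lI : mu I = ((M.+1%:R)^-1)%:E.
    rewrite /I lebesgue_measure_itv /= lte_fin ltr_pM2r ?invr_gt0 // ltr_nat ltnSn.
    by rewrite -EFinD -mulrBl -natrB // subSnn mul1r.
  (* The first cell starts at 0, which [P] excludes; all other cells lie inside [P]. *)
  rewrite -lI; case: J @I {IH1 IH2 mI flI g E lI} => [|J] /=; last first.
    congr (mu _); apply/setIidr => u /=; rewrite in_itv /= => /andP[h _].
    by apply: lt_le_trans h; rewrite divr_gt0 ?ltr0n.
  rewrite mul0r (_ : P `&` _ = `]0, M.+1%:R^-1[%classic).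
    by rewrite !lebesgue_measure_itv /= !lte_fin mul1r.
  apply/seteqP; split => u /=; rewrite !in_itv /= mul1r; first by move=> [? /andP[? ?]]; apply/andP.
  by move=> /andP[h1 h2]; split => //; rewrite h2 (ltW h1).
have gi : mu.-integrable P (EFin \o g).
  rewrite /g -restrict_EFin; apply/integrable_restrict => //; first exact: measurable_posR.
  apply/integrableP; split; first exact: measurable_cst.
  have mPI : measurable (P `&` I) by apply: measurableI => //; exact: measurable_posR.
  have -> : (fun x : measurableTypeR R => `|(EFin \o (fun=> f J : R)) x|%E) = cst `|f J|%:E by [].
  rewrite (integral_cst _ mPI) [X in (_ * X)%E](_ : _ = (M.+1%:R^-1)%:E); last exact: PI.
  by rewrite -EFinM ltry.
have gE : \int[mu]_(u in P) g u = M.+1%:R^-1 * f J.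
  have mPI : measurable (P `&` I) by apply: measurableI => //; exact: measurable_posR.
  rewrite /g -Rintegral_mkcondr (Rintegral_cst _ mPI) mulrC.
  by rewrite [X in fine X](_ : _ = (M.+1%:R^-1)%:E) //; exact: PI.
split.
  have := integrableD measurable_posR IH1 gi; apply: eq_integrable => //; first exact: measurable_posR.
  by move=> u /set_mem u0 /=; rewrite E.
rewrite big_ord_recr /= mulrDr -IH2 -gE -RintegralD //; last exact: measurable_posR.
by apply: eq_Rintegral => u /set_mem u0; rewrite E.
Qed.

Lemma measurable_fl (f : nat -> R) M : measurable_fun P (fun u => f (fl M.+1 u)).
Proof.
apply: (@measurable_fun_cvg _ _ _ P (fun J u => if (fl M.+1 u < J)%N then f (fl M.+1 u) else 0)).
  by move=> J; have [/integrableP[/measurable_EFinP]] := step_integral f M J.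
move=> u _; apply: cvg_near_cst; near=> J; rewrite ifT //.
by near: J; exists (fl M.+1 u).+1.
Unshelve. all: by end_near. Qed.

Lemma cstep_integral (f : nat -> C) M J :
  cmeas P (fun u => if (fl M.+1 u < J)%N then f (fl M.+1 u) else 0) /\
  cint P (fun u => if (fl M.+1 u < J)%N then f (fl M.+1 u) else 0) =
  rc (M.+1%:R^-1) * \sum_(j < J) f j.
Proof.
have E1 u : ReC (if (fl M.+1 u < J)%N then f (fl M.+1 u) else 0) =
  (if (fl M.+1 u < J)%N then ReC (f (fl M.+1 u)) else 0) by case: ifP.
have E2 u : ImC (if (fl M.+1 u < J)%N then f (fl M.+1 u) else 0) =
  (if (fl M.+1 u < J)%N then ImC (f (fl M.+1 u)) else 0) by case: ifP.
have [i1 s1] := step_integral (fun j => ReC (f j)) M J.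
have [i2 s2] := step_integral (fun j => ImC (f j)) M J.
split; first split.
- under eq_fun do rewrite E1; by have /integrableP[/measurable_EFinP] := i1.
- under eq_fun do rewrite E2; by have /integrableP[/measurable_EFinP] := i2.
apply: eqC; rewrite ?rcZ_Re ?rcZ_Im ?Re_sum ?Im_sum /=.
  by under eq_Rintegral do rewrite E1.
by under eq_Rintegral do rewrite E2.
Qed.

End Scaling.

(** * Contiguity relations for truncated hypergeometric sums *)

Section Asymptotics.
Context {R : realType}.
Local Notation C := R[i].
Local Notation mu := (@lebesgue_measure R).
Local Notation P := (@posR R : set (measurableTypeR R)).
Implicit Types (a c : C) (M n J : nat).

Definition ex M j : R := expR (- (j%:R / M.+1%:R)).

Lemma exD M i j : ex M (i + j) = ex M i * ex M j.
Proof. by rewrite /ex natrD mulrDl opprD expRD. Qed.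
Lemma exS M j : ex M j.+1 = ex M j * ex M 1.
Proof. by rewrite -addn1 exD. Qed.
Lemma ex0 M : ex M 0 = 1. Proof. by rewrite /ex mul0r oppr0 expR0. Qed.
Lemma ex_ge0 M j : 0 <= ex M j. Proof. exact: expR_ge0. Qed.
Lemma ex_le1 M j : ex M j <= 1.
Proof. by rewrite -expR0 ler_expR oppr_le0 divr_ge0. Qed.

Lemma cbin_pascal a n : cbin a n.+1 - cbin a n = cbin (a - 1) n.+1.
Proof.
have h := cbin_shift (a - 1) n; rewrite subrK in h.
have n0 := @natC_neq0 R n.
rewrite cbinS [RHS]cbinS (mulrA (cbin (a - 1) n)) -h.
have -> : a + n%:R = n.+1%:R + (a - 1) by rewrite -natr1; ring.
by rewrite mulrDl mulfV // mulrDr mulr1 addrAC subrr add0r mulrA [(a - 1) * _]mulrC.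
Qed.

Definition cbinp a J : C := if J is J'.+1 then cbin a J' else 0.

Lemma cbinp_diff (z' : C) J : cbin (- z') J = cbin (1 - z') J - cbinp (1 - z') J.
Proof.
case: J => [|J] /=; first by rewrite !cbin0 subr0.
by rewrite cbin_pascal addrAC subrr add0r.
Qed.
Lemma cbinp_mul (z' : C) J : J%:R * cbin (- z') J = - z' * cbinp (1 - z') J.
Proof.
case: J => [|J] /=; first by rewrite mul0r mulr0.
have h := cbin_shift (- z') J; rewrite addrC in h; rewrite h cbinS.
have n0 := @natC_neq0 R J.
by rewrite mulrC -!mulrA mulVf // mulr1 mulrC mulrC.
Qed.

(** Up to the factor [cbin z n], the truncation of 2F1(-z', z + n; n + 1; e^(-1/m)) with m = M +
    1. *)
Definition asum (z z' : C) M n J : C := \sum_(j < J) cbin (- z') j * cbin z (n + j) * rc (ex M j).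

(** A contiguous relation that lowers z', obtained from Pascal's rule for both coefficients. The
    last term is the boundary term left by the truncation at [J]. *)
Lemma asum_RB (z z' : C) M n J : asum z z' M n J =
  rc (1 - ex M 1) * asum z (z' - 1) M n J - rc (ex M 1) * asum (z - 1) (z' - 1) M n.+1 J
  + cbinp (1 - z') J * cbin z (n + J) * rc (ex M J).
Proof.
rewrite /asum; elim: J => [|J IH]; first by rewrite !big_ord0 /= !mulr0 !mul0r subrr addr0.
rewrite !big_ord_recr /= IH addnS addSn (exS M J).
rewrite (_ : - (z' - 1) = 1 - z'); last by ring.
rewrite -(cbin_pascal z (n + J)) (cbinp_diff z' J) rcD rcN rcM (_ : rc (1 : R) = 1) //.
ring.
Qed.

(** The relation that lowers [z]. It rests on (z - 1) (z)_k = (z - 1)_k (z - 1 + k) with k = n + j;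
    the summand j of this factor is absorbed by shifting the first coefficient. *)
Lemma asum_RA (z z' : C) M n J : (z - 1) * asum z z' M n J =
  (n%:R + z - 1) * asum (z - 1) z' M n J - z' * (rc (ex M 1) * asum (z - 1) (z' - 1) M n.+1 J)
  + z' * (cbinp (1 - z') J * cbin (z - 1) (n + J) * rc (ex M J)).
Proof.
rewrite /asum; elim: J => [|J IH]; first by rewrite !big_ord0 /= !(mulr0, mul0r) subrr addr0.
rewrite !big_ord_recr /= mulrDr IH addnS addSn (exS M J).
rewrite (_ : - (z' - 1) = 1 - z'); last by ring.
have h := cbin_shift (z - 1) (n + J); rewrite subrK natrD in h.
have h2 := cbinp_mul z' J.
rewrite rcM (_ : (z - 1) * (cbin (- z') J * cbin z (n + J) * rc (ex M J)) =
  cbin (- z') J * ((z - 1) * cbin z (n + J)) * rc (ex M J)); last by ring.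
rewrite h; set S := cbin (1 - z') J; set Sp := cbinp _ _ in h2 *; set X := cbin (z - 1) (n + J) in h *.
set B := cbin (- z') J in h2 *.
have -> : B * (X * (z - 1 + (n%:R + J%:R))) * rc (ex M J) =
  (n%:R + z - 1) * (B * X * rc (ex M J)) + J%:R * B * X * rc (ex M J) by ring.
by rewrite h2; ring.
Qed.

(** The power of m is that of a Riemann sum: the mesh 1/m times the normalizations m^(1+z') and
    m^(1-z) of the two coefficients. *)
Definition nsum (z z' : C) M n J : C := cpow M.+1%:R (1 + z' - z) * asum z z' M n J.
Definition bsum a c M n J : C := sbin M.+1 a J.-1 * sbin M.+1 c (n + J) * rc (ex M J).

Lemma cpow_natS M : cpow (M.+1%:R : R) 1 = M.+1%:R.
Proof. by rewrite (cpow1 (ltr0Sn _ _)) rc_nat. Qed.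

Lemma nsum_RB (z z' : C) M n J : (0 < J)%N -> nsum z z' M n J =
  rc (M.+1%:R * (1 - ex M 1)) * nsum z (z' - 1) M n J -
  rc (ex M 1) * nsum (z - 1) (z' - 1) M n.+1 J + bsum (1 - z') z M n J.
Proof.
case: J => // J _; rewrite /nsum asum_RB /bsum /sbin /=.
have e1 : cpow (M.+1%:R : R) (1 + z' - z) = M.+1%:R * cpow (M.+1%:R : R) (1 + (z' - 1) - z).
  by rewrite -cpow_natS -cpowD; congr cpow; ring.
have e2 : cpow (M.+1%:R : R) (1 + z' - z) = cpow (M.+1%:R : R) (1 + (z' - 1) - (z - 1)).
  by congr cpow; ring.
have e3 : cpow (M.+1%:R : R) (1 + z' - z) = cpow (M.+1%:R : R) (1 - (1 - z')) * cpow (M.+1%:R : R) (1 - z).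
  by rewrite -cpowD; congr cpow; ring.
rewrite mulrDr mulrBr {1}e1 {1}e2 e3 rcM rc_nat.
by congr (_ - _ + _); ring.
Qed.

Lemma nsum_RA (z z' : C) M n J : (0 < J)%N -> (z - 1) * nsum z z' M n J =
  ((n%:R + z - 1) / M.+1%:R) * nsum (z - 1) z' M n J -
  z' * (rc (ex M 1) * nsum (z - 1) (z' - 1) M n.+1 J) + z' / M.+1%:R * bsum (1 - z') (z - 1) M n J.
Proof.
case: J => // J _; rewrite /nsum mulrCA asum_RA /bsum /sbin /=.
have n0 := @natC_neq0 R M.
have e1 : cpow (M.+1%:R : R) (1 + z' - z) = (M.+1%:R)^-1 * cpow (M.+1%:R : R) (1 + z' - (z - 1)).
  by rewrite -cpow_natS -cpowN -cpowD; congr cpow; ring.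
have e2 : cpow (M.+1%:R : R) (1 + z' - z) = cpow (M.+1%:R : R) (1 + (z' - 1) - (z - 1)).
  by congr cpow; ring.
have e3 : cpow (M.+1%:R : R) (1 + z' - z) = (M.+1%:R)^-1 * (cpow (M.+1%:R : R) (1 - (1 - z')) * cpow (M.+1%:R : R) (1 - (z - 1))).
  by rewrite -cpow_natS -cpowN -!cpowD; congr cpow; ring.
rewrite mulrDr mulrBr {1}e1 {1}e2 e3.
by congr (_ - _ + _); ring.
Qed.

(** Once J exceeds M, one half of the exponential absorbs the powers of J/m and the other half
    remains. *)
Lemma bsum_bound a c : exists K k, 0 <= K /\ forall M n J, (M < J)%N ->
  cnorm (bsum a c M n J) <= K * (1 + n.+1%:R / M.+1%:R) ^+ k * expR (- (2^-1 * (J%:R / M.+1%:R))).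
Proof.
have [Ka [Ka0 ha]] := sbin_bound a; have [Kc [Kc0 hc]] := sbin_bound c.
pose ka := (Num.truncn `|ReC a - 1|).+1; pose kc := (Num.truncn `|ReC c - 1|).+1.
have i2 : 0 < 2^-1 :> R by rewrite invr_gt0.
have [E [E0 hE]] := expX_le (ka + kc) i2.
exists (Ka * Kc * E), kc; split => [|M n J MJ]; first by rewrite !mulr_ge0 ?ltW.
have m0 : 0 < M.+1%:R :> R by rewrite ltr0n.
have rb (b : R) (w : R) : 1 <= w -> rpow w b <= w ^+ (Num.truncn `|b|).+1.
  move=> w1; rewrite -rpowX ?(lt_le_trans _ w1) // rpow_le1 // (le_trans (ler_norm _)) //.
  by rewrite ltW // truncnS_gt.
pose w : R := J%:R / M.+1%:R; pose v : R := n.+1%:R / M.+1%:R.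
have v0 : 0 <= v by rewrite divr_ge0.
have J0 : J.-1.+1 = J by rewrite prednK // (leq_ltn_trans _ MJ).
have w1 : 1 <= w by rewrite ler_pdivlMr // mul1r ler_nat.
have w0 : 0 <= w by rewrite (le_trans _ w1).
have h1 : cnorm (sbin M.+1 a J.-1) <= Ka * (1 + w) ^+ ka.
  apply: (le_trans (ha _ _)); rewrite J0 ler_pM2l // (le_trans (rb _ _ w1)) //.
  by rewrite lerXn2r ?nnegrE ?addr_ge0 // lerDr.
have h2 : cnorm (sbin M.+1 c (n + J)) <= Kc * ((1 + v) ^+ kc * (1 + w) ^+ kc).
  have -> : (1 + v) ^+ kc * (1 + w) ^+ kc = ((1 + v) * (1 + w)) ^+ kc by rewrite exprMn.
  apply: (le_trans (hc _ _)); rewrite ler_pM2l //.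
  have -> : (n + J).+1%:R / M.+1%:R = v + w by rewrite -addSn natrD mulrDl.
  apply: (le_trans (rb _ _ _)); first by rewrite (le_trans w1) // lerDr.
  rewrite lerXn2r ?nnegrE ?addr_ge0 ?mulr_ge0 ?addr_ge0 //.
  by have := mulr_ge0 v0 w0; lra.
rewrite /bsum cnormM (cnormM (sbin _ _ _) (sbin _ _ _)) cnorm_rc ger0_norm ?ex_ge0 //.
apply: (le_trans (ler_wpM2r (ex_ge0 _ _) (ler_pM (cnorm_ge0 _) (cnorm_ge0 _) h1 h2))).
have -> : ex M J = expR (- (2^-1 * w)) * expR (- (2^-1 * w)).
  by rewrite -expRD /ex -/w; congr expR; field.
have hh := hE w w0; rewrite exprD in hh.
have -> : Ka * (1 + w) ^+ ka * (Kc * ((1 + v) ^+ kc * (1 + w) ^+ kc)) * (expR (- (2^-1 * w)) * expR (- (2^-1 * w))) =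
  (Ka * Kc * (1 + v) ^+ kc * expR (- (2^-1 * w))) * ((1 + w) ^+ ka * (1 + w) ^+ kc * expR (- (2^-1 * w))) by ring.
have -> : Ka * Kc * E * (1 + v) ^+ kc * expR (- (2^-1 * w)) =
  (Ka * Kc * (1 + v) ^+ kc * expR (- (2^-1 * w))) * E by ring.
apply: ler_wpM2l hh; apply: mulr_ge0; last exact: expR_ge0.
by rewrite mulr_ge0 ?exprn_ge0 ?addr_ge0 // mulr_ge0 // ltW.
Qed.
End Asymptotics.

(** * Limits of the scaled sums and their continuation in the parameters *)

Section ScaledSums.
Context {R : realType}.
Local Notation C := R[i].
Local Notation mu := (@lebesgue_measure R).
Local Notation P := (@posR R : set (measurableTypeR R)).

Definition nonint (w : C) := forall i : int, w != i%:~R.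

Lemma nonintD w i : nonint w -> nonint (w + i%:~R).
Proof. by move=> h j; have := h (j - i); rewrite rmorphB /= [w == _]eq_sym subr_eq eq_sym. Qed.
Lemma nonintN w : nonint w -> nonint (- w).
Proof. by move=> h j; rewrite eqr_oppLR -rmorphN; exact: h. Qed.
Lemma nonint_nonpole w : nonint w -> nonpole w.
Proof. by move=> h j; rewrite -[j%:R]opprK subr_eq0 -(rmorphN intr j%:Z); exact: h. Qed.
Lemma nonintD1 w : nonint w -> nonint (w + 1).
Proof. exact: (@nonintD w 1). Qed.
Lemma nonintB1 w : nonint w -> nonint (w - 1).
Proof. exact: (@nonintD w (-1)). Qed.

Definition vsc M n : R := n.+1%:R / M.+1%:R.
Lemma vsc_ge0 M n : 0 <= vsc M n. Proof. by rewrite divr_ge0. Qed.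

(** A bound uniform in M and J and polynomial in the macroscopic position n/m, as long as this
    position stays away from 0. *)
Definition pbnd (d : R) (f : nat -> nat -> nat -> C) := exists (K : R) (k : nat), 0 <= K /\
  forall M n J, d <= vsc M n -> (M < J)%N -> cnorm (f M n J) <= K * (1 + vsc M n) ^+ k.

Lemma pbndD d f g : pbnd d f -> pbnd d g -> pbnd d (fun M n J => f M n J + g M n J).
Proof.
move=> [K [k [K0 hf]]] [L [l [L0 hg]]]; exists (K + L), (k + l)%N; split => [|M n J h MJ]; first exact: addr_ge0.
have v1 : 1 <= 1 + vsc M n by rewrite lerDl vsc_ge0.
apply: (le_trans (cnormD _ _)); rewrite mulrDl lerD //.
  by apply: (le_trans (hf _ _ _ h MJ)); apply: ler_wpM2l => //; apply: ler_weXn2l => //; exact: leq_addr.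
by apply: (le_trans (hg _ _ _ h MJ)); apply: ler_wpM2l => //; apply: ler_weXn2l => //; exact: leq_addl.
Qed.
Lemma pbndM d f g : pbnd d f -> pbnd d g -> pbnd d (fun M n J => f M n J * g M n J).
Proof.
move=> [K [k [K0 hf]]] [L [l [L0 hg]]]; exists (K * L), (k + l)%N; split => [|M n J h MJ]; first exact: mulr_ge0.
rewrite cnormM exprD mulrACA ler_pM ?cnorm_ge0 ?hf ?hg //.
Qed.
Lemma pbnd_le d f K : (forall M n J, cnorm (f M n J) <= K) -> pbnd d f.
Proof.
move=> h; exists K, 0%N; split => [|M n J _ _]; last by rewrite expr0 mulr1.
exact: le_trans (cnorm_ge0 _) (h 0 0 0)%N.
Qed.
Lemma pbnd_cst d c : pbnd d (fun _ _ _ => c).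
Proof. exact: (@pbnd_le _ _ (cnorm c)). Qed.
Lemma pbndN d f : pbnd d f -> pbnd d (fun M n J => - f M n J).
Proof. by move=> [K [k [K0 h]]]; exists K, k; split => // M n J h1 h2; rewrite cnormN h. Qed.
Lemma pbndS d f : pbnd d f -> pbnd d (fun M n J => f M n.+1 J).
Proof.
move=> [K [k [K0 hf]]]; exists (K * 2 ^+ k), k; split => [|M n J h MJ]; first by rewrite mulr_ge0 // exprn_ge0.
have m0 : 0 < M.+1%:R :> R by rewrite ltr0n.
have vv : vsc M n <= vsc M n.+1 by rewrite ler_pM2r ?invr_gt0 // ler_nat.
apply: (le_trans (hf _ _ _ (le_trans h vv) MJ)); rewrite -mulrA -exprMn ler_wpM2l //.
have i1 : (M.+1%:R)^-1 <= 1 :> R by rewrite invf_le1 // ler1n.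
apply: lerXn2r; rewrite ?nnegrE; [by rewrite addr_ge0 ?vsc_ge0|by rewrite mulr_ge0 // addr_ge0 ?vsc_ge0|].
have -> : vsc M n.+1 = vsc M n + (M.+1%:R)^-1 by rewrite /vsc -(natr1 n.+1) mulrDl mul1r.
by have := vsc_ge0 M n; move: i1; set y := (_^-1); lra.
Qed.

Definition Jinf (J : nat -> nat) := (fun M => (J M)%:R / M.+1%:R : R) @ \oo --> +oo%R.

Lemma Jinf_ge J (A : R) : Jinf J -> \forall M \near \oo, A <= (J M)%:R / M.+1%:R.
Proof. by move/cvgryPge => /(_ A). Qed.
Lemma Jinf_lt J : Jinf J -> \forall M \near \oo, (M < J M)%N.
Proof.
move=> h; have := Jinf_ge 1 h; apply: filterS => M.
by rewrite ler_pdivlMr ?ltr0n // mul1r ler_nat.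
Qed.

(** Convergence along every sequence with n/m -> x, rather than along one choice of n, survives the
    shift to n + 1 in the recursions and the shift by k in the kernel. *)
Definition glim (f : nat -> nat -> nat -> C) (l : R -> C) := forall x n J, 0 < x -> slim n x -> Jinf J ->
  cvgC (fun M => f M (n M) (J M)) (l x).

Lemma glim_near f g l : (forall M n J, (M < J)%N -> f M n J = g M n J) -> glim f l -> glim g l.
Proof.
move=> fg h x n J x0 hn hJ; apply: cvgC_near (h _ _ _ x0 hn hJ).
by have := Jinf_lt hJ; apply: filterS => M; exact: fg.
Qed.

Lemma glim_bsum a c : glim (bsum a c) (fun=> 0).
Proof.
have [K [k [K0 h]]] := bsum_bound a c.
move=> x n J x0 hn hJ; apply: cvgC_norm0.
have hv : (fun M => (1 + vsc M (n M)) ^+ k) @ \oo --> (1 + x) ^+ k.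
  have h1 : (fun M => 1 + vsc M (n M)) @ \oo --> 1 + x by apply: cvgD; [exact: cvg_cst|exact: slimS].
  have h2 := @exprn_continuous R k (1 + x); exact: cvg_comp h1 h2.
have he : (fun M => expR (- (2^-1 * ((J M)%:R / M.+1%:R : R)))) @ \oo --> (0 : R).
  apply: cvg_comp (@cvgr_expR R).
  apply/cvgryPge => A; have := Jinf_ge (2 * A) hJ; apply: filterS => M hM.
  by rewrite mulrC ler_pdivlMr // mulrC.
have hh : (fun M => K * (1 + vsc M (n M)) ^+ k * expR (- (2^-1 * ((J M)%:R / M.+1%:R)))) @ \oo --> (0 : R).
  by rewrite -[X in _ --> X](mulr0 (K * (1 + x) ^+ k)); apply: cvgM => //; apply: cvgM => //; exact: cvg_cst.
apply: (@squeeze_cvgr _ _ _ _ (fun=> 0) _ _ _ 0 _ hh); last exact: cvg_cst.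
have := Jinf_lt hJ; apply: filterS => M MJ.
by rewrite cnorm_ge0 h.
Qed.
Lemma pbnd_bsum d a c : pbnd d (bsum a c).
Proof.
have [K [k [K0 h]]] := bsum_bound a c; exists K, k; split => // M n J _ MJ.
apply: (le_trans (h _ _ _ MJ)); rewrite -[leRHS]mulr1; apply: ler_wpM2l.
  by rewrite mulr_ge0 // exprn_ge0 // addr_ge0 // vsc_ge0.
by rewrite -expR0 ler_expR oppr_le0 mulr_ge0 // ?invr_ge0 // divr_ge0.
Qed.

Lemma cvg_exslim n (x : R) : slim n x -> (fun M => ex M (n M) : R) @ \oo --> expR (- x).
Proof.
move=> hn; have h1 : (fun M => - ((n M)%:R / M.+1%:R)) @ \oo --> - x by exact: cvgN.
by have h2 := @continuous_expR R (- x); exact: cvg_comp h1 h2.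
Qed.
Lemma cvg_ex1 : (fun M => ex M 1) @ \oo --> (1 : R).
Proof. by have := cvg_exslim (@slim_cst R 1); rewrite oppr0 expR0. Qed.
Lemma mex_bounds M : (M.+1%:R / (M.+1%:R + 1) : R) <= (M.+1%:R : R) * (1 - ex M 1) <= (1 : R).
Proof.
have m0 : 0 < M.+1%:R :> R by rewrite ltr0n.
set y : R := (M.+1%:R)^-1; have y0 : 0 < y by rewrite invr_gt0.
have my : M.+1%:R * y = 1 by rewrite mulfV // gt_eqF.
have -> : ex M 1 = expR (- y) by rewrite /ex mul1r.
apply/andP; split.
  rewrite ler_pM2l // lerBrDr -lerBrDl expRN.
  have -> : 1 - (M.+1%:R + 1)^-1 = (1 + y)^-1.
    apply: (@mulIf _ (1 + y)); first by rewrite gt_eqF // addr_gt0.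
    rewrite mulVf ?gt_eqF ?addr_gt0 // /y; field; rewrite ?gt_eqF //= ?ltr_pwDr //.
  by rewrite lef_pV2 ?posrE ?expR_gt0 ?addr_gt0 // expR_ge1Dx.
rewrite -[leRHS]my ler_pM2l //; have := expR_ge1Dx (- y); lra.
Qed.
Lemma cvg_mex : (fun M => M.+1%:R * (1 - ex M 1)) @ \oo --> (1 : R).
Proof.
have h : (fun M => M.+1%:R / (M.+1%:R + 1)) @ \oo --> (1 : R).
  have -> : (fun M => M.+1%:R / (M.+1%:R + 1)) = (fun M => 1 - (M.+2%:R)^-1) :> (nat -> R).
    apply/funext => M; rewrite natr1; have : M.+2%:R != 0 :> R by rewrite pnatr_eq0.
    by rewrite -(natr1 M.+1) => h; field.
  rewrite -[X in _ --> X]subr0; apply: cvgB; first exact: cvg_cst.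
  by have := @cvg_inv_nat R; rewrite -(cvg_shiftS (fun M => (M.+1%:R)^-1 : R)).
apply: (@squeeze_cvgr _ _ _ _ (fun M => M.+1%:R / (M.+1%:R + 1)) (fun=> 1)); [|exact: h|exact: cvg_cst].
by apply: nearW => M; exact: mex_bounds.
Qed.

(* Psi k a c is the pairing of phi_a(u) phi_c(u+1) with e^{-Xu}, continued analytically
   in a by k integrations by parts. *)
Definition Psi0 (a c : C) (X : R) : C :=
  cint P (fun u => cpow u a / cGamma (a + 1) * (cpow (u + 1) c / cGamma (c + 1)) * rc (expR (- (X * u)))).
Fixpoint Psi k (a c : C) (X : R) : C :=
  if k is k'.+1 then rc X * Psi k' (a + 1) c X - Psi k' (a + 1) (c - 1) X else Psi0 a c X.
(** The limit of [nsum z z'] at n/m -> X. The integrals in [Psi k (- z)] converge as soon as k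
    exceeds Re z - 1. *)
Definition Theta k (z z' : C) (X : R) : C := cGamma (z' + 1) / cGamma z * Psi k (- z) z' X.
(** The limit serves for the pointwise convergence of the summand of [kern], the bound for its
    domination. *)
Definition good k z z' := glim (nsum z z') (Theta k z z') /\ forall d, 0 < d -> pbnd d (nsum z z').

Lemma cmeas_Psi0 (a c : C) (X : R) :
  cmeas P (fun u => cpow u a * cpow (u + 1) c * rc (expR (- (X * u)))).
Proof.
have mP := @measurable_posR R.
apply: cmeasM; last first.
  apply: cmeas_rc; apply: measurable_comp_cont => //; first exact: continuous_expR.
  by apply: measurable_funN; exact: measurable_funM.
by apply: cmeasM; apply: cmeas_cpow => //; exact: measurable_funD.
Qed.

Lemma cintegrable_Psi0 (a c : C) (X : R) : -1 < ReC a -> 0 < X ->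
  cintegrable P (fun u => cpow u a * cpow (u + 1) c * rc (expR (- (X * u)))).
Proof.
move=> a1 X0; have mP := @measurable_posR R.
pose k := (Num.truncn `|ReC c|).+1.
apply: (@dom_cintegrable _ _ _ (gdom (ReC a + 1) k X) mP); first exact: cmeas_Psi0.
  by apply: integrable_gdom => //; lra.
move=> u u0; rewrite cnormM (cnormM (cpow _ _) (cpow _ _)) cnorm_rc ger0_norm ?expR_ge0 // !cnorm_cpow_rpow /gdom.
have u0' : 0 < u by [].
rewrite addrK ler_wpM2r ?expR_ge0 // ler_wpM2l ?rpow_ge0 //.
rewrite addrC -rpowX ?addr_gt0 // rpow_le1 ?lerDl ?(ltW u0') //.
by rewrite (le_trans (ler_norm _)) // ltW // truncnS_gt.
Qed.

Definition bterm z z' M n J (u : R) : C :=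
  if (fl M.+1 u < J)%N then sbin M.+1 (- z') (fl M.+1 u) * sbin M.+1 z (n + fl M.+1 u) * rc (ex M (fl M.+1 u)) else 0.

Lemma cmeas_bterm z z' M n J : cmeas P (bterm z z' M n J).
Proof. by have [] := cstep_integral (fun j => sbin M.+1 (- z') j * sbin M.+1 z (n + j) * rc (ex M j)) M J. Qed.

Lemma nsum_cint z z' M n J : nsum z z' M n J = cint P (bterm z z' M n J).
Proof.
have [_ ->] := cstep_integral (fun j => sbin M.+1 (- z') j * sbin M.+1 z (n + j) * rc (ex M j)) M J.
rewrite rcV rc_nat /nsum /asum !mulr_sumr; apply: eq_bigr => j _; rewrite /sbin.
have -> : cpow (M.+1%:R : R) (1 + z' - z) = (M.+1%:R)^-1 * (cpow (M.+1%:R : R) (1 - - z') * cpow (M.+1%:R : R) (1 - z)).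
  by rewrite -cpow_natS -cpowN -!cpowD; congr cpow; ring.
by ring.
Qed.

Lemma bterm_dom z z' d : ReC z' < 0 -> ReC z < 1 -> 0 < d -> exists g : R -> R,
  mu.-integrable P (EFin \o g) /\
  forall M n J u, 0 < u -> d <= vsc M n -> cnorm (bterm z z' M n J u) <= g u.
Proof.
move=> z'0 z1 d0.
have [K1 [K10 h1]] := sbin_bound (- z'); have [K2 [K20 h2]] := sbin_bound z.
(* The factor (j/m)^(-Re z' - 1) is singular at 0 if -Re z' < 1 and growing otherwise; [s] covers
   the first case and the power [k] the second. *)
pose s := Num.min (- ReC z') 1; pose k := (Num.truncn (- ReC z')).+1.
have s0 : 0 < s by rewrite lt_min oppr_gt0 z'0 ltr01.
pose A : R := K1 * (K2 * rpow d (ReC z - 1)) * expR 1.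
have A0 : 0 <= A.
  by apply: mulr_ge0 (expR_ge0 _); apply: mulr_ge0 (ltW K10) _; apply: mulr_ge0 (ltW K20) (rpow_ge0 _ _).
exists (fun u => A * gdom s k 1 u); split.
  by apply: integrable_mull; [exact: measurable_posR|apply: integrable_gdom].
move=> M n J u u0 dv; rewrite /bterm; case: ifP => _; last first.
  by rewrite cnorm0 mulr_ge0 // gdom_ge0.
set j := fl _ _.
have m0 : 0 < M.+1%:R :> R by rewrite ltr0n.
have [f1 f2] := fl_bounds M (ltW u0); rewrite -/j in f1 f2.
have i1 : (M.+1%:R)^-1 <= 1 :> R by rewrite invf_le1 // ler1n.
have f3 : j.+1%:R / M.+1%:R <= 1 + u by rewrite -natr1 mulrDl mul1r addrC lerD.
rewrite cnormM (cnormM (sbin _ _ _) (sbin _ _ _)) cnorm_rc ger0_norm ?ex_ge0 //.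
have b1 : cnorm (sbin M.+1 (- z') j) <= K1 * (rpow u (s - 1) * (1 + u) ^+ k).
  apply: (le_trans (h1 _ _)); rewrite ler_pM2l // ReN.
  have u1 : 1 <= 1 + u by rewrite lerDl ltW.
  rewrite /s /k; case: (leP (- ReC z') 1) => hs.
    apply: (le_trans (rpow_le_neg u0 (ltW f2) _)); first by rewrite subr_le0.
    by rewrite ler_peMr ?rpow_ge0 // exprn_ege1.
  rewrite subrr rpow0 mul1r -rpowX ?(lt_le_trans ltr01) //.
  apply: (le_trans (rpow_le _ f3 _)); first exact: lt_trans f2.
    by rewrite subr_ge0 ltW.
  rewrite rpow_le1 // ltW //; apply: lt_trans (truncnS_gt _); lra.
have b2 : cnorm (sbin M.+1 z (n + j)) <= K2 * rpow d (ReC z - 1).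
  apply: (le_trans (h2 _ _)); rewrite ler_pM2l //.
  apply: rpow_le_neg => //; last by rewrite subr_le0 ltW.
  by apply: (le_trans dv); rewrite /vsc ler_pM2r ?invr_gt0 // ler_nat ltnS leq_addr.
have b3 : ex M j <= expR 1 * expR (- (1 * u)).
  rewrite -expRD ler_expR mul1r.
  have : u <= j%:R / M.+1%:R + (M.+1%:R)^-1 by move/ltW: f2; rewrite -natr1 mulrDl mul1r.
  by move: i1; set y := (_^-1); set w := j%:R * y; lra.
apply: (le_trans (ler_pM (mulr_ge0 (cnorm_ge0 _) (cnorm_ge0 _)) (ex_ge0 _ _) (ler_pM (cnorm_ge0 _) (cnorm_ge0 _) b1 b2) b3)).
by rewrite /A /gdom le_eqVlt; apply/orP; left; apply/eqP; ring.
Qed.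

(** Once Gamma(z'+1) is cancelled, the prefactor involves [z] alone: it is sin(pi z)/pi, which
    changes sign under z -> z - 1. *)
Lemma Theta0_kappa z z' X : nonpole (z' + 1) -> -1 < ReC (- z) -> 0 < X -> Theta 0 z z' X =
  (cGamma z * cGamma (1 - z))^-1 * cint P (fun u => cpow u (- z) * cpow (u + 1) z' * rc (expR (- (X * u)))).
Proof.
move=> hz' hz X0; have g0 := cGamma_neq0 hz'; have mP := @measurable_posR R.
rewrite /Theta /= /Psi0 -!cintZl //; first last.
- rewrite (_ : (fun u => _) = fun u => (cGamma (- z + 1) * cGamma (z' + 1))^-1 * (cpow u (- z) * cpow (u + 1) z' * rc (expR (- (X * u))))).
    by apply: cintegrableZl => //; exact: cintegrable_Psi0.
  by apply/funext => u; set G1 := cGamma _; set G2 := cGamma _; rewrite (invfM G1 G2); ring.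
- exact: cintegrable_Psi0.
apply: eq_cint => u _; rewrite (addrC (- z) 1) (invfM (cGamma z) (cGamma (1 - z))).
set A := cGamma (z' + 1) in g0 *; set B := (cGamma (1 - z))^-1; set D := cpow u (- z).
transitivity (A * A^-1 * ((cGamma z)^-1 * B * (D * cpow (u + 1) z' * rc (expR (- (X * u)))))); first ring.
by rewrite (mulfV g0) mul1r.
Qed.

(** In this range dominated convergence applies, but it yields the integral of u^(-z'-1) (x+u)^(z-1)
    e^-u. Since (x+u)^(z-1) and (u+1)^z' are Laplace transforms, an exchange of integrals turns it
    into that of u^-z (u+1)^z' e^(-xu). This is Kummer's transformation of the confluent
    hypergeometric function U. *)
Lemma good_base z z' : nonint z -> nonint z' -> ReC z' < 0 -> ReC z < 1 -> good 0 z z'.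
Proof.
move=> nz nz' z'0 z1; have mP := @measurable_posR R; split; last first.
  move=> d d0; have [g [ig hg]] := bterm_dom z'0 z1 d0.
  exists (Num.max 0 (2 * \int[mu]_(x in P) g x)), 0%N; split => [|M n J dv MJ]; first by rewrite le_max lexx.
  rewrite expr0 mulr1 nsum_cint le_max; apply/orP; right.
  by apply: cnorm_cint => //; [exact: cmeas_bterm|move=> u u0; exact: hg].
move=> x n J x0 hn hJ.
have [d [d0 hd]] := slim_pos_bound x0 hn; have [g [ig hg]] := bterm_dom z'0 z1 d0.
pose F u := cpow u (- z' - 1) / cGamma (- z') * (cpow (x + u) (z - 1) / cGamma z) * rc (expR (- u)).
have np1 : nonpole (- z') by apply/nonint_nonpole/nonintN.
have np2 : nonpole z by exact: nonint_nonpole.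
have [iF cF] : cintegrable P F /\ cvgC (fun M => nsum z z' M (n M) (J M)) (cint P F).
  rewrite (_ : (fun M => _) = fun M => cint P (bterm z z' M (n M) (J M))); last by apply/funext => M; exact: nsum_cint.
  apply: (@cint_dct _ _ _ _ g) => //; [by move=> M; exact: cmeas_bterm| |by move=> M u u0; apply: hg => //; exact: hd].
  move=> u u0; apply: (@cvgC_near _ (fun M => sbin M.+1 (- z') (fl M.+1 u) * sbin M.+1 z (n M + fl M.+1 u) * rc (ex M (fl M.+1 u)))).
    have := Jinf_ge (u + 1) hJ; apply: filterS => M hM; rewrite /bterm ifT //.
    have [f1 _] := fl_bounds M (ltW u0).
    have : (fl M.+1 u)%:R / M.+1%:R < (J M)%:R / M.+1%:R :> R.
      by apply: (le_lt_trans f1); apply: (lt_le_trans _ hM); rewrite ltrDl.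
    by rewrite ltr_pM2r ?invr_gt0 ?ltr0n // ltr_nat.
  have su := slim_fl (ltW u0).
  apply: cvgCM; first apply: cvgCM.
  - exact: cvgC_sbin.
  - by apply: cvgC_sbin => //; [exact: addr_gt0|exact: slimD].
  - by apply: cvgC_rc; exact: cvg_exslim.
suff -> : Theta 0 z z' x = cint P F by [].
have rez : 0 < ReC (1 - z) by rewrite ReD ReN (_ : ReC 1 = 1) // subr_gt0.
have rez' : 0 < ReC (- z') by rewrite ReN oppr_gt0.
have np3 : nonpole (1 - z) by rewrite addrC; apply/nonint_nonpole/nonintD1/nonintN.
rewrite Theta0_kappa //; first last.
- by move: rez; rewrite ReD (_ : ReC 1 = 1) //; lra.
- by apply/nonint_nonpole/nonintD1.
pose a u := cpow u (- z' - 1) * rc (expR (- (1 * u))) : C.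
pose b u := cpow u ((1 - z) - 1) * rc (expR (- (x * u))) : C.
have ia : cintegrable P a.
  apply: (@dom_cintegrable _ _ _ (gdom (ReC (- z')) 0 1) mP); first exact: cmeas_gamma.
    by apply: integrable_gdom.
  by move=> u u0; rewrite cnorm_gamma_gdom.
have ib : cintegrable P b.
  apply: (@dom_cintegrable _ _ _ (gdom (ReC (1 - z)) 0 x) mP); first exact: cmeas_gamma.
    by apply: integrable_gdom.
  by move=> u u0; rewrite cnorm_gamma_gdom.
have ca u : 0 < u -> clap a u = cGamma (- z') * cpow (u + 1) z'.
  move=> u0; have u10 : 0 < u + 1 by rewrite addr_gt0.
  have := gamma_scale rez' u10; rewrite opprK => <-; apply: eq_cint => w _.
  by rewrite /a -mulrA -rcM -expRD; congr (_ * rc (expR _)); ring.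
have cb u : 0 < u -> clap b u = cGamma (1 - z) * cpow (x + u) (z - 1).
  move=> u0; have u10 : 0 < x + u by rewrite addr_gt0.
  have := gamma_scale rez u10; rewrite opprB => <-; apply: eq_cint => w _.
  by rewrite /b -mulrA -rcM -expRD; congr (_ * rc (expR _)); ring.
have [iab eab] := claplace_swap ia ib.
have g1 := cGamma_neq0 np1; have g2 := cGamma_neq0 np2; have g3 := cGamma_neq0 np3.
have e1 : cint P F = (cGamma (- z') * cGamma z * cGamma (1 - z))^-1 * cint P (fun u => a u * clap b u).
  rewrite -(cintZl _ mP iab); apply: eq_cint => u u0; rewrite (cb u u0) /F /a (mul1r u).
  rewrite [in RHS]invfM [in RHS]invfM; set G := cGamma (1 - z) in g3 *; set G1 := _^-1; set G2 := _^-1.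
  transitivity (G^-1 * G * (G1 * G2 * (cpow u (- z' - 1) * rc (expR (- u)) * cpow (x + u) (z - 1)))); last by ring.
  by rewrite (mulVf g3) [RHS]mul1r; ring.
have iz : -1 < ReC (- z) by rewrite ReN; lra.
rewrite e1 eab -[LHS](cintZl _ mP (cintegrable_Psi0 _ iz x0)).
have [iba _] := claplace_swap ib ia.
rewrite -(cintZl _ mP iba); apply: eq_cint => u u0; rewrite (ca u u0) /b (_ : 1 - z - 1 = - z); last by ring.
rewrite [in RHS]invfM [in RHS]invfM [in LHS]invfM; set G := cGamma (- z') in g1 *; set G1 := _^-1; set G2 := _^-1.
transitivity (G^-1 * G * (G1 * G2 * (cpow u (- z) * cpow (u + 1) z' * rc (expR (- (x * u)))))); last by ring.
by rewrite (mulVf g1) [RHS]mul1r.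
Qed.

Lemma ReB1 (w : C) : ReC (w - 1) = ReC w - 1.
Proof. by rewrite ReD ReN. Qed.

Lemma Gamma_reflect_shift z : nonint z -> (cGamma (z - 1) * cGamma (1 - (z - 1)))^-1 = - (cGamma z * cGamma (1 - z))^-1.
Proof.
move=> nz.
have np1 : nonpole (z - 1) by apply/nonint_nonpole/nonintB1.
have np2 : nonpole (1 - z) by rewrite addrC; apply/nonint_nonpole/nonintD1/nonintN.
have h1 := cGammaS np1; have h2 := cGammaS np2; rewrite subrK in h1.
rewrite (_ : 1 - (z - 1) = 1 - z + 1); last by ring.
rewrite h2 h1; set G1 := cGamma (z - 1); set G2 := cGamma (1 - z).
by rewrite -invrN; congr (_^-1); ring.
Qed.

(** In the limit m (1 - e^(-1/m)) tends to 1 and the boundary term to 0, and the recursion becomes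
    (u+1)^z' = (u+1)^(z'-1) + u (u+1)^(z'-1) under the integral. The minus sign of the recursion is
    undone by [Gamma_reflect_shift]. *)
Lemma good_RB z z' : nonint z -> nonint z' -> ReC z < 1 ->
  good 0 z (z' - 1) -> good 0 (z - 1) (z' - 1) -> good 0 z z'.
Proof.
move=> nz nz' z1 [lim1 b1] [lim2 b2]; have mP := @measurable_posR R.
pose rhs M n J := rc (M.+1%:R * (1 - ex M 1)) * nsum z (z' - 1) M n J -
  rc (ex M 1) * nsum (z - 1) (z' - 1) M n.+1 J + bsum (1 - z') z M n J.
have eqn M n J : (M < J)%N -> rhs M n J = nsum z z' M n J.
  by move=> MJ; rewrite nsum_RB // (leq_trans _ MJ).
split; last first.
  move=> d d0; have [K [k [K0 h]]] : pbnd d rhs.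
    apply: pbndD; last exact: pbnd_bsum.
    apply: pbndD; first apply: pbndM (b1 d d0).
      apply: (@pbnd_le _ _ 1) => M _ _; rewrite cnorm_rc; have /andP[h1 h2] := mex_bounds M.
      by rewrite ger0_norm // (le_trans _ h1) // divr_ge0.
    apply: pbndN; apply: pbndM (pbndS (b2 d d0)).
    by apply: (@pbnd_le _ _ 1) => M _ _; rewrite cnorm_rc ger0_norm ?ex_ge0 ?ex_le1.
  by exists K, k; split => // M n J dv MJ; rewrite -eqn // h.
apply: (glim_near eqn) => x n J x0 hn hJ.
have -> : Theta 0 z z' x = 1 * Theta 0 z (z' - 1) x - 1 * Theta 0 (z - 1) (z' - 1) x + 0; last first.
  apply: cvgCD; last exact: (@glim_bsum _ _ x n J x0 hn hJ).
  apply: cvgCB; apply: cvgCM.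
  - by apply: cvgC_rc; exact: cvg_mex.
  - exact: lim1.
  - by apply: cvgC_rc; exact: cvg_ex1.
  - by apply: (lim2 _ (fun M => (n M).+1)) => //; exact: slimS.
have aux (p q : C) : 1 * p - 1 * q + 0 = p - q by rewrite !mul1r addr0.
have np1 : nonpole (z' + 1) by apply/nonint_nonpole/nonintD1.
have np2 : nonpole (z' - 1 + 1) by rewrite subrK; exact: nonint_nonpole.
have i1 : -1 < ReC (- z) by rewrite ReN; lra.
have i2 : -1 < ReC (- (z - 1)) by rewrite ReN ReB1; lra.
rewrite aux (Theta0_kappa np1 i1 x0) (Theta0_kappa np2 i1 x0) (Theta0_kappa np2 i2 x0) Gamma_reflect_shift //.
rewrite mulNr opprK -mulrDr; congr (_ * _).
rewrite -(cintD mP (cintegrable_Psi0 _ i1 x0) (cintegrable_Psi0 _ i2 x0)).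
apply: eq_cint => u u0; have u1 : 0 < u + 1 by rewrite addr_gt0.
have -> : cpow u (- (z - 1)) = cpow u (- z) * rc u.
  by rewrite -(cpow1 u0) -cpowD; congr cpow; ring.
have -> : cpow (u + 1) z' = cpow (u + 1) (z' - 1) * (rc u + 1).
  rewrite -[rc u + 1](rcD u 1) -(cpow1 u1) -cpowD; congr cpow; ring.
by ring.
Qed.

Lemma good0 p z z' : nonint z -> nonint z' -> ReC z < 1 -> ReC z' < p%:R -> good 0 z z'.
Proof.
elim: p z z' => [|p IH] z z' nz nz' z1 z'p; first exact: good_base.
have h : ReC (z' - 1) < p%:R by rewrite ReB1 ltrBlDr natr1.
have h' : ReC (z - 1) < 1 by rewrite ReB1; lra.
have nz1 := nonintB1 nz; have nz1' := nonintB1 nz'.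
by apply: (good_RB nz nz' z1); [exact: IH nz nz1' z1 h|exact: IH nz1 nz1' h' h].
Qed.

(** Up to Gamma factors, the limit of [asum_RA] is the recursion that defines [Psi k.+1]. *)
Lemma good_RA k z z' : nonint z -> nonint z' ->
  good k (z - 1) z' -> good k (z - 1) (z' - 1) -> good k.+1 z z'.
Proof.
move=> nz nz' [lim1 b1] [lim2 b2].
have z10 : z - 1 != 0 by rewrite -[z - 1]addr0; exact: (nonint_nonpole (nonintB1 nz) 0).
pose rhs M n J := (z - 1)^-1 * (((n%:R + z - 1) / M.+1%:R) * nsum (z - 1) z' M n J -
  z' * (rc (ex M 1) * nsum (z - 1) (z' - 1) M n.+1 J) + z' / M.+1%:R * bsum (1 - z') (z - 1) M n J).
have eqn M n J : (M < J)%N -> rhs M n J = nsum z z' M n J.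
  by move=> MJ; rewrite /rhs -nsum_RA ?(leq_trans _ MJ) // mulKf.
have minv M : cnorm ((M.+1%:R : C)^-1) <= 1.
  by rewrite cnormV -rc_nat cnorm_rc ger0_norm // invf_le1 ?ltr0n // ler1n.
have ratE M n : (n%:R + z - 1) / M.+1%:R = rc (vsc M n) + (z - 2%:R) * (rc (M.+1%:R)^-1).
  by rewrite /vsc rcM rcV !rc_nat -natr1; ring.
split; last first.
  move=> d d0; have [K [kk [K0 h]]] : pbnd d rhs.
    apply: pbndM; first exact: pbnd_cst.
    apply: pbndD; last first.
      apply: pbndM; last exact: pbnd_bsum.
      by apply: pbndM; [exact: pbnd_cst|apply: (@pbnd_le _ _ 1) => M _ _; exact: minv].
    apply: pbndD; first apply: pbndM (b1 d d0).
      have : pbnd d (fun M n _ => rc (vsc M n) + (z - 2%:R) * (rc (M.+1%:R)^-1)).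
        apply: pbndD.
          exists 1, 1%N; split => // M n J _ _; rewrite mul1r expr1 cnorm_rc ger0_norm ?vsc_ge0 //.
          by rewrite lerDr.
        apply: pbndM; first exact: pbnd_cst.
        by apply: (@pbnd_le _ _ 1) => M _ _; rewrite rcV rc_nat; exact: minv.
      by move=> [K [kk [K0 h]]]; exists K, kk; split => // M n J h1 h2; rewrite ratE; exact: h h1 h2.
    apply: pbndN; apply: pbndM; first exact: pbnd_cst.
    apply: pbndM (pbndS (b2 d d0)).
    by apply: (@pbnd_le _ _ 1) => M _ _; rewrite cnorm_rc ger0_norm ?ex_ge0 ?ex_le1.
  by exists K, kk; split => // M n J dv MJ; rewrite -eqn // h.
apply: (glim_near eqn) => x n J x0 hn hJ.
have -> : Theta k.+1 z z' x = (z - 1)^-1 *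
   ((rc x + (z - 2%:R) * rc 0) * Theta k (z - 1) z' x - z' * (1 * Theta k (z - 1) (z' - 1) x) + z' * rc 0 * 0); last first.
  apply: cvgCM; first exact: cvgC_cst.
  apply: cvgCD; last first.
    apply: cvgCM; last exact: (@glim_bsum _ _ x n J x0 hn hJ).
    apply: cvgCM; first exact: cvgC_cst.
    have := cvgC_rc (@cvg_inv_nat R); congr (cvgC _ _).
    by apply/funext => M; rewrite rcV rc_nat.
  apply: cvgCB; first apply: cvgCM.
  - have : cvgC (fun M => rc (vsc M (n M)) + (z - 2%:R) * (rc (M.+1%:R)^-1)) (rc x + (z - 2%:R) * rc 0).
      apply: cvgCD; first by apply: cvgC_rc; exact: slimS.
      by apply: cvgCM; [exact: cvgC_cst|apply: cvgC_rc; exact: cvg_inv_nat].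
    by congr (cvgC _ _); apply/funext => M; rewrite ratE.
  - exact: lim1.
  - apply: cvgCM; first exact: cvgC_cst.
    apply: cvgCM; first by apply: cvgC_rc; exact: cvg_ex1.
    by apply: (lim2 _ (fun M => (n M).+1)) => //; exact: slimS.
have e1 := cGammaS (nonint_nonpole (nonintB1 nz)); rewrite subrK in e1.
have e2 := cGammaS (nonint_nonpole nz').
rewrite /Theta [Psi k.+1 _ _ _]/= subrK (_ : - (z - 1) = - z + 1); last by ring.
rewrite e1 e2 (invfM (z - 1) (cGamma (z - 1))) (_ : rc 0 = 0) //.
by ring.
Qed.

Lemma good_all k z z' : nonint z -> nonint z' -> ReC z < k.+1%:R -> good k z z'.
Proof.
elim: k z z' => [|k IH] z z' nz nz' hz.
  apply: (@good0 (Num.truncn `|ReC z'|).+1) => //.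
  by rewrite (le_lt_trans (ler_norm _)) // truncnS_gt.
have h : ReC (z - 1) < k.+1%:R by rewrite ReB1 ltrBlDr natr1.
have nz1 := nonintB1 nz; have nz1' := nonintB1 nz'.
by apply: (good_RA nz nz'); [exact: IH nz1 nz' h|exact: IH nz1 nz1' h].
Qed.
End ScaledSums.

(** * Limit of the discrete kernel *)

Section Kernel.
Context {R : realType}.
Local Notation C := R[i].
Local Notation mu := (@lebesgue_measure R).
Local Notation P := (@posR R : set (measurableTypeR R)).

Lemma cbin_bound (a : C) : exists (K : R) p, 0 < K /\ forall n, cnorm (cbin a n) <= K * n.+1%:R ^+ p.
Proof.
have [M hM] := gauss_seq_bounded a.
exists (Num.max M 1), (Num.truncn `|ReC a - 1|).+1; split => [|n]; first by rewrite lt_max ltr01 orbT.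
have n0 : 0 < n.+1%:R :> R by rewrite ltr0n.
have -> : cbin a n = gauss_seq a n * cpow (n.+1%:R : R) (a - 1).
  rewrite /gauss_seq -mulrA -cpowD (_ : 1 - a + (a - 1) = 0) ?cpow0 ?mulr1 //; ring.
rewrite cnormM cnorm_cpow_rpow; apply: ler_pM => //; first exact: cnorm_ge0.
- exact: rpow_ge0.
- by rewrite le_max hM.
rewrite -rpowX // ReB1; apply: rpow_le1; first by rewrite ler1n.
by rewrite (le_trans (ler_norm _)) // ltW // truncnS_gt.
Qed.

(** Free of the constraints of [pbnd], at the cost of powers of m. It serves for the last m terms of
    the kernel sum, whose weight of order e^-m pays for any power. *)
Lemma nsum_crude z z' : exists (K : R) p, 0 <= K /\ forall M n J,
  cnorm (nsum z z' M n J) <= K * (M.+1 + n + J)%:R ^+ p.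
Proof.
have [K1 [p1 [K10 h1]]] := cbin_bound (- z'); have [K2 [p2 [K20 h2]]] := cbin_bound z.
pose s := (Num.truncn `|ReC (1 + z' - z)|).+1.
exists (K1 * K2), (s + (p1 + p2).+1)%N; split => [|M n J]; first by rewrite mulr_ge0 // ltW.
set S : R := (M.+1 + n + J)%:R.
have S0 : 0 <= S by [].
have leS k : (k <= M.+1 + n + J)%N -> k%:R <= S by rewrite ler_nat.
have m1 : 1 <= M.+1%:R :> R by rewrite ler1n.
have b1 : cnorm (cpow (M.+1%:R : R) (1 + z' - z)) <= S ^+ s.
  rewrite cnorm_cpow_rpow; apply: (@le_trans _ _ (M.+1%:R ^+ s)).
    rewrite -rpowX ?ltr0n //; apply: rpow_le1 => //.
    by rewrite (le_trans (ler_norm _)) // ltW // truncnS_gt.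
  by apply: lerXn2r; rewrite ?nnegrE // leS // -addnA leq_addr.
have b2 (j : 'I_J) : cnorm (cbin (- z') j * cbin z (n + j) * rc (ex M j)) <= K1 * K2 * S ^+ (p1 + p2).
  rewrite cnormM (cnormM (cbin _ _) (cbin _ _)) cnorm_rc ger0_norm ?ex_ge0 // -[leRHS]mulr1.
  apply: ler_pM (ex_le1 _ _); rewrite ?mulr_ge0 ?cnorm_ge0 ?ex_ge0 // exprD mulrACA.
  have ltj := ltn_ord j; apply: ler_pM; rewrite ?cnorm_ge0 //.
    apply: (le_trans (h1 _)); rewrite ler_pM2l //; apply: lerXn2r; rewrite ?nnegrE // leS //; lia.
  apply: (le_trans (h2 _)); rewrite ler_pM2l //; apply: lerXn2r; rewrite ?nnegrE // leS //; lia.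
rewrite /nsum cnormM exprD mulrCA; apply: ler_pM; rewrite ?cnorm_ge0 //.
apply: (le_trans (cnorm_sum _ _ _)); apply: (le_trans (ler_sum _ (fun j _ => b2 j))).
rewrite sumr_const card_ord -mulr_natr exprSr mulrA ler_wpM2l //; last by rewrite leS // leq_addl.
by apply: mulr_ge0 (exprn_ge0 _ S0); apply: mulr_ge0; exact: ltW.
Qed.

(* Scale m = M + 1; indices are cut off at m^2, so that the weight e^{-n/m} of what is
   neglected is at most e^{-m}, and powers of m do not matter. *)
Definition NN M := (M.+1 ^ 2)%N.
(** The square root of e^(-1/m): configurations are weighted by squared determinants, and each of
    the two factors carries one half of the exponent. *)
Definition rr M : R := expR (- (2 * M.+1%:R)^-1).
Lemma rr_ge0 M : 0 <= rr M. Proof. exact: expR_ge0. Qed.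
Lemma rr_le1 M : rr M <= 1.
Proof. by rewrite -expR0 ler_expR oppr_le0 invr_ge0 mulr_ge0. Qed.
Lemma rrE M n : rr M ^+ n = expR (- (2^-1 * (n%:R / M.+1%:R))).
Proof. by rewrite /rr -expRM_natl; congr expR; rewrite invfM; ring. Qed.
Lemma rrX2 M n : rr M ^+ (2 * n) = ex M n.
Proof. by rewrite rrE /ex natrM; congr expR; rewrite !mulrA mulVf ?mul1r. Qed.

Definition kern z z' M x y : C := \sum_(k < NN M)
  (rc (rr M ^+ (x.+1 + k)) * asum z z' M (x.+1 + k) (NN M - k)) *
  (rc (rr M ^+ (y.+1 + k)) * asum z' z M (y.+1 + k) (NN M - k)).

Definition kterm z z' M x y k : C := rc (rr M ^+ (x.+1 + y.+1) * ex M k) *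
  (nsum z z' M (x.+1 + k) (NN M - k) * nsum z' z M (y.+1 + k) (NN M - k)).

Lemma rrex_ge0 M n k : 0 <= rr M ^+ n * ex M k.
Proof. by apply: mulr_ge0; [exact: exprn_ge0 (rr_ge0 M)|exact: ex_ge0]. Qed.
Lemma rrex_le M n k : rr M ^+ n * ex M k <= ex M k.
Proof. by rewrite -[leRHS]mul1r; apply: ler_wpM2r; [exact: ex_ge0|rewrite exprn_ile1 ?rr_ge0 ?rr_le1]. Qed.

Lemma cnorm_kterm z z' M x y k : cnorm (kterm z z' M x y k) = rr M ^+ (x.+1 + y.+1) * ex M k *
  cnorm (nsum z z' M (x.+1 + k)%N (NN M - k)%N * nsum z' z M (y.+1 + k)%N (NN M - k)%N).
Proof.
rewrite /kterm; set w := _ * nsum _ _ _ _ _; rewrite (cnormM _ w) cnorm_rc ger0_norm //.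
exact: rrex_ge0.
Qed.

(** The normalizations m^(1+z'-z) and m^(1+z-z') of the two sums multiply to m^2, so that the kernel
    times m is a Riemann sum of mesh 1/m. *)
Lemma kern_kterm z z' M x y : M.+1%:R * kern z z' M x y = rc (M.+1%:R^-1) * \sum_(k < NN M) kterm z z' M x y k.
Proof.
rewrite /kern !mulr_sumr; apply: eq_bigr => k _; rewrite /kterm /nsum rcV rc_nat.
set A := asum _ _ _ _ _; set B := asum _ _ _ _ _.
have e : cpow (M.+1%:R : R) (1 + z' - z) * cpow (M.+1%:R : R) (1 + z - z') = M.+1%:R * M.+1%:R.
  by rewrite -cpow_natS -!cpowD; congr cpow; ring.
have n0 := @natC_neq0 R M.
have -> : rc (rr M ^+ (x.+1 + y.+1) * ex M k) = rc (rr M ^+ (x.+1 + k)) * rc (rr M ^+ (y.+1 + k)).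
  by rewrite -rcM -rrX2 -!exprD; congr (rc (_ ^+ _)); lia.
set m := M.+1%:R : C in e n0 *; set r1 := rc _; set r2 := rc _.
set c1 := cpow _ _ in e *; set c2 := cpow _ _ in e *.
transitivity (m^-1 * (c1 * c2) * (r1 * r2 * (A * B))); last by ring.
by rewrite e mulKf //; ring.
Qed.

Definition Klim k l z z' X Y : C :=
  cint P (fun u => rc (expR (- (2^-1 * (X + Y))) * expR (- u)) * (Theta k z z' (X + u) * Theta l z' z (Y + u))).

(** The sum over k is cut m terms before its end: in the head the remaining length exceeds M, as
    [pbnd] demands, and in the tail the weight e^(-k/m) is at most e^(1-m). *)
Definition khead z z' M x y (u : R) : C := if (fl M.+1 u < NN M - M.+1)%N then kterm z z' M x y (fl M.+1 u) else 0.
Definition ktail z z' M x y : C := rc (M.+1%:R^-1) * \sum_(NN M - M.+1 <= k < NN M) kterm z z' M x y k.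

Lemma kern_split z z' M x y : M.+1%:R * kern z z' M x y = cint P (khead z z' M x y) + ktail z z' M x y.
Proof.
have [_ ->] := cstep_integral (kterm z z' M x y) M (NN M - M.+1).
rewrite kern_kterm /ktail -mulrDr; congr (_ * _).
by rewrite -!(big_mkord xpredT (fun k => kterm z z' M x y k)) -big_cat_nat ?leq_subr.
Qed.

Lemma pbnd_pair (d : R) f g : pbnd d f -> pbnd d g -> exists (K : R) p, 0 <= K /\
  forall b M x y k J, 0 <= b -> d <= vsc M x -> vsc M x <= b -> d <= vsc M y -> vsc M y <= b -> (M < J)%N ->
  cnorm (f M (x.+1 + k)%N J * g M (y.+1 + k)%N J) <= K * (2 + b + k%:R / M.+1%:R) ^+ p.
Proof.
move=> [K [p [K0 hf]]] [L [q [L0 hg]]]; exists (K * L), (p + q)%N; split; first exact: mulr_ge0.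
move=> b M x y k J b0 dx xb dy yb MJ; set w := 2 + b + _.
have m0 : 0 < M.+1%:R :> R by rewrite ltr0n.
have i1 : (M.+1%:R)^-1 <= 1 :> R by rewrite invf_le1 // ler1n.
have step h (T : R) s (n : nat) : 0 <= T -> (forall M n J, d <= vsc M n -> (M < J)%N -> cnorm (h M n J) <= T * (1 + vsc M n) ^+ s) ->
    d <= vsc M n -> vsc M n <= b -> cnorm (h M (n.+1 + k)%N J) <= T * w ^+ s.
  move=> T0 hh dn nb; apply: (le_trans (hh _ _ _ _ MJ)).
    by apply: (le_trans dn); rewrite /vsc ler_pM2r ?invr_gt0 // ler_nat (leq_trans (leqnSn _)) // ltnS leq_addr.
  apply: ler_wpM2l => //; apply: lerXn2r; rewrite ?nnegrE ?addr_ge0 ?vsc_ge0 ?divr_ge0 //.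
  have -> : vsc M (n.+1 + k) = vsc M n + k%:R / M.+1%:R + (M.+1%:R)^-1 :> R.
    by rewrite /vsc -addSn (natrD _ n.+2 k) mulrDl -(natr1 n.+1) mulrDl mul1r addrAC.
  by move: i1 nb; rewrite /w; set yy := _^-1; set kk := k%:R * yy; lra.
by rewrite cnormM exprD mulrACA; apply: ler_pM; rewrite ?cnorm_ge0 //; [exact: (step f)|exact: (step g)].
Qed.

Lemma khead_dom k l z z' (d b : R) : good k z z' -> good l z' z -> 0 < d -> 0 <= b -> exists g : R -> R,
  mu.-integrable P (EFin \o g) /\ forall M x y u, 0 < u -> d <= vsc M x -> vsc M x <= b -> d <= vsc M y -> vsc M y <= b ->
  cnorm (khead z z' M x y u) <= g u.
Proof.
move=> [_ h1] [_ h2] d0 b0; have [K [p [K0 h]]] := pbnd_pair (h1 d d0) (h2 d d0).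
exists (fun u => expR 1 * K * (2 + b) ^+ p * gdom 1 p 1 u); split.
  by apply: integrable_mull; [exact: measurable_posR|apply: integrable_gdom].
have C0 : 0 <= expR 1 * K * (2 + b) ^+ p.
  by apply: mulr_ge0; [exact: mulr_ge0 (expR_ge0 _) K0|apply: exprn_ge0; exact: addr_ge0].
move=> M x y u u0 dx xb dy yb; rewrite /khead; case: ifP => hj; last first.
  by rewrite cnorm0 mulr_ge0 // gdom_ge0.
set j := fl _ _ in hj *.
have m0 : 0 < M.+1%:R :> R by rewrite ltr0n.
have [f1 f2] := fl_bounds M (ltW u0); rewrite -/j in f1 f2.
have i1 : (M.+1%:R)^-1 <= 1 :> R by rewrite invf_le1 // ler1n.
have MJ : (M < NN M - j)%N by rewrite ltn_subRL addnC -ltn_subRL in hj; exact: ltnW.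
have b3 : ex M j <= expR 1 * expR (- (1 * u)).
  rewrite -expRD ler_expR mul1r.
  have : u <= j%:R / M.+1%:R + (M.+1%:R)^-1 by move/ltW: f2; rewrite -natr1 mulrDl mul1r.
  by move: i1; set yy := (_^-1); set w := j%:R * yy; lra.
rewrite cnorm_kterm.
have b1 := le_trans (rrex_le M (x.+1 + y.+1) j) b3.
have b2 : K * (2 + b + j%:R / M.+1%:R) ^+ p <= K * ((2 + b) ^+ p * (1 + u) ^+ p).
  rewrite -exprMn; apply: ler_wpM2l => //; apply: lerXn2r; rewrite ?nnegrE.
  - by rewrite !addr_ge0 // divr_ge0.
  - by rewrite mulr_ge0 // addr_ge0 // ltW.
  - move: f1; set w := j%:R / _; have := mulr_ge0 b0 (ltW u0); have := ltW u0; lra.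
apply: (le_trans (ler_pM (rrex_ge0 _ _ _) (cnorm_ge0 _) b1 (le_trans (h b _ _ _ _ _ b0 dx xb dy yb MJ) b2))).
by rewrite /gdom subrr rpow0 le_eqVlt; apply/orP; left; apply/eqP; ring.
Qed.

Lemma ktail_bound z z' (b : R) : 0 <= b -> exists c : R, forall M x y, vsc M x <= b -> vsc M y <= b ->
  cnorm (ktail z z' M x y) <= c / M.+1%:R.
Proof.
move=> b0; have [K [p [K0 hK]]] := nsum_crude z z'; have [L [q [L0 hL]]] := nsum_crude z' z.
have [e [e0 he]] := @expX_le R 1 (2 * (p + q) + 1) ltr01.
exists (K * L * (b + 2) ^+ (p + q) * expR 1 * e) => M x y xb yb.
have m0 : 0 < M.+1%:R :> R by rewrite ltr0n.
have m1 : 1 <= M.+1%:R :> R by rewrite ler1n.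
set m : R := M.+1%:R in m0 m1 *.
have NE : (NN M)%:R = m ^+ 2 :> R by rewrite /NN natrX.
have crude f (T : R) s n k : (forall M n J, cnorm (f M n J) <= T * (M.+1 + n + J)%:R ^+ s) -> 0 <= T -> (k <= NN M)%N ->
   vsc M n <= b -> cnorm (f M (n.+1 + k)%N (NN M - k)%N) <= T * ((b + 2) * m ^+ 2) ^+ s.
  move=> hf T0 kN nb; apply: (le_trans (hf _ _ _)); apply: ler_wpM2l => //.
  apply: lerXn2r; rewrite ?nnegrE ?ler0n //.
    by apply: mulr_ge0; [exact: addr_ge0|exact: exprn_ge0 (ltW m0)].
  have -> : (M.+1 + (n.+1 + k) + (NN M - k) = M.+1 + n.+1 + NN M)%N by move: kN; set q' := NN M; lia.
  rewrite natrD natrD NE -/m.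
  have hn : n.+1%:R <= b * m by rewrite -ler_pdivrMr.
  have mm : m <= m ^+ 2 by rewrite expr2 ler_peMr // ltW.
  have bm := ler_wpM2l b0 mm; lra.
have tb k : (NN M - M.+1 <= k < NN M)%N ->
    cnorm (kterm z z' M x y k) <= expR 1 * expR (- (1 * m)) * (K * L * ((b + 2) * m ^+ 2) ^+ (p + q)).
  move=> /andP[k1 k2]; rewrite cnorm_kterm.
  apply: ler_pM (rrex_ge0 _ _ _) (cnorm_ge0 _) _ _.
    apply: (le_trans (rrex_le _ _ _)).
    rewrite -expRD ler_expR mul1r -/m.
    have : m ^+ 2 - m <= k%:R.
      rewrite -NE lerBlDr -natrD ler_nat; move: k1; set q' := NN M; lia.
    move=> hk; rewrite lerNl opprB addrC -lerBrDr.
    have : (m - 1) * m <= k%:R by rewrite mulrBl mul1r -expr2.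
    by rewrite -ler_pdivlMr // lerBrDr addrC.
  rewrite cnormM exprD mulrACA; apply: ler_pM (cnorm_ge0 _) (cnorm_ge0 _) _ _.
    exact: (crude (nsum z z') K p x k hK K0 (ltnW k2) xb).
  exact: (crude (nsum z' z) L q y k hL L0 (ltnW k2) yb).
rewrite /ktail cnormM cnorm_rc ger0_norm ?invr_ge0 ?ler0n // -/m mulrC ler_pM2r ?invr_gt0 //.
apply: (le_trans (cnorm_sum _ _ _)).
rewrite big_nat_cond; apply: (le_trans (ler_sum _ (fun k hk => tb k (proj1 (andP hk))))).
rewrite -big_nat_cond sumr_const_nat.
have -> : (NN M - (NN M - M.+1) = M.+1)%N by rewrite subKn // /NN -mulnn leq_pmull.
have hm := he m (ltW m0).
rewrite -(mulr_natr _ M.+1) -/m exprMn -exprM.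
set E := expR 1; set B := (b + 2) ^+ _; set X := expR _ in hm *.
have -> : E * X * (K * L * (B * m ^+ (2 * (p + q)))) * m = K * L * B * E * (m ^+ (2 * (p + q) + 1) * X).
  by rewrite exprD expr1; ring.
have B0 : 0 <= B by apply: exprn_ge0; exact: addr_ge0.
apply: ler_wpM2l; first by rewrite !mulr_ge0 // expR_ge0.
apply: (le_trans _ hm); rewrite ler_wpM2r ?expR_ge0 //.
apply: lerXn2r; rewrite ?nnegrE; lra.
Qed.

Lemma kern_bound k l z z' (d b : R) : good k z z' -> good l z' z -> 0 < d -> 0 <= b -> exists c : R,
  forall M x y, d <= vsc M x -> vsc M x <= b -> d <= vsc M y -> vsc M y <= b ->
  cnorm (M.+1%:R * kern z z' M x y) <= c.
Proof.
move=> g1 g2 d0 b0; have [g [ig hg]] := khead_dom g1 g2 d0 b0; have [c hc] := ktail_bound z z' b0.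
exists (2 * \int[mu]_(x in P) g x + `|c|) => M x y dx xb dy yb; rewrite kern_split.
apply: (le_trans (cnormD _ _)); apply: lerD.
  apply: cnorm_cint => //; [exact: measurable_posR| |by move=> u u0; exact: hg].
  by have [] := cstep_integral (kterm z z' M x y) M (NN M - M.+1).
apply: (le_trans (hc _ _ _ xb yb)); rewrite ler_pdivrMr ?ltr0n //.
by apply: (le_trans (ler_norm _)); rewrite ler_peMr // ler1n.
Qed.

Lemma kern_lim k l z z' X Y nx ny : good k z z' -> good l z' z -> 0 < X -> 0 < Y -> slim nx X -> slim ny Y ->
  cvgC (fun M => M.+1%:R * kern z z' M (nx M) (ny M)) (Klim k l z z' X Y).
Proof.
move=> g1 g2 X0 Y0 hx hy; have mP := @measurable_posR R.
have [d1 [d10 hd1]] := slim_pos_bound X0 hx; have [d2 [d20 hd2]] := slim_pos_bound Y0 hy.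
have [b1 hb1] := cvgC_bounded (cvgC_rc (slimS hx)); have [b2 hb2] := cvgC_bounded (cvgC_rc (slimS hy)).
pose d := Num.min d1 d2; have d0 : 0 < d by rewrite lt_min d10 d20.
pose b := Num.max 0 (Num.max b1 b2); have b0 : 0 <= b by rewrite le_max lexx.
have dx M : d <= vsc M (nx M) by rewrite /d ge_min hd1.
have dy M : d <= vsc M (ny M) by rewrite /d ge_min hd2 orbT.
have xb M : vsc M (nx M) <= b.
  by have := hb1 M; rewrite cnorm_rc ger0_norm ?vsc_ge0 // /b !le_max => ->; rewrite !orbT.
have yb M : vsc M (ny M) <= b.
  by have := hb2 M; rewrite cnorm_rc ger0_norm ?vsc_ge0 // /b !le_max => ->; rewrite !orbT.
have [g [ig hg]] := khead_dom g1 g2 d0 b0; have [c hc] := ktail_bound z z' b0.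
have -> : (fun M => M.+1%:R * kern z z' M (nx M) (ny M)) =
  (fun M => cint P (khead z z' M (nx M) (ny M)) + ktail z z' M (nx M) (ny M)).
  by apply/funext => M; exact: kern_split.
rewrite -[Klim _ _ _ _ _ _]addr0; apply: cvgCD; last first.
  apply: cvgC_norm0.
  have h : (fun M => c / M.+1%:R) @ \oo --> (0 : R).
    by rewrite -[X in _ --> X](mulr0 c); apply: cvgM; [exact: cvg_cst|exact: cvg_inv_nat].
  apply: (@squeeze_cvgr _ _ _ _ (fun=> 0) _ _ _ 0 _ h); last exact: cvg_cst.
  by apply: nearW => M; rewrite cnorm_ge0 hc.
have [] := @cint_dct R P (fun M => khead z z' M (nx M) (ny M))
  (fun u => rc (expR (- (2^-1 * (X + Y))) * expR (- u)) * (Theta k z z' (X + u) * Theta l z' z (Y + u))) g mP _ _ ig.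
- by move=> M; have [] := cstep_integral (kterm z z' M (nx M) (ny M)) M (NN M - M.+1).
- move=> u u0; have su := slim_fl (ltW u0).
  have mge (A : R) : \forall M \near \oo, A <= M.+1%:R.
    by near=> M; rewrite (le_trans (ltW (truncnS_gt A))) // ler_nat ltnS; near: M; exact: nbhs_infty_ge.
  have Jg (A : R) : \forall M \near \oo, A <= (NN M - fl M.+1 u)%:R / M.+1%:R.
    have := mge (A + u); apply: filterS => M hM.
    have m0 : 0 < M.+1%:R :> R by rewrite ltr0n.
    have [f1 _] := fl_bounds M (ltW u0).
    apply: (@le_trans _ _ (((NN M)%:R - (fl M.+1 u)%:R) / M.+1%:R)); last first.
      by rewrite ler_pM2r ?invr_gt0 // lerBlDr -natrD ler_nat addnC -leq_subLR.
    rewrite mulrBl /NN natrX expr2 -mulrA mulfV ?gt_eqF // mulr1.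
    by apply: (le_trans _ (lerB (lexx _) f1)); rewrite lerBrDr.
  have J1 : @Jinf R (fun M => NN M - fl M.+1 u)%N by rewrite /Jinf; apply/cvgryPge => A; exact: Jg.
  apply: (@cvgC_near _ (fun M => kterm z z' M (nx M) (ny M) (fl M.+1 u))).
    have := Jinf_ge 2 J1; apply: filterS => M; rewrite ler_pdivlMr ?ltr0n // -natrM ler_nat => h2.
    rewrite /khead ifT // ltn_subRL addnC -ltn_subRL; apply: (leq_trans _ h2); lia.
  apply: cvgCM.
    have hc1 : slim (fun M => (nx M).+1 + (ny M).+1)%N (X + Y) by apply: slimD; exact: slimS.
    have h1 : (fun M => - (2^-1 * (((nx M).+1 + (ny M).+1)%:R / M.+1%:R))) @ \oo --> - (2^-1 * (X + Y)).
      by apply: cvgN; apply: cvgM => //; exact: cvg_cst.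
    have h2 := @continuous_expR R (- (2^-1 * (X + Y))).
    have h3 : (fun M => expR (- (2^-1 * (((nx M).+1 + (ny M).+1)%:R / M.+1%:R)))) @ \oo --> expR (- (2^-1 * (X + Y))).
      exact: cvg_comp h1 h2.
    apply: cvgC_rc; apply: cvgM; last exact: cvg_exslim.
    by under eq_fun do rewrite rrE.
  apply: cvgCM.
    apply: (proj1 g1 _ (fun M => (nx M).+1 + fl M.+1 u)%N _ _ _ J1); first exact: addr_gt0.
    by apply: slimD => //; exact: slimS.
  apply: (proj1 g2 _ (fun M => (ny M).+1 + fl M.+1 u)%N _ _ _ J1); first exact: addr_gt0.
  by apply: slimD => //; exact: slimS.
- by move=> M u u0; exact: hg.
- by [].
Unshelve. all: by end_near.
Qed.
End Kernel.

(** * The kernel M as a Laplace integral *)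

Section MkerFormula.
Context {R : realType}.
Local Notation C := R[i].
Local Notation mu := (@lebesgue_measure R).
Local Notation P := (@posR R : set (measurableTypeR R)).

Definition pol (f : R -> C) := cmeas P f /\ exists (K : R) p, 0 <= K /\
  forall u, 0 < u -> cnorm (f u) <= K * (1 + u) ^+ p.

Lemma polD f g : pol f -> pol g -> pol (fun u => f u + g u).
Proof.
move=> [mf [K [p [K0 hf]]]] [mg [L [q [L0 hg]]]]; split; first exact: cmeasD.
exists (K + L), (p + q)%N; split => [|u u0]; first exact: addr_ge0.
have v1 : 1 <= 1 + u by rewrite lerDl ltW.
apply: (le_trans (cnormD _ _)); rewrite mulrDl; apply: lerD.
  by apply: (le_trans (hf _ u0)); apply: ler_wpM2l => //; apply: ler_weXn2l => //; exact: leq_addr.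
by apply: (le_trans (hg _ u0)); apply: ler_wpM2l => //; apply: ler_weXn2l => //; exact: leq_addl.
Qed.
Lemma polM f g : pol f -> pol g -> pol (fun u => f u * g u).
Proof.
move=> [mf [K [p [K0 hf]]]] [mg [L [q [L0 hg]]]]; split; first exact: cmeasM.
exists (K * L), (p + q)%N; split => [|u u0]; first exact: mulr_ge0.
by rewrite cnormM exprD mulrACA; apply: ler_pM (cnorm_ge0 _) (cnorm_ge0 _) (hf _ u0) (hg _ u0).
Qed.
Lemma pol_cst c : pol (fun=> c).
Proof.
split; first exact: cmeas_cst.
by exists (cnorm c), 0%N; split => [|u _]; [exact: cnorm_ge0|rewrite expr0 mulr1].
Qed.
Lemma pol_rcD x : 0 <= x -> pol (fun u => rc (x + u)).
Proof.
move=> x0; split; first by apply: cmeas_rc; exact: measurable_funD.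
exists (1 + x), 1%N; split => [|u u0]; first exact: addr_ge0.
rewrite expr1 cnorm_rc ger0_norm ?addr_ge0 ?(ltW u0) //.
have := mulr_ge0 x0 (ltW u0); lra.
Qed.
Lemma polN f : pol f -> pol (fun u => - f u).
Proof.
move=> /(polM (pol_cst (-1))); congr pol.
by apply/funext => u; rewrite mulN1r.
Qed.
Lemma polB f g : pol f -> pol g -> pol (fun u => f u - g u).
Proof. by move=> hf /polN; exact: polD. Qed.

(** The weight e^-tau comes from 1/(t1+t2+1), the integral of e^(-tau (t1+t2+1)) over tau > 0; this
    representation decouples the two variables of the pairing. *)
Definition expw (f : R -> C) (u : R) : C := rc (expR (- u)) * f u.
Lemma pol_integrable f : pol f -> cintegrable P (expw f).
Proof.
move=> [mf [K [p [K0 hf]]]]; have mP := @measurable_posR R.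
apply: (@dom_cintegrable _ _ _ (fun u => K * gdom 1 p 1 u) mP).
- apply: cmeasM mf; apply: cmeas_rc; apply: measurable_comp_cont => //; exact: continuous_expR.
- by apply: integrable_mull => //; exact: integrable_gdom.
- move=> u u0; rewrite /expw cnormM cnorm_rc ger0_norm ?expR_ge0 // /gdom subrr rpow0 mul1r mul1r.
  by rewrite mulrA mulrC; apply: ler_wpM2r; [exact: expR_ge0|exact: hf].
Qed.
Definition Jw f := cint P (expw f).
Lemma JwD f g : pol f -> pol g -> Jw (fun u => f u + g u) = Jw f + Jw g.
Proof.
move=> /pol_integrable hf /pol_integrable hg; rewrite /Jw -(cintD (@measurable_posR R) hf hg).
by apply: eq_cint => u _; rewrite /expw mulrDr.
Qed.
Lemma JwZ c f : pol f -> Jw (fun u => c * f u) = c * Jw f.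
Proof.
move=> /pol_integrable hf; rewrite /Jw -(cintZl _ (@measurable_posR R) hf).
by apply: eq_cint => u _; rewrite /expw mulrCA.
Qed.
Lemma JwB f g : pol f -> pol g -> Jw (fun u => f u - g u) = Jw f - Jw g.
Proof.
move=> hf hg; rewrite JwD //; last exact: polN.
rewrite -[- Jw g]mulN1r -(JwZ _ hg); congr (_ + _); apply: eq_cint => u _.
by rewrite /expw mulN1r.
Qed.
Lemma eq_Jw f g : (forall u, 0 < u -> f u = g u) -> Jw f = Jw g.
Proof. by move=> h; apply: eq_cint => u u0; rewrite /expw h. Qed.

Definition phc (c : C) (w : R) : C := cpow w c / cGamma (c + 1).
(** The k-th derivative in u of phi_c(u+1) e^(-(x+tau)u). *)
Fixpoint AA k (c : C) (x u tau : R) : C :=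
  if k is k'.+1 then AA k' (c - 1) x u tau - rc (x + tau) * AA k' c x u tau
  else phc c (u + 1) * rc (expR (- ((x + tau) * u))).

Lemma pol_exp (x u : R) : 0 <= x -> 0 < u -> pol (fun tau => rc (expR (- ((x + tau) * u)))).
Proof.
move=> x0 u0; split.
  apply: cmeas_rc; apply: measurable_comp_cont; [exact: measurable_posR|exact: continuous_expR|].
  by apply: measurable_funN; apply: measurable_funM => //; exact: measurable_funD.
exists 1, 0%N; split => // w w0; rewrite expr0 mulr1 cnorm_rc ger0_norm ?expR_ge0 //.
by rewrite -expR0 ler_expR oppr_le0 mulr_ge0 ?addr_ge0 // ltW.
Qed.

Lemma pol_AA k c x u : 0 <= x -> 0 < u -> pol (AA k c x u).
Proof.
move=> x0 u0; elim: k c => [|k IH] c /=; last by apply: polB => //; apply: polM => //; exact: pol_rcD.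
by apply: polM; [exact: pol_cst|exact: pol_exp].
Qed.

Definition psi_fun (a c : C) (y v : R) : C := cpow v a / cGamma (a + 1) * phc c (v + 1) * rc (expR (- (y * v))).

Lemma psi_fun_integrable a c y : -1 < ReC a -> 0 < y -> cintegrable P (psi_fun a c y).
Proof.
move=> a1 y0; have h := cintegrable_Psi0 c a1 y0.
have := cintegrableZl (cGamma (a + 1))^-1 (@measurable_posR R) (cintegrableZl (cGamma (c + 1))^-1 (@measurable_posR R) h).
congr cintegrable; apply/funext => v; rewrite /psi_fun /phc.
by set G1 := (cGamma _)^-1; set G2 := (cGamma _)^-1; ring.
Qed.

Lemma Psi0_clap a c y tau : Psi0 a c (y + tau) = clap (psi_fun a c y) tau.
Proof.
apply: eq_cint => v _; rewrite /psi_fun -[RHS]mulrA -rcM -expRD; congr (_ * rc (expR _)); ring.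
Qed.

(** At l = 0 the function is a Laplace transform, whose components are bounded by the L1 norm of
    [psi_fun]; each step of the recursion costs a factor y + tau. *)
Lemma pol_Psi l a c y : -1 < ReC a + l%:R -> 0 < y -> pol (fun tau => Psi l a c (y + tau)).
Proof.
move=> al y0; elim: l a c al => [|l IH] a c al /=.
  rewrite addr0 in al; have ip := psi_fun_integrable c al y0.
  rewrite (_ : (fun tau => _) = clap (psi_fun a c y)); last by apply/funext => tau; exact: Psi0_clap.
  split; first exact: cmeas_clap.
  pose g v := cnorm (psi_fun a c y v).
  have mP := @measurable_posR R.
  have ig : mu.-integrable P (EFin \o g).
    have [i1 i2] := ip; have [m1 m2] := cintegrable_meas ip.
    apply: (@le_integrable_EFin _ _ _ mu P g (fun v => `|ReC (psi_fun a c y v)| + `|ImC (psi_fun a c y v)|)) => //.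
    - apply: (@measurableT_comp _ _ _ _ _ _ (@Num.sqrt R)); first exact: continuous_measurable_fun (@sqrt_continuous R).
      by apply: measurable_funD; exact: measurable_funX.
    - rewrite (_ : _ \o _ = (fun v => `|(ReC (psi_fun a c y v))%:E| + `|(ImC (psi_fun a c y v))%:E|)%E) //.
      by apply: integrableD => //; exact: integrable_norm.
    - by move=> v _; rewrite ger0_norm ?cnorm_ge0 // cnorm_le.
  exists (Num.max 0 (2 * \int[mu]_(v in P) g v)), 0%N; split => [|tau t0]; first by rewrite le_max lexx.
  rewrite expr0 mulr1 le_max; apply/orP; right; apply: cnorm_cint => //.
    exact: cintegrable_meas (clap_cintegrable t0 ip).
  move=> v v0; rewrite cnormM cnorm_rc ger0_norm ?expR_ge0 // ler_piMr ?cnorm_ge0 //.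
  by rewrite -expR0 ler_expR oppr_le0 mulr_ge0 // ltW.
have h : -1 < ReC (a + 1) + l%:R by move: al; rewrite ReD (_ : ReC 1 = 1) // -natr1; lra.
by apply: polB; [apply: polM; [apply: pol_rcD; exact: ltW|exact: IH]|exact: IH].
Qed.

Lemma eq_cintegrable (D : set (measurableTypeR R)) (f g : R -> C) : measurable D ->
  (forall v, D v -> f v = g v) -> cintegrable D f -> cintegrable D g.
Proof.
move=> mD h [i1 i2]; split; [apply: eq_integrable mD _ _ _ i1|apply: eq_integrable mD _ _ _ i2];
by move=> v; rewrite inE => Dv; rewrite /= h.
Qed.

(** [AA] and [Psi] obey the same recursion up to sign, which accounts for (-1)^l; at l = 0 the
    identity is the exchange of two Laplace integrals. The free factor [f] takes in the y + tau that
    each step produces. *)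
Lemma pair_step l a c y f : pol f -> -1 < ReC a + l%:R -> 0 < y ->
  cintegrable P (fun v => phi (a + l%:R) v * Jw (fun tau => f tau * AA l c y v tau)) /\
  (-1) ^+ l * cint P (fun v => phi (a + l%:R) v * Jw (fun tau => f tau * AA l c y v tau)) =
  Jw (fun tau => f tau * Psi l a c (y + tau)).
Proof.
move=> pf al y0; have mP := @measurable_posR R.
elim: l a c f pf al => [|l IH] a c f pf al.
  rewrite !addr0 in al *; rewrite expr0 mul1r.
  have [i e] := claplace_swap (psi_fun_integrable c al y0) (pol_integrable pf).
  have h v : 0 < v -> psi_fun a c y v * clap (expw f) v = phi a v * Jw (fun tau => f tau * AA 0 c y v tau).
    move=> v0; rewrite /phi v0 /psi_fun -[LHS]mulrA -[LHS]mulrA; congr (_ * _).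
    have pe : pol (fun tau => f tau * rc (expR (- (tau * v)))).
      apply: polM pf _; have := pol_exp (lexx 0) v0.
      by congr pol; apply/funext => tau; rewrite add0r.
    have -> : clap (expw f) v = Jw (fun tau => f tau * rc (expR (- (tau * v)))).
      by apply: eq_cint => tau _; rewrite /expw [RHS]mulrA (mulrC v tau).
    rewrite mulrA -(JwZ _ pe); apply: eq_cint => tau _; rewrite /expw /=.
    rewrite (_ : expR (- ((y + tau) * v)) = expR (- (y * v)) * expR (- (tau * v))); last by rewrite -expRD; congr expR; ring.
    by rewrite rcM; set q := phc _ _; ring.
  split; first exact: eq_cintegrable mP h i.
  rewrite -(@eq_cint R P _ _ h) e; apply: eq_cint => tau _; rewrite /expw /= Psi0_clap.
  by rewrite mulrA.
have al' : -1 < ReC (a + 1) + l%:R by move: al; rewrite ReD (_ : ReC 1 = 1) // -natr1; lra.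
have pyf : pol (fun tau => f tau * rc (y + tau)) by apply: polM => //; apply: pol_rcD; exact: ltW.
have [i1 e1] := IH (a + 1) (c - 1) f pf al'.
have [i2 e2] := IH (a + 1) c (fun tau => f tau * rc (y + tau)) pyf al'.
have ea : a + 1 + l%:R = a + l.+1%:R by rewrite -natr1; ring.
rewrite ea in i1 e1 i2 e2.
have h v : 0 < v -> phi (a + l.+1%:R) v * Jw (fun tau => f tau * AA l (c - 1) y v tau) +
   -1 * (phi (a + l.+1%:R) v * Jw (fun tau => f tau * rc (y + tau) * AA l c y v tau)) =
   phi (a + l.+1%:R) v * Jw (fun tau => f tau * AA l.+1 c y v tau).
  move=> v0; rewrite mulN1r -mulrBr -JwB.
  - by congr (_ * _); apply: eq_Jw => tau _; rewrite /= mulrBr mulrA.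
  - by apply: polM => //; apply: pol_AA => //; exact: ltW.
  - by apply: polM => //; apply: pol_AA => //; exact: ltW.
have i3 := cintegrableZl (-1) mP i2.
split; first exact: eq_cintegrable mP h (cintegrableD mP i1 i3).
rewrite -(@eq_cint R P _ _ h) (cintD mP i1 i3) (cintZl _ mP i2) exprS.
set I1 := cint _ _ in e1 *; set I2 := cint _ _ in e2 *.
have -> : -1 * (-1) ^+ l * (I1 + -1 * I2) = (-1) ^+ l * I2 - (-1) ^+ l * I1 by ring.
apply: etrans (congr2 (fun p q : C => p - q) e2 e1) _.
have e3 := JwB (polM pyf (pol_Psi c al' y0)) (polM pf (pol_Psi (c - 1) al' y0)).
apply: etrans (esym e3) _.
by apply: eq_Jw => tau _; rewrite /= mulrBr mulrA.
Qed.

Section Derivatives.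
Variables (E : R).

(** The family is built to express its own derivatives: the factor i! (u+v+1)^(-i-1) reproduces
    itself, up to sign, with i + 1. The test function of the kernel is the member i = 0. *)
Definition TT (x y : R) (c' c : C) i (u v : R) : C :=
  phc c' (u + 1) * phc c (v + 1) * rc (E * expR (- (x * u)) * expR (- (y * v))) *
  (i`!%:R * cpow (u + v + 1) (- i.+1%:R)).
Fixpoint Sv (x y : R) l (c' c : C) i (u v : R) : C :=
  if l is l'.+1 then Sv x y l' c' (c - 1) i u v - rc y * Sv x y l' c' c i u v - Sv x y l' c' c i.+1 u v
  else TT x y c' c i u v.
Fixpoint Su (x y : R) k l (c' c : C) i (u v : R) : C :=
  if k is k'.+1 then Su x y k' l (c' - 1) c i u v - rc x * Su x y k' l c' c i u v - Su x y k' l c' c i.+1 u v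
  else Sv x y l c' c i u v.

Lemma TT_sym x y c' c i u v : TT x y c' c i u v = TT y x c c' i v u.
Proof.
rewrite /TT (addrC u v) (mulrAC E) [phc c' _ * _]mulrC; congr (_ * rc _ * _).
Qed.

Lemma cderiv_phc c v : nonint c -> 0 < v -> cderiv (fun r => phc c (r + 1)) v (phc (c - 1) (v + 1)).
Proof.
move=> nc v0; have v1 : 0 < v + 1 by rewrite addr_gt0.
have h := cderivM (cderiv_shift (cderiv_cpow c v1)) (cderiv_cst (cGamma (c + 1))^-1 v).
apply: (cderiv_eq h); rewrite /phc mulr0 add0r subrK (cGammaS (nonint_nonpole nc)).
have c0 : c != 0 by have := nonint_nonpole nc 0; rewrite addr0.
have g0 := cGamma_neq0 (nonint_nonpole nc).
set G := cGamma c in g0 *; rewrite (invfM c G); set X := cpow _ _.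
have -> : c^-1 * G^-1 * (c * X) = c^-1 * c * (X * G^-1) by ring.
by rewrite (mulVf c0) mul1r.
Qed.

Lemma cderiv_exp (y v : R) : cderiv (fun r => rc (expR (- (y * r)))) v (rc (- y * expR (- (y * v)))).
Proof.
apply: cderiv_rc.
have h := is_deriveZ (- y) (is_derive_id v (1 : R)).
have h2 : is_derive v 1 (fun r : R => - (y * r)) (- y).
  have : is_derive v 1 (fun r : R => - (y * r)) (- y *: 1).
    by move: h; congr is_derive; apply/funext => r; rewrite /= /GRing.scale /= mulNr.
  by move/is_derive_eq; apply; rewrite /GRing.scale /= mulr1.
by apply: (is_derive_eq (is_derive1_comp (is_derive_expR _) h2)); rewrite mulrC.
Qed.

Lemma cderiv_TT x y c' c i u v : nonint c -> 0 < u -> 0 < v ->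
  cderiv (TT x y c' c i u) v (TT x y c' (c - 1) i u v - rc y * TT x y c' c i u v - TT x y c' c i.+1 u v).
Proof.
move=> nc u0 v0; have w0 : 0 < v + (u + 1) by rewrite !addr_gt0.
have h1 := cderiv_phc nc v0; have h2 := cderiv_exp y v.
have h3 := cderiv_shift (cderiv_cpow (- i.+1%:R) w0).
have h := cderivM (cderiv_cst (phc c' (u + 1) * rc (E * expR (- (x * u))) * i`!%:R) v) (cderivM h1 (cderivM h2 h3)).
have e : (fun r => phc c' (u + 1) * rc (E * expR (- (x * u))) * i`!%:R *
    (phc c (r + 1) * (rc (expR (- (y * r))) * cpow (r + (u + 1)) (- i.+1%:R)))) = TT x y c' c i u.
  apply/funext => r; rewrite /TT (rcM (E * _)) (_ : r + (u + 1) = u + r + 1); last by ring.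
  by set q := cpow _ _; set p1 := phc _ _; set p2 := phc _ _; ring.
rewrite e in h; apply: (cderiv_eq h); rewrite /TT !(rcM (E * _)) factS natrM.
rewrite (_ : v + (u + 1) = u + v + 1); last by ring.
rewrite (_ : - i.+2%:R = - i.+1%:R - 1 :> C); last by rewrite -(natr1 i.+1) opprD.
rewrite (rcM (- y) (expR _)) (rcN y).
set q := cpow _ (_ - 1); set q1 := cpow _ _; set p1 := phc _ _; set p2 := phc _ _; set p3 := phc _ _.
set a := rc _; set b := rc _; set d := rc _; set j := i.+1%:R; set jj := i`!%:R.
by rewrite mulr0 addr0; ring.
Qed.

Lemma cderiv_Sv x y l c' c i u v : nonint c -> 0 < u -> 0 < v ->
  cderiv (Sv x y l c' c i u) v (Sv x y l.+1 c' c i u v).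
Proof.
move=> nc u0 v0; elim: l c i nc => [|l IH] c i nc; first exact: cderiv_TT.
have h1 := IH (c - 1) i (nonintB1 nc); have h2 := IH c i nc; have h3 := IH c i.+1 nc.
have h := cderivD (cderivD h1 (cderivM (cderiv_cst (- rc y) v) h2)) (cderivM (cderiv_cst (-1) v) h3).
have e : (fun r => Sv x y l c' (c - 1) i u r + - rc y * Sv x y l c' c i u r + -1 * Sv x y l c' c i.+1 u r) =
   Sv x y l.+1 c' c i u by apply/funext => r; rewrite mulN1r mulNr.
rewrite e in h; apply: (cderiv_eq h).
by rewrite !mulr0 !addr0 mulN1r mulNr.
Qed.

Lemma cderiv_Sv_fst x y l c' c i u v : nonint c' -> 0 < u -> 0 < v ->
  cderiv (fun r => Sv x y l c' c i r v) u
    (Sv x y l (c' - 1) c i u v - rc x * Sv x y l c' c i u v - Sv x y l c' c i.+1 u v).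
Proof.
move=> nc u0 v0; elim: l c i => [|l IH] c i.
  have := cderiv_TT y x c i nc v0 u0; rewrite !(TT_sym y x).
  by congr cderiv; apply/funext => r; rewrite TT_sym.
have h1 := IH (c - 1) i; have h2 := IH c i; have h3 := IH c i.+1.
have h := cderivD (cderivD h1 (cderivM (cderiv_cst (- rc y) u) h2)) (cderivM (cderiv_cst (-1) u) h3).
have e : (fun r => Sv x y l c' (c - 1) i r v + - rc y * Sv x y l c' c i r v + -1 * Sv x y l c' c i.+1 r v) =
   (fun r => Sv x y l.+1 c' c i r v) by apply/funext => r; rewrite mulN1r mulNr.
rewrite e in h; apply: (cderiv_eq h) => /=.
set s1 := Sv _ _ _ _ _ _ _ _; set s2 := Sv _ _ _ _ _ _ _ _; set s3 := Sv _ _ _ _ _ _ _ _.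
by rewrite !mulr0 !addr0; ring.
Qed.

Lemma cderiv_Su x y k l c' c i u v : nonint c' -> 0 < u -> 0 < v ->
  cderiv (fun r => Su x y k l c' c i r v) u (Su x y k.+1 l c' c i u v).
Proof.
move=> nc u0 v0; elim: k c' i nc => [|k IH] c' i nc; first exact: cderiv_Sv_fst.
have h1 := IH (c' - 1) i (nonintB1 nc); have h2 := IH c' i nc; have h3 := IH c' i.+1 nc.
have h := cderivD (cderivD h1 (cderivM (cderiv_cst (- rc x) u) h2)) (cderivM (cderiv_cst (-1) u) h3).
have e : (fun r => Su x y k l (c' - 1) c i r v + - rc x * Su x y k l c' c i r v + -1 * Su x y k l c' c i.+1 r v) =
   (fun r => Su x y k.+1 l c' c i r v) by apply/funext => r; rewrite mulN1r mulNr.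
rewrite e in h; apply: (cderiv_eq h).
by rewrite !mulr0 !addr0 mulN1r mulNr.
Qed.

Lemma near_pos (u : R) : 0 < u -> \forall r \near u, 0 < r.
Proof. by move=> u0; exact: lt_nbhsr. Qed.

(** A derivative at a positive point sees only a neighbourhood of it, so agreement for positive
    arguments suffices; the pairing evaluates its derivatives at positive points. *)
Lemma dCn_near (f : R -> C) (g : nat -> R -> C) : (forall r, 0 < r -> f r = g 0%N r) ->
  (forall k u, 0 < u -> cderiv (g k) u (g k.+1 u)) -> forall k u, 0 < u -> dCn k f u = g k u.
Proof.
move=> fg dg; elim=> [|k IH] u u0; first exact: fg.
rewrite /dCn /=; apply: dC_cderiv; apply: (@cderiv_near _ (g k)); last exact: dg.
by have := near_pos u0; apply: filterS => r r0; rewrite -(IH r r0).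
Qed.

Lemma dCn_TT x y k l c' c u v (g : R -> R -> C) : nonint c -> nonint c' -> 0 < u -> 0 < v ->
  (forall r s, 0 < r -> 0 < s -> g r s = TT x y c' c 0 r s) ->
  dCn k (fun r1 => dCn l (fun r2 => g r1 r2) v) u = Su x y k l c' c 0 u v.
Proof.
move=> nc nc' u0 v0 hg.
apply: (@dCn_near _ (fun k r => Su x y k l c' c 0 r v)) => // [r r0|k' r r0]; last exact: cderiv_Su.
apply: (@dCn_near _ (fun l => Sv x y l c' c 0 r)) => // [s s0|l' s s0]; first exact: hg.
exact: cderiv_Sv.
Qed.

(** Gamma(1) = 1 comes from Gauss' sequence, which is constant at a = 1. *)
Lemma cGamma_nat i : cGamma (i.+1%:R : C) = i`!%:R.
Proof.
have np n : nonpole (n.+1%:R : C) by move=> j; rewrite -natrD addSn; exact: natC_neq0.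
elim: i => [|i IH]; last by rewrite -natr1 (cGammaS (np i)) IH factS natrM.
have h := gauss_cGamma (np 0%N).
apply: (cvgC_unique (u := fun n => gauss_seq 1 n * cGamma 1)); last exact: h.
apply: (cvgC_near _ (cvgC_cst (cGamma (1 : C)))); apply: nearW => n.
have -> : gauss_seq (1 : C) n = 1; last by rewrite mul1r.
rewrite /gauss_seq subrr cpow0 mulr1 /cbin.
have -> : cpoch (1 : C) n = n`!%:R.
  elim: n => [|n IH]; first by rewrite /cpoch big_ord0.
  by rewrite cpochS IH factS natrM mulrC addrC natr1.
by rewrite mulfV // factC_neq0.
Qed.

Lemma pol_pow i : pol (fun tau => rc (tau ^+ i)).
Proof.
elim: i => [|i IH]; first by have := pol_cst 1; congr pol; apply/funext => t; rewrite expr0.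
have := polM (pol_rcD (lexx 0)) IH; congr pol; apply/funext => t.
by rewrite add0r -rcM -exprS.
Qed.

Lemma TT_int x y c' c i u v : 0 < u -> 0 < v ->
  TT x y c' c i u v = Jw (fun tau => rc (E * tau ^+ i) * (AA 0 c' x u tau * AA 0 c y v tau)).
Proof.
move=> u0 v0; have w0 : 0 < u + v + 1 by rewrite !addr_gt0.
have i0 : 0 < ReC (i.+1%:R : C) by rewrite Re_nat ltr0n.
have := gamma_scale i0 w0; rewrite cGamma_nat /TT => <-.
rewrite -(cintZl _ (@measurable_posR R)); last first.
  apply: (@dom_cintegrable _ _ _ (gdom (ReC i.+1%:R) 0 (u + v + 1)) (@measurable_posR R)); first exact: (cmeas_gamma _ _ (@measurable_posR R)).
    exact: integrable_gdom.
  by move=> t t0; rewrite cnorm_gamma_gdom.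
apply: eq_cint => tau t0; rewrite /expw /=.
have -> : cpow tau (i.+1%:R - 1) = rc (tau ^+ i).
  by rewrite -natr1 addrK -rc_nat cpow_rc; congr rc; rewrite -(rpowX _ t0).
set p1 := phc _ _; set p2 := phc _ _; rewrite -[LHS]mulrA.
have -> : rc (E * expR (- (x * u)) * expR (- (y * v))) * (rc (tau ^+ i) * rc (expR (- ((u + v + 1) * tau)))) =
  rc (expR (- tau)) * rc (E * tau ^+ i) * rc (expR (- ((x + tau) * u))) * rc (expR (- ((y + tau) * v))).
  rewrite -!rcM; congr rc.
  have -> : - ((u + v + 1) * tau) = - (tau * u) + - (tau * v) + - tau by ring.
  have -> : - ((x + tau) * u) = - (x * u) + - (tau * u) by ring.
  have -> : - ((y + tau) * v) = - (y * v) + - (tau * v) by ring.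
  by rewrite !expRD; ring.
ring.
Qed.

Lemma pol_SS k l c' c i (x y u v : R) : 0 < x -> 0 < y -> 0 < u -> 0 < v ->
  pol (fun tau => rc (E * tau ^+ i) * (AA k c' x u tau * AA l c y v tau)).
Proof.
move=> x0 y0 u0 v0; apply: polM.
  by have := polM (pol_cst (rc E)) (pol_pow i); congr pol; apply/funext => t; rewrite rcM.
by apply: polM; apply: pol_AA => //; exact: ltW.
Qed.

(** Differentiation under the integral in disguise: [Sv] and the integral over tau satisfy the same
    recursion in [l], and at l = 0 the claim is Euler's integral for the power of u+v+1. *)
Lemma Sv_int x y l c' c i u v : 0 < x -> 0 < y -> 0 < u -> 0 < v ->
  Sv x y l c' c i u v = Jw (fun tau => rc (E * tau ^+ i) * (AA 0 c' x u tau * AA l c y v tau)).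
Proof.
move=> x0 y0 u0 v0; elim: l c i => [|l IH] c i; first exact: TT_int.
rewrite [LHS]/= !IH.
have p1 := pol_SS 0 l c' (c - 1) i x0 y0 u0 v0; have p2 := pol_SS 0 l c' c i x0 y0 u0 v0.
have p3 := pol_SS 0 l c' c i.+1 x0 y0 u0 v0; have p2' := polM (pol_cst (rc y)) p2.
rewrite -(JwZ _ p2) -(JwB p1 p2') -(JwB (polB p1 p2') p3); apply: eq_Jw => tau _.
rewrite [AA l.+1 _ _ _ _]/= exprS !rcM rcD; set a1 := AA _ _ _ _ _; set a2 := AA _ _ _ _ _; set a3 := AA _ _ _ _ _.
by ring.
Qed.

Lemma Su_int x y k l c' c i u v : 0 < x -> 0 < y -> 0 < u -> 0 < v ->
  Su x y k l c' c i u v = Jw (fun tau => rc (E * tau ^+ i) * (AA k c' x u tau * AA l c y v tau)).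
Proof.
move=> x0 y0 u0 v0; elim: k c' i => [|k IH] c' i; first exact: Sv_int.
rewrite [LHS]/= !IH.
have p1 := pol_SS k l (c' - 1) c i x0 y0 u0 v0; have p2 := pol_SS k l c' c i x0 y0 u0 v0.
have p3 := pol_SS k l c' c i.+1 x0 y0 u0 v0; have p2' := polM (pol_cst (rc x)) p2.
rewrite -(JwZ _ p2) -(JwB p1 p2') -(JwB (polB p1 p2') p3); apply: eq_Jw => tau _.
rewrite [AA k.+1 _ _ _ _]/= exprS !rcM rcD; set a1 := AA _ _ _ _ _; set a2 := AA _ _ _ _ _; set a3 := AA _ _ _ _ _.
by ring.
Qed.

Lemma sign_sqr n : (-1) ^+ n * (-1) ^+ n = 1 :> C.
Proof. by rewrite -expr2 sqrr_sign. Qed.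

(** With 1/(u+v+1) spread over tau, [pair_step] applies first in [v], with [AA k] as free factor,
    then in [u], with [Psi l] as free factor. The signs they produce cancel against that of
    [pair2]. *)
Lemma pair2_TT (a b c' c : C) (x y : R) (g : R -> R -> C) : 0 < x -> 0 < y -> nonint c -> nonint c' ->
  (forall r s, 0 < r -> 0 < s -> g r s = TT x y c' c 0 r s) ->
  pair2 a b g = rc E * Jw (fun tau => Psi (kcont a) a c' (x + tau) * Psi (kcont b) b c (y + tau)).
Proof.
move=> x0 y0 nc nc' hg; rewrite /pair2; set k := kcont a; set l := kcont b.
have kc (w : C) : -1 < ReC w + (kcont w)%:R.
  have := truncnS_gt `|ReC w|; have := ler_norm (- ReC w); rewrite normrN /kcont; lra.
have E1 u : 0 < u -> cint posR (fun v => phi (a + k%:R) u * phi (b + l%:R) v *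
     dCn k (fun r1 => dCn l (fun r2 => g r1 r2) v) u) =
   (-1) ^+ l * rc E * (phi (a + k%:R) u * Jw (fun tau => Psi l b c (y + tau) * AA k c' x u tau)).
  move=> u0; have pA := pol_AA k c' (ltW x0) u0.
  have [i1 e1] := pair_step c pA (kc b) y0; rewrite -/l in i1 e1.
  have e1' : cint posR (fun v => phi (b + l%:R) v * Jw (fun tau => AA k c' x u tau * AA l c y v tau)) =
     (-1) ^+ l * Jw (fun tau => AA k c' x u tau * Psi l b c (y + tau)).
    by rewrite -e1 mulrA sign_sqr mul1r.
  have -> : Jw (fun tau => Psi l b c (y + tau) * AA k c' x u tau) = Jw (fun tau => AA k c' x u tau * Psi l b c (y + tau)).
    by apply: eq_Jw => tau _; exact: mulrC.
  rewrite [RHS](_ : _ = rc E * phi (a + k%:R) u * ((-1) ^+ l * Jw (fun tau => AA k c' x u tau * Psi l b c (y + tau)))); last first.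
    by set p := phi _ _; set q := Jw _; ring.
  rewrite -e1' -(cintZl _ (@measurable_posR R) i1).
  apply: eq_cint => v v0; rewrite (dCn_TT k l nc nc' u0 v0 hg) (Su_int k l c' c 0 x0 y0 u0 v0).
  have -> : Jw (fun tau => rc (E * tau ^+ 0) * (AA k c' x u tau * AA l c y v tau)) = rc E * Jw (fun tau => AA k c' x u tau * AA l c y v tau).
    rewrite -JwZ; last by apply: polM pA _; apply: pol_AA => //; exact: ltW.
    by apply: eq_Jw => tau _; rewrite expr0 mulr1.
  by set p := phi _ _; set p' := phi _ _; set q := Jw _; ring.
rewrite (@eq_cint R P _ _ E1).
have [i2 e2] := pair_step c' (pol_Psi c (kc b) y0) (kc a) x0; rewrite -/k -/l in i2 e2.
rewrite (cintZl _ (@measurable_posR R) i2).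
have -> : Jw (fun tau => Psi k a c' (x + tau) * Psi l b c (y + tau)) = Jw (fun tau => Psi l b c (y + tau) * Psi k a c' (x + tau)).
  by apply: eq_Jw => tau _; exact: mulrC.
rewrite -e2 exprD; set q := cint _ _; set e := rc E.
rewrite (_ : _ * _ = ((-1) ^+ l * (-1) ^+ l) * (e * ((-1) ^+ k * q))); last by ring.
by rewrite sign_sqr mul1r.
Qed.
End Derivatives.

(** The factor t = z z' is what the Gamma quotients of the two [Theta] leave over. *)
Lemma Mker_Klim (z z' : C) (x y : R) : nonint z -> nonint z' -> ImC (z * z') = 0 -> 0 < x -> 0 < y ->
  Mker z z' x y = Klim (kcont (- z)) (kcont (- z')) z z' x y.
Proof.
move=> nz nz' im0 x0 y0; rewrite /Mker.
set E := expR (- (2^-1 * (x + y))).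
rewrite (@pair2_TT E (- z) (- z') z' z x y) //; last first.
  move=> r s r0 s0; rewrite /TT /phi !addr_gt0 // fact0 mul1r.
  rewrite (cpowN _ 1%:R) cpow1 ?addr_gt0 //; congr (_ * _ * rc _ * _).
  by rewrite /E -!expRD; congr expR; field.
rewrite /Klim; set k := kcont _; set l := kcont _.
have kc (w : C) : -1 < ReC w + (kcont w)%:R.
  have := truncnS_gt `|ReC w|; have := ler_norm (- ReC w); rewrite normrN /kcont; lra.
have pp := polM (pol_Psi z' (kc (- z)) x0) (pol_Psi z (kc (- z')) y0); rewrite -/k -/l in pp.
rewrite -(JwZ _ pp) -(JwZ _ (polM (pol_cst (rc E)) pp)).
have -> : rc (tpar z z') = z * z' by apply: eqC => //; rewrite im0.
apply: eq_cint => tau t0; rewrite /expw /Theta (cGammaS (nonint_nonpole nz)) (cGammaS (nonint_nonpole nz')) rcM.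
have g1 := cGamma_neq0 (nonint_nonpole nz); have g2 := cGamma_neq0 (nonint_nonpole nz').
set G1 := cGamma z in g1 *; set G2 := cGamma z' in g2 *; set p1 := Psi _ _ _ _; set p2 := Psi _ _ _ _.
have -> : z' * G2 / G1 * p1 * (z * G1 / G2 * p2) = G1 * G1^-1 * (G2 * G2^-1) * (z * z' * (p1 * p2)) by ring.
rewrite (mulfV g1) (mulfV g2); ring.
Qed.
End MkerFormula.

(** * The discrete kernel and its gauge *)

Section Gauge.
Context {R : realType}.
Local Notation C := R[i].

(* The only consequence of admissibility that is used. *)
Definition pairpos (z z' : C) := forall i : int, exists2 r : R, 0 < r & (z + i%:~R) * (z' + i%:~R) = rc r.

Lemma pairpos_sym z z' : pairpos z z' -> pairpos z' z.
Proof. by move=> h i; have [r r0 e] := h i; exists r => //; rewrite mulrC. Qed.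
Lemma pairpos_nonint z z' : pairpos z z' -> nonint z.
Proof.
move=> h i; apply/eqP => zi; have [r r0] := h (- i); rewrite zi rmorphN subrr mul0r => e.
by have := congr1 (@ReC R) e; rewrite /= => e0; rewrite -e0 ltxx in r0.
Qed.
Lemma pairposN z z' : pairpos z z' -> pairpos (- z) (- z').
Proof.
move=> h i; have [r r0 e] := h (- i); exists r => //; by rewrite -e rmorphN; ring.
Qed.
Lemma pairposD1 z z' : pairpos z z' -> pairpos (z + 1) (z' + 1).
Proof. by move=> h i; have [r r0 e] := h (1 + i); exists r => //; rewrite -e rmorphD !addrA. Qed.

(** For conjugate parameters the product is the square of |z + i|; for real ones z + i and z' + i
    lie between the same two consecutive integers and have the same sign. *)
Lemma admissible_pairpos z z' : admissible z z' -> pairpos z z'.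
Proof.
case=> [[-> nz] i|[im [im' [m [/andP[m1 m2] /andP[m3 m4]]]]] i].
  exists (cnorm (z + i%:~R) ^+ 2).
    rewrite exprn_gt0 // cnorm_gt0 // addr_eq0; apply/eqP => zi; apply: nz; exists (- i).
    by rewrite rmorphN.
  rewrite /cnorm sqr_sqrtr ?addr_ge0 ?sqr_ge0 //; have -> : (i%:~R : C) = rc i%:~R.
    by case: i => k; rewrite ?NegzE ?rmorphN /= ?rcN ?rc_nat.
  by case: z {nz} => a b; apply: eqC => /=; ring.
have e (w : C) : ImC w = 0 -> w + i%:~R = rc (ReC w + i%:~R).
  move=> w0; have -> : (i%:~R : C) = rc i%:~R by case: i => k; rewrite ?NegzE ?rmorphN /= ?rcN ?rc_nat.
  by rewrite rcD; congr (_ + _); apply: eqC.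
exists ((ReC z + i%:~R) * (ReC z' + i%:~R)); last by rewrite (e z im) (e z' im') -rcM.
have mi : (m + i < 0)%R \/ (0 <= m + i)%R by case: (ltP (m + i) 0); [left|right].
case: mi => mi.
  have h : ((m + i)%:~R + 1 : R) <= 0 by rewrite -[1]/(1%:~R) -intrD lerz0; lia.
  by rewrite rmorphD in h; rewrite nmulr_rgt0; lra.
have h : 0 <= (m + i)%:~R :> R by rewrite ler0z.
by rewrite rmorphD in h; rewrite mulr_gt0 //; lra.
Qed.

Definition uw (a b : C) p : R := ReC (cbin a p * cbin b p).
Lemma uwE a b p : pairpos a b -> rc (uw a b p) = cbin a p * cbin b p /\ 0 < uw a b p.
Proof.
move=> h; suff [r r0 e] : exists2 r, 0 < r & cbin a p * cbin b p = rc r by rewrite /uw e.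
elim: p => [|p [r r0 e]]; first by exists 1; rewrite ?ltr01 // !cbin0 mulr1.
have [s s0 e'] := h p; exists (r * s / p.+1%:R ^+ 2); first by rewrite divr_gt0 ?mulr_gt0 ?exprn_gt0.
rewrite !cbinS !rcM rcV rcX rc_nat -e -e' expr2 (invfM p.+1%:R p.+1%:R).
by set i := (p.+1%:R)^-1; rewrite -[p%:~R]/(p%:R); ring.
Qed.

Lemma cbin_inv_bound (a : C) : nonpole a -> exists (K : R) p, 0 < K /\ forall n, cnorm (cbin a n)^-1 <= K * n.+1%:R ^+ p.
Proof.
move=> na; have g0 := cGamma_neq0 na.
have g0' : (cGamma a)^-1 != 0 by rewrite invr_eq0.
have [M hM] := cvgC_bounded (cvgCV g0' (gauss_seq_cvg na)).
exists (Num.max M 1), (Num.truncn `|ReC (1 - a)|).+1; split => [|n]; first by rewrite lt_max ltr01 orbT.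
have n0 : 0 < n.+1%:R :> R by rewrite ltr0n.
have -> : (cbin a n)^-1 = (gauss_seq a n)^-1 * cpow (n.+1%:R : R) (1 - a).
  have c0 := cpow_neq0 (n.+1%:R : R) (1 - a).
  rewrite /gauss_seq; set x := cbin a n; set y := cpow _ _ in c0 *.
  by rewrite (invfM x y) -mulrA (mulVf c0) mulr1.
rewrite cnormM cnorm_cpow_rpow; apply: ler_pM => //; first exact: cnorm_ge0.
- exact: rpow_ge0.
- by rewrite le_max hM.
rewrite -rpowX //; apply: rpow_le1; first by rewrite ler1n.
by rewrite (le_trans (ler_norm _)) // ltW // truncnS_gt.
Qed.

(** The origin of the Cauchy matrix 1/(p+q+1) in the measure: up to weights in p or q alone it is
    the product of the Hankel matrix of (1-x)^-z and the Toeplitz matrix of (1-x)^z. *)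
Lemma beta_sum (z : C) p q : \sum_(i < q.+1) cbin z (p + i).+1 * cbin (- z) (q - i) =
  z * cbin (z + 1) p * cbin (1 - z) q / (p + q).+1%:R.
Proof.
have sh1 n : cbin z n.+1 = z * cbin (z + 1) n / n.+1%:R.
  by rewrite cbin_shift cbinS mulrA.
have sh2 n : cbin (- z) n.+1 = - z * cbin (1 - z) n / n.+1%:R.
  by rewrite [1 - z]addrC cbin_shift cbinS mulrA.
elim: q p => [|q IH] p.
  by rewrite big_ord1 !cbin0 !mulr1 !addn0 sh1.
rewrite big_ord_recl addn0 subn0 (eq_bigr (fun i : 'I_q.+1 => cbin z (p.+1 + i).+1 * cbin (- z) (q - i))); last first.
  by move=> i _; rewrite lift0 addnS addSn subSS.
rewrite IH sh1 sh2 cbinS [cbin (1 - z) q.+1]cbinS addSn addnS.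
set a := cbin _ p; set b := cbin _ q.
have p0 := @natC_neq0 R p; have q0 := @natC_neq0 R q; have pq0 := @natC_neq0 R (p + q).+1.
have -> : (p + q).+2%:R = p.+1%:R + q.+1%:R :> C by rewrite -natrD addSn addnS.
have pq1 : p.+1%:R + q.+1%:R != 0 :> C by rewrite -natrD addSn addnS.
have -> : z + 1 + p%:R = z + p.+1%:R by rewrite -natr1; ring.
have -> : 1 - z + q%:R = q.+1%:R - z by rewrite -natr1; ring.
move: p0 q0 pq1; move: (p.+1%:R) (q.+1%:R) a b => x y a b x0 y0 xy0.
by field; rewrite ?x0 ?y0 ?xy0.
Qed.

(** The product of (1 - x)^z and (1 - x)^-z is 1. For n > 0 all terms but one are the sum in
    [beta_sum] at p = 0. *)
Lemma cbin_conv (z : C) n : \sum_(s < n.+1) cbin (- z) s * cbin z (n - s) = (n == 0)%:R.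
Proof.
case: n => [|n]; first by rewrite big_ord1 !cbin0 mulr1.
rewrite big_ord_recr /= subnn cbin0 mulr1.
have sh2 : cbin (- z) n.+1 = - z * cbin (1 - z) n / n.+1%:R.
  by rewrite [1 - z]addrC cbin_shift cbinS mulrA.
have := beta_sum z 0 n; rewrite cbin0 mulr1 add0n => h.
rewrite (reindex_inj rev_ord_inj) /= (eq_bigr (fun i : 'I_n.+1 => cbin z (0 + i).+1 * cbin (- z) (n - i))); last first.
  move=> i _; have li : (i <= n)%N by rewrite -ltnS; case: i.
  by rewrite mulrC add0n subSS subSn ?leq_subr // subKn.
by rewrite h sh2 mulNr mulNr addrN.
Qed.

Lemma sqrt_uw a b n : pairpos a b ->
  rc (Num.sqrt (uw a b n)) * rc (Num.sqrt (uw a b n)) = cbin a n * cbin b n /\ rc (Num.sqrt (uw a b n)) != 0 :> C.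
Proof.
move=> pp; have [e u0] := uwE n pp; split; last by rewrite rc_neq0 // sqrtr_eq0 -ltNge.
by rewrite -rcM -e -expr2 sqr_sqrtr // ltW.
Qed.

(** The square of the modulus is |cbin a n| / |cbin b n|, so that a lower bound for one coefficient
    enters besides an upper bound for the other. *)
Lemma gauge_bound a b : pairpos a b -> exists (K : R) p, 0 < K /\
  forall n, cnorm (cbin a n / rc (Num.sqrt (uw a b n))) <= K * n.+1%:R ^+ p.
Proof.
move=> pp; have [K [p [K0 hK]]] := cbin_bound a.
have npb := nonint_nonpole (pairpos_nonint (pairpos_sym pp)).
have npa := nonint_nonpole (pairpos_nonint pp).
have [L [q [L0 hL]]] := cbin_inv_bound npb.
exists (1 + K * L), (p + q)%N; split => [|n]; first by rewrite addr_gt0 // mulr_gt0.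
set w := _ / _.
have w2 : cnorm w ^+ 2 = cnorm (cbin a n) * cnorm (cbin b n)^-1.
  rewrite -cnormX -cnormM; congr cnorm.
  have [e s0] := sqrt_uw n pp; have a0 := cbin_neq0 n npa; have b0 := cbin_neq0 n npb.
  rewrite /w expr2; set s := rc _ in e s0 *; set x := cbin a n in e a0 *; set y := cbin b n in e b0 *.
  have -> : x / s * (x / s) = x * x / (s * s) by rewrite (invfM s s); ring.
  by rewrite e (invfM x y) mulrACA (mulfV a0) mul1r.
have h1 : 1 <= n.+1%:R ^+ (p + q) :> R by rewrite exprn_ege1 // ler1n.
have h2 : cnorm w ^+ 2 <= K * L * n.+1%:R ^+ (p + q).
  rewrite w2 exprD mulrACA; apply: ler_pM (cnorm_ge0 _) (cnorm_ge0 _) (hK n) (hL n).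
(* The inequality |w| <= 1 + |w|^2 avoids the square root of a polynomial bound. *)
rewrite mulrDl mul1r; apply: (@le_trans _ _ (1 + cnorm w ^+ 2)); last exact: lerD.
by have := sqr_ge0 (cnorm w - 1); rewrite sqrrB1; have := cnorm_ge0 w; lra.
Qed.

Section Main.
Variables (z z' : C).
Hypothesis pp : pairpos z z'.
Let nz := pairpos_nonint pp.
Let nz' := pairpos_nonint (pairpos_sym pp).
Lemma ppA : pairpos (z + 1) (z' + 1). Proof. exact: pairposD1. Qed.
Lemma ppB : pairpos (1 - z) (1 - z').
Proof. by rewrite [1 - z]addrC [1 - z']addrC; apply/pairposD1/pairposN. Qed.
Lemma tparE : rc (tpar z z') = z * z' /\ 0 < tpar z z'.
Proof. by have [r r0] := pp 0; rewrite !addr0 /tpar => ->. Qed.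

(** Chosen so that det(A(p_i, q_j))^2 is the poissonized weight of the configuration (p, q); see
    [det_Amx]. *)
Definition Amx M : 'M[R]_(NN M) := \matrix_(p, q)
  (Num.sqrt (tpar z z') * Num.sqrt (uw (z + 1) (z' + 1) p) * rr M ^+ p.+1 *
   (Num.sqrt (uw (1 - z) (1 - z') q) * rr M ^+ q) / (p + q).+1%:R).

(* Conjugation by diag(gx) carries the real symmetric A A^T to the complex Wiener-Hopf
   product. *)
Definition gx (a b : C) n : C := cbin a n / rc (Num.sqrt (uw a b n)).
Definition Gd N : 'M[C]_N := diag_mx (\row_i gx (z + 1) (z' + 1) i).
Definition Gi N : 'M[C]_N := diag_mx (\row_i gx (z' + 1) (z + 1) i).

Lemma diag_conjE N (f g : nat -> C) (B : 'M[C]_N) i j :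
  (diag_mx (\row_i f i) *m B *m diag_mx (\row_i g i)) i j = f i * B i j * g j.
Proof. by rewrite mul_mx_diag mul_diag_mx !mxE. Qed.

Lemma uwC a b n : uw a b n = uw b a n.
Proof. by rewrite /uw mulrC. Qed.

Lemma gxM n : gx (z + 1) (z' + 1) n * gx (z' + 1) (z + 1) n = 1.
Proof.
rewrite /gx (uwC (z' + 1)); have [e s0] := sqrt_uw n ppA.
by rewrite mulrACA -e -(invfM (rc _) (rc _)) mulfV // mulf_neq0.
Qed.
Lemma Gdi N : Gd N *m Gi N = 1%:M.
Proof.
rewrite mulmx_diag -[RHS]diag_const_mx; congr diag_mx; apply/rowP => i; rewrite !mxE; exact: gxM.
Qed.
Lemma Gid N : Gi N *m Gd N = 1%:M.
Proof.
rewrite mulmx_diag -[RHS]diag_const_mx; congr diag_mx; apply/rowP => i; rewrite !mxE mulrC; exact: gxM.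
Qed.

(** The coefficients of (1 - r x)^(-a) with r = [rr M]. *)
Definition geo M (a : C) n : C := rc (rr M ^+ n) * cbin a n.

Lemma hankel_toeplitzE M (a : C) (x q : 'I_(NN M)) :
  (hankel_mx (NN M) (geo M a) *m toeplitz_mx (NN M) (geo M (- a))) x q =
  rc (rr M ^+ (x + q).+1) * (a * cbin (a + 1) x * cbin (1 - a) q / (x + q).+1%:R).
Proof.
rewrite mxE (eq_bigr (fun l : 'I_(NN M) => if (l <= q)%N then geo M a (x + l).+1 * geo M (- a) (q - l)%N else 0)); last first.
  by move=> l _; rewrite !mxE; case: ifP => // _; rewrite mulr0.
rewrite (sum_ord_le (fun l => geo M a (x + l).+1 * geo M (- a) (q - l)%N) (ltn_ord q)) -beta_sum mulr_sumr.
apply: eq_bigr => i _; rewrite /geo mulrACA -rcM -exprD; congr (rc (_ ^+ _) * _).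
by rewrite addSn -addnA subnKC // -ltnS.
Qed.

Lemma toeplitz_hankelE M (a : C) (q y : 'I_(NN M)) :
  ((toeplitz_mx (NN M) (geo M (- a)))^T *m hankel_mx (NN M) (geo M a)) q y =
  rc (rr M ^+ (y + q).+1) * (a * cbin (a + 1) y * cbin (1 - a) q / (y + q).+1%:R).
Proof.
rewrite -hankel_toeplitzE !mxE; apply: eq_bigr => l _.
by rewrite !mxE mulrC addnC.
Qed.

Lemma hankel_toeplitz_asum M (a b : C) (x k : 'I_(NN M)) :
  (hankel_mx (NN M) (geo M a) *m (toeplitz_mx (NN M) (geo M (- b)))^T) x k =
  rc (rr M ^+ (x.+1 + k)) * asum a b M (x.+1 + k) (NN M - k).
Proof.
rewrite mxE (eq_bigr (fun l : 'I_(NN M) => if (k <= l)%N then geo M a (x + l).+1 * geo M (- b) (l - k)%N else 0)); last first.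
  by move=> l _; rewrite !mxE; case: ifP => // _; rewrite mulr0.
rewrite (sum_ord_ge _ _ (fun l => geo M a (x + l).+1 * geo M (- b) (l - k)%N)) /asum mulr_sumr.
apply: eq_bigr => s _; rewrite /geo addnK -rrX2.
have -> : (x + (s + k)).+1 = (x.+1 + k + s)%N by rewrite addSn addnA addnAC.
rewrite mulrACA -rcM -exprD (_ : (x.+1 + k + s + s = (x.+1 + k) + 2 * s)%N); last by rewrite mul2n -addnn addnA.
by rewrite exprD rcM; set c1 := cbin _ _; set c2 := cbin _ _; ring.
Qed.

Lemma toeplitz_hankel_asum M (a b : C) (k y : 'I_(NN M)) :
  (toeplitz_mx (NN M) (geo M (- b)) *m hankel_mx (NN M) (geo M a)) k y =
  rc (rr M ^+ (y.+1 + k)) * asum a b M (y.+1 + k) (NN M - k).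
Proof.
rewrite -hankel_toeplitz_asum !mxE; apply: eq_bigr => l _.
by rewrite !mxE mulrC addnC.
Qed.

Lemma gauge_L M :
  (hankel_mx (NN M) (geo M z) *m toeplitz_mx (NN M) (geo M (- z))) *m
  ((toeplitz_mx (NN M) (geo M (- z')))^T *m hankel_mx (NN M) (geo M z')) =
  Gd (NN M) *m map_mx rc (Amx M *m (Amx M)^T) *m Gi (NN M).
Proof.
apply/matrixP => x y; rewrite mul_mx_diag mul_diag_mx !mxE.
rewrite rc_sum mulr_sumr mulr_suml; apply: eq_bigr => q _.
rewrite hankel_toeplitzE toeplitz_hankelE !mxE.
have [ex0 sx0] := sqrt_uw x ppA; have [ey0 sy0] := sqrt_uw y ppA; have [eq0 _] := sqrt_uw q ppB.
have [et t0] := tparE.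
have est : rc (Num.sqrt (tpar z z')) * rc (Num.sqrt (tpar z z')) = z * z'.
  by rewrite -rcM -expr2 sqr_sqrtr ?et // ltW.
rewrite /gx (uwC (z' + 1) (z + 1) y) !(rcM, rcV, rc_nat) !exprS !exprD !rcM.
move: ex0 sx0 ey0 sy0 eq0 est.
set sx := rc (Num.sqrt (uw (z + 1) (z' + 1) x)); set sy := rc (Num.sqrt (uw (z + 1) (z' + 1) y)).
set sq := rc (Num.sqrt (uw (1 - z) (1 - z') q)); set st := rc (Num.sqrt _).
set cx := cbin (z + 1) x; set cy := cbin (z' + 1) y; set dq := cbin (1 - z) q; set dq' := cbin (1 - z') q.
move=> ex0 sx0 ey0 sy0 eq0 est.
set i1 := (_^-1); set i2 := ((y + q).+1%:R)^-1; set r := rc (rr M); set rx := rc (rr M ^+ x).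
set ry := rc (rr M ^+ y); set rq := rc (rr M ^+ q).
transitivity ((sx * sx^-1) * (sy * sy^-1) * (st * st) * (sq * sq) * (cx * cy) * (r * r * rx * ry * rq * rq) * (i1 * i2)).
  by rewrite est eq0 !mulfV //; ring.
by ring.
Qed.

(** The factors of [gauge_L] with the two Toeplitz matrices in the other order, as [L] and [K] are
    related in [wiener_hopf_defect]. *)
Lemma kern_mx M : \matrix_(x < NN M, y < NN M) kern z z' M x y =
  (hankel_mx (NN M) (geo M z) *m (toeplitz_mx (NN M) (geo M (- z')))^T) *m
  (toeplitz_mx (NN M) (geo M (- z)) *m hankel_mx (NN M) (geo M z')).
Proof.
apply/matrixP => x y; rewrite !mxE /kern; apply: eq_bigr => k _.
by rewrite hankel_toeplitz_asum toeplitz_hankel_asum.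
Qed.

Lemma geo_conv M (a : C) n : \sum_(s < n.+1) geo M (- a) s * geo M a (n - s)%N = (n == 0)%:R.
Proof.
transitivity (rc (rr M ^+ n) * \sum_(s < n.+1) cbin (- a) s * cbin a (n - s)).
  rewrite mulr_sumr; apply: eq_bigr => s _; rewrite /geo mulrACA -rcM -exprD subnKC // -ltnS //.
by rewrite cbin_conv; case: n => [|n]; rewrite ?mulr0 // expr0 mulr1.
Qed.
Lemma toeplitz_inv M (a : C) : toeplitz_mx (NN M) (geo M (- a)) *m toeplitz_mx (NN M) (geo M a) = 1%:M.
Proof. by apply: toeplitz_mxK => n; exact: geo_conv. Qed.
Lemma toeplitz_inv' M (a : C) : toeplitz_mx (NN M) (geo M a) *m toeplitz_mx (NN M) (geo M (- a)) = 1%:M.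
Proof. by rewrite -{1}(opprK a) toeplitz_inv. Qed.

Definition Edef M : 'M[C]_(NN M) :=
  (hankel_mx (NN M) (geo M z) *m toeplitz_mx (NN M) (geo M (- z)) *m (toeplitz_mx (NN M) (geo M (- z')))^T) *m
  toeplitz_defect (NN M) (geo M z) (geo M z') *m
  ((toeplitz_mx (NN M) (geo M (- z')))^T *m (toeplitz_mx (NN M) (geo M (- z)) *m hankel_mx (NN M) (geo M z'))).

Lemma gauge_defect M (L := Gd (NN M) *m map_mx rc (Amx M *m (Amx M)^T) *m Gi (NN M))
  (K := \matrix_(x < NN M, y < NN M) kern z z' M x y) : L - K - L *m K = Edef M.
Proof.
rewrite /L /K -gauge_L kern_mx.
set H1 := hankel_mx _ _; set U := toeplitz_mx _ (geo M (- z)); set V := (toeplitz_mx _ (geo M (- z')))^T.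
set H2 := hankel_mx _ (geo M z').
pose Ui := toeplitz_mx (NN M) (geo M z); pose Vi := (toeplitz_mx (NN M) (geo M z'))^T.
have h1 : U *m Ui = 1%:M by exact: toeplitz_inv.
have h2 : Ui *m U = 1%:M by exact: toeplitz_inv'.
have h3 : V *m Vi = 1%:M by rewrite -trmx_mul toeplitz_inv' trmx1.
have h4 : Vi *m V = 1%:M by rewrite -trmx_mul toeplitz_inv trmx1.
by rewrite (wiener_hopf_defect H1 H2 h1 h2 h3 h4) -(mulmxA V U H2).
Qed.

Definition resid M : 'M[C]_(NN M) :=
  map_mx rc (invmx (1%:M + Amx M *m (Amx M)^T)) *m (Gi (NN M) *m Edef M *m Gd (NN M)).
Definition Kmx M : 'M[R]_(NN M) := 1%:M - invmx (1%:M + Amx M *m (Amx M)^T).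
Definition Wmx M : 'M[C]_(NN M) := Gd (NN M) *m resid M *m Gi (NN M).

Lemma map_rcM m n p (A : 'M[R]_(m, n)) (B : 'M[R]_(n, p)) : map_mx rc (A *m B) = map_mx rc A *m map_mx rc B :> 'M[C]_(m, p).
Proof. by apply/matrixP => i j; rewrite !mxE rc_sum; apply: eq_bigr => k _; rewrite !mxE rcM. Qed.
Lemma map_rcD m n (A B : 'M[R]_(m, n)) : map_mx rc (A + B) = map_mx rc A + map_mx rc B :> 'M[C]_(m, n).
Proof. by apply/matrixP => i j; rewrite !mxE rcD. Qed.
Lemma map_rcN m n (A : 'M[R]_(m, n)) : map_mx rc (- A) = - map_mx rc A :> 'M[C]_(m, n).
Proof. by apply/matrixP => i j; rewrite !mxE rcN. Qed.
Lemma map_rc1 n : map_mx rc (1%:M : 'M[R]_n) = 1%:M :> 'M[C]_n.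
Proof. by apply/matrixP => i j; rewrite !mxE; case: (i == j). Qed.

(** The relation L - (1 + L) K = E gives 1 - (1 + L)^-1 - K = (1 + L)^-1 E. The inverse is taken for
    the real symmetric matrix and only then conjugated, because [sym_resolvent_bound] holds on that
    side. *)
Lemma gauge_K M : Gd (NN M) *m map_mx rc (Kmx M) *m Gi (NN M) = \matrix_(x, y) kern z z' M x y + Wmx M.
Proof.
set K := \matrix_(x, y) _; set G := Gd _; set H := Gi _; set S := map_mx rc (Amx M *m (Amx M)^T) : 'M[C]_(NN M).
have GH : G *m H = 1%:M := Gdi _; have HG : H *m G = 1%:M := Gid _.
have eE := gauge_defect M; rewrite /= -/K -/G -/H -/S in eE.
pose I := map_mx rc (invmx (1%:M + Amx M *m (Amx M)^T)) : 'M[C]_(NN M).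
have IS : I *m (1%:M + S) = 1%:M.
  by rewrite -(map_rc1 (NN M)) -map_rcD -map_rcM mulVmx // sym_resolvent_unit.
have e1 : H *m Edef M *m G = S - (1%:M + S) *m (H *m K *m G).
  rewrite -eE !mulmxBr !mulmxBl !mulmxDl mul1mx opprD addrA.
  rewrite !mulmxA HG mul1mx -!mulmxA HG mulmx1 !mulmxA; congr (_ - _ - _).
have e2 : resid M = 1%:M - I - H *m K *m G.
  rewrite /resid -/G -/H -/I e1 mulmxBr (mulmxA I (1%:M + S)) IS mul1mx; congr (_ - _).
  by rewrite -IS mulmxDr mulmx1 addrC addKr.
rewrite /Wmx -/G -/H e2 /Kmx map_rcD map_rcN map_rc1 -/I.
rewrite [_ *m (_ - _ - _)]mulmxBr [(_ - _) *m H]mulmxBl.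
have -> : G *m (H *m K *m G) *m H = K by rewrite !mulmxA GH mul1mx -mulmxA GH mulmx1.
by rewrite addrCA subrr addr0.
Qed.

Lemma gauge_det M n (x : 'I_n -> 'I_(NN M)) :
  rc (\det (\matrix_(i, j) Kmx M (x i) (x j))) =
  \det (\matrix_(i, j) (kern z z' M (x i) (x j) + Wmx M (x i) (x j))).
Proof.
have e (i j : 'I_(NN M)) : kern z z' M i j + Wmx M i j = gx (z + 1) (z' + 1) i * rc (Kmx M i j) * gx (z' + 1) (z + 1) j.
  have := congr1 (fun A : 'M[C]_(NN M) => A i j) (gauge_K M).
  by rewrite [in RHS]mxE [X in X + _]mxE => <-; rewrite mul_mx_diag mul_diag_mx !mxE.
have -> : \matrix_(i, j) (kern z z' M (x i) (x j) + Wmx M (x i) (x j)) =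
  diag_mx (\row_i gx (z + 1) (z' + 1) (x i)) *m map_mx rc (\matrix_(i, j) Kmx M (x i) (x j)) *m
  diag_mx (\row_j gx (z' + 1) (z + 1) (x j)).
  by apply/matrixP => i j; rewrite [LHS]mxE e mul_mx_diag mul_diag_mx !mxE.
rewrite !det_mulmx !det_diag mulrAC -big_split big1 ?mul1r; last by move=> i _; rewrite /= !mxE gxM.
rewrite /determinant rc_sum; apply: eq_bigr => s _; rewrite rcM rcX rcN rc_prod.
by congr (_ * _); apply: eq_bigr => i _; rewrite !mxE.
Qed.

Lemma le_rc (x y : R) : (rc x <= rc y :> C) = (x <= y).
Proof. exact: lecR. Qed.

Lemma geo_geo_bounded M (a : C) (K : R) p : (forall n, cnorm (cbin a n) <= K * n.+1%:R ^+ p) -> 0 <= K ->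
  geo_bounded (NN M) (rc (K * (2 * NN M).+1%:R ^+ p)) (rc (rr M)) (geo M a).
Proof.
move=> h K0 n nN; rewrite cnorm_normr -rcX -rcM le_rc /geo cnormM cnorm_rc ger0_norm ?exprn_ge0 ?rr_ge0 // mulrC.
apply: ler_wpM2r; first exact: exprn_ge0 (rr_ge0 M).
apply: (le_trans (h n)); apply: ler_wpM2l => //.
by apply: lerXn2r; rewrite ?nnegrE // ler_nat.
Qed.

Lemma Edef_bound : exists (K : R) p, 0 <= K /\ forall M x y,
  cnorm (Edef M x y) <= 2 * (NN M)%:R ^+ 7 * ((K * (2 * NN M).+1%:R ^+ p) ^+ 8 * ex M (NN M)).
Proof.
have [K1 [p1 [K10 h1]]] := cbin_bound z; have [K2 [p2 [K20 h2]]] := cbin_bound (- z).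
have [K3 [p3 [K30 h3]]] := cbin_bound z'; have [K4 [p4 [K40 h4]]] := cbin_bound (- z').
pose K := K1 + K2 + K3 + K4; pose p := (p1 + p2 + p3 + p4)%N.
have K0 : 0 <= K by rewrite !addr_ge0 ?(ltW K10) ?(ltW K20) ?(ltW K30) ?(ltW K40).
have wk a K' p' : (forall n, cnorm (cbin a n) <= K' * n.+1%:R ^+ p') -> K' <= K -> 0 <= K' -> (p' <= p)%N ->
   forall n, cnorm (cbin a n) <= K * n.+1%:R ^+ p.
  move=> h KK K'0 pp' n; apply: (le_trans (h n)); apply: ler_pM => //.
  by apply: ler_weXn2l => //; rewrite ler1n.
exists K, p; split => // M x y.
have gb a : (forall n, cnorm (cbin a n) <= K * n.+1%:R ^+ p) ->
    geo_bounded (NN M) (rc (K * (2 * NN M).+1%:R ^+ p)) (rc (rr M)) (geo M a).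
  by move=> hh; apply: geo_geo_bounded.
have [k1 k2 k3 k4] : [/\ K1 <= K, K2 <= K, K3 <= K & K4 <= K] by rewrite /K; split; lra.
have [q1 q2 q3 q4] : [/\ p1 <= p, p2 <= p, p3 <= p & p4 <= p]%N by rewrite /p; split; clear; lia.
have b1 := gb _ (wk _ _ _ h1 k1 (ltW K10) q1).
have b2 := gb _ (wk _ _ _ h2 k2 (ltW K20) q2).
have b3 := gb _ (wk _ _ _ h3 k3 (ltW K30) q3).
have b4 := gb _ (wk _ _ _ h4 k4 (ltW K40) q4).
rewrite -le_rc -cnorm_normr.
have P0 : 0 <= rc (K * (2 * NN M).+1%:R ^+ p) :> C by rewrite -[0]/(rc 0) le_rc mulr_ge0 // exprn_ge0.
have r0 : 0 <= rc (rr M) :> C by rewrite -[0]/(rc 0) le_rc rr_ge0.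
have r1 : rc (rr M) <= 1 :> C by rewrite -[1]/(rc 1) le_rc rr_le1.
have := wiener_hopf_bound P0 r0 r1 x y b1 b2 b3 b4.
by rewrite -!rcX rrX2 -rc_nat -!rcM natrM natrX.
Qed.

Lemma cnorm_sum_Re n (f : 'I_n -> C) c : (forall i, cnorm (f i) <= c) -> \sum_i `|ReC (f i)| <= n%:R * c.
Proof.
move=> h; rewrite -[n in n%:R]card_ord mulr_natl -sumr_const; apply: ler_sum => i _.
exact: le_trans (Re_le_cnorm _) (h i).
Qed.

Lemma resid_bound M c : (forall x y, cnorm ((Gi (NN M) *m Edef M *m Gd (NN M)) x y) <= c) ->
  forall x y, cnorm (resid M x y) <= 2 * ((NN M)%:R * c).
Proof.
move=> h x y; set E' := _ *m Gd _ in h.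
have key (w : C) : cnorm w = cnorm (mkC 0 (-1) * w).
  by rewrite cnormM (_ : cnorm (mkC 0 (-1)) = 1) ?mul1r // /cnorm /= expr0n add0r sqrrN expr1n sqrtr1.
(* The real resolvent bound is applied to the real part of [s] times a column: s = 1 gives the real
   part and s = -i the imaginary part. *)
have main (s : C) : cnorm s = 1 -> `|ReC (s * resid M x y)| <= (NN M)%:R * c.
  move=> s1; pose v : 'cV[R]_(NN M) := \col_i ReC (s * resid M i y).
  pose e : 'cV[R]_(NN M) := \col_i ReC (s * E' i y).
  have ve : (1%:M + Amx M *m (Amx M)^T) *m v = e.
    have eq1 : map_mx rc (1%:M + Amx M *m (Amx M)^T) *m resid M = E'.
      rewrite /resid mulmxA -map_rcM mulmxV ?sym_resolvent_unit //.
      by rewrite map_rc1 mul1mx.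
    apply/colP => i; rewrite [RHS]mxE -eq1 [in RHS]mxE mulr_sumr Re_sum mxE; apply: eq_bigr => j _.
    by rewrite [in RHS]mxE [v j 0]mxE mulrCA rcZ_Re.
  have := sym_resolvent_bound x ve; rewrite mxE => /le_trans; apply.
  rewrite (eq_bigr (fun i => `|ReC (s * E' i y)|)); last by move=> i _; rewrite mxE.
  by apply: cnorm_sum_Re => i; rewrite cnormM s1 mul1r.
apply: (le_trans (cnorm_le _)); rewrite mulr_natl mulr2n; apply: lerD.
  by have := main 1 (@cnorm1 R); rewrite mul1r.
have := main (mkC 0 (-1)); rewrite [ReC _]ReM /= mul0r sub0r mulN1r opprK; apply.
by rewrite /cnorm /= expr0n add0r sqrrN expr1n sqrtr1.
Qed.

Lemma Wmx_bound : exists c : R, forall M x y, cnorm (Wmx M x y) <= c / M.+1%:R ^+ 2.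
Proof.
have [K [p [K0 hE]]] := Edef_bound.
have [G [q [G0 hG]]] := gauge_bound ppA; have [H [s [H0 hH]]] := gauge_bound (pairpos_sym ppA).
(* The powers of m to be absorbed: four gauge factors, N^8 = m^16 from the summations, the eighth
   power of the coefficient bound, and the m^2 of the claim. *)
pose a := (2 * (q + s) * 2 + 2 * 8 + 2 * p * 8 + 2)%N.
have [e [e0 he]] := @expX_le R 1 a ltr01.
exists ((G * H) ^+ 2 * 4 * (K * 3 ^+ p) ^+ 8 * e) => M x y.
pose m : R := M.+1%:R; have m0 : 0 < m by rewrite ltr0n.
have m1 : 1 <= m by rewrite ler1n.
have NE : (NN M)%:R = m ^+ 2 :> R by rewrite /NN natrX.
have bG (i : 'I_(NN M)) : cnorm (gx (z + 1) (z' + 1) i) <= G * (m ^+ 2) ^+ q.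
  apply: (le_trans (hG i)); apply: ler_wpM2l; first exact: ltW.
  by apply: lerXn2r; rewrite ?nnegrE // -?NE ?ler0n // ler_nat.
have bH (i : 'I_(NN M)) : cnorm (gx (z' + 1) (z + 1) i) <= H * (m ^+ 2) ^+ s.
  apply: (le_trans (hH i)); apply: ler_wpM2l; first exact: ltW.
  by apply: lerXn2r; rewrite ?nnegrE // -?NE ?ler0n // ler_nat.
pose g := G * (m ^+ 2) ^+ q; pose h := H * (m ^+ 2) ^+ s.
have g0 : 0 <= g by rewrite mulr_ge0 ?(ltW G0) // exprn_ge0 // sqr_ge0.
have h0 : 0 <= h by rewrite mulr_ge0 ?(ltW H0) // exprn_ge0 // sqr_ge0.
pose B := 2 * m ^+ 14 * ((K * (3 * m ^+ 2) ^+ p) ^+ 8 * expR (- (1 * m))).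
have B0 : 0 <= B.
  rewrite /B; do 2 (apply: mulr_ge0; last first).
  - exact: expR_ge0.
  - by apply: exprn_ge0; apply: mulr_ge0 => //; apply: exprn_ge0; rewrite mulr_ge0 // sqr_ge0.
  - by apply: exprn_ge0; exact: ltW.
  - by [].
have bE i j : cnorm (Edef M i j) <= B.
  apply: (le_trans (hE M i j)); rewrite NE -exprM.
  have -> : ex M (NN M) = expR (- (1 * m)).
    by rewrite /ex NE expr2 -mulrA mulfV ?gt_eqF // mul1r mulr1.
  apply: ler_wpM2l; first by rewrite mulr_ge0 // exprn_ge0 // ltW.
  apply: ler_wpM2r; first exact: expR_ge0.
  have q0 : 0 <= 3 * m ^+ 2 by rewrite mulr_ge0 // sqr_ge0.
  apply: lerXn2r; rewrite ?nnegrE; [by rewrite mulr_ge0 // exprn_ge0|by rewrite mulr_ge0 // exprn_ge0|].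
  apply: ler_wpM2l => //; apply: lerXn2r; rewrite ?nnegrE //.
  rewrite -natr1 natrM NE.
  have mm : 1 <= m ^+ 2 by rewrite exprn_ege1.
  by move: mm; set w := m ^+ 2; lra.
have bE' i j : cnorm ((Gi (NN M) *m Edef M *m Gd (NN M)) i j) <= h * B * g.
  rewrite diag_conjE (cnormM _ (gx _ _ _)) (cnormM (gx _ _ _)).
  apply: ler_pM (bG j); [exact: mulr_ge0 (cnorm_ge0 _) (cnorm_ge0 _)|exact: cnorm_ge0|].
  by apply: ler_pM (bH i) (bE i j); exact: cnorm_ge0.
have bR := resid_bound bE'.
have bW : cnorm (Wmx M x y) <= g * (2 * ((NN M)%:R * (h * B * g))) * h.
  rewrite /Wmx diag_conjE (cnormM _ (gx _ _ _)) (cnormM (gx _ _ _)).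
  apply: ler_pM (bH y); [exact: mulr_ge0 (cnorm_ge0 _) (cnorm_ge0 _)|exact: cnorm_ge0|].
  by apply: ler_pM (bG x) (bR x y); exact: cnorm_ge0.
apply: (le_trans bW); rewrite ler_pdivlMr ?exprn_gt0 //.
have -> : g * (2 * ((NN M)%:R * (h * B * g))) * h * M.+1%:R ^+ 2 =
  (G * H) ^+ 2 * 4 * (K * 3 ^+ p) ^+ 8 * (m ^+ a * expR (- (1 * m))).
  have -> : m ^+ a = ((m ^+ 2) ^+ q * (m ^+ 2) ^+ s) ^+ 2 * m ^+ 16 * ((m ^+ 2) ^+ p) ^+ 8 * m ^+ 2.
    by rewrite -!exprM -!exprD -!exprM -!exprD /a; congr (_ ^+ _); clear; lia.
  rewrite NE /g /h /B -/m (_ : (3 * m ^+ 2) ^+ p = 3 ^+ p * (m ^+ 2) ^+ p); last by rewrite exprMn.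
  set X := (m ^+ 2) ^+ q; set Y := (m ^+ 2) ^+ s; set Z := (m ^+ 2) ^+ p.
  by set T := 3 ^+ p; ring.
apply: ler_wpM2l.
  by do 2 (apply: mulr_ge0; last first); rewrite ?exprn_ge0 ?mulr_ge0 ?exprn_ge0 ?(ltW G0) ?(ltW H0).
apply: (le_trans _ (he m (ltW m0))); apply: ler_wpM2r; first exact: expR_ge0.
by apply: lerXn2r; rewrite ?nnegrE; lra.
Qed.
End Main.
End Gauge.

(** * Positive functionals and iterated integrals *)

Section PositiveFunctionals.
Context {R : realType}.
Local Notation fn := ((nat -> R) -> R).

(* Joint measurability, tested along measurable sequences in place of a sigma-algebra on
   nat -> R. *)
Definition jp (f : fn) : Prop := (forall x, 0 <= f x) /\
  forall d (T : measurableType d) (X : nat -> T -> R), (forall k, measurable_fun setT (X k)) ->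
    measurable_fun setT (fun w => f (fun k => X k w)).

Lemma jpD f g : jp f -> jp g -> jp (fun x => f x + g x).
Proof.
move=> [f0 mf] [g0 mg]; split => [x|d T X mX]; first exact: addr_ge0.
by apply: measurable_funD; [exact: mf|exact: mg].
Qed.
Lemma jpM f g : jp f -> jp g -> jp (fun x => f x * g x).
Proof.
move=> [f0 mf] [g0 mg]; split => [x|d T X mX]; first exact: mulr_ge0.
by apply: measurable_funM; [exact: mf|exact: mg].
Qed.
Lemma jpB f g : jp f -> jp g -> (forall x, g x <= f x) -> jp (fun x => f x - g x).
Proof.
move=> [f0 mf] [g0 mg] gf; split => [x|d T X mX]; first by rewrite subr_ge0.
by apply: measurable_funB; [exact: mf|exact: mg].
Qed.
Lemma jp_cst (c : R) : 0 <= c -> jp (fun=> c).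
Proof. by move=> c0; split. Qed.
Lemma jp_coord (g : R -> R) k : measurable_fun setT g -> (forall u, 0 <= g u) -> jp (fun x => g (x k)).
Proof. by move=> mg g0; split => // d T X mX; exact: measurableT_comp. Qed.
Lemma jp_lim (f_ : nat -> fn) (f : fn) : (forall j, jp (f_ j)) -> (forall x, (f_ ^~ x) @ \oo --> f x) -> jp f.
Proof.
move=> jf lf; split => [x|d T X mX].
  have := lf x; move/cvg_lim => <- //; apply: limr_ge; first by apply/cvg_ex; exists (f x); exact: lf.
  by apply: nearW => j; have [] := jf j.
apply: (@measurable_fun_cvg _ _ _ _ (fun j w => f_ j (fun k => X k w))) => //.
by move=> j; have [_] := jf j; apply.
Qed.

Definition prodf (g : nat -> R -> R) n : fn := fun x => \prod_(k < n) g k (x k).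

Lemma jp_prodf (g : nat -> R -> R) n : (forall k, (k < n)%N -> measurable_fun setT (g k) /\ forall u, 0 <= g k u) -> jp (prodf g n).
Proof.
elim: n => [|n IH] h; first by rewrite /prodf; under eq_fun do rewrite big_ord0; exact: jp_cst.
rewrite /prodf; under eq_fun do rewrite big_ord_recr /=.
apply: jpM; first by apply: IH => k kn; apply: h; exact: ltnW.
by have [m0 g0] := h n (ltnSn n); exact: jp_coord.
Qed.

(** The properties of an integral that a monotone class argument uses. The correlation functional
    and iterated integration against a density both have them. *)
Definition posfun (I : fn -> \bar R) :=
  [/\ forall f, jp f -> (0 <= I f)%E,
      forall f g, jp f -> jp g -> I (fun x => f x + g x) = (I f + I g)%E &
      forall (f_ : nat -> fn) f, (forall j, jp (f_ j)) -> (forall x, {homo f_ ^~ x : i j / (i <= j)%N >-> i <= j}) ->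
        (forall x, (f_ ^~ x) @ \oo --> f x) -> (fun j => I (f_ j)) @ \oo --> I f].

Lemma posfun_le I f g : posfun I -> jp f -> jp g -> (forall x, f x <= g x) -> (I f <= I g)%E.
Proof.
move=> [I0 ID _] jf jg fg; have jh := jpB jg jf fg.
have -> : I g = (I f + I (fun x => g x - f x)%R)%E.
  by rewrite -ID //; congr I; apply/funext => x; rewrite addrC subrK.
by rewrite leeDl // I0.
Qed.

Definition bump (a b : R) (h : R -> R) := [/\ forall x, 0 <= h x <= 1, forall x, ~~ (a <= x <= b) -> h x = 0 &
  exists K, 0 <= K /\ forall x y, `|h x - h y| <= K * `|x - y|].

Lemma lipschitz_measurable (h : R -> R) (K : R) : 0 <= K -> (forall x y, `|h x - h y| <= K * `|x - y|) ->
  measurable_fun setT h.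
Proof.
move=> K0 hK; apply: continuous_measurable_fun => x; apply/cvgrPdist_le => e e0.
have K1 : 0 < K + 1 by rewrite ltr_wpDl.
have e1 : 0 < e / (K + 1) by rewrite divr_gt0.
near=> y; apply: (le_trans (hK _ _)).
apply: (@le_trans _ _ ((K + 1) * `|x - y|)); first by rewrite ler_wpM2r // lerDl.
rewrite -ler_pdivlMl // mulrC; near: y.
by exists (e / (K + 1)) => // y /= /ltW.
Unshelve. all: by end_near. Qed.

Lemma bump_measurable a b h : bump a b h -> measurable_fun setT h.
Proof. by move=> [_ _ [K [K0 hK]]]; exact: lipschitz_measurable hK. Qed.

(** A trapezoid: 1 on [c, b], with sides of slope i. It decreases to the indicator of [c, b]. *)
Definition trap (c b : R) (i : nat) (x : R) : R := Num.max 0 (1 - i%:R * Num.max 0 (Num.max (c - x) (x - b))).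

Lemma trap_ge0 c b i x : 0 <= trap c b i x. Proof. by rewrite le_max lexx. Qed.
Lemma trap_le1 c b i x : trap c b i x <= 1.
Proof. by rewrite ge_max ler01 /= lerBlDr lerDl mulr_ge0 // le_max lexx. Qed.

Lemma max_lip (x y x' y' d : R) : `|x - x'| <= d -> `|y - y'| <= d -> `|Num.max x y - Num.max x' y'| <= d.
Proof.
rewrite !maxEle !ler_norml; case: (leP x y) => hx; case: (leP x' y') => hy /andP[h1 h2] /andP[h3 h4];
by apply/andP; split; lra.
Qed.
Lemma max0_lip (x y : R) : `|Num.max 0 x - Num.max 0 y| <= `|x - y|.
Proof. by apply: max_lip => //; rewrite subrr normr0. Qed.

Lemma trap_bump (a b c e : R) i : 0 < e -> 1 <= i%:R * e -> a <= c -> bump (a - e) (b + e) (trap c b i).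
Proof.
move=> e0 ie ac; split => [x|x|].
- by rewrite trap_ge0 trap_le1.
- rewrite negb_and -!ltNge => h; rewrite /trap; apply: max_l; rewrite subr_le0 (le_trans ie) // ler_wpM2l //.
  by rewrite !le_max; case/orP: h => h; apply/orP; right; apply/orP; [left|right]; lra.
- exists i%:R; split => // x y; rewrite /trap; apply: (le_trans (max0_lip _ _)).
  rewrite (_ : 1 - _ - _ = - (i%:R * (Num.max 0 (Num.max (c - x) (x - b)) - Num.max 0 (Num.max (c - y) (y - b))))); last by ring.
  rewrite normrN normrM ger0_norm // ler_wpM2l //; apply: (le_trans (max0_lip _ _)).
  apply: max_lip; last by rewrite (_ : x - b - (y - b) = x - y) //; ring.
  by rewrite (_ : c - x - (c - y) = - (x - y)) ?normrN //; ring.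
Qed.

Lemma trap_in c b i x : c <= x <= b -> trap c b i x = 1.
Proof.
move=> /andP[cx xb]; rewrite /trap (max_l (y := Num.max (c - x) (x - b))).
  by rewrite mulr0 subr0 max_r.
by rewrite ge_max !subr_le0 cx xb.
Qed.
Lemma trap_noninc c b x i j : (i <= j)%N -> trap c b j x <= trap c b i x.
Proof.
move=> ij; rewrite /trap ge_max le_max lexx /= le_max; apply/orP; right.
by rewrite lerD2l lerN2 ler_wpM2r ?ler_nat // le_max lexx.
Qed.
Lemma trap_cvg c b x (i0 : nat) : (fun i => trap c b (i + i0) x) @ \oo --> (\1_[set u | c <= u <= b] x : R).
Proof.
rewrite indicE; case: (boolP (c <= x <= b)) => h.
  rewrite mem_set //; under eq_fun do rewrite trap_in //; exact: cvg_cst.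
rewrite memNset; last by move=> /= h'; rewrite h' in h.
set d := Num.max 0 (Num.max (c - x) (x - b)).
have d0 : 0 < d.
  rewrite /d !lt_max !subr_gt0; move: h; rewrite negb_and -!ltNge => /orP[->|->]; by rewrite !orbT.
apply: cvg_near_cst; near=> i; rewrite /trap -/d; apply: max_l; rewrite subr_le0.
rewrite -ler_pdivrMr // mul1r (le_trans (ltW (truncnS_gt _))) // ler_nat (leq_trans _ (leq_addr _ _)) //.
near: i; exact: nbhs_infty_ge.
Unshelve. all: by end_near. Qed.

Definition upd (g : nat -> R -> R) j h : nat -> R -> R := fun k => if k == j then h else g k.

Lemma prodf_upd g j h n x (jn : (j < n)%N) :
  prodf (upd g j h) n x = h (x j) * \prod_(k < n | k != Ordinal jn) g k (x k).
Proof.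
rewrite /prodf (bigD1 (Ordinal jn)) // /upd [nat_of_ord (Ordinal jn)]/= eqxx; congr (_ * _).
by apply: eq_bigr => k; rewrite -val_eqE => /negbTE /= ->.
Qed.

Lemma eq_prodf g h n : (forall k, (k < n)%N -> g k = h k) -> prodf g n = prodf h n.
Proof. by move=> gh; apply/funext => x; apply: eq_bigr => k _; rewrite gh. Qed.

Section Extension.
Variables (n : nat) (I1 I2 : fn -> \bar R).
Hypotheses (pI1 : posfun I1) (pI2 : posfun I2).
Hypothesis I12 : forall a b h, 0 < a -> (forall k, (k < n)%N -> bump a b (h k)) ->
  I1 (prodf h n) = I2 (prodf h n) /\ (I1 (prodf h n) < +oo)%E.

Definition cut (a b : R) (A : set R) : R -> R := \1_(A `&` [set u | a <= u <= b]).

Lemma measurable_cut a b (A : set (measurableTypeR R)) : measurable A -> measurable_fun setT (cut a b A : R -> R).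
Proof.
move=> mA; apply: measurable_indic; apply: measurableI => //.
rewrite (_ : [set u | _] = `[a, b]); last by apply/seteqP; split => u /=; rewrite in_itv.
exact: measurable_itv.
Qed.

Lemma cut_ge0 a b A u : 0 <= cut a b A u. Proof. by rewrite /cut indicE. Qed.
Lemma cut_le1 a b A u : cut a b A u <= 1. Proof. by rewrite /cut indicE lern1 leq_b1. Qed.
Lemma cut_out a b A u : ~~ (a <= u <= b) -> cut a b A u = 0.
Proof. by move=> h; rewrite /cut indicE memNset // => -[_ /= h']; rewrite h' in h. Qed.

Lemma cut_in a b A u : a <= u <= b -> cut a b A u = \1_A u.
Proof.
move=> h; rewrite /cut !indicE; congr (nat_of_bool _)%:R; apply/idP/idP; rewrite !inE; first by case.
by move=> Au; split.
Qed.

(** Interpolates from products of bumps, j = 0, to products of indicators, j = n, one coordinate at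
    a time. Bumps may reach a/2 beyond [a, b], which leaves room for the trapezoids over its
    subintervals. *)
Definition mixed a b j (g : nat -> R -> R) := forall k, (k < n)%N ->
  if (k < j)%N then exists2 A : set (measurableTypeR R), measurable A & g k = cut a b A
  else bump (a / 2) (b + a / 2) (g k).

Lemma mixed_meas a b j g : mixed a b j g -> forall k, (k < n)%N ->
  [/\ measurable_fun setT (g k), forall u, 0 <= g k u <= 1 & forall u, ~~ (a / 2 <= u <= b + a / 2) -> 0 < a -> g k u = 0].
Proof.
move=> m k kn; have := m k kn; case: ifP => _ => [[A mA ->]|[h1 h2 [K [K0 hK]]]].
  split; [exact: measurable_cut|by move=> u; rewrite cut_ge0 cut_le1|move=> u h a0; apply: cut_out].
  by apply: contra h => /andP[h1 h2]; apply/andP; split; lra.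
by split => //; [exact: lipschitz_measurable hK|move=> u h _; exact: h2].
Qed.

(** All factors are dominated by one trapezoid supported in [a/4, b + 3a/4], and products of bumps
    have finite value by assumption. *)
Lemma mixed_fin a b j g : 0 < a -> mixed a b j g -> (I1 (prodf g n) < +oo)%E /\ (I2 (prodf g n) < +oo)%E.
Proof.
move=> a0 m; have e0 : 0 < a / 4 by rewrite divr_gt0.
pose i := (Num.truncn (a / 4)^-1).+1.
have ie : 1 <= i%:R * (a / 4) by rewrite -ler_pdivrMr // div1r ltW // truncnS_gt.
pose h (k : nat) := trap (a / 2) (b + a / 2) i.
have bh k : (k < n)%N -> bump (a / 2 - a / 4) (b + a / 2 + a / 4) (h k) by move=> _; exact: trap_bump.
have p0 : 0 < a / 2 - a / 4 by lra.
have [E F] := I12 p0 bh.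
have gh x : prodf g n x <= prodf h n x.
  apply: ler_prod => k _; have [_ g01 g0] := mixed_meas m (ltn_ord k).
  have /andP[g1 g2] := g01 (x k); rewrite g1 /=.
  case: (boolP (a / 2 <= x k <= b + a / 2)) => hx; first by rewrite /h trap_in.
  by rewrite g0 // trap_ge0.
have jg : jp (prodf g n).
  by apply: jp_prodf => k kn; have [m0 g01 _] := mixed_meas m kn; split => // u; have /andP[] := g01 u.
have jh : jp (prodf h n).
  by apply: jp_prodf => k kn; split => [|u]; [exact: bump_measurable (bh k kn)|exact: trap_ge0].
split; first exact: le_lt_trans (posfun_le pI1 jg jh gh) F.
by apply: le_lt_trans (posfun_le pI2 jg jh gh) _; rewrite -E.
Qed.

Lemma posfun_fin I f : posfun I -> jp f -> (I f < +oo)%E -> I f \is a fin_num.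
Proof. by move=> [I0 _ _] jf; rewrite ge0_fin_numE // I0. Qed.

Lemma mixed_jp a b j g : mixed a b j g -> jp (prodf g n).
Proof.
by move=> m; apply: jp_prodf => k kn; have [m0 g01 _] := mixed_meas m kn; split => // u; have /andP[] := g01 u.
Qed.

Lemma mixed_upd a b j g A : mixed a b j.+1 g -> measurable (A : set (measurableTypeR R)) -> mixed a b j.+1 (upd g j (cut a b A)).
Proof.
move=> m mA k kn; have := m k kn; rewrite /upd; case: eqP => [->|//].
by rewrite ltnSn => _; exists A.
Qed.

Lemma mixed_upd_bump a b j g h : mixed a b j.+1 g -> bump (a / 2) (b + a / 2) h -> mixed a b j (upd g j h).
Proof.
move=> m bh k kn; have := m k kn; rewrite /upd; case: eqP => [->|/eqP kj]; first by rewrite ltnn.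
by rewrite ltnS leq_eqVlt (negbTE kj).
Qed.

(** Induction on the number of indicator coordinates; in coordinate [j] Dynkin's theorem extends the
    equality from half-lines to Borel sets. *)
Lemma mixed_eq a b j g : 0 < a -> mixed a b j g -> I1 (prodf g n) = I2 (prodf g n).
Proof.
move=> a0; have [I10 I1D I1M] := pI1; have [I20 I2D I2M] := pI2.
have a20 : 0 < a / 2 by rewrite divr_gt0.
elim: j g => [|j IH] g m; first exact: (proj1 (I12 a20 m)).
case: (ltnP j n) => jn; last first.
  by apply: IH => k kn; have := m k kn; rewrite !(leq_trans kn) // ltnW.
pose Pr (A : set (measurableTypeR R)) := I1 (prodf (upd g j (cut a b A)) n) = I2 (prodf (upd g j (cut a b A)) n).
have add A B f : f = (fun u => cut a b A u + cut a b B u) -> measurable A -> measurable B ->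
    I1 (prodf (upd g j f) n) = (I1 (prodf (upd g j (cut a b A)) n) + I1 (prodf (upd g j (cut a b B)) n))%E /\
    I2 (prodf (upd g j f) n) = (I2 (prodf (upd g j (cut a b A)) n) + I2 (prodf (upd g j (cut a b B)) n))%E.
  move=> -> mA mB; have jA := mixed_jp (mixed_upd m mA); have jB := mixed_jp (mixed_upd m mB).
  by rewrite -I1D // -I2D //; split; [congr I1|congr I2]; apply/funext => x; rewrite !(prodf_upd _ _ _ jn) mulrDl.
have fin A : measurable A -> I1 (prodf (upd g j (cut a b A)) n) \is a fin_num /\ I2 (prodf (upd g j (cut a b A)) n) \is a fin_num.
  move=> mA; have mm := mixed_upd m mA; have [f1 f2] := mixed_fin a0 mm.
  by split; apply: posfun_fin => //; exact: mixed_jp mm.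
have interval c : a <= c -> Pr [set u | c <= u].
  move=> ac; have e0 : 0 < a / 2 by rewrite divr_gt0.
  pose i0 := (Num.truncn (a / 2)^-1).+1.
  have ie i : 1 <= (i + i0)%:R * (a / 2).
    rewrite -ler_pdivrMr // div1r; apply: (le_trans (ltW (truncnS_gt _))).
    by rewrite ler_nat leq_addl.
  pose h i := trap c b (i + i0).
  have bh i : bump (a / 2) (b + a / 2) (h i).
    by have := trap_bump b e0 (ie i) ac; rewrite (_ : a - a / 2 = a / 2) //; lra.
  have mh i := mixed_upd_bump m (bh i).
  pose F i := prodf (upd g j (h i)) n; pose G := prodf (upd g j (cut a b [set u | c <= u])) n.
  have mcut : measurable ([set u | c <= u] : set (measurableTypeR R)).
    by rewrite (_ : [set u | _] = `[c, +oo[) //; apply/seteqP; split => u /=; rewrite in_itv /= andbT.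
  have jF i : jp (F i) by exact: mixed_jp (mh i).
  have jG : jp G by exact: mixed_jp (mixed_upd m mcut).
  have FF x i i' : (i <= i')%N -> F i' x <= F i x.
    move=> ii; apply: ler_prod => k _; rewrite /upd; case: eqP => _.
      by rewrite trap_ge0 trap_noninc // leq_add2r.
    by have [_ /(_ (x k))/andP[-> _] _] := mixed_meas m (ltn_ord k); rewrite lexx.
  have FG x : (F ^~ x) @ \oo --> G x.
    rewrite /G (prodf_upd _ _ _ jn).
    have -> : F ^~ x = (fun i => h i (x j) * \prod_(k < n | k != Ordinal jn) g k (x k)).
      by apply/funext => i; exact: prodf_upd.
    apply: cvgM; last exact: cvg_cst.
    rewrite /cut (_ : _ `&` _ = [set u | c <= u <= b]); first exact: trap_cvg.
    apply/seteqP; split => u /=; first by move=> [-> /andP[_ ->]].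
    by move=> /andP[cu ub]; rewrite cu ub (le_trans ac cu).
  have GF x i : G x <= F i x.
    move/cvg_lim: (FG x) => <- //; apply: limr_le; first by apply/cvg_ex; exists (G x); exact: FG.
    by near=> i'; apply: FF; near: i'; exact: nbhs_infty_ge.
  (* The trapezoids decrease, whereas [posfun] offers continuity along increasing sequences; hence
     the passage to F 0 - F i, subtracted again in finite values. *)
  have jFF i : jp (fun x => F 0%N x - F i x) by apply: jpB => // x; exact: FF.
  have jFG : jp (fun x => F 0%N x - G x) by apply: jpB.
  have inc x : {homo (fun i x => F 0%N x - F i x) ^~ x : i i' / (i <= i')%N >-> i <= i'}.
    by move=> i i' ii /=; rewrite lerD2l lerN2 FF.
  have lim x : (fun i => F 0%N x - F i x) @ \oo --> F 0%N x - G x by apply: cvgB; [exact: cvg_cst|exact: FG].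
  have eqF i : I1 (F i) = I2 (F i) := IH _ (mh i).
  have finF i : I1 (F i) \is a fin_num by apply: posfun_fin => //; have [] := mixed_fin a0 (mh i).
  have split1 i : I1 (F 0%N) = (I1 (F i) + I1 (fun x => F 0%N x - F i x)%R)%E.
    by rewrite -I1D //; congr I1; apply/funext => x; rewrite addrC subrK.
  have split2 i : I2 (F 0%N) = (I2 (F i) + I2 (fun x => F 0%N x - F i x)%R)%E.
    by rewrite -I2D //; congr I2; apply/funext => x; rewrite addrC subrK.
  have dif (I : fn -> \bar R) f f' : I f \is a fin_num -> (I (F 0%N) = I f + I f')%E -> (I f' = I (F 0%N) - I f)%E.
    by move=> ff ->; rewrite [(I f + _)%E]addeC addeK.
  have eqD : (fun i => I1 (fun x => F 0%N x - F i x)) = (fun i => I2 (fun x => F 0%N x - F i x)).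
    apply/funext => i; rewrite (dif I1 (F i) _ (finF i) (split1 i)).
    by rewrite (dif I2 (F i) _ _ (split2 i)) -?eqF.
  have L1 := I1M _ _ jFF inc lim; have L2 := I2M _ _ jFF inc lim.
  have eqL : I1 (fun x => F 0%N x - G x) = I2 (fun x => F 0%N x - G x).
    by rewrite -eqD in L2; apply: (cvg_unique _ L1 L2).
  have s1 : I1 (F 0%N) = (I1 G + I1 (fun x => F 0%N x - G x)%R)%E.
    by rewrite -I1D //; congr I1; apply/funext => x; rewrite addrC subrK.
  have s2 : I2 (F 0%N) = (I2 G + I2 (fun x => F 0%N x - G x)%R)%E.
    by rewrite -I2D //; congr I2; apply/funext => x; rewrite addrC subrK.
  have finD : I1 (fun x => F 0%N x - G x) \is a fin_num.
    have := finF 0%N; rewrite s1 fin_numD => /andP[]//.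
  have : (I1 G + I1 (fun x => F 0%N x - G x)%R = I2 G + I1 (fun x => F 0%N x - G x)%R)%E by rewrite -s1 eqL -s2 eqF.
  by move/(congr1 (fun e => e - I1 (fun x => F 0%N x - G x)%R)%E); rewrite !addeK.
have cutE A B : (forall u, a <= u <= b -> A u <-> B u) -> cut a b A = cut a b B.
  move=> h; rewrite /cut; congr (\1_ _); apply/seteqP; split => u /= [Au ab]; split => //; exact/h.
have PT : Pr setT.
  rewrite /Pr (cutE setT [set u | a <= u]); first exact: interval.
  by move=> u /andP[h _]; split.
have key A : measurable (A : set (measurableTypeR R)) -> Pr A.
  rewrite RGenCInfty.measurableE => mA.
  (* The half-lines form a pi-system. Cut to [a, b], each becomes some [c, b] with c >= a, the case
     already settled. *)
  apply: (@dynkin_induction _ (measurableTypeR R) (@RGenCInfty.G R) Pr) mA.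
  - exact: RGenCInfty.measurableE.
  - move=> _ _ [x ->] [y ->]; exists (Num.max x y).
    by apply/seteqP; split => u /=; rewrite !in_itv /= !andbT ge_max => /andP.
  - exact: PT.
  - move=> _ [x ->]; rewrite /Pr (cutE _ [set u | Num.max a x <= u]); first by apply: interval; rewrite le_max lexx.
    by move=> u /andP[h _]; rewrite /= in_itv /= andbT ge_max h.
  - move=> {}A mA PA; have mC := measurableC mA.
    have ef : cut a b setT = (fun u => cut a b A u + cut a b (~` A) u).
      apply/funext => u; case: (boolP (a <= u <= b)) => h; last by rewrite !cut_out ?addr0.
      by rewrite !cut_in // !indicE in_setT in_setC; case: (u \in A); rewrite ?addr0 ?add0r.
    have [e1 e2] := add _ _ _ ef mA mC.
    rewrite /Pr in PT PA; rewrite PA in e1; rewrite e2 e1 in PT.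
    have [_ f2] := fin _ mA.
    move/(congr1 (fun e => e - I2 (prodf (upd g j (cut a b A)) n))%E): PT.
    by rewrite ![(I2 (prodf (upd g j (cut a b A)) n) + _)%E]addeC !addeK.
  - move=> B mB tB PB.
    have PU N : Pr (\bigcup_(i < N) B i) /\ measurable (\bigcup_(i < N) B i).
      elim: N => [|N [P1 m1]].
        split; last by rewrite bigcup_mkord big_ord0.
        rewrite /Pr bigcup_mkord big_ord0.
        have ef : cut a b set0 = (fun u => cut a b set0 u + cut a b set0 u).
          by apply/funext => u; rewrite /cut set0I indicE in_set0 addr0.
        have [e1 e2] := add _ _ _ ef measurable0 measurable0; have [f1 f2] := fin _ measurable0.
        move/(congr1 (fun e => e - I1 (prodf (upd g j (cut a b set0)) n))%E): e1.
        move/(congr1 (fun e => e - I2 (prodf (upd g j (cut a b set0)) n))%E): e2.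
        by rewrite !addeK // !subee // => <- <-.
      have m2 : measurable (\bigcup_(i < N.+1) B i) by rewrite bigcup_mkord; apply: bigsetU_measurable.
      split => //; have ef : cut a b (\bigcup_(i < N.+1) B i) = (fun u => cut a b (\bigcup_(i < N) B i) u + cut a b (B N) u).
        apply/funext => u; case: (boolP (a <= u <= b)) => h; last by rewrite !cut_out ?addr0.
        rewrite !cut_in // !indicE; case: (pselect (B N u)) => Bu.
          rewrite (mem_set Bu) mem_set; last by exists N => /=.
          rewrite memNset ?add0r // => -[i /= iN Bi].
          have hh := tB N i Logic.I Logic.I (ex_intro _ u (conj Bu Bi)).
          by rewrite hh ltnn in iN.
        rewrite (memNset (A := B N)) // addr0.
        congr (nat_of_bool _)%:R; apply/idP/idP; rewrite !inE => -[i /= iN Bi].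
          by exists i => //=; rewrite ltnS leq_eqVlt in iN; case/orP: iN => [/eqP iN|//]; rewrite iN in Bi.
        by exists i => //=; exact: ltnW.
      have [e1 e2] := add _ _ _ ef m1 (mB N).
      by rewrite /Pr e1 e2 P1 PB.
    have jN N : jp (prodf (upd g j (cut a b (\bigcup_(i < N) B i))) n).
      by apply: mixed_jp; apply: mixed_upd m (proj2 (PU N)).
    have inc x : {homo (fun N => prodf (upd g j (cut a b (\bigcup_(i < N) B i))) n) ^~ x : N N' / (N <= N')%N >-> N <= N'}.
      move=> N N' NN' /=; apply: ler_prod => k _; rewrite /upd; case: eqP => _.
        rewrite cut_ge0 /cut !indicE ler_nat; case: (boolP (x k \in _)) => //; rewrite inE => -[[i /= iN Bi] hh].
        by rewrite mem_set //; split => //; exists i => //=; exact: leq_trans iN NN'.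
      by have [_ /(_ (x k))/andP[-> _] _] := mixed_meas m (ltn_ord k); rewrite lexx.
    have lim x : (fun N => prodf (upd g j (cut a b (\bigcup_(i < N) B i))) n x) @ \oo --> prodf (upd g j (cut a b (\bigcup_i B i))) n x.
      apply: cvg_near_cst; case: (pselect ((\bigcup_i B i) (x j))) => hx.
        case: hx => i _ Bi; near=> N; apply: eq_bigr => k _; rewrite /upd; case: eqP => // kj.
        rewrite /cut !indicE; congr (_%:R); congr nat_of_bool; apply/idP/idP; rewrite !inE => -[[i' hi' Bi'] hh]; split => //.
          by exists i'.
        exists i; last by rewrite kj.
        rewrite /=; near: N; exact: nbhs_infty_gt.
      near=> N; apply: eq_bigr => k _; rewrite /upd; case: eqP => // kj.
      rewrite /cut !indicE !memNset // => -[h hh]; apply: hx; rewrite -kj //.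
      by case: h => i _ Bi; exists i.
    have L1 := I1M _ _ jN inc lim; have L2 := I2M _ _ jN inc lim.
    have e : (fun N => I1 (prodf (upd g j (cut a b (\bigcup_(i < N) B i))) n)) = (fun N => I2 (prodf (upd g j (cut a b (\bigcup_(i < N) B i))) n)).
      by apply/funext => N; have [] := PU N.
    by rewrite -e in L2; apply: (cvg_unique _ L1 L2).
have := m j jn; rewrite ltnSn => -[A mA gA].
have -> : prodf g n = prodf (upd g j (cut a b A)) n by apply: eq_prodf => k _; rewrite /upd; case: eqP => // ->.
exact: key.
Unshelve. all: by end_near. Qed.

(** The sets are exhausted by their parts in [1/(N+1), N+1], along which both functionals are
    continuous. *)
Lemma posfun_ext (A : nat -> set (measurableTypeR R)) :
  (forall k, (k < n)%N -> measurable (A k) /\ A k `<=` posR) ->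
  I1 (prodf (fun k => \1_(A k)) n) = I2 (prodf (fun k => \1_(A k)) n).
Proof.
move=> hA; have [I10 I1D I1M] := pI1; have [I20 I2D I2M] := pI2.
pose g N k := cut N.+1%:R^-1 N.+1%:R (A k).
have mg N : mixed N.+1%:R^-1 N.+1%:R n (g N).
  by move=> k kn; rewrite kn; exists (A k) => //; have [] := hA k kn.
have e : (fun N => I1 (prodf (g N) n)) = (fun N => I2 (prodf (g N) n)).
  by apply/funext => N; apply: (mixed_eq _ (mg N)); rewrite invr_gt0.
have jN N : jp (prodf (g N) n) by exact: mixed_jp (mg N).
have inc x : {homo (fun N => prodf (g N) n) ^~ x : N N' / (N <= N')%N >-> N <= N'}.
  move=> N N' NN' /=; apply: ler_prod => k _; rewrite cut_ge0 /g /cut !indicE ler_nat.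
  case: (boolP (x k \in _)) => //; rewrite inE => -[Ax /= /andP[h1 h2]].
  rewrite mem_set //; split => //=; rewrite (le_trans h2) ?ler_nat //= andbT.
  by apply: le_trans h1; rewrite lef_pV2 ?posrE ?ltr0n // ler_nat.
have lim x : (fun N => prodf (g N) n x) @ \oo --> prodf (fun k => \1_(A k)) n x.
  rewrite /prodf; elim: n hA => [|p IH] hA'; first by under eq_fun do rewrite big_ord0; rewrite big_ord0; exact: cvg_cst.
  under eq_fun do rewrite big_ord_recr /=; rewrite big_ord_recr /=.
  apply: cvgM; first by apply: IH => k kp; apply: hA'; exact: ltnW.
  apply: cvg_near_cst; near=> N; rewrite /g /cut !indicE; congr (_%:R); congr nat_of_bool.
  apply/idP/idP; first by rewrite !inE => -[].
  rewrite !inE => Ax; split => //=.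
  have x0 : 0 < x p by have [_] := hA' p (ltnSn p); apply.
  apply/andP; split.
    rewrite invf_ple ?posrE ?ltr0n // (le_trans (ltW (truncnS_gt _))) // ler_nat ltnS.
    near: N; exact: nbhs_infty_ge.
  rewrite (le_trans (ltW (truncnS_gt _))) // ler_nat ltnS; near: N; exact: nbhs_infty_ge.
have L1 := I1M _ _ jN inc lim; have L2 := I2M _ _ jN inc lim.
by rewrite -e in L2; apply: (cvg_unique _ L1 L2).
Unshelve. all: by end_near. Qed.
End Extension.
End PositiveFunctionals.

(** * Iterated integrals and multiple Riemann sums *)

Section IteratedIntegrals.
Context {R : realType}.
Local Notation mu := (@lebesgue_measure R).
Local Notation P := (@posR R : set (measurableTypeR R)).
Local Notation iter k G x := (iterint (fun=> [set: R]) k G x).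

Definition updx (x : nat -> R) k y : nat -> R := fun i => if i == k then y else x i.

Definition ejp (G : (nat -> R) -> \bar R) : Prop := (forall x, 0 <= G x)%E /\
  forall d (T : measurableType d) (X : nat -> T -> R), (forall k, measurable_fun setT (X k)) ->
    measurable_fun setT (fun w => G (fun k => X k w)).

Lemma jp_ejp f : jp f -> ejp (fun x => (f x)%:E).
Proof.
move=> [f0 mf]; split => [x|d T X mX]; first by rewrite lee_fin.
by apply/measurable_EFinP; exact: mf.
Qed.

Lemma ejp_slice G x k : ejp G -> measurable_fun [set: measurableTypeR R] (fun y => G (updx x k y)).
Proof.
move=> [G0 mG]; apply: (mG _ (measurableTypeR R) (fun i y => if i == k then y else x i)) => i.
by case: (i == k).
Qed.

Lemma ejp_iter k G : ejp G -> ejp (fun x => iter k G x).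
Proof.
move=> jG; elim: k => [//|k IH]; have [I0 mI] := IH; split => [x|d T X mX] /=.
  by apply: integral_ge0.
apply: (@measurable_fun_fubini_tonelli_F _ _ T (measurableTypeR R) R mu
  (fun p => iter k G (fun i => if i == k then p.2 else X i p.1))) => [|p //].
apply: (mI _ _ (fun i (p : T * measurableTypeR R) => if i == k then p.2 else X i p.1)) => i.
by case: (i == k); [exact: measurable_snd|apply: measurableT_comp].
Qed.

Lemma iterD k G H x : ejp G -> ejp H -> iter k (fun x => G x + H x)%E x = (iter k G x + iter k H x)%E.
Proof.
move=> jG jH; elim: k x => [//|k IH] x /=.
have jGk := ejp_iter k jG; have jHk := ejp_iter k jH.
rewrite -ge0_integralD //.
- by apply: eq_integral => y _; exact: IH.
- by move=> y _; exact: (proj1 jGk).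
- exact: (ejp_slice x k jGk).
- by move=> y _; exact: (proj1 jHk).
- exact: (ejp_slice x k jHk).
Qed.

Lemma iter_le k G H x : ejp G -> ejp H -> (forall x, G x <= H x)%E -> (iter k G x <= iter k H x)%E.
Proof.
move=> jG jH GH; elim: k x => [|k IH] x /=; first exact: GH.
have jGk := ejp_iter k jG; have jHk := ejp_iter k jH.
apply: ge0_le_integral => //.
- by move=> y _; exact: (proj1 jGk).
- exact: (ejp_slice x k jGk).
- exact: (ejp_slice x k jHk).
Qed.

Lemma iter_MCT k (G_ : nat -> (nat -> R) -> \bar R) G x : (forall j, ejp (G_ j)) ->
  (forall x, {homo G_ ^~ x : i j / (i <= j)%N >-> (i <= j)%E}) ->
  (forall x, (G_ ^~ x) @ \oo --> G x) -> (fun j => iter k (G_ j) x) @ \oo --> iter k G x.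
Proof.
move=> jG inc lim; elim: k x => [|k IH] x /=; first exact: lim.
have jGk j := ejp_iter k (jG j).
rewrite (_ : (\int[mu]_y iter k G _)%E = (\int[mu]_y limn (fun j => iter k (G_ j) (updx x k y)))%E); last first.
  by apply: eq_integral => y _; apply/esym/cvg_lim => //; exact: IH.
apply: (@cvg_monotone_convergence _ _ _ mu setT measurableT (fun j y => iter k (G_ j) (updx x k y))).
- by move=> j; exact: ejp_slice.
- by move=> j y _; exact: (proj1 (jGk j)).
- by move=> y _ i j ij; apply: iter_le => // x'; exact: inc.
Qed.

(** The coordinates below [k] are integrated out, so that only points agreeing with [x] from [k] on
    are ever visited. *)
Lemma iter_ext k G H x : (forall x', (forall i, (k <= i)%N -> x' i = x i) -> G x' = H x') -> iter k G x = iter k H x.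
Proof.
elim: k x => [|k IH] x GH /=; first exact: GH.
apply: eq_integral => y _; apply: IH => x' h; apply: GH => i ki.
by rewrite h ?(ltnW ki) // gtn_eqF.
Qed.

Lemma iter0 k x : iter k (fun=> 0%E) x = 0%E.
Proof.
elim: k x => [//|k IH] x /=.
by rewrite (eq_integral (fun=> 0%E)) ?integral0 // => y _; rewrite IH.
Qed.

Lemma posfun_iter n (rho : (nat -> R) -> R) x : jp rho -> posfun (fun f => iter n (fun x => (f x * rho x)%:E) x).
Proof.
move=> jr; have jm f : jp f -> ejp (fun x => (f x * rho x)%:E) by move=> jf; apply/jp_ejp/jpM.
split => [f jf|f g jf jg|f_ f jf inc lim].
- exact: (proj1 (ejp_iter n (jm f jf))).
- rewrite -iterD; [|exact: jm..]; apply: iter_ext => x' _.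
  by rewrite mulrDl EFinD.
- apply: iter_MCT => [j|y i j ij|y].
  + exact: jm.
  + by rewrite lee_fin ler_wpM2r ?inc //; exact: (proj1 jr).
  + by apply: cvg_EFin; [exact: nearW|apply: cvgM => //; exact: cvg_cst].
Qed.

Lemma iter_indic (A : nat -> set (measurableTypeR R)) k F x : (forall i, (i < k)%N -> measurable (A i)) ->
  iterint A k (fun x => (F x)%:E) x = iter k (fun x => (prodf (fun i => \1_(A i)) k x * F x)%:E) x.
Proof.
elim: k x => [|k IH] x mA /=; first by rewrite /prodf big_ord0 mul1r.
rewrite integral_mkcond; apply: eq_integral => y _; rewrite /patch.
rewrite IH; last by move=> i ik; apply: mA; exact: ltnW.
case: ifPn => yA.
  apply: iter_ext => x' h; rewrite /prodf big_ord_recr /= h // eqxx indicE yA mulr1 //.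
rewrite -[LHS](iter0 k (updx x k y)); apply: iter_ext => x' h.
by rewrite /prodf big_ord_recr /= h // /updx eqxx indicE (negbTE yA) mulr0 mul0r.
Qed.

(** Dominated convergence one variable at a time: the bound c (b-a)^k on the inner integral, which
    vanishes off [a, b], is the majorant for the next variable. *)
Lemma iter_DCT k (G_ : nat -> (nat -> R) -> R) G (c a b : R) : 0 <= c -> a <= b -> (forall j, jp (G_ j)) ->
  (forall j x, G_ j x <= c) -> (forall j x i, (i < k)%N -> ~~ (a <= x i <= b) -> G_ j x = 0) ->
  (forall x, (G_ ^~ x) @ \oo --> G x) ->
  forall x, (fun j => iter k (fun x => (G_ j x)%:E) x) @ \oo --> iter k (fun x => (G x)%:E) x /\
    forall j, (iter k (fun x => (G_ j x)%:E) x <= (c * (b - a) ^+ k)%:E)%E.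
Proof.
move=> c0 ab jG Gc Gz lim; have jGe j := jp_ejp (jG j); elim: k Gz => [|k IH] Gz x.
  by split => [|j /=]; [apply: cvg_EFin; [exact: nearW|exact: lim]|rewrite expr0 mulr1 lee_fin].
have IHx y := IH (fun j x i ik => Gz j x i (ltnW ik)) (updx x k y).
have jGk j := ejp_iter k (jGe j).
pose D : R := c * (b - a) ^+ k.
have D0 : 0 <= D by rewrite mulr_ge0 // exprn_ge0 // subr_ge0.
have mab : measurable (`[a, b] : set (measurableTypeR R)) by exact: measurable_itv.
have bnd j y : (iter k (fun x => (G_ j x)%:E) (updx x k y) <= (D * \1_(`[a, b]) y)%:E)%E.
  rewrite indicE; case: (boolP (y \in _)) => hy; first by rewrite mulr1; have [_] := IHx y; apply.
  rewrite mulr0 (_ : iter k _ _ = 0%E) //.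
  rewrite -[RHS](iter0 k (updx x k y)); apply: iter_ext => x' h; rewrite (Gz j x' k) //.
  by rewrite h // /updx eqxx; apply: contra hy => hy; rewrite inE /= in_itv.
have iD : mu.-integrable setT (fun y : measurableTypeR R => (D * \1_(`[a, b]) y)%:E).
  apply: integrable_mull => //; exact: integrable_indic_itv.
split => [|j] /=.
  have jlim : jp G by apply: (jp_lim jG).
  have mlim := ejp_slice x k (ejp_iter k (jp_ejp jlim)).
  have hc : {ae mu, forall y, [set: measurableTypeR R] y ->
      (fun j => iter k (fun x => (G_ j x)%:E) (updx x k y)) @ \oo --> iter k (fun x => (G x)%:E) (updx x k y)}.
    by apply: aeW => y _; have [] := IHx y.
  have hb : {ae mu, forall y j, [set: measurableTypeR R] y ->
      (`|iter k (fun x => (G_ j x)%:E) (updx x k y)| <= (D * \1_(`[a, b]) y)%:E)%E}.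
    by apply: aeW => y j _; rewrite gee0_abs ?bnd //; exact: (proj1 (jGk j)).
  by have [_ _ h] := dominated_convergence measurableT (fun j => ejp_slice x k (jGk j)) mlim hc iD hb; exact: h.
apply: (@le_trans _ _ (\int[mu]_y (D * \1_(`[a, b]) y)%:E)%E).
  apply: ge0_le_integral => //.
  - by move=> y _; exact: (proj1 (jGk j)).
  - exact: (ejp_slice x k (jGk j)).
  - by have /integrableP[] := iD.
  - by move=> y _; exact: bnd.
under eq_integral do rewrite EFinM.
rewrite ge0_integralZl_EFin // ?integral_indic ?setIT //; last by apply/measurable_EFinP; exact: measurable_indic.
have e : mu `[a, b] = (b - a)%:E.
  rewrite lebesgue_measure_itv /= lte_fin; case: ltP => h; first by rewrite -EFinB.
  by rewrite (@le_anti _ _ a b) ?ab ?h // subrr.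
rewrite [X in (_ * X)%E](_ : _ = (b - a)%:E); last exact: e.
by rewrite -EFinM exprSr mulrA.
Qed.

Definition ext_ord k N (f : {ffun 'I_k -> 'I_N}) (v : nat -> nat) : nat -> nat :=
  fun i => if (insub i : option 'I_k) is Some j then f j : nat else v i.
(** Mirrors the order of the variables in [iterint], so that [iter_step] can compare the two by
    induction. *)
Fixpoint itersum N k (Phi : (nat -> nat) -> R) (v : nat -> nat) : R :=
  if k is k'.+1 then \sum_(j < N) itersum N k' Phi (fun i => if i == k' then j : nat else v i) else Phi v.

Lemma itersumE N k Phi v : itersum N k Phi v = \sum_(f : {ffun 'I_k -> 'I_N}) Phi (ext_ord f v).
Proof.
elim: k v => [|k IH] v /=.
  have uniq0 (f : {ffun 'I_0 -> 'I_N}) : f == ffun0 (card_ord 0) by apply/eqP/ffunP => -[].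
  rewrite (big_pred1 (ffun0 (card_ord 0))) => [|f]; last by rewrite [RHS]uniq0.
  by congr Phi; apply/funext => i; rewrite /ext_ord insubF.
rewrite (eq_bigr _ (fun j _ => IH _)) pair_big /=.
pose h (f : {ffun 'I_k.+1 -> 'I_N}) : 'I_N * {ffun 'I_k -> 'I_N} := (f ord_max, [ffun i => f (widen_ord (leqnSn k) i)]).
pose g (p : 'I_N * {ffun 'I_k -> 'I_N}) : {ffun 'I_k.+1 -> 'I_N} :=
  [ffun i : 'I_k.+1 => if (insub (i : nat) : option 'I_k) is Some i' then p.2 i' else p.1].
rewrite (reindex h) /=; last first.
  exists g => [f _|[j q] _].
    apply/ffunP => i; rewrite ffunE /=; case: insubP => [i' ik e|].
      by rewrite ffunE; congr (f _); apply: val_inj.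
    by rewrite -leqNgt => ki; congr (f _); apply: val_inj; apply/eqP; rewrite eqn_leq ki -ltnS ltn_ord.
  congr (_, _); first by rewrite ffunE insubF // ltnn.
  by apply/ffunP => i; rewrite !ffunE /= valK.
apply: eq_bigr => f _; congr Phi; apply/funext => i; rewrite /ext_ord.
case: insubP => [i' ik e|]; first by rewrite insubT ?ltnS 1?ltnW // => h'; rewrite ffunE; congr (f _ : nat); apply: val_inj.
rewrite -leqNgt => ki; case: eqP => [->|/eqP ik].
  by rewrite (insubT (fun x => x < k.+1)%N (ltnSn k)); congr (f _ : nat); apply: val_inj.
by rewrite insubF //; apply/negbTE; rewrite -leqNgt ltn_neqAle eq_sym ik.
Qed.

Lemma iter_step N k n M (Phi : (nat -> nat) -> R) x : (k <= n)%N ->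
  (forall v i, (i < n)%N -> (N <= v i)%N -> Phi v = 0) ->
  (forall i, (k <= i < n)%N -> 0 < x i) ->
  iter k (fun x => (if [forall i : 'I_n, 0 < x i] then Phi (fun i => fl M.+1 (x i)) else 0)%:E) x =
  (M.+1%:R^-1 ^+ k * itersum N k Phi (fun i => fl M.+1 (x i)))%:E.
Proof.
move=> kn Pz; elim: k x kn => [|k IH] x kn hx /=.
  by rewrite expr0 mul1r ifT //; apply/forallP => i; apply: hx; exact: ltn_ord.
set G := fun x => _.
have mP := @measurable_posR R.
pose f j : R := M.+1%:R^-1 ^+ k * itersum N k Phi (fun i => if i == k then j else fl M.+1 (x i)).
have [i1 e1] := step_integral f M N.
transitivity (\int[mu]_(y in P) (if (fl M.+1 y < N)%N then f (fl M.+1 y) else 0)%:E)%E.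
  rewrite [RHS]integral_mkcond; apply: eq_integral => y _; rewrite /patch; case: ifPn => hy.
    have y0 : 0 < y by move: hy; rewrite inE.
    rewrite /G IH ?(ltnW kn) //; last by move=> i /andP[ki iN]; case: eqP => // ik; apply: hx; rewrite iN andbT ltn_neqAle eq_sym ki andbT; apply/eqP.
    congr EFin; rewrite /f.
    have -> : (fun i => fl M.+1 (if i == k then y else x i)) = (fun i => if i == k then fl M.+1 y else fl M.+1 (x i)).
      by apply/funext => i; case: eqP.
    case: ltnP => // hN; rewrite (_ : itersum _ _ _ _ = 0) ?mulr0 //.
    rewrite itersumE big1 // => g _; apply: (Pz _ k kn).
    rewrite /ext_ord insubF ?ltnn // eqxx //.
  have hy' : ~~ (0 < y) by apply: contra hy; rewrite inE.
  rewrite -[RHS](iter0 k (updx x k y)); apply: iter_ext => x' h; rewrite /G ifF //.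
  by apply/negbTE; apply: contra hy' => /forallP /(_ (Ordinal kn)) /=; rewrite h // eqxx.
rewrite -[LHS]fineK; last exact: integrable_fin_num.
rewrite (_ : fine _ = M.+1%:R^-1 * \sum_(j < N) f j) //.
by rewrite /f -mulr_sumr mulrA -exprS.
Qed.
End IteratedIntegrals.

(** * Riemann sums of the discrete correlations *)

Section Density.
Context {R : realType}.
Local Notation C := R[i].
Local Notation mu := (@lebesgue_measure R).
Local Notation P := (@posR R : set (measurableTypeR R)).
Local Notation iter k G x := (iterint (fun=> [set: R]) k G x).
Variables (z z' : C).
Hypothesis pp : pairpos z z'.

(** The L-ensemble identity at n = 0 writes the determinant as a sum of squares, and it is nonzero
    because the matrix is invertible. *)
Lemma Z_gt0 D (A : 'M[R]_D) : 0 < \det (1%:M + A *m A^T).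
Proof.
have := correlation_L_ensemble A (fun (k : 'I_0) _ => 1) => /= h.
rewrite lt_neqAle; apply/andP; split.
  by have := sym_resolvent_unit A; rewrite unitmxE unitfE eq_sym.
have e : \sum_(x : {ffun 'I_0 -> 'I_D}) (\prod_(k < 0) 1) * \det (\matrix_(i < 0, j < 0) (1%:M - invmx (1%:M + A *m A^T)) (x i) (x j)) = 1 :> R.
  have uniq0 (f : {ffun 'I_0 -> 'I_D}) : f == ffun0 (card_ord 0) by apply/eqP/ffunP => -[].
  rewrite (big_pred1 (ffun0 (card_ord 0))) => [|f]; last by rewrite [RHS]uniq0.
  by rewrite big_ord0 mul1r det_mx00.
rewrite e mulr1 in h; rewrite -h; apply: sumr_ge0 => d _; apply: sumr_ge0 => p _; apply: sumr_ge0 => q _.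
by apply: mulr_ge0; [exact: sqr_ge0|apply: sumr_ge0 => f _; apply: prodr_ge0].
Qed.

(** With delta functions for [h], one side of the L-ensemble identity is this single minor times a
    positive constant, and the other side has nonnegative terms. *)
Lemma det_kernel_ge0 D n (A : 'M[R]_D) (y : 'I_n -> 'I_D) :
  0 <= \det (\matrix_(i, j) (1%:M - invmx (1%:M + A *m A^T)) (y i) (y j)).
Proof.
have := correlation_L_ensemble A (fun k p => (p == y k)%:R : R) => /= h.
rewrite -(pmulr_rge0 _ (Z_gt0 A)).
have e : \sum_(x : {ffun 'I_n -> 'I_D}) (\prod_k (x k == y k)%:R) * \det (\matrix_(i, j) (1%:M - invmx (1%:M + A *m A^T)) (x i) (x j)) =
  \det (\matrix_(i, j) (1%:M - invmx (1%:M + A *m A^T)) (y i) (y j)).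
  rewrite (bigD1 [ffun k => y k]) //= big1 ?mul1r => [|k _]; last by rewrite ffunE eqxx.
  rewrite big1 ?addr0 => [|x xy].
    by congr (\det _); apply/matrixP => i j; rewrite !mxE !ffunE.
  suff [k xk] : exists k, x k != y k by rewrite (bigD1 k) //= (negbTE xk) !mul0r.
  apply/existsP; rewrite -negb_forall; apply: contra xy => /forallP h'.
  by apply/eqP/ffunP => k; rewrite ffunE; exact/eqP.
rewrite -e -h; apply: sumr_ge0 => d _; apply: sumr_ge0 => p _; apply: sumr_ge0 => q _.
by apply: mulr_ge0; [exact: sqr_ge0|apply: sumr_ge0 => f _; apply: prodr_ge0].
Qed.

Definition Kn M (x y : nat) : R :=
  if (insub x : option 'I_(NN M)) is Some i then
    if (insub y : option 'I_(NN M)) is Some j then Kmx z z' M i j else 0 else 0.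

(** The factor m^n turns the discrete correlation function into a density for cells of side 1/m. *)
Definition rhoM n M (v : nat -> nat) : R := M.+1%:R ^+ n * \det (\matrix_(i < n, j < n) Kn M (v i) (v j)).

Lemma rhoM_out n M v i : (i < n)%N -> (NN M <= v i)%N -> rhoM n M v = 0.
Proof.
move=> ni vi; rewrite /rhoM (expand_det_row _ (Ordinal ni)) big1 ?mulr0 // => j _.
by rewrite !mxE /Kn insubF ?mul0r //; apply/negbTE; rewrite -leqNgt.
Qed.

Lemma KnE M (i j : 'I_(NN M)) : Kn M i j = Kmx z z' M i j.
Proof. by rewrite /Kn !valK. Qed.

Lemma rhoM_ord n M (x : 'I_n -> 'I_(NN M)) (v : nat -> nat) : (forall i : 'I_n, v i = x i :> nat) ->
  rhoM n M v = M.+1%:R ^+ n * \det (\matrix_(i, j) Kmx z z' M (x i) (x j)).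
Proof.
move=> vx; congr (_ * \det _); apply/matrixP => i j; by rewrite [LHS]mxE [RHS]mxE !vx KnE.
Qed.

Lemma rhoM_C n M (v : nat -> nat) : (forall i : 'I_n, v i < NN M)%N -> exists x : 'I_n -> 'I_(NN M),
  (forall i, x i = v i :> nat) /\ rc (rhoM n M v) =
  \det (\matrix_(i, j) (M.+1%:R * kern z z' M (v i) (v j) + M.+1%:R * Wmx z z' M (x i) (x j))).
Proof.
move=> hv; pose x (i : 'I_n) := Ordinal (hv i); exists x; split => //.
rewrite (@rhoM_ord n M x) // rcM rcX rc_nat (gauge_det pp) -detZ; congr (\det _).
by apply/matrixP => i j; rewrite !mxE mulrDr.
Qed.

Lemma rhoM_ge0 n M v : 0 <= rhoM n M v.
Proof.
case: (boolP [forall i : 'I_n, v i < NN M]%N) => [/forallP hv|]; last first.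
  by move/forallPn => [i hi]; rewrite -leqNgt in hi; rewrite (@rhoM_out n M v i).
rewrite (@rhoM_ord n M (fun i => Ordinal (hv i))) // mulr_ge0 ?exprn_ge0 //; exact: det_kernel_ge0.
Qed.

Let nz := pairpos_nonint pp.
Let nz' := pairpos_nonint (pairpos_sym pp).
Lemma good1 : good (kcont (- z)) z z'.
Proof.
apply: good_all => //; rewrite (le_lt_trans (ler_norm _)) // /kcont ReN normrN.
by apply: (lt_trans (truncnS_gt _)); rewrite ltr_nat.
Qed.
Lemma good2 : good (kcont (- z')) z' z.
Proof.
apply: good_all => //; rewrite (le_lt_trans (ler_norm _)) // /kcont ReN normrN.
by apply: (lt_trans (truncnS_gt _)); rewrite ltr_nat.
Qed.

Lemma cnorm_det n (B : 'M[C]_n) (c : R) : (forall i j, cnorm (B i j) <= c) -> cnorm (\det B) <= n`!%:R * c ^+ n.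
Proof.
move=> hB; rewrite /determinant; apply: (le_trans (cnorm_sum _ _ _)).
have h (s : 'S_n) : cnorm ((-1) ^+ s * \prod_i B i (s i)) <= c ^+ n.
  rewrite cnormM cnormX cnormN cnorm1 expr1n mul1r cnorm_prod -[n in c ^+ n]card_ord -prodr_const.
  by apply: ler_prod => i _; rewrite cnorm_ge0 hB.
by apply: (le_trans (ler_sum _ (fun s _ => h s))); rewrite sumr_const card_Sn mulr_natl.
Qed.

Lemma rhoM_bound n (a b : R) : 0 < a -> 0 <= b -> exists c : R, 0 <= c /\ forall M v,
  (forall i, (i < n)%N -> a <= vsc M (v i) <= b) -> rhoM n M v <= c.
Proof.
move=> a0 b0; have [c hc] := kern_bound good1 good2 a0 b0; have [e he] := Wmx_bound pp.
pose d := `|c| + `|e|; have d0 : 0 <= d by rewrite addr_ge0.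
exists (n`!%:R * d ^+ n); split => [|M v hv]; first by rewrite mulr_ge0 // exprn_ge0.
case: (boolP [forall i : 'I_n, v i < NN M]%N) => [/forallP hN|]; last first.
  move/forallPn => [i hi]; rewrite -leqNgt in hi; rewrite (@rhoM_out n M v i) //.
  by rewrite mulr_ge0 // exprn_ge0.
have [x [xv ex]] := rhoM_C hN; apply: (le_trans (ler_norm _)); rewrite -cnorm_rc ex.
apply: cnorm_det => i j; rewrite mxE; apply: (le_trans (cnormD _ _)); apply: lerD.
  have /andP[h1 h2] := hv i (ltn_ord i); have /andP[h3 h4] := hv j (ltn_ord j).
  exact: le_trans (hc _ _ _ h1 h2 h3 h4) (ler_norm _).
have m1 : 1 <= M.+1%:R :> R by rewrite ler1n.
have m0 : 0 < M.+1%:R :> R by rewrite ltr0n.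
rewrite cnormM -rc_nat cnorm_rc ger0_norm //.
apply: (@le_trans _ _ (M.+1%:R * (e / M.+1%:R ^+ 2))); first by rewrite ler_pM2l.
rewrite expr2 (invfM (M.+1%:R : R) M.+1%:R) mulrCA mulrA mulrA mulfK ?gt_eqF // ler_pdivrMr //.
by apply: (le_trans (ler_norm _)); rewrite ler_peMr.
Qed.

Lemma fl_lt_near (u : R) : 0 < u -> \forall M \near \oo, (fl M.+1 u < NN M)%N.
Proof.
move=> u0; near=> M; have m0 : 0 < M.+1%:R :> R by rewrite ltr0n.
have [f1 _] := fl_bounds M (ltW u0); rewrite -(@ltr_nat R) /NN natrX expr2 -ltr_pdivrMr //.
apply: (le_lt_trans f1); apply: (lt_le_trans (truncnS_gt u)).
by rewrite ler_nat ltnS; near: M; exact: nbhs_infty_ge.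
Unshelve. all: by end_near. Qed.

Lemma near_forall_ord n (Q : 'I_n -> nat -> Prop) : (forall i, \forall M \near \oo, Q i M) -> \forall M \near \oo, forall i, Q i M.
Proof. by move=> h; apply: filter_forall. Qed.

(** Minors do not see the gauge, the rescaled defect is O(1/m), and [kern_lim] with [Mker_Klim]
    identifies the limit of each entry. *)
Lemma rhoM_cvgC n (x : nat -> R) : (forall i, (i < n)%N -> 0 < x i) ->
  cvgC (fun M => rc (rhoM n M (fun i => fl M.+1 (x i)))) (detMker z z' n x).
Proof.
move=> x0; have [et t0] := tparE pp.
have im0 : ImC (z * z') = 0 by rewrite -et.
pose W M i j : C := if (insub i : option 'I_(NN M)) is Some p then
   if (insub j : option 'I_(NN M)) is Some q then M.+1%:R * Wmx z z' M p q else 0 else 0.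
have W0 (i j : nat -> nat) : cvgC (fun M => W M (i M) (j M)) 0.
  apply: cvgC_norm0; have [e he] := Wmx_bound pp.
  have h : (fun M => `|e| / M.+1%:R) @ \oo --> (0 : R).
    by rewrite -[X in _ --> X](mulr0 `|e|); apply: cvgM; [exact: cvg_cst|exact: cvg_inv_nat].
  apply: (@squeeze_cvgr _ _ _ _ (fun=> 0) _ _ _ 0 _ h); last exact: cvg_cst.
  apply: nearW => M; rewrite cnorm_ge0 /=.
  have m0 : 0 < M.+1%:R :> R by rewrite ltr0n.
  have r0 : 0 <= `|e| / M.+1%:R by rewrite divr_ge0.
  rewrite /W; case: insubP => [p _ _|_]; last by rewrite cnorm0.
  case: insubP => [q _ _|_]; last by rewrite cnorm0.
  rewrite cnormM -rc_nat cnorm_rc ger0_norm //.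
  apply: (@le_trans _ _ (M.+1%:R * (e / M.+1%:R ^+ 2))); first by rewrite ler_pM2l.
  rewrite expr2 (invfM (M.+1%:R : R) M.+1%:R) mulrCA mulrA mulrA mulfK ?gt_eqF // ler_pM2r ?invr_gt0 //.
  exact: ler_norm.
apply: (@cvgC_near _ (fun M => \det (\matrix_(i < n, j < n)
   (M.+1%:R * kern z z' M (fl M.+1 (x i)) (fl M.+1 (x j)) + W M (fl M.+1 (x i)) (fl M.+1 (x j)))))).
  have h := @near_forall_ord n (fun i M => fl M.+1 (x i) < NN M)%N (fun i => fl_lt_near (x0 i (ltn_ord i))).
  apply: filterS h => M hM; have [y [yv ->]] := rhoM_C (v := fun i => fl M.+1 (x i)) hM.
  congr (\det _); apply/matrixP => i j; rewrite [LHS]mxE [RHS]mxE; congr (_ + _).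
  by rewrite /W -(yv i) -(yv j) !valK.
rewrite /detMker; apply: cvgC_det => i j.
have xi := x0 i (ltn_ord i); have xj := x0 j (ltn_ord j).
rewrite (Mker_Klim nz nz' im0 xi xj) -[X in cvgC _ X]addr0.
apply: cvgCD; last exact: W0.
apply: (kern_lim good1 good2 xi xj); apply: slim_fl; exact: ltW.
Qed.

(** The determinant is a limit of real ones. *)
Lemma detMker_real n (x : nat -> R) : (forall i, (i < n)%N -> 0 < x i) -> ImC (detMker z z' n x) = 0.
Proof.
move=> x0; have [_ h] := rhoM_cvgC x0.
apply: (cvg_unique (@norm_hausdorff _ _) h); exact: cvg_cst.
Qed.

Definition rho n (x : nat -> R) : R := if [forall i : 'I_n, 0 < x i] then ReC (detMker z z' n x) else 0.

Definition fl_ind M j (u : R) : R := if (0 < u) && (fl M.+1 u == j) then 1 else 0.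
Lemma measurable_fl_ind M j : measurable_fun [set: measurableTypeR R] (fl_ind M j).
Proof.
have h := measurable_fl (fun j' => (j' == j)%:R : R) M.
have mP := @measurable_posR R.
have := (measurable_restrictT _ mP).1 h; congr measurable_fun; apply/funext => u.
rewrite /patch /fl_ind; case: ifPn => hu.
  by have -> : 0 < u by [move: hu; rewrite inE]; case: eqP.
by rewrite ifF //; apply/negbTE; apply: contra hu => /andP[u0 _]; rewrite inE.
Qed.

Definition stepf n M (Phi : (nat -> nat) -> R) (x : nat -> R) : R :=
  if [forall i : 'I_n, 0 < x i] then Phi (fun i => fl M.+1 (x i)) else 0.

(** A finite sum of products of one-variable indicators, the form from which joint measurability is
    read off. *)
Lemma stepf_sum n M (Phi : (nat -> nat) -> R) x : (forall v i, (i < n)%N -> (NN M <= v i)%N -> Phi v = 0) ->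
  (forall v w, (forall i, (i < n)%N -> v i = w i) -> Phi v = Phi w) ->
  stepf n M Phi x = \sum_(f : {ffun 'I_n -> 'I_(NN M)}) Phi (ext_ord f (fun=> 0%N)) * \prod_(i < n) fl_ind M (f i) (x i).
Proof.
move=> Pz Pe; rewrite /stepf; case: ifPn => [/forallP hx|]; last first.
  move/forallPn => [i hi]; rewrite big1 // => f _.
  by rewrite (bigD1 i) //= /fl_ind (negbTE hi) mul0r mulr0.
case: (boolP [forall i : 'I_n, fl M.+1 (x i) < NN M]%N) => [/forallP hv|]; last first.
  move/forallPn => [i hi]; rewrite -leqNgt in hi; rewrite (Pz _ i) // big1 // => f _.
  rewrite (bigD1 i) //= /fl_ind hx ifF ?mul0r ?mulr0 //; apply/negbTE; rewrite neq_ltn orbC.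
  by rewrite (leq_trans (ltn_ord _) hi).
pose f0 : {ffun 'I_n -> 'I_(NN M)} := [ffun i => Ordinal (hv i)].
rewrite (bigD1 f0) //= big1 ?mulr1 => [|i _]; last by rewrite /fl_ind hx ffunE eqxx.
rewrite big1 ?addr0 => [|f ff].
  apply: Pe => i ni; rewrite /ext_ord (insubT (fun j => j < n)%N ni) ffunE //.
have [i fi] : exists i, f i != f0 i.
  apply/existsP; rewrite -negb_forall; apply: contra ff => /forallP h; apply/eqP/ffunP => i; exact/eqP.
rewrite (bigD1 i) //= /fl_ind ifF ?mul0r ?mulr0 //; apply/negbTE; rewrite negb_and; apply/orP; right.
by move: fi; rewrite ffunE -val_eqE eq_sym.
Qed.

Lemma jp_sum I (s : seq I) (f : I -> (nat -> R) -> R) : (forall i, jp (f i)) -> jp (fun x => \sum_(i <- s) f i x).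
Proof.
move=> h; elim: s => [|i s IH]; first by under eq_fun do rewrite big_nil; exact: jp_cst.
by under eq_fun do rewrite big_cons; exact: jpD.
Qed.

Lemma jp_stepf n M Phi : (forall v i, (i < n)%N -> (NN M <= v i)%N -> Phi v = 0) ->
  (forall v w, (forall i, (i < n)%N -> v i = w i) -> Phi v = Phi w) -> (forall v, 0 <= Phi v) -> jp (stepf n M Phi).
Proof.
move=> Pz Pe P0; rewrite (_ : stepf n M Phi = fun x => \sum_(f : {ffun 'I_n -> 'I_(NN M)}) Phi (ext_ord f (fun=> 0%N)) * \prod_(i < n) fl_ind M (f i) (x i)); last first.
  by apply/funext => x; exact: stepf_sum.
apply: jp_sum => f; apply: jpM; first exact: jp_cst.
pose g k : R -> R := if (insub k : option 'I_n) is Some i then fl_ind M (f i) else fun=> 0.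
rewrite (_ : (fun x => _) = prodf g n); last by apply/funext => x; apply: eq_bigr => i _; rewrite /g valK.
apply: jp_prodf => k kn; rewrite /g (insubT (fun j => j < n)%N kn); split => [|u]; first exact: measurable_fl_ind.
by rewrite /fl_ind; case: ifP.
Qed.

Lemma rhoM_ext n M v w : (forall i, (i < n)%N -> v i = w i) -> rhoM n M v = rhoM n M w.
Proof. by move=> h; congr (_ * \det _); apply/matrixP => i j; rewrite !mxE !h. Qed.

Lemma stepf_rho n x : (fun M => stepf n M (rhoM n M) x) @ \oo --> rho n x.
Proof.
rewrite /stepf /rho; case: ifPn => [/forallP h|_]; last exact: cvg_cst.
by have [] := @rhoM_cvgC n x (fun i ni => h (Ordinal ni)).
Qed.

(** Positivity and measurability of the density are inherited from the step functions of the
    discrete minors, which are nonnegative as correlation functions. *)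
Lemma jp_rho n : jp (rho n).
Proof.
apply: (@jp_lim _ (fun M => stepf n M (rhoM n M))); last exact: stepf_rho.
by move=> M; apply: jp_stepf; [exact: rhoM_out|exact: rhoM_ext|exact: rhoM_ge0].
Qed.

Lemma prod_le1 n (f : 'I_n -> R) : (forall k, 0 <= f k <= 1) -> \prod_k f k <= 1.
Proof.
move=> h; apply: (@le_trans _ _ (\prod_(k < n) 1)); last by rewrite big1.
by apply: ler_prod => k _; exact: h.
Qed.

Lemma cvg_bigprod I (s : seq I) (f : I -> nat -> R) (g : I -> R) : (forall i, f i @ \oo --> g i) ->
  (fun M => \prod_(i <- s) f i M) @ \oo --> \prod_(i <- s) g i.
Proof.
move=> h; elim: s => [|i s IH]; first by rewrite big_nil; under eq_fun do rewrite big_nil; exact: cvg_cst.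
by rewrite big_cons; under eq_fun do rewrite big_cons; exact: cvgM.
Qed.

Lemma riemann_kernel n (a b : R) (h : nat -> R -> R) : 0 < a -> (forall k, (k < n)%N -> bump a b (h k)) ->
  (fun M => (\sum_(x : {ffun 'I_n -> 'I_(NN M)}) (\prod_(k < n) h k (((x k)%:R + 2^-1) / M.+1%:R)) *
     \det (\matrix_(i, j) Kmx z z' M (x i) (x j)))%:E) @ \oo -->
    iter n (fun x => (prodf h n x * rho n x)%:E) (fun=> 0) /\
  (iter n (fun x => (prodf h n x * rho n x)%:E) (fun=> 0%R) < +oo)%E.
Proof.
move=> a0 bh; pose b' := Num.max 0 b; have b'0 : 0 <= b' by rewrite le_max lexx.
have bb' : b <= b' by rewrite le_max lexx orbT.
pose Phi M (v : nat -> nat) := \prod_(k < n) h k (((v k)%:R + 2^-1) / M.+1%:R) * rhoM n M v.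
have [c [c0 hc]] := @rhoM_bound n a (b' + 1) a0 (addr_ge0 b'0 ler01).
have Pz M v i : (i < n)%N -> (NN M <= v i)%N -> Phi M v = 0 by move=> ni vi; rewrite /Phi (rhoM_out ni vi) mulr0.
have Pe M v w : (forall i, (i < n)%N -> v i = w i) -> Phi M v = Phi M w.
  by move=> vw; rewrite /Phi (rhoM_ext _ vw); congr (_ * _); apply: eq_bigr => k _; rewrite vw.
have h01 k u : (k < n)%N -> 0 <= h k u <= 1 by move=> kn; have [] := bh k kn.
have P0 M v : 0 <= Phi M v.
  by rewrite mulr_ge0 ?rhoM_ge0 // prodr_ge0 // => k _; have /andP[] := h01 k (((v k)%:R + 2^-1) / M.+1%:R) (ltn_ord k).
(* The bump is evaluated at (v + 1/2)/m and the bounds on [rhoM] are stated at (v + 1)/m; the half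
   step moves it up by at most 1. *)
have Psupp M v : Phi M v != 0 -> forall i, (i < n)%N -> a <= vsc M (v i) <= b' + 1.
  move=> Pn i ni; have m0 : 0 < M.+1%:R :> R by rewrite ltr0n.
  have i1 : (M.+1%:R)^-1 <= 1 :> R by rewrite invf_le1 // ler1n.
  have i0 : 0 <= (M.+1%:R)^-1 :> R by rewrite invr_ge0.
  have : a <= ((v i)%:R + 2^-1) / M.+1%:R <= b.
    apply: contraNT Pn => hn; have [_ hz _] := bh i ni.
    by rewrite /Phi (bigD1 (Ordinal ni)) //= (hz _ hn) !mul0r.
  by rewrite /vsc -(natr1 (v i)) !mulrDl mul1r; move: i0 i1; set y := M.+1%:R^-1; set w := (v i)%:R * y; lra.
have Pc M v : Phi M v <= c.
  have [->//|Pn] := eqVneq (Phi M v) 0; have hb := hc M v (Psupp M v Pn).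
  rewrite /Phi -[leRHS]mul1r; apply: ler_pM (rhoM_ge0 _ _ _) _ hb.
    by rewrite prodr_ge0 // => k _; have /andP[] := h01 k (((v k)%:R + 2^-1) / M.+1%:R) (ltn_ord k).
  by apply: prod_le1 => k; exact: h01.
pose G M := stepf n M (Phi M).
have jG M : jp (G M) by apply: jp_stepf; [exact: Pz|exact: Pe|exact: P0].
have Gc M x : G M x <= c by rewrite /G /stepf; case: ifP.
have Gz M x i : (i < n)%N -> ~~ (0 <= x i <= b' + 1) -> G M x = 0.
  move=> ni hx; rewrite /G /stepf; case: ifP => // /forallP x0.
  apply/eqP; apply: contraNT hx => Pn; have /andP[_ h2] := Psupp M _ Pn i ni.
  have xi := x0 (Ordinal ni); rewrite /= in xi; rewrite (ltW xi) /=.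
  have [_ f2] := fl_bounds M (ltW xi); exact: le_trans (ltW f2) h2.
have lim x : (G ^~ x) @ \oo --> prodf h n x * rho n x.
  rewrite /G; have [hx|hx] := boolP [forall i : 'I_n, 0 < x i]; last first.
    by rewrite /rho (negbTE hx) mulr0; under eq_fun do rewrite /stepf (negbTE hx); exact: cvg_cst.
  have := @stepf_rho n x; rewrite /stepf hx => lr.
  apply: cvgM => //; move/forallP: hx => hx; rewrite /prodf.
  have lk (k : 'I_n) : (fun M => h k (((fl M.+1 (x k))%:R + 2^-1) / M.+1%:R)) @ \oo --> h k (x k).
    have [_ _ [K [K0 hK]]] := bh k (ltn_ord k).
    have l1 : (fun M => ((fl M.+1 (x k))%:R + 2^-1) / M.+1%:R) @ \oo --> x k.
      have l0 : (fun M => (fl M.+1 (x k))%:R / M.+1%:R + 2^-1 * M.+1%:R^-1) @ \oo --> x k + 2^-1 * 0.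
        by apply: cvgD; [exact: slim_fl (ltW (hx k))|apply: cvgM; [exact: cvg_cst|exact: cvg_inv_nat]].
      by rewrite mulr0 addr0 in l0; under eq_fun do rewrite mulrDl.
    have l2 : (fun M => K * `|x k - ((fl M.+1 (x k))%:R + 2^-1) / M.+1%:R|) @ \oo --> (0 : R).
      rewrite -[X in _ --> X](mulr0 K); apply: cvgM; first exact: cvg_cst.
      rewrite -[X in _ --> X](@normr0 _ R) -[X in `|X|](subrr (x k)); apply: cvg_norm; apply: cvgB => //; exact: cvg_cst.
    apply/cvgrPdist_le => e e0; have /cvgrPdist_le /(_ e e0) l3 := l2; move: l3; apply: filterS => M /=.
    by rewrite sub0r normrN ger0_norm ?mulr_ge0 // => h'; exact: le_trans (hK _ _) h'.
  exact: cvg_bigprod.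
have main := @iter_DCT R n G (fun x => prodf h n x * rho n x) c 0 (b' + 1) c0 (addr_ge0 b'0 ler01) jG Gc Gz lim (fun=> 0).
have [cv bd] := main.
have e M : iter n (fun x => (G M x)%:E) (fun=> 0) = (\sum_(x : {ffun 'I_n -> 'I_(NN M)}) (\prod_(k < n) h k (((x k)%:R + 2^-1) / M.+1%:R)) *
     \det (\matrix_(i, j) Kmx z z' M (x i) (x j)))%:E.
  rewrite (@iter_step R (NN M) n n M (Phi M) (fun=> 0) (leqnn n) (Pz M)); last by move=> i /andP[ni]; rewrite ltnNge ni.
  congr EFin; rewrite itersumE mulr_sumr; apply: eq_bigr => f _; rewrite /Phi.
  have ef (i : 'I_n) : ext_ord f (fun i => fl M.+1 (0 : R)) i = f i by rewrite /ext_ord valK.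
  rewrite (@rhoM_ord n M f) // mulrCA; under eq_bigr do rewrite ef.
  congr (_ * _); rewrite mulrA -exprMn mulVf ?expr1n ?mul1r //.
split; first by under eq_fun do rewrite -e.
apply: (@le_lt_trans _ _ (c * (b' + 1 - 0) ^+ n)%:E); last exact: ltry.
by apply: (@cvge_le _ _ _ _ _ _ _ _ cv); apply: nearW.
Qed.
End Density.

(** * Poissonization of the measures P^(n) *)

Section InjectiveSums.
Context {R : realType}.

Lemma itersum_widen N N' k (Phi : (nat -> nat) -> R) v : (N <= N')%N ->
  (forall v i, (i < k)%N -> (N <= v i)%N -> Phi v = 0) -> itersum N' k Phi v = itersum N k Phi v.
Proof.
move=> NN' h; rewrite !itersumE.
have {h} : forall v i, (i < k)%N -> (N <= v i)%N -> Phi v = 0 by [].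
rewrite -!itersumE; elim: k v => [//|k IH] v h /=.
have z0 (j : nat) : (N <= j)%N -> itersum N' k Phi (fun i => if i == k then j else v i) = 0.
  move=> Nj; rewrite itersumE big1 // => f _; apply: (h _ k) => //.
  by rewrite /ext_ord insubF ?ltnn ?eqxx.
rewrite (big_ord_widen N' (fun j => itersum N k Phi (fun i => if i == k then j else v i)) NN').
rewrite [RHS]big_mkcond; apply: eq_bigr => j _; case: ltnP => hj; last exact: z0.
by apply: IH => w i ik; apply: h; exact: ltnW.
Qed.

Lemma itersum_ge0 N k (Phi : (nat -> nat) -> R) v : (forall v, 0 <= Phi v) -> 0 <= itersum N k Phi v.
Proof. by move=> h; rewrite itersumE sumr_ge0. Qed.

Lemma itersum_mono N N' k (Phi Psi : (nat -> nat) -> R) v : (N <= N')%N -> (forall v, 0 <= Psi v) ->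
  (forall v, Phi v <= Psi v) -> itersum N k Phi v <= itersum N' k Psi v.
Proof.
move=> NN' P0 h; elim: k v => [|k IH] v /=; first exact: h.
rewrite (big_ord_widen N' (fun j => itersum N k Phi (fun i => if i == k then j else v i)) NN') big_mkcond.
by apply: ler_sum => j _; case: ifP => _; [exact: IH|exact: itersum_ge0].
Qed.

Definition injsum n L (a : nat -> nat -> R) : R :=
  \sum_(f : {ffun 'I_n -> 'I_L} | injectiveb f) \prod_(k < n) a k (f k).

Lemma injsum_itersum n L a : injsum n L a = itersum L n (fun v =>
  (injectiveb [ffun k : 'I_n => v k])%:R * \prod_(k < n) a k (v k)) (fun=> 0).
Proof.
rewrite itersumE /injsum big_mkcond; apply: eq_bigr => f _.
have e (k : 'I_n) : ext_ord f (fun=> 0) k = f k by rewrite /ext_ord valK.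
under [in RHS]eq_bigr do rewrite e.
have -> : injectiveb [ffun k : 'I_n => ext_ord f (fun=> 0) k] = injectiveb f.
  apply/injectiveP/injectiveP => h i j; have := h i j; rewrite !ffunE !e.
    by move=> h' fij; apply: h'; rewrite fij.
  by move=> h' /val_inj.
by case: (injectiveb f); rewrite ?mul1r ?mul0r.
Qed.

Lemma injsum_widen n L L' a : (L <= L')%N -> (forall k i, (k < n)%N -> (L <= i)%N -> a k i = 0) ->
  injsum n L' a = injsum n L a.
Proof.
move=> LL h; rewrite !injsum_itersum; apply: itersum_widen => // v i ni Lv.
by rewrite (bigD1 (Ordinal ni)) //= h // mul0r mulr0.
Qed.

Lemma injsum_stable n L L' a : (forall k i, (k < n)%N -> (L <= i)%N -> a k i = 0) ->
  (forall k i, (k < n)%N -> (L' <= i)%N -> a k i = 0) -> injsum n L a = injsum n L' a.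
Proof.
move=> h h'; case/orP: (leq_total L L') => H; last exact: injsum_widen.
by apply/esym/injsum_widen.
Qed.

Lemma eq_injsum n L a b : (forall k i, (k < n)%N -> (i < L)%N -> a k i = b k i) -> injsum n L a = injsum n L b.
Proof. by move=> h; apply: eq_bigr => f _; apply: eq_bigr => k _; rewrite h. Qed.

Lemma injsum_ge0 n L a : (forall k i, (k < n)%N -> 0 <= a k i) -> 0 <= injsum n L a.
Proof. by move=> h; apply: sumr_ge0 => f _; apply: prodr_ge0 => k _; exact: h. Qed.

Lemma prod_lip n (a b : 'I_n -> R) e : (forall k, 0 <= a k <= 1) -> (forall k, 0 <= b k <= 1) ->
  (forall k, `|a k - b k| <= e) -> `|\prod_k a k - \prod_k b k| <= n%:R * e.
Proof.
elim: n a b => [|n IH] a b ha hb hab; first by rewrite !big_ord0 subrr normr0 mul0r.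
rewrite !big_ord_recr /= -natr1 mulrDl mul1r.
set A := \prod_(k < n) _; set B := \prod_(k < n) _.
have -> : A * a ord_max - B * b ord_max = (A - B) * a ord_max + B * (a ord_max - b ord_max) by ring.
have /andP[a0 a1] := ha ord_max.
apply: (le_trans (ler_normD _ _)); rewrite !normrM; apply: lerD.
  rewrite -[leRHS]mulr1; apply: ler_pM => //; last by rewrite ger0_norm.
  exact: IH.
rewrite -[leRHS]mul1r; apply: ler_pM => //.
have B0 : 0 <= B by apply: prodr_ge0 => k _; have /andP[] := hb (widen_ord (leqnSn n) k).
by rewrite ger0_norm //; apply: prod_le1 => k; exact: hb.
Qed.

Lemma card_injsum n L (c : R) : 0 <= c -> \sum_(f : {ffun 'I_n -> 'I_L} | injectiveb f) c <= L%:R ^+ n * c.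
Proof.
move=> c0; apply: (@le_trans _ _ (\sum_(f : {ffun 'I_n -> 'I_L}) c)).
  by rewrite big_mkcond; apply: ler_sum => f _; case: ifP.
have -> : \sum_(f : {ffun 'I_n -> 'I_L}) c = c *+ #|{: {ffun 'I_n -> 'I_L}}| by rewrite -sumr_const; apply: eq_bigl => f; rewrite inE.
by rewrite card_ffun !card_ord -natrX mulr_natl.
Qed.

Lemma injsum_le n L a : (forall k i, (k < n)%N -> 0 <= a k i <= 1) -> injsum n L a <= L%:R ^+ n.
Proof.
move=> h; rewrite -[leRHS]mulr1; apply: le_trans (card_injsum n L ler01).
by apply: ler_sum => f _; apply: prod_le1 => k; exact: h.
Qed.

Lemma injsum_lip n L a b e : 0 <= e -> (forall k i, (k < n)%N -> 0 <= a k i <= 1) -> (forall k i, (k < n)%N -> 0 <= b k i <= 1) ->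
  (forall k i, (k < n)%N -> `|a k i - b k i| <= e) -> `|injsum n L a - injsum n L b| <= L%:R ^+ n * (n%:R * e).
Proof.
move=> e0 ha hb hab; rewrite /injsum -sumrB; apply: (le_trans (ler_norm_sum _ _ _)).
have ne0 : 0 <= n%:R * e by rewrite mulr_ge0.
apply: le_trans (card_injsum n L ne0); apply: ler_sum => f _.
by apply: prod_lip => k; [exact: ha|exact: hb|exact: hab].
Qed.
End InjectiveSums.

(** * Weights of the L-ensemble and of the mixture *)

Section Poissonization.
Context {R : realType}.
Local Notation C := R[i].
Variables (z z' : C).
Hypothesis pp : pairpos z z'.
Local Notation t := (tpar z z').

(** The mass of P^(N) without the factor N!/(t)_N. The mixing weight (t)_N/N! cancels that factor,
    which is why this particular mixture is determinantal. *)
Definition wt d (v w : nat -> nat) : R :=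
  t ^+ d * \prod_(i < d) (uw (z + 1) (z' + 1) (v i) * uw (1 - z) (1 - z') (w i)) *
  (\det (\matrix_(i < d, j < d) ((v i + w j).+1%:R : R)^-1)) ^+ 2.

Lemma wt_ge0 d v w : 0 <= wt d v w.
Proof.
have [_ t0] := tparE pp; rewrite mulr_ge0 ?sqr_ge0 // mulr_ge0 ?exprn_ge0 ?(ltW t0) //.
apply: prodr_ge0 => i _; have [_ a0] := uwE (v i) (ppA pp); have [_ b0] := uwE (w i) (ppB pp).
by rewrite mulr_ge0 ?ltW.
Qed.

Lemma det_Amx M d (p q : {ffun 'I_d -> 'I_(NN M)}) :
  (\det (\matrix_(i, j) Amx z z' M (p i) (q j))) ^+ 2 =
  ex M (\sum_(i < d) (p i + q i).+1) * wt d (ext_ord p (fun=> 0)) (ext_ord q (fun=> 0)).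
Proof.
have [_ t0] := tparE pp.
have e (f : {ffun 'I_d -> 'I_(NN M)}) (i : 'I_d) : ext_ord f (fun=> 0) i = f i by rewrite /ext_ord valK.
pose A (x : nat) := Num.sqrt t * Num.sqrt (uw (z + 1) (z' + 1) x) * rr M ^+ x.+1.
pose B (x : nat) := Num.sqrt (uw (1 - z) (1 - z') x) * rr M ^+ x.
have -> : \matrix_(i, j) Amx z z' M (p i) (q j) =
    diag_mx (\row_i A (p i)) *m (\matrix_(i < d, j < d) ((p i + q j).+1%:R)^-1) *m diag_mx (\row_j B (q j)) :> 'M[R]_d.
  apply/matrixP => i j; rewrite mul_diag_mx mul_mx_diag [LHS]mxE [RHS]mxE [in RHS]mxE [in RHS]mxE /Amx mxE /A /B !mxE.
  by rewrite mulrAC.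
rewrite !det_mulmx !det_diag.
under eq_bigr do rewrite mxE.
under [X in _ * _ * X]eq_bigr do rewrite mxE.
rewrite /wt; under [X in t ^+ d * X]eq_bigr do rewrite !e.
rewrite (_ : (\matrix_(i, j) ((ext_ord p (fun=> 0) i + ext_ord q (fun=> 0) j).+1%:R)^-1) = \matrix_(i < d, j < d) ((p i + q j).+1%:R)^-1 :> 'M[R]_d); last first.
  by apply/matrixP => i j; rewrite !mxE !e.
set Dt := \det _.
have -> : ex M (\sum_(i < d) (p i + q i).+1) = \prod_(i < d) (rr M ^+ (p i).+1 * rr M ^+ q i) ^+ 2 :> R.
  rewrite (big_morph (ex M) (exD M) (ex0 M)); apply: eq_bigr => i _.
  by rewrite -exprD -exprM mulnC rrX2 addSn.
have -> : t ^+ d = \prod_(i < d) t by rewrite prodr_const card_ord.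
rewrite -big_split mulrA -big_split mulrAC exprMn -big_split -prodrXl; congr (_ * _).
apply: eq_bigr => i _; have [_ a0] := uwE (p i) (ppA pp); have [_ b0] := uwE (q i) (ppB pp).
rewrite /A /B /= !exprMn (sqr_sqrtr (ltW t0)) (sqr_sqrtr (ltW a0)) (sqr_sqrtr (ltW b0)); ring.
Qed.

Definition decn d (v : nat -> nat) := [forall i : 'I_d, forall j : 'I_d, (i < j)%N ==> (v j < v i)%N].
Definition wt_at (H : nat -> (nat -> nat) -> R) N d v w : R :=
  if [&& decn d v, decn d w & (\sum_(i < d) (v i + w i).+1 == N)%N] then wt d v w * H d v else 0.
(** [D] is the cutoff of the finite matrices, for the number of points and for their coordinates;
    [N] is the size of the configuration. For N <= D the cutoff has no effect. *)
Definition Wsum H D N : R := \sum_(d < D.+1) itersum D d (fun v => itersum D d (wt_at H N d v) (fun=> 0)) (fun=> 0).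

Lemma wt_at_ge0 H N d v w : (forall d v, 0 <= H d v) -> 0 <= wt_at H N d v w.
Proof. by move=> H0; rewrite /wt_at; case: ifP => // _; rewrite mulr_ge0 ?wt_ge0. Qed.

Lemma Wsum_ge0 H D N : (forall d v, 0 <= H d v) -> 0 <= Wsum H D N.
Proof. by move=> H0; apply: sumr_ge0 => d _; apply: itersum_ge0 => v; apply: itersum_ge0 => w; exact: wt_at_ge0. Qed.

Lemma wt_at_out H N d (v w : nat -> nat) : (N < d)%N || [exists i : 'I_d, (N <= v i)%N || (N <= w i)%N] -> wt_at H N d v w = 0.
Proof.
move=> h; rewrite /wt_at ifF //; apply/negbTE; rewrite !negb_and; apply/orP; right; apply/orP; right.
apply: contraL h => /eqP <-; rewrite negb_or -leqNgt; apply/andP; split.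
  by rewrite -[X in (X <= _)%N](card_ord d) -sum1_card leq_sum.
by rewrite negb_exists; apply/forallP => i; rewrite negb_or -!ltnNge; apply/andP; split;
  rewrite (bigD1 i) //= ltn_addr // ltnS ?leq_addr ?leq_addl.
Qed.

Lemma Wsum_widen H D N : (N <= D)%N -> Wsum H D N = Wsum H N N.
Proof.
move=> ND; rewrite /Wsum (big_ord_widen D.+1 (fun d => itersum N d (fun v => itersum N d (wt_at H N d v) (fun=> 0)) (fun=> 0))) //.
rewrite [RHS]big_mkcond; apply: eq_bigr => d _; case: ltnP => hd; last first.
  rewrite itersumE big1 // => f _; rewrite itersumE big1 // => g _; apply: wt_at_out; by rewrite hd.
rewrite (@itersum_widen R N D) // => [|v i id Nv].
  rewrite !itersumE; apply: eq_bigr => f _; apply: itersum_widen => // w i id Nw.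
  by apply: wt_at_out; apply/orP; right; apply/existsP; exists (Ordinal id); rewrite /= Nw orbT.
rewrite itersumE big1 // => g _; apply: wt_at_out; apply/orP; right; apply/existsP; exists (Ordinal id).
by rewrite /= Nv.
Qed.

Lemma Wsum_mono H D N : (forall d v, 0 <= H d v) -> (D <= N)%N -> Wsum H D N <= Wsum H N N.
Proof.
move=> H0 DN; have g0 d v w := wt_at_ge0 N d v w H0.
rewrite /Wsum (big_ord_widen N.+1 (fun d => itersum D d (fun v => itersum D d (wt_at H N d v) (fun=> 0)) (fun=> 0))) //.
rewrite big_mkcond; apply: ler_sum => d _.
have p0 : 0 <= itersum N d (fun v => itersum N d (wt_at H N d v) (fun=> 0)) (fun=> 0).
  by apply: itersum_ge0 => v; exact: itersum_ge0.
by case: ifP => // _; apply: itersum_mono => // [v|v]; [exact: itersum_ge0|exact: itersum_mono].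
Qed.

Lemma Wsum_le H D N : (forall d v, 0 <= H d v) -> Wsum H D N <= Wsum H N N.
Proof.
by move=> H0; case/orP: (leq_total D N) => h; [exact: Wsum_mono|rewrite Wsum_widen].
Qed.

Lemma ext_ordE k N (f : {ffun 'I_k -> 'I_N}) v (i : 'I_k) : ext_ord f v i = f i.
Proof. by rewrite /ext_ord valK. Qed.

Lemma wt_at_ext H N d D (p q : {ffun 'I_d -> 'I_D}) : wt_at H N d (ext_ord p (fun=> 0)) (ext_ord q (fun=> 0)) =
  if [&& strdec p, strdec q & (\sum_(i < d) (p i + q i).+1 == N)%N]
  then wt d (ext_ord p (fun=> 0)) (ext_ord q (fun=> 0)) * H d (ext_ord p (fun=> 0)) else 0.
Proof.
have e (f : {ffun 'I_d -> 'I_D}) : decn d (ext_ord f (fun=> 0)) = strdec f.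
  by apply: eq_forallb => i; apply: eq_forallb => j; rewrite !ext_ordE.
by rewrite /wt_at !e; under eq_bigr do rewrite !ext_ordE.
Qed.

(** The size of a configuration is additive over its pairs, so that e^(-N/m) factors into the powers
    of [rr M] in [Amx]. At most D pairs of size at most 2D occur, whence the range of N. *)
Lemma poissonization n M (h : nat -> R -> R) (D := NN M) :
  \det (1%:M + Amx z z' M *m (Amx z z' M)^T) *
  (\sum_(x : {ffun 'I_n -> 'I_(NN M)}) (\prod_(k < n) h k (((x k)%:R + 2^-1) / M.+1%:R)) *
     \det (\matrix_(i, j) Kmx z z' M (x i) (x j))) =
  \sum_(N < (2 * D * D).+1) ex M N * Wsum (fun d v => injsum n d (fun k i => h k (((v i)%:R + 2^-1) / M.+1%:R))) D N.
Proof.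
have := correlation_L_ensemble (Amx z z' M) (fun (k : 'I_n) x => h k ((x%:R + 2^-1) / M.+1%:R)).
rewrite /Kmx => <-; rewrite /Wsum.
under [RHS]eq_bigr do rewrite mulr_sumr.
rewrite exchange_big; apply: eq_bigr => d _.
under [RHS]eq_bigr do (rewrite itersumE mulr_sumr; under eq_bigr do rewrite itersumE mulr_sumr).
rewrite [RHS]exchange_big [LHS]big_mkcond; apply: eq_bigr => p _.
rewrite [RHS]exchange_big /=.
have -> : (if strdec p then \sum_(q : {ffun 'I_d -> 'I_D} | strdec q)
      \det (\matrix_(i, j) Amx z z' M (p i) (q j)) ^+ 2 *
      \sum_(f : {ffun 'I_n -> 'I_d} | injectiveb f) \prod_(k < n) h k (((p (f k))%:R + 2^-1) / M.+1%:R) else 0) =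
   \sum_(q : {ffun 'I_d -> 'I_D}) if strdec p && strdec q then \det (\matrix_(i, j) Amx z z' M (p i) (q j)) ^+ 2 *
      \sum_(f : {ffun 'I_n -> 'I_d} | injectiveb f) \prod_(k < n) h k (((p (f k))%:R + 2^-1) / M.+1%:R) else 0.
  by case: (strdec p) => /=; [rewrite [LHS]big_mkcond|rewrite big1].
apply: eq_bigr => q _; under eq_bigr do rewrite wt_at_ext.
set Hp := injsum _ _ _; have eH : Hp = \sum_(f : {ffun 'I_n -> 'I_d} | injectiveb f) \prod_(k < n) h k (((p (f k))%:R + 2^-1) / M.+1%:R).
  by apply: eq_bigr => f _; apply: eq_bigr => k _; rewrite ext_ordE.
case: (boolP (strdec p)) => hp; last by rewrite ?andbF /= [RHS]big1 // => N _; rewrite ?andbF mulr0.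
case: (boolP (strdec q)) => hq; last by rewrite ?andbF /= [RHS]big1 // => N _; rewrite ?andbF mulr0.
set s := (\sum_(i < d) (p i + q i).+1)%N.
have sB : (s < (2 * D * D).+1)%N.
  rewrite ltnS; apply: (@leq_trans (\sum_(i < d) (2 * D))).
    by apply: leq_sum => i _; have := ltn_ord (p i); have := ltn_ord (q i); rewrite -/D; clear; lia.
  by rewrite sum_nat_const card_ord mulnC leq_mul2l -ltnS ltn_ord orbT.
rewrite (bigD1 (Ordinal sB)) //= eqxx [X in _ = _ + X]big1 ?addr0 => [|N].
  by rewrite det_Amx -/s -eH mulrA.
by rewrite -val_eqE /= eq_sym => /negbTE ->; rewrite mulr0.
Qed.

Lemma ReC_wt d N (p q : {ffun 'I_d -> 'I_N}) : Pn_mass z z' p q =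
  N`!%:R / rpoch t N * wt d (ext_ord p (fun=> 0)) (ext_ord q (fun=> 0)).
Proof.
rewrite /Pn_mass /wt [RHS]mulrA; congr (_ * (_ ^+ 2)); last by congr (\det _); apply/matrixP => i j; rewrite !mxE !ext_ordE.
set P := \prod_(i < d) (_ / _); set Q := \prod_(i < d) (_ * _).
have -> : P = rc Q.
  rewrite rc_prod; apply: eq_bigr => i _; rewrite !ext_ordE !rcM.
  have [-> _] := uwE (p i) (ppA pp); have [-> _] := uwE (q i) (ppB pp).
  rewrite /cbin !rc_nat ![1 - _]addrC !invfM.
  by set a := _%:R^-1; set b := _%:R^-1; ring.
by rewrite -rcM /=; ring.
Qed.

Lemma rpoch_gt0 N : 0 < rpoch t N.
Proof. by have [_ t0] := tparE pp; apply: prodr_gt0 => i _; rewrite ltr_pwDl. Qed.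

Lemma Pn_expect_Wsum N F H : (forall d (p : {ffun 'I_d -> 'I_N}) (q : {ffun 'I_d -> 'I_N}), strdec p -> strdec q ->
    (\sum_(i < d) (p i + q i).+1 == N)%N -> F (ptseq p, ptseq q) = H d (ext_ord p (fun=> 0))) ->
  Wsum H N N = rpoch t N / N`!%:R * Pn_expect z z' N F.
Proof.
move=> FH; rewrite /Wsum /Pn_expect mulr_sumr; apply: eq_bigr => d _.
rewrite itersumE mulr_sumr; apply: eq_bigr => p _; rewrite itersumE mulr_sumr; apply: eq_bigr => q _.
rewrite wt_at_ext; case: ifP => [/and3P[hp hq hs]|_]; last by rewrite mulr0.
rewrite (FH d p q hp hq hs) ReC_wt; set w := wt _ _ _; set H1 := H _ _.
have r0 := rpoch_gt0 N; have n0 : N`!%:R != 0 :> R by rewrite pnatr_eq0 -lt0n fact_gt0.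
move: (gt_eqF r0) n0 => /negbT; move: (rpoch t N) (N`!%:R) => r f r0' f0.
by field; rewrite f0 r0'.
Qed.

End Poissonization.

(** * Test functions on Omega and the limit of the mixture *)

Section WeakLimit.
Context {R : realType}.
Local Notation C := R[i].
Local Notation mu := (@lebesgue_measure R).
Local Notation P := (@posR R : set (measurableTypeR R)).

Lemma bump_lipschitz n (a b : R) (h : nat -> R -> R) : (forall k, (k < n)%N -> bump a b (h k)) ->
  exists K, 0 <= K /\ forall k, (k < n)%N -> forall x y, `|h k x - h k y| <= K * `|x - y|.
Proof.
elim: n => [_|n IH hb]; first by exists 0.
have [K [K0 hK]] : exists K, 0 <= K /\ forall k, (k < n)%N -> forall x y, `|h k x - h k y| <= K * `|x - y|.
  by apply: IH => k kn; apply: hb; exact: ltnW.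
have [_ _ [K' [K'0 hK']]] := hb n (ltnSn n).
exists (K + K'); split => [|k kn x y]; first exact: addr_ge0.
rewrite mulrDl; move: kn; rewrite ltnS leq_eqVlt => /orP[/eqP ->|kn].
  by rewrite ler_wpDl ?hK' // mulr_ge0.
by rewrite ler_wpDr ?hK // mulr_ge0.
Qed.

Lemma Omega_le (x y : nat -> R) i : InOmega x y -> 0 <= x i /\ i.+1%:R * x i <= 1.
Proof.
move=> [hx [hy hs]]; have x0 j : 0 <= x j by have /andP[h1 h2] := hx j; exact: le_trans h2.
have y0 j : 0 <= y j by have /andP[h1 h2] := hy j; exact: le_trans h2.
split => //; apply: le_trans (hs i.+1).
have mono j k : (j <= k)%N -> x k <= x j.
  elim: k => [|k IH]; first by rewrite leqn0 => /eqP ->.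
  by rewrite leq_eqVlt => /orP[/eqP -> //|/IH]; apply: le_trans; have /andP[] := hx k.
rewrite mulr_natl -[X in _ *+ X](card_ord i.+1) -sumr_const; apply: ler_sum => j _.
by rewrite -[leLHS]addr0 lerD // mono // -ltnS.
Qed.

(* al_i <= 1/(i+1) on Omega, so only indices i < u/a + 1 contribute for bumps that vanish
   below a. *)
Definition Gf n (h : nat -> R -> R) a (u : R) (x : nat -> R) : R :=
  injsum n (Num.truncn (u / a)).+1 (fun k i => h k (u * x i)).

Lemma bump_out (a b : R) h x : bump a b h -> x < a -> h x = 0.
Proof. by move=> [_ h0 _] xa; apply: h0; rewrite negb_and -ltNge xa. Qed.

Lemma cvg_bigsum I (s : seq I) (f : I -> nat -> R) (g : I -> R) : (forall i, f i @ \oo --> g i) ->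
  (fun M => \sum_(i <- s) f i M) @ \oo --> \sum_(i <- s) g i.
Proof.
move=> fg; elim: s => [|i s IH]; first by rewrite big_nil; under eq_fun do rewrite big_nil; exact: cvg_cst.
by rewrite big_cons; under eq_fun do rewrite big_cons; exact: cvgD.
Qed.

Section Fixed.
Variables (n : nat) (a b : R) (h : nat -> R -> R).
Hypotheses (a0 : 0 < a) (hb : forall k, (k < n)%N -> bump a b (h k)).

Lemma Gf_vanish u S x y k i : InOmega x y -> 0 <= u -> u <= S -> (k < n)%N -> ((Num.truncn (S / a)).+1 <= i)%N ->
  h k (u * x i) = 0.
Proof.
move=> hO u0 uS kn hi; apply: (bump_out (hb kn)); have [x0 hx] := Omega_le i hO.
have Si : S < a * i.+1%:R.
  rewrite mulrC -ltr_pdivrMr //; apply: (lt_le_trans (truncnS_gt _)).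
  by rewrite ler_nat; exact: leqW.
have i0 : 0 < i.+1%:R :> R by rewrite ltr0n.
rewrite -(ltr_pM2r i0); apply: le_lt_trans Si.
rewrite -mulrA (mulrC (x i)); apply: le_trans uS; rewrite -[leRHS]mulr1; exact: ler_wpM2l.
Qed.

(** Enlarging the cutoff adds vanishing terms only; a common cutoff makes the values at different
    [u] comparable. *)
Lemma GfE u S x y : InOmega x y -> 0 <= u -> u <= S ->
  Gf n h a u x = injsum n (Num.truncn (S / a)).+1 (fun k i => h k (u * x i)).
Proof.
move=> hO u0 uS; apply: injsum_stable => k i kn hi.
  exact: (Gf_vanish (S := u) hO).
exact: (Gf_vanish (S := S) hO).
Qed.

Lemma h01 k u : (k < n)%N -> 0 <= h k u <= 1. Proof. by move=> kn; have [] := hb kn. Qed.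

Lemma Gf_ge0 u x : 0 <= Gf n h a u x.
Proof. by apply: injsum_ge0 => k i kn; have /andP[] := h01 (u * x i) kn. Qed.

Lemma Gf_le u x : 0 <= u -> Gf n h a u x <= (u / a + 1) ^+ n.
Proof.
move=> u0; apply: (le_trans (injsum_le _ _)) => [k i kn|]; first exact: h01.
have q0 : 0 <= u / a by rewrite divr_ge0 // ltW.
apply: lerXn2r; rewrite ?nnegrE ?addr_ge0 //.
by rewrite -natr1 lerD2r truncn_le.
Qed.

Lemma Gf_lipschitz : exists K, 0 <= K /\ forall S u u' x y, InOmega x y -> 0 <= u <= S -> 0 <= u' <= S ->
  `|Gf n h a u x - Gf n h a u' x| <= (Num.truncn (S / a)).+1%:R ^+ n * (n%:R * (K * `|u - u'|)).
Proof.
have [K [K0 hK]] := bump_lipschitz hb; exists K; split => // S u u' x y hO /andP[u0 uS] /andP[u0' uS'].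
rewrite (GfE hO u0 uS) (GfE hO u0' uS'); apply: injsum_lip => [|k i kn|k i kn|k i kn].
- by rewrite mulr_ge0.
- exact: h01.
- exact: h01.
apply: (le_trans (hK _ kn _ _)); apply: ler_wpM2l => //; rewrite -mulrBl normrM.
have [x0 hx] := Omega_le i hO; rewrite (ger0_norm x0) ler_piMr //.
apply: le_trans hx; rewrite ler_peMl // ler1n //.
Qed.

Lemma Gf_bdd u : 0 <= u -> OmegaBdd (fun p : (nat -> R) * (nat -> R) => Gf n h a u p.1).
Proof. by move=> u0; exists ((u / a + 1) ^+ n) => x y _; rewrite ger0_norm ?Gf_ge0 ?Gf_le. Qed.

Lemma bump_cvg k (f : nat -> R) l : (k < n)%N -> f @ \oo --> l -> (fun m => h k (f m)) @ \oo --> h k l.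
Proof.
move=> kn fl; have [_ _ [K [K0 hK]]] := hb kn.
have l2 : (fun m => K * `|l - f m|) @ \oo --> (0 : R).
  rewrite -[X in _ --> X](mulr0 K); apply: cvgM; first exact: cvg_cst.
  rewrite -[X in _ --> X](@normr0 _ R) -[X in `|X|](subrr l); apply: cvg_norm; apply: cvgB => //; exact: cvg_cst.
apply/cvgrPdist_le => e e0; have /cvgrPdist_le /(_ e e0) l3 := l2; move: l3; apply: filterS => M /=.
by rewrite sub0r normrN ger0_norm ?mulr_ge0 // => h'; exact: le_trans (hK _ _) h'.
Qed.

Lemma injsum_cvg L (f : nat -> nat -> nat -> R) g : (forall k i, (k < n)%N -> (fun m => f m k i) @ \oo --> (g k i : R)) ->
  (fun m => injsum n L (f m)) @ \oo --> injsum n L g.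
Proof.
move=> fg; rewrite /injsum.
under eq_fun do rewrite big_mkcond; rewrite big_mkcond.
apply: cvg_bigsum => p; case: ifP => _; last exact: cvg_cst.
by apply: cvg_bigprod => k; exact: fg.
Qed.

(** A finite sum of products of continuous functions of single coordinates, hence continuous for the
    product topology. *)
Lemma Gf_cont u : OmegaCont (fun p : (nat -> R) * (nat -> R) => Gf n h a u p.1).
Proof.
move=> xm ym x y _ _ hx _ /=; rewrite /Gf; apply: injsum_cvg => k i kn.
by apply: bump_cvg => //; apply: cvgM => //; exact: cvg_cst.
Qed.
End Fixed.

Lemma ptseq_Omega N d (p q : {ffun 'I_d -> 'I_N}) : strdec p -> strdec q ->
  (\sum_(i < d) (p i + q i).+1 == N)%N -> InOmega (@ptseq R N d p) (@ptseq R N d q).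
Proof.
have mono (f : {ffun 'I_d -> 'I_N}) : strdec f -> forall i, 0 <= @ptseq R N d f i.+1 <= @ptseq R N d f i.
  move=> hf i; have ge0 j : 0 <= @ptseq R N d f j.
    by rewrite /ptseq; case: insubP => // *; rewrite divr_ge0 // addr_ge0 // invr_ge0.
  rewrite ge0 /=; case: (ltnP i.+1 d) => hi; last first.
    by rewrite {1}/ptseq insubF ?ge0 //; apply/negbTE; rewrite -leqNgt.
  rewrite /ptseq (insubT (fun i => i < d)%N hi) (insubT (fun i => i < d)%N (ltnW hi)).
  rewrite ler_wpM2r ?invr_ge0 // lerD2r ler_nat ltnW //.
  by move/forallP/(_ (Ordinal (ltnW hi)))/forallP/(_ (Ordinal hi)) : hf; rewrite /= ltnSn.
move=> hp hq /eqP hs; split; [exact: mono|split; [exact: mono|]] => K.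
have e (f : {ffun 'I_d -> 'I_N}) (i : 'I_d) : @ptseq R N d f i = ((f i)%:R + 2^-1) / N%:R by rewrite /ptseq valK.
pose g i := @ptseq R N d p i + @ptseq R N d q i.
have g0 i : 0 <= g i by have /andP[h1 h2] := mono p hp i; have /andP[h3 h4] := mono q hq i; rewrite addr_ge0 // (le_trans _ h2, le_trans _ h4).
apply: (@le_trans _ _ (\sum_(i < d) g i)).
  pose m := maxn K d; rewrite (big_ord_widen m g (leq_maxl _ _)) (big_ord_widen m g (leq_maxr _ _)).
  rewrite big_mkcond [leRHS]big_mkcond; apply: ler_sum => i _; case: ifP => _; case: ifPn => // hd.
  by rewrite /g /ptseq insubF ?addr0 //; exact: negbTE.
have -> : \sum_(i < d) g i = (\sum_(i < d) (p i + q i).+1)%:R / N%:R.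
  rewrite natr_sum mulr_suml; apply: eq_bigr => i _; rewrite /g !e -mulrDl; congr (_ / _).
  by rewrite -addn1 !natrD; field.
rewrite hs; have [->|N0] := posnP N; first by rewrite mul0r.
by rewrite divff // pnatr_eq0 -lt0n.
Qed.

Section Pn.
Variables z z' : C.
Hypothesis pp : pairpos z z'.

Lemma Pn_mass_ge0 N d (p q : {ffun 'I_d -> 'I_N}) : 0 <= Pn_mass z z' p q.
Proof. by rewrite ReC_wt // mulr_ge0 ?wt_ge0 // divr_ge0 // ltW // rpoch_gt0. Qed.

Lemma Pn_dist N F F' c : (forall x y, InOmega x y -> `|F (x, y) - F' (x, y)| <= c) ->
  `|Pn_expect z z' N F - Pn_expect z z' N F'| <= c * Pn_expect z z' N (fun=> 1).
Proof.
move=> hF; rewrite /Pn_expect -sumrB mulr_sumr; apply: (le_trans (ler_norm_sum _ _ _)); apply: ler_sum => d _.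
rewrite -sumrB mulr_sumr; apply: (le_trans (ler_norm_sum _ _ _)); apply: ler_sum => p _.
rewrite -sumrB mulr_sumr; apply: (le_trans (ler_norm_sum _ _ _)); apply: ler_sum => q _.
case: ifP => [/and3P[hp hq hs]|_]; last by rewrite subrr normr0 mulr0.
rewrite -mulrBr normrM (ger0_norm (Pn_mass_ge0 p q)) mulr1 mulrC.
by apply: ler_wpM2r; [exact: Pn_mass_ge0|apply: hF; exact: ptseq_Omega].
Qed.

Lemma Pn0 N : Pn_expect z z' N (fun=> 0) = 0.
Proof.
rewrite /Pn_expect big1 // => d _; rewrite big1 // => p _; rewrite big1 // => q _.
by rewrite mulr0; case: ifP.
Qed.

Lemma Pn_norm N F c : (forall x y, InOmega x y -> `|F (x, y)| <= c) ->
  `|Pn_expect z z' N F| <= c * Pn_expect z z' N (fun=> 1).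
Proof.
move=> hF; rewrite -[X in `|X|]subr0 -(Pn0 N); apply: Pn_dist => x y hO.
by rewrite subr0; exact: hF.
Qed.

Local Notation t := (tpar z z').
Lemma sbin_rc M N : sbin M.+1 (rc t) N = rc (rpow M.+1%:R (1 - t) * (rpoch t N / N`!%:R)) :> C.
Proof.
have e1 : 1 - rc t = rc (1 - t) :> C by rewrite rcD rcN.
rewrite /sbin e1 cpow_rc [RHS]rcM; congr (_ * _).
rewrite /cbin /cpoch /rpoch rcM rcV rc_prod -(@rc_nat R N`!); congr (_ / _).
by apply: eq_bigr => i _; rewrite rcD rc_nat.
Qed.

Lemma nonpole_t : nonpole (rc t : C).
Proof.
have [_ t0] := tparE pp; move=> j; rewrite -(@rc_nat R j) -rcD; apply: rc_neq0.
by rewrite gt_eqF // ltr_pwDl.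
Qed.

Definition gdens (u : R) : R := ReC (cpow u (rc t - 1) / cGamma (rc t)) * expR (- u).

Variables (n : nat) (a b : R) (h : nat -> R -> R).
Hypotheses (a0 : 0 < a) (hb : forall k, (k < n)%N -> bump a b (h k)).
Variables (g : R -> R) (Cn : R).
Hypothesis hg : forall u, 0 < u -> (fun N => Pn_expect z z' N (fun p => Gf n h a u p.1)) @ \oo --> g u.
Hypothesis hC : forall N, Pn_expect z z' N (fun=> 1) <= Cn.

Let HH M d (v : nat -> nat) : R := injsum n d (fun k i => h k (((v i)%:R + 2^-1) / M.+1%:R)).

Lemma HH_ge0 M d v : 0 <= HH M d v.
Proof. by apply: injsum_ge0 => k i kn; have /andP[] := h01 hb (((v i)%:R + 2^-1) / M.+1%:R) kn. Qed.

Lemma Wsum_Pn M N : Wsum z z' (HH M) N N =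
  rpoch t N / N`!%:R * Pn_expect z z' N (fun p => Gf n h a (N%:R / M.+1%:R) p.1).
Proof.
apply: Pn_expect_Wsum => // d p q hp hq hs.
have hO := ptseq_Omega hp hq hs.
have u0 : 0 <= N%:R / M.+1%:R :> R by rewrite divr_ge0.
have L1 := Gf_vanish a0 hb hO u0 (lexx _).
rewrite /= /Gf (injsum_stable (L' := d) L1) => [|k i kn di].
  apply: eq_injsum => k i kn id; congr (h k _); rewrite (ext_ordE p (fun=> 0%N) (Ordinal id)) /ptseq (insubT (fun i => i < d)%N id) /=.
  have N0 : N%:R != 0 :> R by rewrite pnatr_eq0 -lt0n (leq_ltn_trans _ (ltn_ord (p (Ordinal id)))).
  by rewrite mulrC mulrA divfK.
rewrite /ptseq insubF ?mulr0; last by apply/negbTE; rewrite -leqNgt.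
by apply: (bump_out (hb kn)).
Qed.

(** The mean of the test function under P^(N), restricted to configurations within the cutoff: equal
    to the mean for N <= [NN M], and at most the mean beyond. *)
Let vv M N := Wsum z z' (HH M) (NN M) N / (rpoch t N / N`!%:R).

Lemma cN_gt0 N : 0 < rpoch t N / N`!%:R :> R.
Proof. by rewrite divr_gt0 ?rpoch_gt0 // ltr0n fact_gt0. Qed.

Lemma vv_ge0 M N : 0 <= vv M N.
Proof. by rewrite divr_ge0 ?(ltW (cN_gt0 N)) // Wsum_ge0 // => d v; exact: HH_ge0. Qed.

Lemma vv_eq M N : (N <= NN M)%N -> vv M N = Pn_expect z z' N (fun p => Gf n h a (N%:R / M.+1%:R) p.1).
Proof. by move=> ND; rewrite /vv Wsum_widen // Wsum_Pn mulrC mulKf // gt_eqF // cN_gt0. Qed.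

Lemma vv_le M N : vv M N <= (N%:R / M.+1%:R / a + 1) ^+ n * Cn.
Proof.
have u0 : 0 <= N%:R / M.+1%:R :> R by rewrite divr_ge0.
apply: (@le_trans _ _ (Pn_expect z z' N (fun p => Gf n h a (N%:R / M.+1%:R) p.1))).
  rewrite ler_pdivrMr ?cN_gt0 // mulrC -Wsum_Pn; apply: Wsum_le => // d v; exact: HH_ge0.
apply: (le_trans (ler_norm _)); apply: (le_trans (@Pn_norm N _ ((N%:R / M.+1%:R / a + 1) ^+ n) _)).
  by move=> x y _ /=; rewrite ger0_norm; [exact: (Gf_le a0 hb)|apply: Gf_ge0; exact: hb].
apply: ler_wpM2l; last exact: hC.
by rewrite exprn_ge0 // addr_ge0 // divr_ge0 // ltW.
Qed.

(** The weak limit is known at fixed u, whereas here the test function is taken at N/m; the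
    Lipschitz bound of [Gf] in u, uniform over Omega, bridges the two. *)
Lemma vv_cvg u : 0 < u -> (fun M => vv M (fl M.+1 u)) @ \oo --> g u.
Proof.
move=> u0; have fu := slim_fl (ltW u0); have fo := slim_infty u0 fu.
have c1 := cvg_comp _ _ fo (hg u0).
have [K [K0 hK]] := Gf_lipschitz a0 hb.
pose A := (Num.truncn (u / a)).+1%:R ^+ n * (n%:R * K) * Cn.
have c2 : (fun M => A * `|(fl M.+1 u)%:R / M.+1%:R - u|) @ \oo --> (0 : R).
  rewrite -[X in _ --> X](mulr0 A); apply: cvgM; first exact: cvg_cst.
  rewrite -[X in _ --> X](@normr0 _ R) -[X in `|X|](subrr u); apply: cvg_norm; apply: cvgB => //; exact: cvg_cst.
have c3 : (fun M => vv M (fl M.+1 u) - Pn_expect z z' (fl M.+1 u) (fun p => Gf n h a u p.1)) @ \oo --> (0 : R).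
  have hu : \forall M \near \oo, u <= M%:R by exact: nbhs_infty_ger.
  apply/cvgrPdist_le => e e0; have /cvgrPdist_le /(_ e e0) l3 := c2; near=> M.
  have hM : `|0 - A * `|(fl M.+1 u)%:R / M.+1%:R - u| | <= e by near: M; exact: l3.
  have uM : u <= M%:R by near: M; exact: hu.
  have m0 : 0 < M.+1%:R :> R by rewrite ltr0n.
  have [f1 f2] := fl_bounds M (ltW u0).
  have fD : (fl M.+1 u <= NN M)%N.
    rewrite -(ler_nat R) /NN natrX expr2 -ler_pdivrMr //; apply: (le_trans f1); apply: (le_trans uM).
    by rewrite ler_nat.
  rewrite vv_eq // sub0r normrN; apply: le_trans hM.
  have C0 : 0 <= Cn.
    apply: le_trans (hC 0); apply: le_trans (normr_ge0 _) _; last by rewrite -[leRHS]mul1r; apply: (@Pn_norm 0 (fun=> 1)) => x y _; rewrite normr1.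
  have A0 : 0 <= A by rewrite /A mulr_ge0 // mulr_ge0 ?exprn_ge0 // mulr_ge0.
  rewrite sub0r normrN (ger0_norm (mulr_ge0 A0 (normr_ge0 _))).
  set B := (Num.truncn (u / a)).+1%:R ^+ n * (n%:R * (K * `|(fl M.+1 u)%:R / M.+1%:R - u|)).
  have B0 : 0 <= B by rewrite /B mulr_ge0 ?exprn_ge0 // mulr_ge0 // mulr_ge0.
  have -> : A * `|(fl M.+1 u)%:R / M.+1%:R - u| = B * Cn by rewrite /A /B; ring.
  apply: le_trans (ler_wpM2l B0 (hC (fl M.+1 u))).
  apply: Pn_dist => // x y hO; apply: (hK u _ _ x y hO); first by rewrite f1 divr_ge0.
  by rewrite lexx ltW.
have -> : (fun M => vv M (fl M.+1 u)) = (fun M => (vv M (fl M.+1 u) - Pn_expect z z' (fl M.+1 u) (fun p => Gf n h a u p.1)) +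
  Pn_expect z z' (fl M.+1 u) (fun p => Gf n h a u p.1)) by apply/funext => M; rewrite subrK.
by rewrite -[X in _ --> X]add0r; apply: cvgD.
Unshelve. all: by end_near. Qed.

Lemma sbin_fl_bound (s : R) : 0 < s -> exists sig K k, [/\ 0 < sig, 0 < K & forall M u, 0 < u ->
  cnorm (sbin M.+1 (rc s) (fl M.+1 u) : C) * ex M (fl M.+1 u) <= K * gdom sig k 1 u].
Proof.
move=> s0; have [K1 [K10 h1]] := sbin_bound (rc s : C).
exists (if s <= 1 then s else 1), (K1 * expR 1), (Num.truncn s).+1; split; [by case: ifP|by rewrite mulr_gt0 ?expR_gt0|].
move=> M u u0; set j := fl _ _; set sig := if _ then _ else _; set k := (Num.truncn s).+1.
have m0 : 0 < M.+1%:R :> R by rewrite ltr0n.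
have [f1 f2] := fl_bounds M (ltW u0); rewrite -/j in f1 f2.
have i1 : (M.+1%:R)^-1 <= 1 :> R by rewrite invf_le1 // ler1n.
have f3 : j.+1%:R / M.+1%:R <= 1 + u by rewrite -natr1 mulrDl mul1r addrC lerD.
have b1 : cnorm (sbin M.+1 (rc s) j : C) <= K1 * (rpow u (sig - 1) * (1 + u) ^+ k).
  apply: (le_trans (h1 _ _)); rewrite ler_pM2l //= /sig /k.
  have u1 : 1 <= 1 + u by rewrite lerDl ltW.
  case: (leP s 1) => hs.
    apply: (le_trans (rpow_le_neg u0 (ltW f2) _)); first by rewrite subr_le0.
    by rewrite ler_peMr ?rpow_ge0 // exprn_ege1.
  rewrite subrr rpow0 mul1r -rpowX ?(lt_le_trans ltr01) //.
  apply: (le_trans (rpow_le _ f3 _)); first exact: lt_trans f2.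
    by rewrite subr_ge0 ltW.
  rewrite rpow_le1 // ltW //; apply: lt_trans (truncnS_gt _); lra.
have b3 : ex M j <= expR 1 * expR (- (1 * u)).
  rewrite -expRD ler_expR mul1r.
  have : u <= j%:R / M.+1%:R + (M.+1%:R)^-1 by move/ltW: f2; rewrite -natr1 mulrDl mul1r.
  by move: i1; set y := (_^-1); set w := j%:R * y; lra.
apply: (le_trans (ler_pM (cnorm_ge0 _) (ex_ge0 _ _) b1 b3)).
by rewrite /gdom le_eqVlt; apply/orP; left; apply/eqP; ring.
Qed.

(** After multiplication by m^-t the sum over N is a Riemann sum in u = N/m: the weight (t)_N/N!
    e^(-N/m) becomes the gamma density by Gauss' limit, and the mean under P^(N) becomes [g]. *)
Lemma cvg_poissonization :
  mu.-integrable P (EFin \o (fun u => gdens u * g u)) /\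
  (fun M => rpow M.+1%:R (- t) * (\det (1%:M + Amx z z' M *m (Amx z z' M)^T) *
  (\sum_(x : {ffun 'I_n -> 'I_(NN M)}) (\prod_(k < n) h k (((x k)%:R + 2^-1) / M.+1%:R)) *
     \det (\matrix_(i, j) Kmx z z' M (x i) (x j))))) @ \oo --> \int[mu]_(u in P) (gdens u * g u).
Proof.
have [_ t0] := tparE pp.
pose B M := (2 * NN M * NN M).+1.
pose f M j : R := ReC (sbin M.+1 (rc t) j) * ex M j * vv M j.
pose F M (u : R) : R := if (fl M.+1 u < B M)%N then f M (fl M.+1 u) else 0.
have C0 : 0 <= Cn.
  apply: le_trans (hC 0); apply: le_trans (normr_ge0 _) _; last by rewrite -[leRHS]mul1r; apply: (@Pn_norm 0 (fun=> 1)) => x y _; rewrite normr1.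
have [sig [K [k [s0 K0 hK]]]] := sbin_fl_bound t0.
pose A := K * ((a^-1 + 1) ^+ n * Cn).
have A0 : 0 <= A by rewrite /A mulr_ge0 ?(ltW K0) // mulr_ge0 // exprn_ge0 // addr_ge0 // invr_ge0 ltW.
have FB M u : P u -> `|F M u| <= A * gdom sig (k + n) 1 u.
  move=> u0; rewrite /F; case: ifP => _; last by rewrite normr0 mulr_ge0 // gdom_ge0.
  have h1 : `|ReC (sbin M.+1 (rc t) (fl M.+1 u) : C)| * ex M (fl M.+1 u) <= K * gdom sig k 1 u.
    by apply: le_trans (hK M u u0); apply: ler_wpM2r; [exact: ex_ge0|exact: Re_le_cnorm].
  have h2 : vv M (fl M.+1 u) <= ((a^-1 + 1) * (1 + u)) ^+ n * Cn.
    apply: (le_trans (vv_le _ _)); apply: ler_wpM2r => //.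
    have [f1 f2] := fl_bounds M (ltW u0); have ai : 0 <= a^-1 by rewrite invr_ge0 ltW.
    have w0 : 0 <= (fl M.+1 u)%:R / M.+1%:R :> R by rewrite divr_ge0.
    apply: lerXn2r; rewrite ?nnegrE ?addr_ge0 // ?mulr_ge0 // ?addr_ge0 // ?(ltW u0) //.
    by move: f1 ai (ltW u0); set w := _ / M.+1%:R; set i := a^-1 => *; nra.
  rewrite /f; move: h2 (vv_ge0 M (fl M.+1 u)); move: (vv M (fl M.+1 u)) => v h2 v0.
  rewrite normrM (ger0_norm v0) normrM (ger0_norm (ex_ge0 _ _)).
  apply: (le_trans (ler_pM _ v0 h1 h2)); first by rewrite mulr_ge0 // ex_ge0.
  by rewrite /A /gdom exprD (exprMn _ (a^-1 + 1)) le_eqVlt; apply/orP; left; apply/eqP; ring.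
have Flim u : P u -> (F ^~ u) @ \oo --> gdens u * g u.
  move=> u0; have fu := slim_fl (ltW u0).
  have fB : \forall M \near \oo, (fl M.+1 u < B M)%N.
    have hu : \forall M \near \oo, u <= M%:R by exact: nbhs_infty_ger.
    move: hu; apply: filterS => M uM; have [f1 f2] := fl_bounds M (ltW u0).
    have m0 : 0 < M.+1%:R :> R by rewrite ltr0n.
    have fD : (fl M.+1 u <= NN M)%N.
      rewrite -(ler_nat R) /NN natrX expr2 -ler_pdivrMr //; apply: (le_trans f1); apply: (le_trans uM).
      by rewrite ler_nat.
    by rewrite /B ltnS; apply: (leq_trans fD); rewrite /NN; clear; nia.
  apply: cvg_trans; first apply: near_eq_cvg.
    move: fB; apply: filterS => M hM; rewrite /F hM; reflexivity.
  apply: cvgM; last exact: vv_cvg.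
  apply: cvgM; last exact: cvg_exslim.
  have [c _] := cvgC_sbin nonpole_t u0 fu; exact: c.
have mF M : measurable_fun P (F M).
  by have [/integrableP[/measurable_EFinP m _] _] := step_integral (f M) M (B M).
have iG : mu.-integrable P (EFin \o (fun u => A * gdom sig (k + n) 1 u)).
  by apply: integrable_mull; [exact: measurable_posR|exact: integrable_gdom].
have [iL cL] := Rintegral_dct (@measurable_posR R) mF Flim iG FB.
split => //; have -> : (fun M => rpow M.+1%:R (- t) * (\det (1%:M + Amx z z' M *m (Amx z z' M)^T) *
  (\sum_(x : {ffun 'I_n -> 'I_(NN M)}) (\prod_(k < n) h k (((x k)%:R + 2^-1) / M.+1%:R)) *
     \det (\matrix_(i, j) Kmx z z' M (x i) (x j))))) = (fun M => \int[mu]_(u in P) F M u); last exact: cL.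
apply/funext => M; have [_ ->] := step_integral (f M) M (B M).
rewrite (poissonization pp) !mulr_sumr; apply: eq_bigr => N _; rewrite /f sbin_rc /=.
have m0 : 0 < M.+1%:R :> R by rewrite ltr0n.
have c0 := cN_gt0 N; rewrite -/(HH M) /vv.
have -> : rpow (M.+1%:R : R) (1 - t) = M.+1%:R * rpow M.+1%:R (- t) by rewrite rpowD rpow1.
move: (gt_eqF c0) (gt_eqF m0) => /negbT c1 /negbT m1.
set W := Wsum _ _ _ _ _; move: W c1; move: (rpoch t N / N`!%:R) => c W c1.
move: (M.+1%:R : R) m1 (rpow _ _) => m m1 r; by field; rewrite m1 c1.
Qed.
End Pn.
End WeakLimit.

(** * The lifted point process *)

Section PointProcess.
Context {R : realType}.
Local Notation fn := ((nat -> R) -> R).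
Variables (d : measure_display) (T : measurableType d) (Pr : probability T R).
Variables (al be : nat -> T -> R) (s : T -> R).
Hypotheses (mal : forall i, measurable_fun setT (al i)) (mbe : forall i, measurable_fun setT (be i)).
Hypothesis ms : measurable_fun setT s.
Variable n : nat.
Local Notation lab := {ffun 'I_n -> nat * bool}.

(** Replaces the sum over labels by a series, which can be integrated term by term. *)
Lemma sum_pickle (U : countType) (c : U -> \bar R) : (forall x, 0 <= c x)%E ->
  (\sum_(N <oo) (if pickle_inv N is Some x then c x else 0) = \esum_(x in [set: U]) c x)%E.
Proof.
move=> c0; rewrite nneseries_esumT; last by move=> N; case: (pickle_inv N).
rewrite [LHS](_ : _ = (\esum_(N in range (@pickle U)) (if pickle_inv N is Some x then c x else 0))%E).
  rewrite (@reindex_esum _ _ _ [set: U] (range pickle) pickle).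
    by apply: eq_esum => x _; rewrite pickleK_inv.
  split; [by move=> x; exists x|by move=> x y _ _; exact: (pcan_inj pickleK)|by move=> N [x _ <-]; exists x].
rewrite [RHS]esum_mkcond; apply: eq_esum => N _; case: ifPn => // hN.
case e : (pickle_inv N) => [x|//]; case/negP: hN; apply/mem_set; exists x => //.
by have := @pickle_invK U N; rewrite e.
Qed.

Definition pt (p : lab) w : nat -> R := fun k =>
  if (insub k : option 'I_n) is Some j then lab_val (fun i => al i w) (fun i => be i w) (s w) (p j) else 0.
Definition present (p : lab) w : R := (injectiveb p)%:R *
  \prod_(k < n) ((if (p k).2 then al (p k).1 w else be (p k).1 w) != 0)%:R.
(* pickle_inv, unlike unpickle, hits each label exactly once. *)
Definition term (f : fn) (N : nat) w : \bar R :=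
  if (pickle_inv N : option lab) is Some p then (present p w * f (pt p w))%:E else 0%E.
Definition corr (f : fn) : \bar R := (\int[Pr]_w \sum_(N <oo) term f N w)%E.

Lemma present_ge0 p w : 0 <= present p w.
Proof. by rewrite mulr_ge0 // prodr_ge0. Qed.

Lemma measurable_present p : measurable_fun setT (present p).
Proof.
apply: measurable_funM => //; apply: measurable_prod => k _.
apply: (measurableT_comp (f := fun u : R => (u != 0)%:R : R)); last by case: ((p k).2).
have -> : (fun u : R => (u != 0)%:R : R) = \1_(~` [set 0]).
  by apply/funext => u; rewrite indicE in_setC; congr (nat_of_bool (~~ _))%:R; apply/eqP/idP; rewrite inE.
by apply: measurable_indic; apply: measurableC.
Qed.

Lemma measurable_pt p k : measurable_fun setT (fun w => pt p w k).
Proof.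
rewrite /pt; case: insubP => // j _ _; rewrite /lab_val; case: ((p j).2).
  exact: measurable_funM.
by apply: measurable_funN; exact: measurable_funM.
Qed.

Lemma term_ge0 f N w : jp f -> (0 <= term f N w)%E.
Proof. by move=> [f0 _]; rewrite /term; case: pickle_inv => // p; rewrite lee_fin mulr_ge0 // present_ge0. Qed.

Lemma measurable_term f N : jp f -> measurable_fun setT (term f N).
Proof.
move=> [_ mf]; rewrite /term; case: pickle_inv => // p; apply/measurable_EFinP.
apply: measurable_funM; first exact: measurable_present.
by apply: mf => k; exact: measurable_pt.
Qed.

Lemma corrE f : jp f -> corr f = (\sum_(N <oo) \int[Pr]_w term f N w)%E.
Proof.
move=> jf; rewrite /corr integral_nneseries // => [N|N w _]; [exact: measurable_term|exact: term_ge0].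
Qed.

(** Continuity takes monotone convergence twice: for the probability, and for the counting measure
    on the labels. *)
Lemma posfun_corr : posfun corr.
Proof.
have i0 f N : jp f -> (0 <= \int[Pr]_w term f N w)%E by move=> jf; apply: integral_ge0 => w _; exact: term_ge0.
split => [f jf|f g jf jg|f_ f jf inc lim].
- by rewrite corrE // nneseries_ge0 // => N _ _; exact: i0.
- rewrite !corrE //; last exact: jpD.
  rewrite -nneseriesD => [|N _ _|N _ _]; [|exact: i0..].
  congr (limn _); apply/funext => m; apply: eq_bigr => N _.
  rewrite -ge0_integralD // => [|w _|*|w _|*]; [|exact: term_ge0|exact: measurable_term|exact: term_ge0|exact: measurable_term].
  apply: eq_integral => w _; rewrite /term; case: pickle_inv => [p|]; last by rewrite adde0.
  by rewrite mulrDr.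
- have jl : jp f := jp_lim jf lim.
  have tinc N w : {homo (fun j => term (f_ j) N w) : i j / (i <= j)%N >-> (i <= j)%E}.
    move=> i j ij; rewrite /term; case: pickle_inv => // p.
    by rewrite lee_fin ler_wpM2l ?present_ge0 // inc.
  have tlim N w : (fun j => term (f_ j) N w) @ \oo --> term f N w.
    rewrite /term; case: pickle_inv => [p|]; last exact: cvg_cst.
    by apply: cvg_EFin; [exact: nearW|apply: cvgM; [exact: cvg_cst|exact: lim]].
  have ilim N : (fun j => \int[Pr]_w term (f_ j) N w)%E @ \oo --> (\int[Pr]_w term f N w)%E.
    rewrite (_ : (\int[Pr]_w term f N w)%E = (\int[Pr]_w limn (fun j => term (f_ j) N w))%E); last first.
      by apply: eq_integral => w _; apply/esym/cvg_lim.
    apply: (@cvg_monotone_convergence _ _ _ Pr setT measurableT (fun j w => term (f_ j) N w)).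
    + by move=> j; exact: measurable_term.
    + by move=> j w _; exact: term_ge0.
    + by move=> w _; exact: tinc.
  rewrite corrE //; under eq_fun do rewrite corrE //.
  rewrite -ge0_integral_count => [|N]; last exact: i0.
  rewrite (_ : (fun x => _) = (fun j => \int[counting]_N \int[Pr]_w term (f_ j) N w)%E); last first.
    by apply/funext => j; rewrite ge0_integral_count // => N; exact: i0.
  rewrite (_ : (\int[counting]_N \int[Pr]_w term f N w)%E = (\int[counting]_N limn (fun j => \int[Pr]_w term (f_ j) N w))%E); last first.
    by apply: eq_integral => N _; apply/esym/cvg_lim.
  apply: (@cvg_monotone_convergence _ _ _ counting setT measurableT (fun j N => \int[Pr]_w term (f_ j) N w)%E) => //.
  + by move=> j N _; exact: i0.
  + move=> N _ i j ij; apply: ge0_le_integral => //.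
    * by move=> w _; exact: term_ge0.
    * exact: measurable_term.
    * exact: measurable_term.
    * by move=> w _; exact: tinc.
Qed.

Lemma corr_measE (A : nat -> set (measurableTypeR R)) :
  corr_meas Pr al be s n A = corr (prodf (fun k => \1_(A k)) n).
Proof.
apply: eq_integral => w _; rewrite sum_pickle; last first.
  by move=> p; rewrite lee_fin mulr_ge0 ?present_ge0 // prodr_ge0 // => k _; rewrite indicE.
rewrite esum_mkcond; apply: eq_esum => p _; rewrite /present.
case: (boolP (p \in _)) => hp; last first.
  rewrite (_ : injectiveb p = false) ?mul0r //; apply/negbTE; apply: contra hp => /injectiveP hp.
  exact/mem_set.
rewrite (_ : injectiveb p = true) ?mul1r; last by apply/injectiveP; exact: set_mem.
congr EFin; rewrite /prodf -big_split indicE /=.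
have e (k : 'I_n) : pt p w k = lab_val (fun i => al i w) (fun i => be i w) (s w) (p k) by rewrite /pt valK.
have ok (k : 'I_n) : ((if (p k).2 then al (p k).1 w else be (p k).1 w) != 0) = `[< lab_ok (fun i => al i w) (fun i => be i w) (p k) >].
  by rewrite /lab_ok; case: (p k) => i [] /=; apply/idP/asboolP => /eqP.
case: (boolP (p \in _)) => [/set_mem h|h].
  rewrite big1 // => k _; have [h1 h2] := h k.
  by rewrite ok (asboolT h1) mul1r indicE e mem_set.
have : exists k : 'I_n, ~ (lab_ok (fun i => al i w) (fun i => be i w) (p k) /\ A k (lab_val (fun i => al i w) (fun i => be i w) (s w) (p k))).
  by apply/existsNP => H; move/negP: h; apply; exact/mem_set.
move=> [k hk]; rewrite (bigD1 k) //= ok indicE e.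
case: asboolP => h1; last by rewrite !mul0r.
rewrite memNset ?mulr0 ?mul0r // => h2; exact: hk.
Qed.

Section OmegaLaw.
Hypothesis hO : forall w, InOmega (fun i => al i w) (fun i => be i w).

(** Bumps vanish on the negative half-line, which removes the beta points, and below [a], which
    removes all indices from [L] on; what remains is the finite sum [Gf]. *)
Lemma corr_bump a b (h : nat -> R -> R) w : 0 < a -> (forall k, (k < n)%N -> bump a b (h k)) -> 0 < s w ->
  (\sum_(N <oo) term (prodf h n) N w = (Gf n h a (s w) (fun i => al i w))%:E)%E.
Proof.
move=> a0 hb s0; have h0 k x : (k < n)%N -> x <= 0 -> h k x = 0.
  by move=> kn x0; apply: (bump_out (hb k kn)); exact: le_lt_trans a0.
have ge0 p : 0 <= present p w * prodf h n (pt p w).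
  by rewrite mulr_ge0 ?present_ge0 // prodr_ge0 // => k _; have /andP[] := h01 hb (pt p w k) (ltn_ord k).
rewrite sum_pickle; last by move=> p; rewrite lee_fin.
pose L := (Num.truncn (s w / a)).+1.
pose e (f : {ffun 'I_n -> 'I_L}) : lab := [ffun k => (f k : nat, true)].
have ptE p (k : 'I_n) : pt p w k = lab_val (fun i => al i w) (fun i => be i w) (s w) (p k) by rewrite /pt valK.
have inj_e : injective e.
  move=> f g fg; apply/ffunP => k; apply: val_inj.
  by have := congr1 (fun F : lab => (F k).1) fg; rewrite !ffunE.
transitivity (\esum_(p in range e) (present p w * prodf h n (pt p w))%:E)%E.
  rewrite [RHS]esum_mkcond; apply: eq_esum => p _; case: ifPn => // hp.
  congr EFin; apply/eqP; rewrite mulf_eq0; apply/orP; right; rewrite /prodf.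
  have [k hk] : exists k : 'I_n, ~ ((p k).2 /\ ((p k).1 < L)%N).
    apply/existsNP => H; move/negP: hp; apply; apply/mem_set.
    exists [ffun k => Ordinal (proj2 (H k))] => //; apply/ffunP => k; rewrite !ffunE /=.
    by have [] := H k; case: (p k) => i [].
  rewrite (bigD1 k) //= mulf_eq0; apply/orP; left; apply/eqP; rewrite ptE /lab_val.
  case: (p k) hk => i [] /= hk.
    by apply: (Gf_vanish a0 hb (hO w) (ltW s0) (lexx _) (ltn_ord k)); rewrite leqNgt; apply/negP => iL; exact: hk.
  apply: h0 => //; rewrite oppr_le0 mulr_ge0 ?(ltW s0) //.
  have [_ [hy _]] := hO w; have /andP[h1 h2] := hy i; exact: le_trans h2.
rewrite (@reindex_esum _ _ _ setT (range e) e); last first.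
  by split; [move=> f _; exists f|move=> f g _ _; exact: inj_e|].
rewrite esum_fset; [|exact: finite_finset|by move=> f _; rewrite lee_fin].
rewrite (@fsbig_fwiden _ _ _ _ (index_enum {ffun 'I_n -> 'I_L}) setT) ?index_enum_uniq // => [|f _|f [_ []]//]; last by rewrite /= mem_index_enum.
rewrite sumEFin; congr EFin; rewrite /Gf /injsum [RHS]big_mkcond; apply: eq_bigr => f _.
have -> : injectiveb f = injectiveb (e f).
  apply/injectiveP/injectiveP => H i j; have := H i j; rewrite !ffunE => H' E; apply: H'.
    by case: E => /val_inj.
  by rewrite E.
rewrite /present; case: (injectiveb (e f)); last by rewrite !mul0r.
rewrite mul1r /prodf -big_split; apply: eq_bigr => k _ /=; rewrite ptE /lab_val ffunE /=.
(* A vanishing al_i is not a point of the configuration, yet [Gf] counts its index; both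
   contributions are 0 because bumps vanish at 0. *)
by have [->|_] := eqVneq (al (f k) w) 0; [rewrite mul0r mulr0 h0|rewrite mul1r].
Qed.
End OmegaLaw.
End PointProcess.

(** * The independent gamma variable as a mixture *)

Section GammaMixture.
Context {R : realType}.
Local Notation C := R[i].
Local Notation mu := (@lebesgue_measure R).
Local Notation P := (@posR R : set (measurableTypeR R)).
Variables (z z' : C).
Hypothesis pp : pairpos z z'.
Local Notation t := (tpar z z').

(** Gauss' limit exhibits the inverse as a limit of positive reals, and that inverse is not 0. *)
Lemma cGamma_t : exists2 c : R, 0 < c & cGamma (rc t) = rc c.
Proof.
have np := nonpole_t pp; have [g1 g2] := gauss_seq_cvg np; have nz := cGamma_neq0 np.
have e N : gauss_seq (rc t) N = rc (rpow N.+1%:R (1 - t) * (rpoch t N / N`!%:R)) :> C by rewrite -sbin_rc /sbin /gauss_seq mulrC.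
have i0 : ImC (cGamma (rc t))^-1 = 0.
  move: g2; rewrite (_ : (fun N => ImC _) = fun=> 0); last by apply/funext => N; rewrite e.
  by move/cvg_lim => <- //; exact: lim_cst.
have r0 : 0 <= ReC (cGamma (rc t))^-1.
  move/cvg_lim: (g1) => <- //; apply: limr_ge; first by apply/cvg_ex; eexists; exact: g1.
  by apply: nearW => N; rewrite e /= mulr_ge0 ?rpow_ge0 // ltW // cN_gt0.
have ei : (cGamma (rc t))^-1 = rc (ReC (cGamma (rc t))^-1) by apply: eqC; rewrite //= i0.
exists (ReC (cGamma (rc t))^-1)^-1; last by rewrite rcV -ei invrK.
rewrite invr_gt0 lt_neqAle r0 andbT eq_sym; apply: contra nz => /eqP r1.
by move: ei; rewrite r1 => /eqP; rewrite invr_eq0.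
Qed.

Lemma gdensE u : gdens z z' u = expR ((t - 1) * ln u) * expR (- u) / ReC (cGamma (rc t)).
Proof.
have [c c0 e] := cGamma_t; rewrite /gdens e.
have -> : rc t - 1 = rc (t - 1) :> C by rewrite rcD rcN.
by rewrite cpow_rc -rcV -rcM /=; ring.
Qed.

Lemma gdens_ge0 u : 0 <= gdens z z' u.
Proof.
have [c c0 e] := cGamma_t; rewrite gdensE e /= divr_ge0 ?(ltW c0) // mulr_ge0 // expR_ge0.
Qed.

Lemma integrable_gdens : mu.-integrable P (EFin \o gdens z z').
Proof.
have [_ t0] := tparE pp.
rewrite (_ : _ \o _ = EFin \o (fun u => (ReC (cGamma (rc t)))^-1 * gdom t 0 1 u)).
  by apply: integrable_mull; [exact: measurable_posR|exact: integrable_gdom].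
apply/funext => u /=; congr EFin; rewrite gdensE /gdom expr0 mul1r.
by rewrite -/(rpow u (t - 1)) mulr1 mulrC.
Qed.

Lemma gamma_lawE (B : set R) : gamma_law t B = (\int[mu]_(u in B `&` P) (gdens z z' u)%:E)%E.
Proof. by apply: eq_integral => u _; rewrite gdensE. Qed.

Variables (d : measure_display) (T : measurableType d) (Pr : probability T R).
Variables (al be : nat -> T -> R) (s : T -> R).
Hypotheses (mal : forall i, measurable_fun setT (al i)) (ms : measurable_fun setT s).
Hypothesis hO : forall w, InOmega (fun i => al i w) (fun i => be i w).
Hypothesis hind : forall F (B : set R), OmegaBdd F -> OmegaCont F -> measurable B ->
     (\int[Pr]_w (F (fun i => al i w, fun i => be i w) * \1_B (s w))%:E)%E =
     ((\int[Pr]_w (F (fun i => al i w, fun i => be i w))%:E) * gamma_law t B)%E.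
Variables (n : nat) (a b : R) (h : nat -> R -> R).
Hypotheses (a0 : 0 < a) (hb : forall k, (k < n)%N -> bump a b (h k)).

Let GG u w := Gf n h a u (fun i => al i w).
Definition gmean u : R := \int[Pr]_w GG u w.

Lemma GG_ge0 u w : 0 <= GG u w. Proof. by apply: Gf_ge0; exact: hb. Qed.
Lemma GG_le u w : 0 <= u -> GG u w <= (u / a + 1) ^+ n. Proof. exact: (Gf_le a0 hb). Qed.

Lemma measurable_GG u : measurable_fun setT (GG u).
Proof.
rewrite /GG /Gf /injsum; under eq_fun do rewrite big_mkcond.
apply: (@measurable_sum _ _ R setT {ffun 'I_n -> _} _ (fun (f : {ffun 'I_n -> 'I_(Num.truncn (u / a)).+1}) w => if injectiveb f then \prod_(k < n) h k (u * al (f k) w) else 0)) => f.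
case: (injectiveb f) => //; apply: measurable_prod => k _.
apply: (measurableT_comp (bump_measurable (hb (ltn_ord k)))); exact: measurable_funM.
Qed.

Lemma integrable_GG u : 0 <= u -> Pr.-integrable setT (EFin \o GG u).
Proof.
move=> u0; apply: (@le_integrable_EFin R _ _ Pr setT _ (fun=> (u / a + 1) ^+ n)) => //.
- exact: measurable_GG.
- by apply: finite_measure_integrable_cst.
- by move=> w _; rewrite ger0_norm ?GG_ge0 // GG_le.
Qed.

Lemma gmeanE u : 0 <= u -> (\int[Pr]_w (GG u w)%:E)%E = (gmean u)%:E.
Proof. by move=> u0; rewrite /gmean /Rintegral fineK //; apply: integrable_fin_num => //; exact: integrable_GG. Qed.

Lemma gmean_ge0 u : 0 <= gmean u.
Proof. by apply: Rintegral_ge0 => w _; exact: GG_ge0. Qed.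

Definition Bn M j : set (measurableTypeR R) := P `&` [set u | fl M.+1 u == j].

Lemma measurable_Bn M j : measurable (Bn M j).
Proof.
have := @measurable_fl R (fun i => (i == j)%:R) M (@measurable_posR R) [set 1] (measurable_set1 _).
rewrite (_ : _ `&` _ = Bn M j) //; apply/seteqP; split => u [u0 hu]; split => //=; move: hu => /=.
  by case: (fl M.+1 u == j) => // /eqP; rewrite eq_sym oner_eq0.
by move=> ->.
Qed.

Lemma sum_Bn (f : nat -> R) M J u : \sum_(j < J) f j * \1_(Bn M j) u =
  if (0 < u) && (fl M.+1 u < J)%N then f (fl M.+1 u) else 0.
Proof.
have e j : \1_(Bn M j) u = ((0 < u) && (fl M.+1 u == j))%:R :> R.
  rewrite indicE; congr (nat_of_bool _)%:R; apply/idP/idP; rewrite inE /Bn /posR /=.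
    by move=> [-> ->].
  by move=> /andP[-> ->].
under eq_bigr do rewrite e; case: (ltP 0 u) => _ /=; last by rewrite big1 // => j _; rewrite mulr0.
case: ltnP => hJ.
  rewrite (bigD1 (Ordinal hJ)) //= eqxx mulr1 big1 ?addr0 // => j; rewrite -val_eqE /= eq_sym => /negbTE ->.
  by rewrite mulr0.
by rewrite big1 // => j _; rewrite gtn_eqF ?mulr0 // (leq_trans (ltn_ord j)).
Qed.

(** Independence is given for products of a function of (al, be) and an indicator of [s], while the
    test function depends on both jointly; so [s] is frozen on cells of mesh 1/m. *)
Lemma mixture_step M J :
  (\int[Pr]_w (\sum_(j < J) GG (j%:R / M.+1%:R) w * \1_(Bn M j) (s w))%:E =
   \int[mu]_(u in P) (\sum_(j < J) (gmean (j%:R / M.+1%:R) * gdens z z' u) * \1_(Bn M j) u)%:E)%E.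
Proof.
have mP := @measurable_posR R.
have u0 j : 0 <= j%:R / M.+1%:R :> R by rewrite divr_ge0.
under eq_integral do rewrite -sumEFin; under [RHS]eq_integral do rewrite -sumEFin.
rewrite ge0_integral_sum //; last 2 first.
- move=> j; apply/measurable_EFinP; apply: measurable_funM; first exact: measurable_GG.
  apply: (measurableT_comp (f := \1_(Bn M j) : R -> R)) => //; apply: measurable_indic; exact: measurable_Bn.
- by move=> j w _; rewrite lee_fin mulr_ge0 ?GG_ge0 // indicE.
have [/measurable_EFinP mg _] := integrableP _ _ _ integrable_gdens.
rewrite ge0_integral_sum //; last 2 first.
- move=> j; apply/measurable_EFinP; apply: measurable_funM; first exact: measurable_funM.
  by apply: measurable_indic; exact: measurable_Bn.
- by move=> j u _; rewrite lee_fin mulr_ge0 ?indicE // mulr_ge0 ?gmean_ge0 ?gdens_ge0.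
apply: eq_bigr => j _.
have := hind (Gf_bdd a0 hb (u0 j)) (@Gf_cont R n a b h hb _) (measurable_Bn M j).
rewrite /= => ->; rewrite [X in (X * _)%E](gmeanE (u0 j)) gamma_lawE setIC integral_mkcondr.
rewrite (_ : (\int[mu]_(x in P) _ x)%E = (\int[mu]_(u in P) (gdens z z' u * \1_(Bn M j) u)%:E)%E); last first.
  by apply: eq_integral => u _; rewrite patchE indicE; case: ifP => _; rewrite ?mulr1 ?mulr0.
rewrite -ge0_integralZl_EFin ?gmean_ge0 //; first last.
- apply/measurable_EFinP; apply: measurable_funM => //; apply: measurable_indic; exact: measurable_Bn.
- by move=> u _; rewrite lee_fin mulr_ge0 ?gdens_ge0 // indicE.
by apply: eq_integral => u _; rewrite -EFinM mulrA.
Qed.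

Lemma GG_lipschitz S : exists K, 0 <= K /\ forall u u' w, 0 <= u <= S -> 0 <= u' <= S -> `|GG u w - GG u' w| <= K * `|u - u'|.
Proof.
have [K [K0 hK]] := Gf_lipschitz a0 hb.
exists ((Num.truncn (S / a)).+1%:R ^+ n * (n%:R * K)); split; first by rewrite mulr_ge0 ?exprn_ge0 // mulr_ge0.
move=> u u' w hu hu'; apply: (le_trans (hK S u u' _ _ (hO w) hu hu')).
by rewrite le_eqVlt; apply/orP; left; apply/eqP; ring.
Qed.

Lemma cvg_GG u w : 0 < u -> (fun M => GG ((fl M.+1 u)%:R / M.+1%:R) w) @ \oo --> GG u w.
Proof.
move=> u0; have [K [K0 hK]] := GG_lipschitz u.
have c2 : (fun M => K * `|u - (fl M.+1 u)%:R / M.+1%:R|) @ \oo --> (0 : R).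
  rewrite -[X in _ --> X](mulr0 K); apply: cvgM; first exact: cvg_cst.
  rewrite -[X in _ --> X](@normr0 _ R) -[X in `|X|](subrr u); apply: cvg_norm; apply: cvgB; first exact: cvg_cst.
  exact: slim_fl (ltW u0).
apply/cvgrPdist_le => e e0; have /cvgrPdist_le /(_ e e0) l3 := c2; move: l3; apply: filterS => M /=.
rewrite sub0r normrN ger0_norm ?mulr_ge0 // => h'; apply: le_trans h'; apply: hK; first by rewrite ltW //=.
by have [-> _] := fl_bounds M (ltW u0); rewrite divr_ge0.
Qed.

Lemma fl_div_le M (u S : R) : 0 <= u -> u <= S -> 0 <= ((fl M.+1 u)%:R / M.+1%:R : R) <= S.
Proof. by move=> u0 uS; have [f1 _] := fl_bounds M u0; rewrite divr_ge0 // (le_trans f1). Qed.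

Lemma GG_boundS S u w : 0 <= u <= S -> `|GG u w| <= (S / a + 1) ^+ n.
Proof.
move=> /andP[u0 uS]; rewrite ger0_norm ?GG_ge0 //; apply: (le_trans (GG_le w u0)).
have q (v : R) : 0 <= v -> 0 <= v / a + 1 by move=> v0; rewrite addr_ge0 // divr_ge0 // ltW.
by apply: lerXn2r; rewrite ?nnegrE ?q ?(le_trans u0 uS) // lerD2r ler_pM2r ?invr_gt0.
Qed.

Lemma cvg_gmean u : 0 < u -> (fun M => gmean ((fl M.+1 u)%:R / M.+1%:R)) @ \oo --> gmean u.
Proof.
move=> u0; apply: (@Rintegral_dct R _ _ Pr setT (fun M w => GG ((fl M.+1 u)%:R / M.+1%:R) w) (GG u) (fun=> (u / a + 1) ^+ n) measurableT _ _ _ _).2.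
- by move=> M; exact: measurable_GG.
- by move=> w _; exact: cvg_GG.
- exact: finite_measure_integrable_cst.
- by move=> M w _; apply: GG_boundS; exact: fl_div_le (ltW u0) (lexx u).
Qed.

Lemma gmean_boundS S u : 0 <= u <= S -> gmean u <= (S / a + 1) ^+ n.
Proof.
move=> /andP[u0 uS]; rewrite -lee_fin -gmeanE //.
apply: (@le_trans _ _ (\int[Pr]_w ((S / a + 1) ^+ n)%:E)%E).
  apply: ge0_le_integral => //.
  - by move=> w _; rewrite lee_fin GG_ge0.
  - by apply/measurable_EFinP; exact: measurable_GG.
  - move=> w _; rewrite lee_fin; apply: (le_trans (ler_norm _)); apply: GG_boundS; exact/andP.
by rewrite integral_cst // [X in (_ * X)%E]probability_setT mule1.
Qed.

(** The mesh of the cells tends to 0; the cutoff s < S keeps their number finite and the test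
    functions bounded. *)
Lemma mixture_trunc (S : nat) :
  let F w := if 0 < s w < S%:R then GG (s w) w else 0 in
  let H u := if u < S%:R then gmean u * gdens z z' u else 0 in
  [/\ Pr.-integrable setT (EFin \o F), mu.-integrable P (EFin \o H) &
    \int[Pr]_w F w = \int[mu]_(u in P) H u].
Proof.
move=> F H; have mP := @measurable_posR R.
pose J M := (S * M.+1)%N.
pose F_ M w := \sum_(j < J M) GG (j%:R / M.+1%:R) w * \1_(Bn M j) (s w).
pose H_ M u := \sum_(j < J M) (gmean (j%:R / M.+1%:R) * gdens z z' u) * \1_(Bn M j) u.
pose c := (S%:R / a + 1) ^+ n.
have c0 : 0 <= c by rewrite exprn_ge0 // addr_ge0 // divr_ge0 // ltW.
have flS M u : 0 < u -> (fl M.+1 u < J M)%N = (u < S%:R).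
  move=> u0; rewrite /fl truncn_lt_nat ?mulr_ge0 ?(ltW u0) // /J natrM ltr_pM2r //.
have FE M w : F_ M w = if 0 < s w < S%:R then GG ((fl M.+1 (s w))%:R / M.+1%:R) w else 0.
  rewrite /F_ (sum_Bn (fun j => GG (j%:R / M.+1%:R) w)); case: (ltP 0 (s w)) => //= s0.
  by rewrite flS.
have HE M u : P u -> H_ M u = if u < S%:R then gmean ((fl M.+1 u)%:R / M.+1%:R) * gdens z z' u else 0.
  move=> u0; rewrite /H_ (sum_Bn (fun j => gmean (j%:R / M.+1%:R) * gdens z z' u)).
  by rewrite flS // (_ : 0 < u).
have [/measurable_EFinP mg _] := integrableP _ _ _ integrable_gdens.
have mB M j : measurable_fun setT (\1_(Bn M j) : measurableTypeR R -> R) by apply: measurable_indic; exact: measurable_Bn.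
have [iF cF] : Pr.-integrable setT (EFin \o F) /\ (fun M => \int[Pr]_w F_ M w) @ \oo --> \int[Pr]_w F w.
  apply: (@Rintegral_dct R _ _ Pr setT F_ F (fun=> c)) => //.
  - move=> M; apply: measurable_sum => j; apply: measurable_funM; first exact: measurable_GG.
    exact: (measurableT_comp (mB M j)).
  - move=> w _; under eq_fun do rewrite FE; rewrite /F; case: ifP => [/andP[s0 _]|_]; last exact: cvg_cst.
    exact: cvg_GG.
  - exact: finite_measure_integrable_cst.
  - move=> M w _; rewrite FE; case: ifP => [/andP[s0 sS]|_]; last by rewrite normr0.
    by apply: GG_boundS; apply: fl_div_le; exact: ltW.
have [iH cH] : mu.-integrable P (EFin \o H) /\ (fun M => \int[mu]_(u in P) H_ M u) @ \oo --> \int[mu]_(u in P) H u.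
  apply: (@Rintegral_dct R _ _ mu P H_ H (fun u => c * gdens z z' u)) => //.
  - move=> M; apply: measurable_sum => j; apply: measurable_funM; first exact: measurable_funM.
    exact: measurable_funS (mB M j).
  - move=> u u0; rewrite (_ : H_ ^~ u = fun M => if u < S%:R then gmean ((fl M.+1 u)%:R / M.+1%:R) * gdens z z' u else 0).
      rewrite /H; case: ifP => _; last exact: cvg_cst.
      by apply: cvgM; [exact: cvg_gmean|exact: cvg_cst].
    by apply/funext => M; exact: HE.
  - by apply: integrable_mull => //; exact: integrable_gdens.
  - move=> M u u0; rewrite HE //; case: ifP => uS; last by rewrite normr0 mulr_ge0 // gdens_ge0.
    rewrite normrM !ger0_norm ?gmean_ge0 ?gdens_ge0 //; apply: ler_wpM2r; first exact: gdens_ge0.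
    by apply: gmean_boundS; apply: fl_div_le; exact: ltW.
split => //; apply: (cvg_unique (@norm_hausdorff _ _) cF); rewrite (_ : (fun M => _) = (fun M => \int[mu]_(u in P) H_ M u)) //.
by apply/funext => M; rewrite /Rintegral /F_ mixture_step.
Qed.

Lemma mixture : (\int[Pr]_w (if 0 < s w then GG (s w) w else 0)%:E = \int[mu]_(u in P) (gdens z z' u * gmean u)%:E)%E.
Proof.
have mP := @measurable_posR R.
pose F (S : nat) w := if 0 < s w < S%:R then GG (s w) w else 0.
pose H (S : nat) u := if u < S%:R then gmean u * gdens z z' u else 0.
have FH S : (\int[Pr]_w (F S w)%:E = \int[mu]_(u in P) (H S u)%:E)%E.
  have [iF iH e] := mixture_trunc S.
  rewrite -[LHS]fineK; last exact: integrable_fin_num iF.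
  rewrite -[RHS]fineK; last exact: integrable_fin_num iH.
  by congr EFin.
have big (v c : R) : (fun S : nat => if v < S%:R then c else 0) @ \oo --> c.
  apply: cvg_near_cst; near=> S; rewrite ifT //; near: S; exact: nbhs_infty_gtr.
have cF : (fun S => \int[Pr]_w (F S w)%:E)%E @ \oo --> (\int[Pr]_w (if 0 < s w then GG (s w) w else 0)%:E)%E.
  rewrite (_ : (\int[Pr]_w _)%E = (\int[Pr]_w limn (fun S => (F S w)%:E))%E); last first.
    apply: eq_integral => w _; apply/esym/cvg_lim => //; apply: cvg_EFin; first exact: nearW.
    rewrite /F; case: (ltP 0 (s w)) => s0 /=; [exact: big|exact: cvg_cst].
  apply: (@cvg_monotone_convergence _ _ _ Pr setT measurableT (fun S w => (F S w)%:E)).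
  - by move=> S; have [/integrableP[m _] _ _] := mixture_trunc S.
  - by move=> S w _; rewrite lee_fin /F; case: ifP => // _; exact: GG_ge0.
  - move=> w _ S S' SS; rewrite lee_fin /F; case: (ltP 0 (s w)) => //= s0; case: (ltP (s w) S%:R) => h1; case: ifP => // h2.
      by move: h2; rewrite (lt_le_trans h1) // ler_nat.
    exact: GG_ge0.
have cH : (fun S => \int[mu]_(u in P) (H S u)%:E)%E @ \oo --> (\int[mu]_(u in P) (gdens z z' u * gmean u)%:E)%E.
  rewrite (_ : (\int[mu]_(u in P) _)%E = (\int[mu]_(u in P) limn (fun S => (H S u)%:E))%E); last first.
    apply: eq_integral => u _; apply/esym/cvg_lim => //; apply: cvg_EFin; first exact: nearW.
    by rewrite /H mulrC; exact: big.
  have p0 u : 0 <= gmean u * gdens z z' u by rewrite mulr_ge0 ?gmean_ge0 ?gdens_ge0.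
  apply: (@cvg_monotone_convergence _ _ _ mu P mP (fun S u => (H S u)%:E)).
  - by move=> S; have [_ /integrableP[m _] _] := mixture_trunc S.
  - by move=> S u _; rewrite lee_fin /H; case: ifP.
  - move=> u _ S S' SS; rewrite lee_fin /H; case: (ltP u S%:R) => h1; case: ifP => // h2.
    by move: h2; rewrite (lt_le_trans h1) // ler_nat.
apply: (cvg_unique (@ereal_hausdorff R) cF).
by rewrite (_ : (fun S => _) = (fun S => \int[mu]_(u in P) (H S u)%:E)%E) //; apply/funext => S; exact: FH.
Unshelve. all: by end_near. Qed.
End GammaMixture.

(** * Comparison of the two functionals *)

Section Conclusion.
Context {R : realType}.
Local Notation C := R[i].
Local Notation mu := (@lebesgue_measure R).
Local Notation P := (@posR R : set (measurableTypeR R)).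
Local Notation iter k G x := (iterint (fun=> [set: R]) k G x).

Lemma injsum0 L (f : nat -> nat -> R) : injsum 0 L f = 1.
Proof.
rewrite injsum_itersum /= big_ord0 mulr1 (_ : injectiveb _ = true) //.
by apply/injectiveP => -[].
Qed.

Lemma sum_ffun0 L (Phi : {ffun 'I_0 -> 'I_L} -> R) c : (forall f, Phi f = c) -> \sum_f Phi f = c.
Proof.
move=> h; have -> : \sum_f Phi f = c *+ #|{: {ffun 'I_0 -> 'I_L}}|.
  by rewrite -sumr_const; apply: eq_big => f; rewrite ?inE ?h.
by rewrite card_ffun !card_ord expn0.
Qed.

Variables (z z' : C).
Hypothesis pp : pairpos z z'.
Local Notation t := (tpar z z').
Variables (d : measure_display) (T : measurableType d) (Pr : probability T R).
Variables (al be : nat -> T -> R) (s : T -> R).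
Hypotheses (mal : forall i, measurable_fun setT (al i)) (mbe : forall i, measurable_fun setT (be i)).
Hypothesis ms : measurable_fun setT s.
Hypothesis hO : forall w, InOmega (fun i => al i w) (fun i => be i w).
Hypothesis hlim : forall F, OmegaBdd F -> OmegaCont F ->
     (fun n => (Pn_expect z z' n F)%:E) @ \oo -->
       (\int[Pr]_w (F (fun i => al i w, fun i => be i w))%:E)%E.
Hypothesis hind : forall F (B : set R), OmegaBdd F -> OmegaCont F -> measurable B ->
     (\int[Pr]_w (F (fun i => al i w, fun i => be i w) * \1_B (s w))%:E)%E =
     ((\int[Pr]_w (F (fun i => al i w, fun i => be i w))%:E) * gamma_law t B)%E.

Lemma int1 : (\int[Pr]_w (1 : R)%:E = 1)%E.
Proof. by rewrite integral_cst // [X in (_ * X)%E]probability_setT mule1. Qed.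

Lemma bdd1 : OmegaBdd (fun=> 1 : R).
Proof. by exists 1 => *; rewrite normr1. Qed.
Lemma cont1 : OmegaCont (fun=> 1 : R).
Proof. by move=> *; exact: cvg_cst. Qed.

Lemma indep1 (B : set (measurableTypeR R)) : measurable B -> (\int[Pr]_w (\1_B (s w))%:E = gamma_law t B)%E.
Proof.
move=> mB; have := hind bdd1 cont1 mB; rewrite int1 mul1e => <-.
by apply: eq_integral => w _; rewrite mul1r.
Qed.

Lemma gdens_total : (\int[mu]_(u in P) (gdens z z' u)%:E = 1)%E.
Proof.
have := indep1 measurableT; rewrite (gamma_lawE pp) setTI => <-.
by rewrite -int1; apply: eq_integral => w _; rewrite indicT.
Qed.

Lemma s_pos_as : Pr [set w | s w <= 0] = 0%E.
Proof.
have mB : measurable ([set u | u <= 0] : set (measurableTypeR R)).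
  by rewrite (_ : [set u | _] = `]-oo, 0]%classic); [exact: measurable_itv|apply/seteqP; split => u /=; rewrite in_itv].
have := indep1 mB; rewrite (gamma_lawE pp) (_ : _ `&` _ = set0) ?integral_set0; last first.
  by apply/seteqP; split => // u [/= h1 h2]; move: h2; rewrite /posR /= ltNge h1.
have mS : measurable [set w | s w <= 0].
  by have := ms measurableT mB; rewrite setTI.
rewrite (_ : (\int[Pr]_w _)%E = (\int[Pr]_w (\1_[set w | s w <= 0] w)%:E)%E) ?integral_indic ?setIT //.
Qed.

(** The weak limit with F = 1 shows that the total masses converge to 1, which bounds them
    uniformly. *)
Lemma Pn_one_bounded : exists c, forall N, Pn_expect z z' N (fun=> 1) <= c.
Proof.
have l : (fun N => Pn_expect z z' N (fun=> 1)) @ \oo --> (1 : R).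
  by have l := hlim bdd1 cont1; rewrite int1 in l; exact: (fine_cvg l).
have [c hc] := cvgC_bounded (cvgC_rc l); exists c => N; apply: le_trans (hc N).
by rewrite cnorm_rc ler_norm.
Qed.

Section Bumps.
Variables (n : nat) (a b : R) (h : nat -> R -> R).
Hypotheses (a0 : 0 < a) (hb : forall k, (k < n)%N -> bump a b (h k)).
Let g := gmean Pr al n a h.

Lemma Pn_gmean u : 0 < u -> (fun N => Pn_expect z z' N (fun p => Gf n h a u p.1)) @ \oo --> g u.
Proof.
move=> u0; have l := hlim (Gf_bdd a0 hb (ltW u0)) (@Gf_cont R n a b h hb u).
have l' : (fun N => (Pn_expect z z' N (fun p => Gf n h a u p.1))%:E) @ \oo --> (g u)%:E.
  by rewrite -(gmeanE Pr mal a0 hb (ltW u0)); exact: l.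
exact: (fine_cvg l').
Qed.

Lemma corr_mixture : corr Pr al be s n (prodf h n) = (\int[mu]_(u in P) (gdens z z' u * g u)%:E)%E.
Proof.
have jh : jp (prodf h n).
  apply: jp_prodf => k kn; split; first exact: bump_measurable (hb kn).
  by move=> u; have /andP[] := h01 hb u kn.
have mN : measurable [set w | s w <= 0].
  rewrite (_ : [set w | _] = s @^-1` `]-oo, 0]%classic); last by apply/seteqP; split => w /=; rewrite in_itv.
  by rewrite -[X in measurable X]setTI; apply: ms => //; exact: measurable_itv.
rewrite -(mixture pp mal ms hO hind a0 hb) /corr.
rewrite (ge0_negligible_integral mN measurableT _ _ s_pos_as); first last.
- by move=> w _; apply: nneseries_ge0 => N _ _; exact: term_ge0.
- by apply: ge0_emeasurable_sum => N *; [exact: term_ge0|exact: measurable_term].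
rewrite setTD integral_mkcond; apply: eq_integral => w _; rewrite patchE in_setC.
have -> : (w \in [set w | s w <= 0]) = ~~ (0 < s w) by rewrite -leNgt; apply/idP/idP; rewrite inE.
by rewrite negbK; case: (ltP 0 (s w)) => // s0; exact: (corr_bump hO a0 hb s0).
Qed.
End Bumps.

(** The case n = 0 of [cvg_poissonization]: the limit is the total mass of the gamma density, so
    that the partition function is asymptotic to m^t. *)
Lemma cvg_normalization :
  (fun M => rpow M.+1%:R (- t) * \det (1%:M + Amx z z' M *m (Amx z z' M)^T)) @ \oo --> (1 : R).
Proof.
have [c hc] := Pn_one_bounded.
(* At n = 0 the condition on the bumps is empty; the interval and the zero function are
   placeholders. *)
have hb0 k : (k < 0)%N -> bump 1 1 ((fun _ _ => 0) k : R -> R) by [].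
have [_ l] := cvg_poissonization pp (ltr01 : 0 < 1 :> R) hb0 (Pn_gmean ltr01 hb0) hc.
have I1 : \int[mu]_(u in P) (gdens z z' u * gmean Pr al 0 1 (fun _ _ => 0) u) = 1.
  rewrite -[RHS]/(fine 1%E) -gdens_total; congr fine; apply: eq_integral => u _.
  congr EFin; rewrite (_ : gmean _ _ _ _ _ _ = 1) ?mulr1 // -[RHS]/(fine 1%E) -int1; congr fine.
  by apply: eq_integral => w _; rewrite /Gf injsum0.
move: l; rewrite [X in _ --> X -> _]I1.
move=> l0; rewrite (_ : (fun M => _) = (fun M => rpow M.+1%:R (- t) * (\det (1%:M + Amx z z' M *m (Amx z z' M)^T) *
  (\sum_(x : {ffun 'I_0 -> 'I_(NN M)}) (\prod_(k < 0) 0) * \det (\matrix_(i, j) Kmx z z' M (x i) (x j)))))); first exact: l0.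
apply/funext => M; rewrite (sum_ffun0 (c := 1)) ?mulr1 // => f.
by rewrite big_ord0 det_mx00 mulr1.
Qed.

(** One sequence of sums has its limit computed twice: the quotient of [cvg_poissonization] by
    [cvg_normalization] gives the correlation functional, and [riemann_kernel] gives the integral of
    det M. *)
Lemma corr_bump_kernel n (a b : R) (h : nat -> R -> R) : 0 < a -> (forall k, (k < n)%N -> bump a b (h k)) ->
  corr Pr al be s n (prodf h n) = iter n (fun x => (prodf h n x * rho z z' n x)%:E) (fun=> 0) /\
  (corr Pr al be s n (prodf h n) < +oo)%E.
Proof.
move=> a0 hb; have [c hc] := Pn_one_bounded.
have [iI l] := cvg_poissonization pp a0 hb (Pn_gmean a0 hb) hc.
have [lJ fJ] := riemann_kernel pp a0 hb.
have l1 := cvg_normalization.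
set I := \int[mu]_(u in P) _ in l.
pose RS M := \sum_(x : {ffun 'I_n -> 'I_(NN M)}) (\prod_(k < n) h k (((x k)%:R + 2^-1) / M.+1%:R)) *
     \det (\matrix_(i, j) Kmx z z' M (x i) (x j)).
have lR : RS @ \oo --> I.
  rewrite -[X in _ --> X]divr1; have l2 := cvgM l (cvgV (oner_neq0 R) l1).
  rewrite (_ : RS = (fun M => rpow M.+1%:R (- t) * (\det (1%:M + Amx z z' M *m (Amx z z' M)^T) * RS M) /
    (rpow M.+1%:R (- t) * \det (1%:M + Amx z z' M *m (Amx z z' M)^T)))); first exact: l2.
  apply/funext => M.
  have Z0 := Z_gt0 (Amx z z' M); have r0 : 0 < rpow (M.+1%:R : R) (- t) by exact: expR_gt0.
  move: (gt_eqF Z0) (gt_eqF r0) => /negbT; move: (\det _) (rpow _ _) (RS M) => D r S D0 /negbT r1.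
  by field; rewrite D0 r1.
have e : corr Pr al be s n (prodf h n) = I%:E.
  rewrite (corr_mixture a0 hb) /I /Rintegral fineK //; apply: integrable_fin_num iI; exact: measurable_posR.
have eJ : iter n (fun x => (prodf h n x * rho z z' n x)%:E) (fun=> 0) = I%:E.
  apply: (cvg_unique (@ereal_hausdorff R) lJ); apply: cvg_EFin; [exact: nearW|exact: lR].
by rewrite e eJ; split => //; rewrite ltry.
Qed.
End Conclusion.

Theorem theorem3p3p1 (R : realType) (z z' : R[i])
  (d : measure_display) (T : measurableType d) (Pr : probability T R)
  (al be : nat -> T -> R) (s : T -> R) :
  admissible z z' ->
  (forall i, measurable_fun setT (al i)) ->
  (forall i, measurable_fun setT (be i)) ->
  measurable_fun setT s ->
  (forall w, InOmega (fun i => al i w) (fun i => be i w)) ->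
  (* the law of (alpha, beta) is P_{zz'} = weak limit of P^(n)_{zz'} *)
  (forall F, OmegaBdd F -> OmegaCont F ->
     (fun n => (Pn_expect z z' n F)%:E) @ \oo -->
       (\int[Pr]_w (F (fun i => al i w, fun i => be i w))%:E)%E) ->
  (* s is independent of (alpha, beta) and Gamma(t)-distributed *)
  (forall F (B : set R), OmegaBdd F -> OmegaCont F -> measurable B ->
     (\int[Pr]_w (F (fun i => al i w, fun i => be i w) * \1_B (s w))%:E)%E =
     ((\int[Pr]_w (F (fun i => al i w, fun i => be i w))%:E) *
      gamma_law (tpar z z') B)%E) ->
  forall n : nat, (0 < n)%N ->
    (forall x : nat -> R, (forall k, (k < n)%N -> 0 < x k) ->
       ImC (detMker z z' n x) = 0) /\
    (forall A : nat -> set R,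
       (forall k, (k < n)%N -> measurable (A k) /\ A k `<=` posR) ->
       corr_meas Pr al be s n A =
       iterint A n (fun x => (ReC (detMker z z' n x))%:E) (fun _ => 0)).
Proof.
move=> /admissible_pairpos pp mal mbe ms hO hlim hind n _; split.
  by move=> x x0; exact: detMker_real.
move=> A hA; have jr := jp_rho pp n.
rewrite corr_measE (posfun_ext (posfun_corr Pr mal mbe ms n) (posfun_iter n (fun=> 0) jr)
  (corr_bump_kernel pp mal mbe ms hO hlim hind (n := n)) hA).
rewrite iter_indic => [|k kn]; last by have [] := hA k kn.
(* Outside the positive orthant [rho] is 0 by convention, and there the product of indicators
   vanishes as well, because each [A k] lies in [posR]. *)
apply: iter_ext => x _; congr EFin; rewrite /rho; case: ifP => // /negbT /forallPn [k hk].
rewrite /prodf (bigD1 k) //= indicE memNset ?mul0r // => Ak.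
by move: hk; rewrite (proj2 (hA k (ltn_ord k)) _ Ak).
Qed.
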